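(* For every $u_0\in BMO_+$, there exists a unique $u\in C(\mathbb{R},L^2_+)\cap C_{w*}(\mathbb{R},BMO_+)$ solution to $$ i\partial_t u=2J\Pi(|u|^2)+\overline{J}u^2,\qquad u(0)=u_0,\qquad J:=(u^2\vert u).$$ This solution stays bounded in the $BMO$ norm: for all $t\in\mathbb{R}$, $$\|u_0\|_{BMO}^2-\|u_0\|_{L^2}^2\le\|u(t)\|_{BMO}^2\le\|u_0\|_{BMO}^2+\|u_0\|_{L^2}^2.$$ In addition, for each $t\in\mathbb{R}$ and each $R>0$, the mapping $u_0\mapsto u(t)$ is Lipschitz on the ball $\mathcal{B}_{BMO}(R):=\{v\in BMO_+(\mathbb{T}) : \|v\|_{BMO}\le R\}$ endowed with the $L^2$ topology (i.e. Lipschitz for the $L^2$ distance).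
   Context: $\mathbb{T}$ is the one-dimensional torus; $(f\vert g):=\frac1{2\pi}\int_0^{2\pi}f(e^{ix})\overline{g(e^{ix})}\,dx$ and $\|f\|_{L^2}^2=(f\vert f)$. $L^2_+(\mathbb{T})=\{u\in L^2(\mathbb{T}) : \hat u(k)=0\ \forall k<0\}$ and $\Pi:L^2(\mathbb{T})\to L^2_+(\mathbb{T})$ is the orthogonal projection. $BMO_+(\mathbb{T})=BMO(\mathbb{T})\cap L^2_+(\mathbb{T})=\{\Pi(b) : b\in L^\infty(\mathbb{T})\}$, with norm $\|u\|_{BMO}=\inf\{\|b\|_{L^\infty} : \Pi(b)=u\}$. It is continuously embedded in $L^p$ for every $p<\infty$. $BMO_+$ is the dual of $L^1_+$ ($L^1$ functions on $\mathbb{T}$ with vanishing negative Fourier coefficients), and $C_{w*}(\mathbb{R},BMO_+)$ denotes the functions $\mathbb{R}\to BMO_+$ that are continuous for the corresponding weak-$*$ topology. ''Solution'' means that for all $t\in\mathbb{R}$, $u(t)=u_0-i\int_0^t\big(2J_{u(\tau)}\Pi(|u(\tau)|^2)+\overline{J_{u(\tau)}}\,u(\tau)^2\big)d\tau$, with $J_w:=(w^2\vert w)$. *)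

(* Defs.v *)
From HB Require Import structures.
From mathcomp Require Import all_boot all_order all_algebra.
From mathcomp Require Import complex.
From mathcomp Require Import all_classical all_reals all_analysis.

Set Implicit Arguments.
Unset Strict Implicit.
Unset Printing Implicit Defensive.

Import Order.TTheory GRing.Theory Num.Theory.
Import numFieldNormedType.Exports.

Local Open Scope classical_set_scope.
Local Open Scope ring_scope.

(* A function f on the torus is encoded by x |-> f(e^{ix}), as a function on R.
   The measure below is dx/(2 pi) carried by [0, 2 pi[, so that the values of
   the encoding outside [0, 2 pi[ are irrelevant.  Elements of the Lebesgue
   spaces are represented by Borel functions, equality in these spaces being
   equality almost everywhere for torus_measure. *)
Section torus_measure.
Context {R : realType}.

Lemma inv2pi_ge0 : 0 <= (2 * pi : R)^-1.
Proof. by rewrite invr_ge0 mulr_ge0// pi_ge0. Qed.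

Definition torus_measure : set (measurableTypeR R) -> \bar R :=
  mscale (NngNum inv2pi_ge0)
    (mrestr lebesgue_measure (measurable_itv `[0, 2 * pi[)).

HB.instance Definition _ := Measure.on torus_measure.

End torus_measure.

Section torus.
Context {R : realType}.
Local Notation C := R[i].
Local Notation mu := (@torus_measure R).
Implicit Types (f g h u v b : R -> C) (w : R -> R -> C).

Definition modulus f : R -> R := fun x => Normc.normc (f x).

Definition cintegral f : C :=
  Complex (\int[mu]_x complex.Re (f x)) (\int[mu]_x complex.Im (f x)).

Definition inner f g : C := cintegral (fun x => f x * conjc (g x)).

Definition cLnorm (p : \bar R) f : \bar R := 'N[mu]_p [EFin \o modulus f].

Definition L2dist f g : \bar R := cLnorm 2%:E (fun x => f x - g x).

Definition cLfun (p : \bar R) : set (R -> C) :=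
  [set f | [/\ measurable_fun setT (fun x => complex.Re (f x)),
               measurable_fun setT (fun x => complex.Im (f x)) &
               (cLnorm p f < +oo)%E]].

Definition cexp (k : int) : R -> C :=
  fun x => Complex (cos (k%:~R * x)) (sin (k%:~R * x)).

Definition fourier f (k : int) : C := inner f (cexp k).

Definition Lplus (p : \bar R) : set (R -> C) :=
  [set f | cLfun p f /\ forall k : int, k < 0 -> fourier f k = 0].

Local Notation L2plus := (Lplus 2%:E).

(* The orthogonal projection of f on L2plus (for f in L^2; a representative
   of it is selected by choice). *)
Definition Szego f : R -> C :=
  xget (fun=> 0) [set g | L2plus g /\
    forall h, L2plus h -> inner (fun x => f x - g x) h = 0].

(* The bounded functions b such that Pi(b) = u. *)
Definition bmo_symbol u : set (R -> C) :=
  [set b | cLfun +oo%E b /\ Szego b = u %[ae mu]].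

Definition BMOplus : set (R -> C) :=
  [set u | L2plus u /\ bmo_symbol u !=set0].

Definition bmo_norm u : \bar R :=
  ereal_inf [set cLnorm +oo%E b | b in bmo_symbol u].

Definition bmo_ball (r : R) : set (R -> C) :=
  [set u | BMOplus u /\ (bmo_norm u <= r%:E)%E].

(* The duality between f in L^1_+ and u = Pi(b) in BMO_+ is (f | b), which
   does not depend on the choice of the bounded function b. *)
Definition bmo_pairing f u : C := inner f (xget (fun=> 0) (bmo_symbol u)).

Definition continuous_L2plus w :=
  (forall t, L2plus (w t)) /\
  forall t, L2dist (w s) (w t) @[s --> t] --> 0%E.

Definition continuous_weakstar_BMOplus w :=
  (forall t, BMOplus (w t)) /\
  forall f, Lplus 1%E f -> forall t,
    Normc.normc (bmo_pairing f (w s) - bmo_pairing f (w t)) @[s --> t]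
      --> (0 : R).

(* Riemann integrals of functions of a real variable with values in L^2: the
   partition a = x_0 < ... < x_n = b is given by the list s of x_1, ..., x_n,
   and xi i is the tag in [x_i, x_(i+1)]. *)
Definition riemann_sum w (a b : R) (s : seq R) (xi : nat -> R) : R -> C :=
  fun x => \sum_(0 <= i < size s)
    (nth b (a :: s) i.+1 - nth b (a :: s) i)%:C%C * w (xi i) x.

Definition is_L2_Rint_le w (a b : R) v :=
  cLfun 2%:E v /\
  forall e : R, 0 < e -> exists2 d : R, 0 < d &
    forall (s : seq R) (xi : nat -> R), itv_partition a b s ->
      (forall i, (i < size s)%N ->
         nth b (a :: s) i.+1 - nth b (a :: s) i < d /\
         nth b (a :: s) i <= xi i <= nth b (a :: s) i.+1) ->
      (L2dist (riemann_sum w a b s xi) v < e%:E)%E.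

Definition is_L2_Rint w (a b : R) v :=
  if a <= b then is_L2_Rint_le w a b v
  else is_L2_Rint_le w b a (fun x => - v x).

Definition J u : C := inner (fun x => u x ^+ 2) u.

Definition szego_rhs u : R -> C := fun x =>
  2 * J u * Szego (fun y => (modulus u y ^+ 2)%:C%C) x + conjc (J u) * u x ^+ 2.

Definition is_solution u0 w :=
  forall t : R, exists2 v, is_L2_Rint (fun tau => szego_rhs (w tau)) 0 t v &
    w t = (fun x => u0 x - 'i%C * v x) %[ae mu].

Definition is_BMO_solution u0 w :=
  [/\ continuous_L2plus w, continuous_weakstar_BMOplus w & is_solution u0 w].

End torus.

(* Submission.v *)
Require Import Defs.
From HB Require Import structures.
From mathcomp Require Import all_boot all_order all_algebra.
From mathcomp Require Import complex.
From mathcomp Require Import all_classical all_reals all_analysis.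
From mathcomp Require Import measurable_realfun ess_sup_inf.
From mathcomp Require Import ring lra.

Set Implicit Arguments.
Unset Strict Implicit.
Unset Printing Implicit Defensive.

Import Order.TTheory GRing.Theory Num.Theory.
Import numFieldNormedType.Exports.

Local Open Scope classical_set_scope.
Local Open Scope ring_scope.

(** Write u = Pi(b) and J = (u^2|u).  The equation is not Lipschitz in L2, and
    BMO_+ is not an algebra, so that neither space carries a Picard iteration.
    The proof rests on a dynamical system for the symbol b which preserves the
    uniform bound of b.

    A function u of the Hardy space lies in BMO_+ with norm at most M if and
    only if |(f|u)| <= M ||f||_1 for all f in the Hardy space (the property HB
    below): this is Nehari's theorem [nehari], obtained by projecting u on the
    closed convex set of the Pi(b) with |b| <= M.  Testing the form on squares
    gives the estimate ||u^2||_2 <= 3 M ||u||_2 [HB_sq], which replaces the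
    embedding of BMO in L4.

    Existence.  Let |b| <= N and suppose that u and b have the same Fourier
    coefficients of positive index, and put w = u - b, so that w is
    antiholomorphic.  For a constant A, expanding u = b + w gives
      2 A |u|^2 + conj A u^2
        = 4 Re(conj A u) b - conj A b^2 + 2 A w conj u + conj A w^2,
    where the last two terms are antiholomorphic.  Hence, up to the mean value,
    the equation is induced by the pointwise Riccati equation
      i b' = 4 Re(conj A u) b - conj A b^2 - N^2 A,   A = J(u),
    the constant - N^2 A being chosen so that the field is tangent to the circle
    |b| = N.  Thus |b| <= N is preserved.  The mean value c of u is evolved
    separately.  The Riccati equation is discretized by a rotation followed by a
    step preserving the disc [disc_step_bd]; the scheme is stable in L2
    [step_stable], consistent [step_consistent, profile_consistent] and therefore
    converges along dyadic meshes [scheme_cvg, half_evolution].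

    Bounds.  If b bounds u up to its mean value, then u has norm at most
    sqrt(N^2 + ||u||_2^2) [HB_step]: a factorization f = g k of an analytic
    polynomial, with g and k of comparable size in L2, splits (f|u) into the
    form with symbol b and a product of mean values, and the two are combined by
    the Cauchy-Schwarz inequality.  As the mass ||u||_2 is conserved
    [mass_conserved], the upper bound follows.  The lower one is the upper bound
    for the equation run backwards [solution_lower_bound].

    Uniqueness and Lipschitz dependence.  For two solutions u, v bounded in BMO,
    the difference d = u - v satisfies d/dt ||d||^2 <= C ||d||^2: the terms
    quadratic in d with coefficient v combine into a real number, and the others
    are bounded by the dual form of the norm [energy_form].  A weak-* continuous
    curve is locally bounded in BMO by the uniform boundedness principle
    [local_bound], which makes this applicable to every solution; the integral
    equation is differentiated in L2 by [Rint_derivative]. *)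

(** * Moduli of complex numbers *)

Section complex_modulus.
Context {R : realType}.
Local Notation C := R[i].
Local Notation nc := (@Normc.normc R).
Implicit Types (z w : C) (x : R).

Lemma ncE z : nc z ^+ 2 = complex.Re z ^+ 2 + complex.Im z ^+ 2.
Proof. by case: z => a b /=; rewrite sqr_sqrtr// addr_ge0// sqr_ge0. Qed.

Lemma nc_ge0 z : 0 <= nc z.
Proof. by case: z => a b; rewrite /= sqrtr_ge0. Qed.

Lemma ncM z w : nc (z * w) = nc z * nc w. Proof. exact: Normc.normcM. Qed.

Lemma ncX z n : nc (z ^+ n) = nc z ^+ n.
Proof. by elim: n => [|n IH]; rewrite ?expr0 ?Normc.normc1// !exprS ncM IH. Qed.

Lemma ncD z w : nc (z + w) <= nc z + nc w. Proof. exact: le_normcD. Qed.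

Lemma ncN z : nc (- z) = nc z. Proof. exact: normcN. Qed.

Lemma ncB z w : nc (z - w) <= nc z + nc w.
Proof. by rewrite (le_trans (ncD _ _))// ncN. Qed.

Lemma nc_sub z w : nc (z - w) = nc (w - z).
Proof. by rewrite -ncN opprB. Qed.

Lemma ncV z : nc z^-1 = (nc z)^-1. Proof. exact: Normc.normcV. Qed.

Lemma nc0 : nc 0 = 0. Proof. exact: Normc.normc0. Qed.

Lemma nc1 : nc 1 = 1. Proof. exact: Normc.normc1. Qed.

Lemma nc_eq0 z : nc z = 0 -> z = 0. Proof. exact: Normc.eq0_normc. Qed.

Lemma nc_conj z : nc (conjc z) = nc z.
Proof. by case: z => a b /=; rewrite sqrrN. Qed.

Lemma nc_real x : nc x%:C%C = `|x|.
Proof. by rewrite /= expr0n/= addr0 sqrtr_sqr. Qed.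

Lemma nci : nc 'i%C = 1.
Proof. by rewrite /= expr0n/= add0r expr1n sqrtr1. Qed.

Lemma nc_Re z : `|complex.Re z| <= nc z.
Proof. by case: z => a b; rewrite /= -sqrtr_sqr ler_wsqrtr// lerDl sqr_ge0. Qed.

Lemma nc_Im z : `|complex.Im z| <= nc z.
Proof. by case: z => a b; rewrite /= -sqrtr_sqr ler_wsqrtr// lerDr sqr_ge0. Qed.

Lemma nc_le z : nc z <= `|complex.Re z| + `|complex.Im z|.
Proof.
rewrite -(@ler_pXn2r _ 2)// ?nnegrE ?nc_ge0 ?addr_ge0//.
rewrite ncE sqrrD !real_normK ?num_real// -addrA lerD2l lerDr.
by rewrite mulrn_wge0// mulr_ge0.
Qed.

Lemma mul_conj z : z * conjc z = (nc z ^+ 2)%:C%C.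
Proof.
rewrite ncE; case: z => a b /=; apply/eqP; rewrite eq_complex /=.
by apply/andP; split; apply/eqP; ring.
Qed.

Lemma Re_D z w : complex.Re (z + w) = complex.Re z + complex.Re w.
Proof. by case: z w => [? ?] [? ?]. Qed.
Lemma Im_D z w : complex.Im (z + w) = complex.Im z + complex.Im w.
Proof. by case: z w => [? ?] [? ?]. Qed.
Lemma Re_N z : complex.Re (- z) = - complex.Re z.
Proof. by case: z => [? ?]. Qed.
Lemma Im_N z : complex.Im (- z) = - complex.Im z.
Proof. by case: z => [? ?]. Qed.
Lemma Re_M z w : complex.Re (z * w) =
  complex.Re z * complex.Re w - complex.Im z * complex.Im w.
Proof. by case: z w => [? ?] [? ?]. Qed.
Lemma Im_M z w : complex.Im (z * w) =
  complex.Re z * complex.Im w + complex.Im z * complex.Re w.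
Proof. by case: z w => [? ?] [? ?] /=; rewrite [X in _ = _ + X]mulrC addrC mulrC addrC; ring. Qed.
Lemma Re_conjc z : complex.Re (conjc z) = complex.Re z.
Proof. by case: z => [? ?]. Qed.
Lemma Im_conjc z : complex.Im (conjc z) = - complex.Im z.
Proof. by case: z => [? ?]. Qed.

Lemma eq_C z w : complex.Re z = complex.Re w -> complex.Im z = complex.Im w -> z = w.
Proof. by case: z w => [? ?] [? ?] /= -> ->. Qed.

Lemma Re_CM x z : complex.Re (x%:C%C * z) = x * complex.Re z.
Proof. by rewrite Re_M /= mul0r subr0. Qed.
Lemma Im_CM x z : complex.Im (x%:C%C * z) = x * complex.Im z.
Proof. by rewrite Im_M /= mul0r addr0. Qed.

Lemma conjcM z w : conjc (z * w) = conjc z * conjc w.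
Proof. exact: rmorphM. Qed.
Lemma conjcD z w : conjc (z + w) = conjc z + conjc w.
Proof. exact: rmorphD. Qed.
Lemma conjcB z w : conjc (z - w) = conjc z - conjc w.
Proof. exact: rmorphB. Qed.
Lemma conjcN z : conjc (- z) = - conjc z.
Proof. exact: rmorphN. Qed.
Lemma conjcX z n : conjc (z ^+ n) = conjc z ^+ n.
Proof. exact: rmorphXn. Qed.
Lemma conjci : conjc 'i%C = - 'i%C :> C.
Proof. by apply: eq_C; rewrite /= ?oppr0. Qed.

Lemma conjc_sum (I : Type) (s : seq I) (P : pred I) (F : I -> C) :
  conjc (\sum_(i <- s | P i) F i) = \sum_(i <- s | P i) conjc (F i).
Proof. exact: rmorph_sum. Qed.

Lemma CM x y : (x * y)%:C%C = x%:C%C * y%:C%C :> C.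
Proof. exact: rmorphM. Qed.
Lemma CD x y : (x + y)%:C%C = x%:C%C + y%:C%C :> C.
Proof. exact: rmorphD. Qed.
Lemma CB x y : (x - y)%:C%C = x%:C%C - y%:C%C :> C.
Proof. exact: rmorphB. Qed.
Lemma CN x : (- x)%:C%C = - x%:C%C :> C.
Proof. exact: rmorphN. Qed.
Lemma CX x n : (x ^+ n)%:C%C = x%:C%C ^+ n :> C.
Proof. exact: rmorphXn. Qed.
Lemma CV x : (x^-1)%:C%C = x%:C%C^-1 :> C.
Proof. exact: fmorphV. Qed.
Lemma Cnat n : n%:R%:C%C = n%:R :> C.
Proof. exact: rmorph_nat. Qed.

Lemma nc_sum (I : Type) (s : seq I) (P : pred I) (F : I -> C) :
  nc (\sum_(i <- s | P i) F i) <= \sum_(i <- s | P i) nc (F i).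
Proof.
elim/big_rec2: _ => [|i y1 y2 _ h]; first by rewrite nc0.
by rewrite (le_trans (ncD _ _))// lerD2l.
Qed.

End complex_modulus.

(** * Measurability and integrals of complex functions on the torus *)

Section measurability.
Context {R : realType}.
Local Notation C := R[i].
Local Notation mu := (@torus_measure R).
Local Notation nc := (@Normc.normc R).
Implicit Types (f g h : R -> C) (p q : R -> R).

Definition cmeas f := measurable_fun setT (fun x => complex.Re (f x)) /\
  measurable_fun setT (fun x => complex.Im (f x)).

Lemma cmeasD f g : cmeas f -> cmeas g -> cmeas (fun x => f x + g x).
Proof.
move=> [f1 f2] [g1 g2]; split.
  by under eq_fun do rewrite Re_D; exact: measurable_funD.
by under eq_fun do rewrite Im_D; exact: measurable_funD.
Qed.

Lemma cmeasN f : cmeas f -> cmeas (fun x => - f x).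
Proof.
move=> [f1 f2]; split.
  by under eq_fun do rewrite Re_N; exact: measurableT_comp.
by under eq_fun do rewrite Im_N; exact: measurableT_comp.
Qed.

Lemma cmeasB f g : cmeas f -> cmeas g -> cmeas (fun x => f x - g x).
Proof. by move=> mf mg; apply: cmeasD => //; exact: cmeasN. Qed.

Lemma cmeasM f g : cmeas f -> cmeas g -> cmeas (fun x => f x * g x).
Proof.
move=> [f1 f2] [g1 g2]; split.
  by under eq_fun do rewrite Re_M; apply: measurable_funB; exact: measurable_funM.
by under eq_fun do rewrite Im_M; apply: measurable_funD; exact: measurable_funM.
Qed.

Lemma cmeas_conj f : cmeas f -> cmeas (fun x => conjc (f x)).
Proof.
move=> [f1 f2]; split.
  by under eq_fun do rewrite Re_conjc.
by under eq_fun do rewrite Im_conjc; exact: measurableT_comp.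
Qed.

Lemma cmeas_cst (c : C) : cmeas (fun=> c). Proof. by split. Qed.

Lemma cmeas_real p : measurable_fun setT p -> cmeas (fun x => (p x)%:C%C).
Proof. by move=> mp; split. Qed.

Lemma cmeasX f n : cmeas f -> cmeas (fun x => f x ^+ n).
Proof.
move=> mf; elim: n => [|n IH]; first exact: cmeas_cst.
by under eq_fun do rewrite exprS; exact: cmeasM.
Qed.

Lemma cmeas_sum (I : Type) (s : seq I) (F : I -> R -> C) :
  (forall i, cmeas (F i)) -> cmeas (fun x => \sum_(i <- s) F i x).
Proof.
move=> mF; elim: s => [|i s IH].
  by under eq_fun do rewrite big_nil; exact: cmeas_cst.
by under eq_fun do rewrite big_cons; exact: cmeasD.
Qed.

Lemma measurable_modulus f : cmeas f -> measurable_fun setT (modulus f).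
Proof.
move=> [f1 f2]; rewrite (_ : modulus f =
  @Num.sqrt R \o (fun x => complex.Re (f x) ^+ 2 + complex.Im (f x) ^+ 2)).
  apply: measurableT_comp.
    by apply: continuous_measurable_fun; exact: sqrt_continuous.
  by apply: measurable_funD; exact: measurable_funX.
by apply/funext => x; rewrite /modulus /=; case: (f x).
Qed.

Lemma mu_setT : mu setT = 1%E.
Proof.
rewrite /torus_measure /mscale/= /mrestr setTI lebesgue_measure_itv/=.
rewrite lte_fin mulr_gt0 ?pi_gt0// -EFinB subr0 -EFinM mulVf//.
by rewrite gt_eqF// mulr_gt0 ?pi_gt0.
Qed.

Lemma mu_fin : (mu setT < +oo)%E. Proof. by rewrite mu_setT ltry. Qed.

Lemma ae_filter : Filter (nbhs (almost_everywhere mu)).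
Proof.
exact: (@ae_filter_ringOfSetsType _ (measurableTypeR R) R
  [the measure _ _ of @torus_measure R]).
Qed.

Lemma ae_imp (P Q : R -> Prop) : (forall x, P x -> Q x) ->
  {ae mu, forall x, P x} -> {ae mu, forall x, Q x}.
Proof. by move=> PQ; apply: filterS; first exact: ae_filter. Qed.

Lemma ae_imp2 (P Q S : R -> Prop) : (forall x, P x -> Q x -> S x) ->
  {ae mu, forall x, P x} -> {ae mu, forall x, Q x} -> {ae mu, forall x, S x}.
Proof. by move=> PQ; apply: filterS2; first exact: ae_filter. Qed.

Lemma ae_all (P : R -> Prop) : (forall x, P x) -> {ae mu, forall x, P x}.
Proof. by move=> h; exists set0; split => // x /=; case; exact: h. Qed.

Lemma ae_eqE (U : Type) (f g : R -> U) :
  f = g %[ae mu] <-> {ae mu, forall x, f x = g x}.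
Proof. by split; apply: ae_imp => x h //; apply: h. Qed.

Definition rint p := mu.-integrable setT (EFin \o p).

Lemma rint_dom p q : measurable_fun setT p -> rint q ->
  (forall x, `|p x| <= q x) -> rint p.
Proof.
move=> mp iq pq; apply: le_integrable iq => //; first exact/measurable_EFinP.
by move=> x _ /=; rewrite lee_fin (le_trans (pq x))// ler_norm.
Qed.

Lemma rint_cst (c : R) : rint (fun=> c).
Proof.
apply: measurable_bounded_integrable => //; first exact: mu_fin.
exists `|c|; split; first exact: num_real.
by move=> y cy z _ /=; apply: ltW.
Qed.

Lemma rint_bd p c : measurable_fun setT p -> (forall x, `|p x| <= c) -> rint p.
Proof. by move=> mp pc; apply: rint_dom (rint_cst c) pc. Qed.

Lemma rintD p q : rint p -> rint q -> rint (fun x => p x + q x).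
Proof. by move=> ip iq; exact: (integrableD measurableT ip iq). Qed.

Lemma rintZ (k : R) p : rint p -> rint (fun x => k * p x).
Proof. by move=> ip; exact: (integrableZl measurableT k ip). Qed.

Lemma rint_meas p : rint p -> measurable_fun setT p.
Proof. by move=> /integrableP[/measurable_EFinP]. Qed.

Lemma RintM p : rint p -> forall k : R,
  (\int[mu]_x (k * p x) = k * \int[mu]_x p x)%R.
Proof. by move=> ip k; rewrite RintegralZl. Qed.

Lemma Rint_cst (c : R) : (\int[mu]_x c)%R = c.
Proof.
rewrite Rintegral_cst// [X in fine X](_ : _ = 1%E) /= ?mulr1//.
exact: mu_setT.
Qed.

Lemma Rint_ae p q : measurable_fun setT p -> measurable_fun setT q ->
  p = q %[ae mu] -> (\int[mu]_x p x = \int[mu]_x q x)%R.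
Proof.
move=> mp mq pq; congr fine; apply: ae_eq_integral => //.
- exact/measurable_EFinP.
- exact/measurable_EFinP.
- by move: pq; apply: ae_imp => x /= h i; rewrite (h i).
Qed.

Lemma Rint0_ae p : rint p -> (forall x, 0 <= p x) ->
  (\int[mu]_x p x)%R = 0 -> {ae mu, forall x, p x = 0}.
Proof.
move=> ip p0 Ip.
have : (\int[mu]_x `|(EFin \o p) x| = 0)%E.
  transitivity (\int[mu]_x (p x)%:E)%E.
    by apply: eq_integral => x _ /=; rewrite ger0_norm.
  by rewrite -(fineK (integrable_fin_num measurableT ip)); move: Ip; rewrite /Rintegral => ->.
move/ae_eq_integral_abs => /(_ measurableT) H.
have := H (measurable_int _ ip); apply: ae_imp => x /= /(_ I) /eqP.
by rewrite eqe => /eqP.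
Qed.

End measurability.

Section complex_integral.
Context {R : realType}.
Local Notation C := R[i].
Local Notation mu := (@torus_measure R).
Local Notation nc := (@Normc.normc R).
Implicit Types (f g h : R -> C) (p q : R -> R).

Definition L1 f := cmeas f /\ rint (modulus f).

Definition N1 f : R := (\int[mu]_x modulus f x)%R.

Lemma L1_Re f : L1 f -> rint (fun x => complex.Re (f x)).
Proof.
move=> [[f1 f2] fi]; apply: rint_dom fi _ => // x; exact: nc_Re.
Qed.

Lemma L1_Im f : L1 f -> rint (fun x => complex.Im (f x)).
Proof.
move=> [[f1 f2] fi]; apply: rint_dom fi _ => // x; exact: nc_Im.
Qed.

Lemma L1_dom f q : cmeas f -> rint q -> (forall x, nc (f x) <= q x) -> L1 f.
Proof.
move=> mf iq fq; split => //; apply: rint_dom iq _.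
  exact: measurable_modulus.
by move=> x; rewrite ger0_norm; [exact: fq|exact: nc_ge0].
Qed.

Lemma L1_bd f c : cmeas f -> (forall x, nc (f x) <= c) -> L1 f.
Proof. by move=> mf fc; exact: (L1_dom mf (rint_cst c) fc). Qed.

Lemma L1D f g : L1 f -> L1 g -> L1 (fun x => f x + g x).
Proof.
move=> [mf fi] [mg gi]; apply: L1_dom (rintD fi gi) _; first exact: cmeasD.
move=> x; exact: ncD.
Qed.

Lemma L1Z c f : L1 f -> L1 (fun x => c * f x).
Proof.
move=> [mf fi]; apply: L1_dom (rintZ (nc c) fi) _.
  by apply: cmeasM => //; exact: cmeas_cst.
by move=> x; rewrite ncM.
Qed.

Lemma L1N f : L1 f -> L1 (fun x => - f x).
Proof.
by move=> [mf fi]; apply: L1_dom fi _ => [|x]; [exact: cmeasN|rewrite ncN].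
Qed.

Lemma L1B f g : L1 f -> L1 g -> L1 (fun x => f x - g x).
Proof. by move=> lf lg; apply: L1D => //; exact: L1N. Qed.

Lemma L1_conj f : L1 f -> L1 (fun x => conjc (f x)).
Proof.
by move=> [mf fi]; apply: L1_dom fi _ => [|x]; [exact: cmeas_conj|rewrite nc_conj].
Qed.

Lemma L1_sum (I : Type) (s : seq I) (F : I -> R -> C) :
  (forall i, L1 (F i)) -> L1 (fun x => \sum_(i <- s) F i x).
Proof.
move=> mF; elim: s => [|i s IH].
  by under eq_fun do rewrite big_nil; apply: (@L1_bd _ 0) => [|x];
    [exact: cmeas_cst|rewrite nc0].
by under eq_fun do rewrite big_cons; exact: L1D.
Qed.

Lemma cintD f g : L1 f -> L1 g ->
  cintegral (fun x => f x + g x) = cintegral f + cintegral g.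
Proof.
move=> lf lg; apply: eq_C => /=.
  by under eq_Rintegral do rewrite Re_D; rewrite RintegralD//; exact: L1_Re.
by under eq_Rintegral do rewrite Im_D; rewrite RintegralD//; exact: L1_Im.
Qed.

Lemma cintZ c f : L1 f -> cintegral (fun x => c * f x) = c * cintegral f.
Proof.
move=> lf; have r := L1_Re lf; have i := L1_Im lf.
apply: eq_C; rewrite ?Re_M ?Im_M /=.
  under eq_Rintegral do rewrite Re_M.
  by rewrite RintegralB ?RintM//; exact: rintZ.
under eq_Rintegral do rewrite Im_M.
by rewrite RintegralD ?RintM//; exact: rintZ.
Qed.

Lemma cintN f : L1 f -> cintegral (fun x => - f x) = - cintegral f.
Proof.
by move=> lf; under eq_fun do rewrite -mulN1r; rewrite cintZ// mulN1r.
Qed.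

Lemma cintB f g : L1 f -> L1 g ->
  cintegral (fun x => f x - g x) = cintegral f - cintegral g.
Proof. by move=> lf lg; rewrite cintD ?cintN//; exact: L1N. Qed.

Lemma cint_conj f : L1 f -> cintegral (fun x => conjc (f x)) = conjc (cintegral f).
Proof.
move=> lf; apply: eq_C; rewrite ?Re_conjc ?Im_conjc /=.
  by under eq_Rintegral do rewrite Re_conjc.
under eq_Rintegral do rewrite Im_conjc -mulN1r.
by rewrite RintM ?mulN1r//; exact: L1_Im.
Qed.

Lemma cint_sum (I : Type) (s : seq I) (F : I -> R -> C) :
  (forall i, L1 (F i)) ->
  cintegral (fun x => \sum_(i <- s) F i x) = \sum_(i <- s) cintegral (F i).
Proof.
move=> mF; elim: s => [|i s IH].
  under eq_fun do rewrite big_nil.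
  by rewrite big_nil; apply: eq_C => /=; exact: Rint_cst.
under eq_fun do rewrite big_cons.
by rewrite big_cons cintD ?IH//; exact: L1_sum.
Qed.

Lemma cint_cst (c : C) : cintegral (fun=> c) = c.
Proof. by apply: eq_C => /=; exact: Rint_cst. Qed.

Lemma cint_real p : cintegral (fun x => (p x)%:C%C) = ((\int[mu]_x p x)%R)%:C%C.
Proof. by apply: eq_C => //=; exact: Rint_cst. Qed.

Lemma le_N1 f q : cmeas f -> rint q -> (forall x, nc (f x) <= q x) ->
  N1 f <= (\int[mu]_x q x)%R.
Proof.
move=> mf iq fq; apply: le_Rintegral => //; last by move=> x _; exact: fq.
by have [] := L1_dom mf iq fq.
Qed.

(** Rotating the integral onto the positive half-line reduces the triangle
    inequality to the monotonicity of the real integral. *)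
Lemma cint_le f : L1 f -> nc (cintegral f) <= N1 f.
Proof.
move=> lf; set I := cintegral f.
have [I0|I0] := eqVneq (nc I) 0.
  by rewrite I0; apply: Rintegral_ge0 => x _; exact: nc_ge0.
have Ip : 0 < nc I by rewrite lt_def I0 nc_ge0.
pose c := conjc I * ((nc I)^-1)%:C%C.
have cI : c * I = (nc I)%:C%C.
  rewrite /c mulrAC [conjc I * I]mulrC mul_conj -rmorphM /=; congr (_%:C%C).
  by rewrite expr2 mulfK.
have nc_c : nc c = 1.
  by rewrite /c ncM nc_conj nc_real ger0_norm ?invr_ge0 ?nc_ge0// mulfV.
have -> : nc I = complex.Re (cintegral (fun x => c * f x)) by rewrite cintZ// cI.
apply: le_Rintegral => //; first exact: (L1_Re (L1Z c lf)).
  by case: lf.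
by move=> x _; rewrite (le_trans (ler_norm _))// (le_trans (nc_Re _))// ncM nc_c mul1r.
Qed.

Lemma cint_ae f g : cmeas f -> cmeas g -> f = g %[ae mu] ->
  cintegral f = cintegral g.
Proof.
move=> [f1 f2] [g1 g2] fg; apply: eq_C => /=; apply: Rint_ae => //.
  by move: fg; apply: ae_imp => x /= h I; rewrite (h I).
by move: fg; apply: ae_imp => x /= h I; rewrite (h I).
Qed.

End complex_integral.

(** * The Hilbert space L2 of the torus *)

Section L2_theory.
Context {R : realType}.
Local Notation C := R[i].
Local Notation mu := (@torus_measure R).
Local Notation nc := (@Normc.normc R).
Implicit Types (f g h : R -> C) (p q : R -> R).

Definition L2 f := cmeas f /\ rint (fun x => modulus f x ^+ 2).

Definition n2 f : R := Num.sqrt (\int[mu]_x (modulus f x ^+ 2))%R.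

Lemma Lnorm2E p : measurable_fun setT p ->
  ('N[mu]_2%:E [EFin \o p] = (\int[mu]_x ((p x) ^+ 2)%:E) `^ (2^-1))%E.
Proof.
move=> mp; rewrite unlock /=; congr (_ `^ _)%E.
apply: eq_integral => x _ /=.
by rewrite powR_mulrn// real_normK ?num_real.
Qed.

Lemma L2P f : cLfun 2%:E f <-> L2 f.
Proof.
have key : cmeas f -> ((cLnorm 2%:E f < +oo)%E <-> rint (fun x => modulus f x ^+ 2)).
  move=> mf; have mm := measurable_modulus mf.
  have mi : measurable_fun setT (EFin \o (fun x => modulus f x ^+ 2)).
    by apply/measurable_EFinP; exact: measurable_funX.
  have E : (\int[mu]_x `|(EFin \o (fun x => modulus f x ^+ 2)%R) x| =
            \int[mu]_x ((modulus f x) ^+ 2)%R%:E)%E.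
    by apply: eq_integral => x _ /=; rewrite ger0_norm// sqr_ge0.
  rewrite /cLnorm Lnorm2E//; split => [h|/integrableP[_]].
    apply/integrableP; split => //; rewrite E ltey; apply/negP => /eqP h'.
    by move: h; rewrite h' poweRyr ?ltxx// invr_eq0 pnatr_eq0.
  by rewrite E => h; rewrite poweR_lty.
split=> [[f1 f2 f3]|[[f1 f2] fi]].
  by have mf : cmeas f by []; split=> //; apply/key.
by split => //; apply/key.
Qed.

Lemma L2_meas f : L2 f -> cmeas f. Proof. by case. Qed.

Lemma n2_ge0 f : 0 <= n2 f. Proof. exact: sqrtr_ge0. Qed.
Hint Resolve n2_ge0 : core.

Lemma n2sq f : n2 f ^+ 2 = (\int[mu]_x (modulus f x ^+ 2))%R.
Proof. by rewrite sqr_sqrtr// Rintegral_ge0// => x _; exact: sqr_ge0. Qed.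

Lemma cLnorm2 f : L2 f -> cLnorm 2%:E f = (n2 f)%:E.
Proof.
move=> [mf fi]; rewrite /cLnorm Lnorm2E; last exact: measurable_modulus.
have fin := integrable_fin_num measurableT fi.
rewrite -(fineK fin) poweR_EFin powR12_sqrt// fine_ge0// integral_ge0// => x _.
by rewrite lee_fin sqr_ge0.
Qed.

Lemma L2_dom f q : cmeas f -> rint q -> (forall x, nc (f x) ^+ 2 <= q x) -> L2 f.
Proof.
move=> mf iq fq; split => //; apply: rint_dom iq _.
  by apply: measurable_funX; exact: measurable_modulus.
by move=> x; rewrite ger0_norm ?sqr_ge0//; exact: fq.
Qed.

Lemma L2_mono f g c : cmeas f -> L2 g -> (forall x, nc (f x) <= c * nc (g x)) ->
  L2 f.
Proof.
move=> mf [mg gi] fg; apply: L2_dom mf (rintZ (c ^+ 2) gi) _ => x.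
rewrite -exprMn; apply: lerXn2r (fg x); rewrite ?nnegrE ?nc_ge0//.
by rewrite (le_trans _ (fg x))// nc_ge0.
Qed.

Lemma n2_dom f q c : 0 <= c -> cmeas f -> rint q ->
  (forall x, nc (f x) ^+ 2 <= q x) -> (\int[mu]_x q x)%R <= c ^+ 2 -> n2 f <= c.
Proof.
move=> c0 mf iq fq qc; rewrite -(@ler_pXn2r _ 2)// ?nnegrE// n2sq.
apply: le_trans qc; apply: le_Rintegral => //; last by move=> x _; exact: fq.
by have [] := L2_dom mf iq fq.
Qed.

Lemma n2_mono f g c : 0 <= c -> cmeas f -> L2 g ->
  (forall x, nc (f x) <= c * nc (g x)) -> n2 f <= c * n2 g.
Proof.
move=> c0 mf [mg gi] fg.
apply: (n2_dom _ mf (rintZ (c ^+ 2) gi)); first by rewrite mulr_ge0.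
  move=> x; rewrite -exprMn; apply: lerXn2r (fg x); rewrite ?nnegrE ?nc_ge0//.
  by rewrite mulr_ge0// nc_ge0.
by rewrite RintM// -n2sq exprMn.
Qed.

Lemma L2_bd f c : cmeas f -> (forall x, nc (f x) <= c) -> L2 f.
Proof.
move=> mf fc; apply: L2_dom mf (rint_cst (c ^+ 2)) _ => x.
by apply: lerXn2r (fc x); rewrite ?nnegrE ?nc_ge0// (le_trans _ (fc x))// nc_ge0.
Qed.

Lemma n2_bd f c : cmeas f -> (forall x, nc (f x) <= c) -> n2 f <= c.
Proof.
move=> mf fc; have c0 : 0 <= c by rewrite (le_trans _ (fc 0))// nc_ge0.
apply: (n2_dom c0 mf (rint_cst (c ^+ 2))); last by rewrite Rint_cst.
by move=> x; apply: lerXn2r (fc x); rewrite ?nnegrE ?nc_ge0.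
Qed.

Lemma L2N f : L2 f -> L2 (fun x => - f x).
Proof.
move=> lf; apply: (@L2_mono _ f 1) => //; first by apply: cmeasN; case: lf.
by move=> x; rewrite ncN mul1r.
Qed.

Lemma L2Z c f : L2 f -> L2 (fun x => c * f x).
Proof.
move=> lf; apply: (@L2_mono _ f (nc c)) => //; last by move=> x; rewrite ncM.
by apply: cmeasM; [exact: cmeas_cst|case: lf].
Qed.

Lemma L2_conj f : L2 f -> L2 (fun x => conjc (f x)).
Proof.
move=> lf; apply: (@L2_mono _ f 1) => //; first by apply: cmeas_conj; case: lf.
by move=> x; rewrite nc_conj mul1r.
Qed.

Lemma L2M_bd f g c : L2 f -> cmeas g -> (forall x, nc (g x) <= c) ->
  L2 (fun x => f x * g x).
Proof.
move=> lf mg gc; apply: (@L2_mono _ f c) => //.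
  by apply: cmeasM => //; case: lf.
by move=> x; rewrite ncM mulrC ler_wpM2r// nc_ge0.
Qed.

Lemma L2D f g : L2 f -> L2 g -> L2 (fun x => f x + g x).
Proof.
move=> [mf fi] [mg gi].
apply: L2_dom (rintD (rintZ 2 fi) (rintZ 2 gi)) _; first exact: cmeasD.
move=> x; apply: (@le_trans _ _ ((nc (f x) + nc (g x)) ^+ 2)).
  by apply: lerXn2r (ncD _ _); rewrite nnegrE ?addr_ge0 ?nc_ge0.
rewrite /modulus -subr_ge0 [leRHS](_ : _ = (nc (f x) - nc (g x)) ^+ 2) ?sqr_ge0//.
by ring.
Qed.

Lemma L2B f g : L2 f -> L2 g -> L2 (fun x => f x - g x).
Proof. by move=> lf lg; apply: L2D => //; exact: L2N. Qed.

Lemma L2_sum (I : Type) (s : seq I) (F : I -> R -> C) :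
  (forall i, L2 (F i)) -> L2 (fun x => \sum_(i <- s) F i x).
Proof.
move=> mF; elim: s => [|i s IH].
  by under eq_fun do rewrite big_nil; apply: (@L2_bd _ 0) => [|x];
    [exact: cmeas_cst|rewrite nc0].
by under eq_fun do rewrite big_cons; exact: L2D.
Qed.

Lemma L2_cst c : L2 (fun=> c).
Proof. by apply: (@L2_bd _ (nc c)) => //; exact: cmeas_cst. Qed.

Lemma L2_L1 f : L2 f -> L1 f.
Proof.
move=> [mf fi]; apply: L1_dom mf (rintD fi (rint_cst 1)) _ => x.
rewrite /modulus -subr_ge0; set a := nc _.
rewrite [leRHS](_ : _ = (a - 1/2) ^+ 2 + 3/4); last by field.
by rewrite addr_ge0 ?sqr_ge0.
Qed.

Lemma L2M f g : L2 f -> L2 g -> L1 (fun x => f x * g x).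
Proof.
move=> [mf fi] [mg gi].
apply: L1_dom (rintD fi gi) _; first exact: cmeasM.
move=> x; rewrite ncM /modulus; set a := nc _; set b := nc _.
rewrite -subr_ge0 [leRHS](_ : _ = (a - b/2) ^+ 2 + 3/4 * b ^+ 2); last by field.
by rewrite addr_ge0 ?sqr_ge0// mulr_ge0 ?sqr_ge0.
Qed.

Lemma quadratic_form_bound (X A B : R) : 0 <= A -> 0 <= B ->
  (forall s t : R, 2 * s * t * X <= s ^+ 2 * A ^+ 2 + t ^+ 2 * B ^+ 2) ->
  X <= A * B.
Proof.
move=> A0 B0 H.
have [A00|An0] := eqVneq A 0.
  rewrite A00 mul0r leNgt; apply/negP => X0.
  have := H ((B ^+ 2 + 1) / (2 * X)) 1; rewrite A00 expr0n mulr0 add0r expr1n mul1r.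
  rewrite mulr1 [leLHS](_ : _ = B ^+ 2 + 1); first by lra.
  by field; rewrite gt_eqF.
have [B00|Bn0] := eqVneq B 0.
  rewrite B00 mulr0 leNgt; apply/negP => X0.
  have := H 1 ((A ^+ 2 + 1) / (2 * X)); rewrite B00 expr0n mulr0 addr0 expr1n mul1r.
  rewrite mulr1 [leLHS](_ : _ = A ^+ 2 + 1); first by lra.
  by field; rewrite gt_eqF.
have P : 0 < A * B by rewrite mulr_gt0// lt_def ?An0 ?Bn0.
have := H B A; rewrite -subr_ge0 [leRHS](_ : _ = (2 * (A * B)) * (A * B - X)).
  by rewrite pmulr_rge0 ?subr_ge0// mulr_gt0.
by ring.
Qed.

Lemma N1M f g : L2 f -> L2 g -> N1 (fun x => f x * g x) <= n2 f * n2 g.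
Proof.
move=> lf lg; have [_ fgi] := L2M lf lg.
have [mf fi] := lf; have [mg gi] := lg.
apply: quadratic_form_bound => // s t.
rewrite !n2sq -!RintM// -RintegralD//; last 2 first.
- exact: (rintZ _ fi).
- exact: (rintZ _ gi).
apply: le_Rintegral => //.
- exact: (rintZ _ fgi).
- exact: rintD (rintZ _ fi) (rintZ _ gi).
move=> x _; rewrite /modulus ncM; set a := nc _; set b := nc _.
rewrite -subr_ge0 [leRHS](_ : _ = (s * a - t * b) ^+ 2) ?sqr_ge0//.
by ring.
Qed.

Lemma N1_ge0 f : 0 <= N1 f.
Proof. by apply: Rintegral_ge0 => x _; exact: nc_ge0. Qed.

Lemma n2_eq f g : (forall x, nc (f x) = nc (g x)) -> n2 f = n2 g.
Proof.
by move=> fg; congr Num.sqrt; apply: eq_Rintegral => x _; rewrite /modulus fg.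
Qed.

Lemma n2N f : n2 (fun x => - f x) = n2 f.
Proof. by apply: n2_eq => x; rewrite ncN. Qed.

Lemma n2_sub f g : n2 (fun x => f x - g x) = n2 (fun x => g x - f x).
Proof. by apply: n2_eq => x; rewrite nc_sub. Qed.

Lemma n2_conj f : n2 (fun x => conjc (f x)) = n2 f.
Proof. by apply: n2_eq => x; rewrite nc_conj. Qed.

Lemma n2_cst c : n2 (fun=> c) = nc c.
Proof. by rewrite /n2 /modulus Rint_cst sqrtr_sqr ger0_norm// nc_ge0. Qed.

Lemma n2Z c f : L2 f -> n2 (fun x => c * f x) = nc c * n2 f.
Proof.
move=> [mf fi]; rewrite /n2 /modulus; under eq_Rintegral do rewrite ncM exprMn.
by rewrite RintM// sqrtrM ?sqr_ge0// sqrtr_sqr ger0_norm// nc_ge0.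
Qed.

Lemma N1_le_n2 f : L2 f -> N1 f <= n2 f.
Proof.
move=> lf; have := N1M lf (L2_cst 1); rewrite n2_cst nc1 mulr1.
by apply: le_trans; under [in leRHS]eq_fun do rewrite mulr1.
Qed.

Lemma innerC f g : L2 f -> L2 g -> inner g f = conjc (inner f g).
Proof.
move=> lf lg; rewrite /inner -cint_conj; last by apply: L2M => //; exact: L2_conj.
by congr cintegral; apply/funext => x; rewrite conjcM conjcK mulrC.
Qed.

Lemma innerDl f g h : L2 f -> L2 g -> L2 h ->
  inner (fun x => f x + g x) h = inner f h + inner g h.
Proof.
move=> lf lg /L2_conj lh; rewrite /inner -cintD//; try exact: L2M.
by congr cintegral; apply/funext => x; rewrite mulrDl.
Qed.

Lemma innerZl c f h : L2 f -> L2 h ->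
  inner (fun x => c * f x) h = c * inner f h.
Proof.
move=> lf /L2_conj lh; rewrite /inner -cintZ//; last exact: L2M.
by congr cintegral; apply/funext => x; rewrite mulrA.
Qed.

Lemma innerNl f h : L2 f -> L2 h -> inner (fun x => - f x) h = - inner f h.
Proof.
move=> lf lh; under eq_fun do rewrite -mulN1r.
by rewrite innerZl// mulN1r.
Qed.

Lemma innerBl f g h : L2 f -> L2 g -> L2 h ->
  inner (fun x => f x - g x) h = inner f h - inner g h.
Proof. by move=> lf lg lh; rewrite innerDl ?innerNl//; exact: L2N. Qed.

Lemma innerDr f g h : L2 f -> L2 g -> L2 h ->
  inner h (fun x => f x + g x) = inner h f + inner h g.
Proof.
move=> lf lg lh; rewrite innerC//; last exact: L2D.
by rewrite innerDl// conjcD -!innerC.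
Qed.

Lemma innerZr c f h : L2 f -> L2 h ->
  inner h (fun x => c * f x) = conjc c * inner h f.
Proof.
move=> lf lh; rewrite innerC//; last exact: L2Z.
by rewrite innerZl// conjcM -!innerC.
Qed.

Lemma innerNr f h : L2 f -> L2 h -> inner h (fun x => - f x) = - inner h f.
Proof.
move=> lf lh; rewrite innerC//; last exact: L2N.
by rewrite innerNl// conjcN -!innerC.
Qed.

Lemma innerBr f g h : L2 f -> L2 g -> L2 h ->
  inner h (fun x => f x - g x) = inner h f - inner h g.
Proof. by move=> lf lg lh; rewrite innerDr ?innerNr//; exact: L2N. Qed.

Lemma inner_suml (I : Type) (s : seq I) (F : I -> R -> C) h :
  (forall i, L2 (F i)) -> L2 h ->
  inner (fun x => \sum_(i <- s) F i x) h = \sum_(i <- s) inner (F i) h.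
Proof.
move=> lF lh; rewrite /inner -cint_sum; last by move=> i; apply: L2M => //; exact: L2_conj.
by congr cintegral; apply/funext => x; rewrite mulr_suml.
Qed.

Lemma inner_self f : inner f f = (n2 f ^+ 2)%:C%C.
Proof.
rewrite n2sq -cint_real; congr cintegral; apply/funext => x.
exact: mul_conj.
Qed.

Lemma inner_le f g : L2 f -> L2 g -> nc (inner f g) <= n2 f * n2 g.
Proof.
move=> lf lg; have lg' := L2_conj lg; rewrite (le_trans (cint_le (L2M lf lg')))//.
by rewrite (le_trans (N1M lf lg'))// n2_conj.
Qed.

Lemma n2sqD f g : L2 f -> L2 g ->
  n2 (fun x => f x + g x) ^+ 2 =
  n2 f ^+ 2 + n2 g ^+ 2 + 2 * complex.Re (inner f g).
Proof.
move=> lf lg; have lfg := L2D lf lg.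
have := inner_self (fun x => f x + g x).
rewrite innerDl// !innerDr// (innerC lf lg) !inner_self => /(congr1 (@complex.Re R)).
by rewrite !Re_D Re_conjc /= => <-; ring.
Qed.

Lemma n2sqB f g : L2 f -> L2 g ->
  n2 (fun x => f x - g x) ^+ 2 =
  n2 f ^+ 2 + n2 g ^+ 2 - 2 * complex.Re (inner f g).
Proof.
by move=> lf lg; rewrite n2sqD ?n2N ?innerNr ?Re_N//; [ring|exact: L2N].
Qed.

Lemma parallelogram f g : L2 f -> L2 g ->
  n2 (fun x => f x + g x) ^+ 2 + n2 (fun x => f x - g x) ^+ 2 =
  2 * n2 f ^+ 2 + 2 * n2 g ^+ 2.
Proof. by move=> lf lg; rewrite n2sqD// n2sqB//; ring. Qed.

Lemma n2D f g : L2 f -> L2 g -> n2 (fun x => f x + g x) <= n2 f + n2 g.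
Proof.
move=> lf lg; rewrite -(@ler_pXn2r _ 2)// ?nnegrE ?addr_ge0//.
have h : complex.Re (inner f g) <= n2 f * n2 g.
  by rewrite (le_trans (ler_norm _))// (le_trans (nc_Re _))// inner_le.
by rewrite n2sqD// sqrrD; lra.
Qed.

Lemma n2B f g : L2 f -> L2 g -> n2 (fun x => f x - g x) <= n2 f + n2 g.
Proof. by move=> lf lg; rewrite (le_trans (n2D lf (L2N lg)))// n2N. Qed.

Lemma n2_trans f g h : L2 f -> L2 g -> L2 h ->
  n2 (fun x => f x - h x) <= n2 (fun x => f x - g x) + n2 (fun x => g x - h x).
Proof.
move=> lf lg lh; have := n2D (L2B lf lg) (L2B lg lh).
by under [X in n2 X <= _]eq_fun do rewrite addrA subrK.
Qed.

Lemma n2_dist f g : L2 f -> L2 g -> `|n2 f - n2 g| <= n2 (fun x => f x - g x).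
Proof.
move=> lf lg; rewrite ler_distl.
have h1 := n2D (L2B lf lg) lg; have h2 := n2D (L2B lg lf) lf.
have e1 : (fun x => f x - g x + g x) = f by apply/funext => x; rewrite subrK.
have e2 : (fun x => g x - f x + f x) = g by apply/funext => x; rewrite subrK.
rewrite e1 in h1; rewrite e2 n2_sub in h2.
by apply/andP; split; lra.
Qed.

Lemma n2_ae f g : cmeas f -> cmeas g -> f = g %[ae mu] -> n2 f = n2 g.
Proof.
move=> mf mg fg; congr Num.sqrt; apply: Rint_ae.
- by apply: measurable_funX; exact: measurable_modulus.
- by apply: measurable_funX; exact: measurable_modulus.
- by move: fg; apply: ae_imp => x /= h i; rewrite /modulus h.
Qed.

Lemma L2_ae f g : cmeas f -> L2 g -> f = g %[ae mu] -> L2 f.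
Proof.
move=> mf [mg /integrableP[mg' gi]] fg; split => //; apply/integrableP; split.
  by apply/measurable_EFinP; apply: measurable_funX; exact: measurable_modulus.
apply: le_lt_trans gi; rewrite le_eqVlt; apply/orP; left; apply/eqP.
apply: ae_eq_integral => //.
- apply: measurableT_comp => //; apply/measurable_EFinP; apply: measurable_funX.
  exact: measurable_modulus.
- by apply: measurableT_comp.
- by move: fg; apply: ae_imp => x /= h i; rewrite /modulus h.
Qed.

Lemma n2_eq0 f : L2 f -> n2 f = 0 -> f = (fun=> 0) %[ae mu].
Proof.
move=> [mf fi] f0; apply/ae_eqE.
have : (\int[mu]_x (modulus f x ^+ 2))%R = 0 by rewrite -n2sq f0 expr0n.
move=> /(Rint0_ae fi) H; apply: ae_imp (H _) => x.
  by move/eqP; rewrite sqrf_eq0 => /eqP /nc_eq0.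
exact: sqr_ge0.
Qed.

Lemma n2B_eq0 f g : L2 f -> L2 g -> n2 (fun x => f x - g x) = 0 -> f = g %[ae mu].
Proof.
move=> lf lg /(n2_eq0 (L2B lf lg)) H; apply/ae_eqE; move/ae_eqE: H.
by apply: ae_imp => x /eqP; rewrite subr_eq0 => /eqP.
Qed.

Lemma n2B_ae f g : cmeas f -> cmeas g -> f = g %[ae mu] -> n2 (fun x => f x - g x) = 0.
Proof.
move=> mf mg fg; rewrite (@n2_ae _ (fun=> 0)); first by rewrite n2_cst nc0.
- exact: cmeasB.
- exact: cmeas_cst.
- by move: fg; apply: ae_imp => x h i; rewrite h ?subrr.
Qed.

Lemma L2dist_n2 f g : L2 f -> L2 g -> L2dist f g = (n2 (fun x => f x - g x))%:E.
Proof. by move=> lf lg; rewrite /L2dist cLnorm2//; exact: L2B. Qed.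

End L2_theory.
#[export] Hint Resolve n2_ge0 : core.
#[export] Hint Resolve N1_ge0 : core.

(** Linear arithmetic on norms, treated as atoms. *)
Ltac abs_lra :=
  repeat match goal with
  | |- context [n2 ?f] => generalize (n2 f); intro
  | |- context [N1 ?f] => generalize (N1 f); intro
  | |- context [complex.Re ?z] => generalize (complex.Re z); intro
  end; lra.

(** * Completeness of L2 and almost everywhere limits *)

Section completeness.
Context {R : realType}.
Local Notation C := R[i].
Local Notation mu := (@torus_measure R).
Local Notation nc := (@Normc.normc R).
Implicit Types (f g h : R -> C) (p q : R -> R).

Lemma half_sum (n : nat) : \sum_(0 <= i < n) (2^-1 : R) ^+ i = 2 - 2 * 2^-1 ^+ n.
Proof.
elim: n => [|n IH]; first by rewrite big_nil expr0 mulr1 subrr.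
by rewrite big_nat_recr//= IH exprS; field.
Qed.

Lemma half_sum_le (n : nat) : \sum_(0 <= i < n) (2^-1 : R) ^+ i <= 2.
Proof. by rewrite half_sum gerBl mulr_ge0// exprn_ge0// invr_ge0. Qed.

Lemma cvg_of_variation (a : nat -> R) (S : R) :
  (forall n, \sum_(0 <= i < n) `|a i.+1 - a i| <= S) -> cvgn a.
Proof.
move=> aS.
have : cvgn (series (telescope a)).
  apply: normed_cvg; rewrite /normed_series_of seriesEnat /=.
  apply: nondecreasing_is_cvgn.
    by apply/nondecreasing_seqP => n; rewrite big_nat_recr//= lerDl.
  by exists S => _ [n _ <-]; exact: aS.
move=> /cvg_ex[l hl]; apply/cvg_ex; exists (a 0%N + l : R).
have h0 : (fun=> a 0%N) @ \oo --> a 0%N by exact: cvg_cst.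
apply: (cvg_trans _ (cvgD h0 hl)); apply: near_eq_cvg; apply: nearW => n.
by rewrite [RHS]eq_sum_telescope.
Qed.

(** The pointwise limit exists wherever the sum of the increments is finite,
    and this sum has a finite integral by monotone convergence. *)
Lemma ae_limit (F : nat -> R -> C) (c : R) :
  (forall n, cmeas (F n)) ->
  (forall n, L1 (fun x => F n.+1 x - F n x)) ->
  (forall n, N1 (fun x => F n.+1 x - F n x) <= c * 2^-1 ^+ n) ->
  exists2 g, cmeas g &
    {ae mu, forall x, nc (F n x - g x) @[n --> \oo] --> (0 : R)}.
Proof.
move=> mF lF bF.
pose d n x := modulus (fun x => F n.+1 x - F n x) x.
have d0 n x : 0 <= d n x by exact: nc_ge0.
have c0 : 0 <= c.
  by have := bF 0%N; rewrite expr0 mulr1; apply: le_trans; exact: N1_ge0.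
have md n : measurable_fun setT (EFin \o d n).
  by apply/measurable_EFinP; apply: measurable_modulus; case: (lF n).
pose D x := (\sum_(n <oo) (d n x)%:E)%E.
have iD : (\int[mu]_x D x < +oo)%E.
  rewrite /D integral_nneseries//; last by move=> n x _; rewrite lee_fin.
  apply: (@le_lt_trans _ _ (c * 2)%:E); last exact: ltry.
  apply: lime_le.
    by apply: is_cvg_nneseries => n _ _; apply: integral_ge0 => x _; rewrite lee_fin.
  apply: nearW => n.
  apply: (@le_trans _ _ (\sum_(0 <= i < n) (c * 2^-1 ^+ i)%:E)%E).
    apply: lee_sum => i _; have [_ hi] := lF i.
    by rewrite -(fineK (integrable_fin_num measurableT hi)) lee_fin; exact: bF.
  by rewrite sumEFin lee_fin -mulr_sumr ler_wpM2l// half_sum_le.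
have mD : measurable_fun setT D.
  by apply: (@ge0_emeasurable_sum _ _ _ _ (fun n x => (d n x)%:E) xpredT) => n;
    [move=> x _ _; rewrite lee_fin|move=> _; exact: md].
have D0 x : (0 <= D x)%E by apply: nneseries_ge0 => n _ _; rewrite lee_fin.
have ID : mu.-integrable setT D.
  apply/integrableP; split => //; under eq_integral do rewrite gee0_abs//.
  exact: iD.
pose Fr n x := complex.Re (F n x). pose Fi n x := complex.Im (F n x).
pose g x : C := Complex (fine (limn_esup (fun n => (Fr n x)%:E)))
                        (fine (limn_esup (fun n => (Fi n x)%:E))).
exists g.
  split; apply: measurableT_comp => //;
    by apply: measurable_fun_limn_esup => n; apply/measurable_EFinP; case: (mF n).
have := integrable_ae measurableT ID; apply: ae_imp => x /(_ Logic.I) Dx.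
have bd n : \sum_(0 <= i < n) d i x <= fine (D x).
  rewrite -lee_fin (fineK Dx) -sumEFin; apply: nneseries_lim_ge => i _ _.
  by rewrite lee_fin.
have cr : cvgn (fun n => Fr n x).
  apply: (@cvg_of_variation _ (fine (D x))) => n; apply: le_trans (bd n).
  apply: ler_sum => i _; rewrite /Fr /d /modulus.
  by have := nc_Re (F i.+1 x - F i x); rewrite Re_D Re_N.
have ci : cvgn (fun n => Fi n x).
  apply: (@cvg_of_variation _ (fine (D x))) => n; apply: le_trans (bd n).
  apply: ler_sum => i _; rewrite /Fi /d /modulus.
  by have := nc_Im (F i.+1 x - F i x); rewrite Im_D Im_N.
have lr : fine (limn_esup (fun n => (Fr n x)%:E)) = limn (fun n => Fr n x).
  have : (EFin \o (fun n => Fr n x)) @ \oo --> (limn (fun n => Fr n x))%:E.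
    by apply: cvg_comp; [exact: cr|exact: cvg_id].
  by move=> /cvg_limn_einf_sup[_ ->].
have li : fine (limn_esup (fun n => (Fi n x)%:E)) = limn (fun n => Fi n x).
  have : (EFin \o (fun n => Fi n x)) @ \oo --> (limn (fun n => Fi n x))%:E.
    by apply: cvg_comp; [exact: ci|exact: cvg_id].
  by move=> /cvg_limn_einf_sup[_ ->].
apply: (@squeeze_cvgr _ _ _ _ (fun=> 0)
  (fun n => `|Fr n x - limn (fun n => Fr n x)| + `|Fi n x - limn (fun n => Fi n x)|)).
- apply: nearW => n; rewrite nc_ge0 (le_trans (nc_le _))//.
  by rewrite Re_D Im_D Re_N Im_N /= lr li.
- exact: cvg_cst.
- have nl (a : nat -> R) : cvgn a -> `|a n - limn a| @[n --> \oo] --> (0 : R).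
    move=> ca; apply/cvgrPdist_lt => e e0; move/cvgrPdist_lt: ca => /(_ e e0).
    by apply: filterS => n; rewrite sub0r normrN normr_id distrC.
  have h1 := nl _ cr; have h2 := nl _ ci; have h3 := cvgD h1 h2.
  by rewrite addr0 in h3; exact: h3.
Qed.

Lemma fatou_real (P : nat -> R -> R) p (c : R) :
  (forall n, rint (P n)) -> (forall n x, 0 <= P n x) ->
  (forall n, (\int[mu]_x P n x)%R <= c) ->
  measurable_fun setT p -> (forall x, 0 <= p x) ->
  {ae mu, forall x, P n x @[n --> \oo] --> p x} ->
  rint p /\ (\int[mu]_x p x)%R <= c.
Proof.
move=> iP P0 Pc mp p0 Pp.
have mP n : measurable_fun setT (EFin \o P n) by exact: measurable_int (iP n).
have H : (\int[mu]_x (p x)%:E <= c%:E)%E.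
  have -> : (\int[mu]_x (p x)%:E = \int[mu]_x limn_einf (fun n => (P n x)%:E))%E.
    apply: ae_eq_integral => //; first exact/measurable_EFinP.
      rewrite (_ : (fun _ => _) = fun x => - (limn_esup (fun n => - (P n x)%:E)))%E.
        apply: measurableT_comp => //; apply: measurable_fun_limn_esup => n.
        by apply: measurableT_comp => //; exact: mP.
      by apply/funext => x; rewrite limn_esupN oppeK.
    move: Pp; apply: ae_imp => x h _.
    have : (fun n => (P n x)%:E) @ \oo --> (p x)%:E.
      by apply: cvg_comp; [exact: h|exact: cvg_id].
    by move=> /cvg_limn_einf_sup[->].
  apply: (le_trans (fatou mu measurableT mP _)); first by move=> n x _; rewrite lee_fin.
  rewrite limn_einf_lim; apply: lime_le; first exact: is_cvg_einfs.
  apply: nearW => n; apply: (@le_trans _ _ (\int[mu]_x (P n x)%:E)%E).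
    by apply: ereal_inf_lbound; exists n => /=.
  by rewrite -(fineK (integrable_fin_num measurableT (iP n))) lee_fin; exact: Pc.
have ip : rint p.
  apply/integrableP; split; first exact/measurable_EFinP.
  apply: le_lt_trans (ltry c); apply: le_trans H.
  by apply: ge0_le_integral => //; [apply: measurableT_comp => //|..];
    try exact/measurable_EFinP; move=> x _ /=; rewrite ?lee_fin ?ger0_norm.
by split => //; rewrite -lee_fin /Rintegral (fineK (integrable_fin_num measurableT ip)).
Qed.

Definition ae_cvg (F : nat -> R -> C) g :=
  {ae mu, forall x, nc (F n x - g x) @[n --> \oo] --> (0 : R)}.

Lemma nc_cvg (a : nat -> C) (l : C) :
  nc (a n - l) @[n --> \oo] --> (0 : R) ->
  (fun n => nc (a n) : R) @ \oo --> (nc l : R).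
Proof.
move=> h; apply/cvgrPdist_lt => e e0; move/cvgrPdist_lt: h => /(_ e e0).
apply: filterS => n; rewrite sub0r normrN ger0_norm ?nc_ge0//.
apply: le_lt_trans; rewrite ler_distl.
have h1 := ncD (a n - l) l; rewrite subrK in h1.
have h2 := ncD (l - a n) (a n); rewrite subrK nc_sub in h2.
by apply/andP; split; lra.
Qed.

Lemma sqr_cvg (a : nat -> R) (l : R) :
  a @ \oo --> l -> (fun n => a n ^+ 2) @ \oo --> l ^+ 2.
Proof.
move=> h; apply: (@cvg_comp _ _ _ a (fun x : R => x ^+ 2)); first exact: h.
exact: exprn_continuous.
Qed.

Lemma fatou_n2 (F : nat -> R -> C) g (c : R) : 0 <= c ->
  (forall n, L2 (F n)) -> (forall n, n2 (F n) <= c) -> cmeas g ->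
  ae_cvg F g -> L2 g /\ n2 g <= c.
Proof.
move=> c0 lF Fc mg Fg.
have [ip Ip] : rint (fun x => modulus g x ^+ 2) /\
    (\int[mu]_x (modulus g x ^+ 2))%R <= c ^+ 2.
  apply: (@fatou_real (fun n x => modulus (F n) x ^+ 2)).
  - by move=> n; case: (lF n).
  - by move=> n x; exact: sqr_ge0.
  - by move=> n; rewrite -n2sq; apply: (lerXn2r _ _ _ (Fc n)); rewrite nnegrE ?n2_ge0.
  - by apply: measurable_funX; exact: measurable_modulus.
  - by move=> x; exact: sqr_ge0.
  - move: Fg; apply: ae_imp => x /nc_cvg h.
    exact: sqr_cvg h.
split => //; rewrite -(@ler_pXn2r _ 2)// ?nnegrE ?n2_ge0// n2sq//.
Qed.

Lemma fatou_N1 (F : nat -> R -> C) g (c : R) :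
  (forall n, L1 (F n)) -> (forall n, N1 (F n) <= c) -> cmeas g ->
  ae_cvg F g -> L1 g /\ N1 g <= c.
Proof.
move=> lF Fc mg Fg.
have [ip Ip] : rint (modulus g) /\ (\int[mu]_x modulus g x)%R <= c.
  apply: (@fatou_real (fun n x => modulus (F n) x)) => //.
  - by move=> n; case: (lF n).
  - by move=> n x; exact: nc_ge0.
  - exact: measurable_modulus.
  - by move=> x; exact: nc_ge0.
  - by move: Fg; apply: ae_imp => x /nc_cvg h.
by [].
Qed.

Lemma ae_cvg_subr (F : nat -> R -> C) g h : ae_cvg F g ->
  ae_cvg (fun n x => F n x - h x) (fun x => g x - h x).
Proof.
apply: ae_imp => x hx; under eq_fun do rewrite opprB addrA subrK.
by [].
Qed.

Lemma ae_cvg_shift (F : nat -> R -> C) g m : ae_cvg F g ->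
  ae_cvg (fun n => F (n + m)%N) g.
Proof.
apply: ae_imp => x hx.
by rewrite (cvg_shiftn m (fun n => nc (F n x - g x))).
Qed.

Definition L2_cauchy (F : nat -> R -> C) := forall e : R, 0 < e ->
  exists N, forall m n, (N <= m)%N -> (N <= n)%N ->
    n2 (fun x => F m x - F n x) <= e.

Lemma riesz_fischer (F : nat -> R -> C) : (forall n, L2 (F n)) -> L2_cauchy F ->
  exists2 g, L2 g & forall e : R, 0 < e ->
    exists N, forall n, (N <= n)%N -> n2 (fun x => F n x - g x) <= e.
Proof.
move=> lF cF.
have e0 k : 0 < (2^-1 : R) ^+ k by rewrite exprn_gt0// invr_gt0.
have /choice[N HN] : forall k, exists N, forall m n, (N <= m)%N -> (N <= n)%N ->
    n2 (fun x => F m x - F n x) <= 2^-1 ^+ k.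
  by move=> k; exact: cF.
pose phi k := (\sum_(0 <= i < k.+1) N i)%N.
have Nphi k : (N k <= phi k)%N by rewrite /phi big_nat_recr//= leq_addl.
have phiS k : (phi k <= phi k.+1)%N by rewrite /phi [leqRHS]big_nat_recr//= leq_addr.
have phim k n : (k <= n)%N -> (phi k <= phi n)%N.
  move=> /subnK <-; elim: (n - k)%N => // j IH.
  by rewrite addSn (leq_trans IH).
have [g mg Fg] := @ae_limit (fun k => F (phi k)) 1
  (fun k => L2_meas (lF _)) (fun k => L2_L1 (L2B (lF _) (lF _)))
  (fun k => le_trans (N1_le_n2 (L2B (lF _) (lF _))) (le_trans
    (HN k _ _ (leq_trans (Nphi k) (phiS k)) (Nphi k))
    (eq_ind_r (fun y => _ <= y) (lexx _) (mul1r _)))).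
have key k n : (N k <= n)%N -> L2 (fun x => g x - F n x) /\
    n2 (fun x => g x - F n x) <= 2^-1 ^+ k.
  move=> kn.
  apply: (@fatou_n2 (fun j x => F (phi (j + k)%N) x - F n x)) => //.
  - by move=> j; exact: L2B.
  - by move=> j; apply: HN => //; rewrite (leq_trans (Nphi k))// phim// leq_addl.
  - by apply: cmeasB => //; case: (lF n).
  - apply: (@ae_cvg_subr (fun j => F (phi (j + k)%N))).
    exact: (@ae_cvg_shift (fun j => F (phi j))).
have lg : L2 g.
  have [l _] := key 0%N (N 0%N) (leqnn _).
  have := L2D l (lF (N 0%N)).
  by under eq_fun do rewrite subrK.
exists g => // e ep.
have [k hk] : exists k, (2^-1 : R) ^+ k <= e.
  have : (fun k => (2^-1 : R) ^+ k) @ \oo --> 0 by apply: cvg_expr; rewrite ger0_norm// invf_lt1// ltr1n.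
  move=> /cvgrPdist_lt /(_ e ep) [k _ /(_ k (leqnn k))] /=.
  by rewrite sub0r normrN ger0_norm ?ltW// => h; exists k; exact: ltW.
exists (N k) => n kn; apply: le_trans hk.
by rewrite n2_sub; have [] := key k n kn.
Qed.

End completeness.

(** * Exponentials and their Fourier coefficients *)

Section exponentials.
Context {R : realType}.
Local Notation C := R[i].
Local Notation mu := (@torus_measure R).
Local Notation nc := (@Normc.normc R).
Implicit Types (f g h : R -> C) (p q : R -> R) (k j : int) (x : R).

Lemma cexpD j k x : cexp (j + k) x = cexp j x * cexp k x :> C.
Proof.
rewrite /cexp rmorphD /= mulrDl cosD sinD; apply: eq_C; rewrite ?Re_M ?Im_M//=.
by rewrite addrC.
Qed.

Lemma cexp0 x : cexp 0 x = 1 :> C.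
Proof. by rewrite /cexp mul0r cos0 sin0. Qed.

Lemma cexpN k x : cexp (- k) x = conjc (cexp k x) :> C.
Proof. by rewrite /cexp rmorphN /= mulNr cosN sinN. Qed.

Lemma nc_cexp k x : nc (cexp k x) = 1.
Proof. by rewrite /= cos2Dsin2 sqrtr1. Qed.

Lemma measurable_lin (c : R) : measurable_fun setT (fun x : R => c * x).
Proof. exact: mulrl_measurable. Qed.

Lemma cmeas_cexp k : cmeas (@cexp R k).
Proof.
split; [apply: (@measurableT_comp _ _ _ _ _ _ (@cos R))|
        apply: (@measurableT_comp _ _ _ _ _ _ (@sin R))];
  try exact: measurable_lin; apply: continuous_measurable_fun.
- exact: continuous_cos.
- exact: continuous_sin.
Qed.

Lemma L2_cexp k : L2 (@cexp R k).
Proof. by apply: (@L2_bd _ _ 1) => [|x]; [exact: cmeas_cexp|rewrite nc_cexp]. Qed.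

Lemma L1_cexp k : L1 (@cexp R k). Proof. exact: L2_L1 (L2_cexp k). Qed.

Local Notation leb := (@lebesgue_measure R).
Local Notation D := (`[0, 2 * pi[%classic : set R).

Lemma torus_integral_ge0 (f : R -> \bar R) : measurable_fun setT f ->
  (forall x, (0 <= f x)%E) ->
  (\int[mu]_x f x = ((2 * pi)^-1)%:E * \int[leb]_(x in D) f x)%E.
Proof.
move=> mf f0.
have mD : measurable (D : set (measurableTypeR R)) by exact: measurable_itv.
rewrite [LHS]ge0_integral_mscale//; congr (_ * _)%E.
rewrite (ge0_negligible_integral (measurableC mD) measurableT)//; last first.
  by rewrite /= /mrestr setICl measure0.
rewrite setTD setCK; apply: eq_measure_integral => A mA AD.
by rewrite /= /mrestr setIidl.
Qed.

Lemma mean_trig (c : R) : c != 0 -> sin (c * (2 * pi)) = 0 -> cos (c * (2 * pi)) = 1 ->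
  (\int[mu]_x cos (c * x) = 0)%R /\ (\int[mu]_x sin (c * x) = 0)%R.
Proof.
move=> c0 s1 c1.
have pi2 : 0 < 2 * pi :> R by rewrite mulr_gt0// pi_gt0.
have mc : measurable_fun setT (fun x : R => cos (c * x)).
  apply: (@measurableT_comp _ _ _ _ _ _ (@cos R)); last exact: measurable_lin.
  by apply: continuous_measurable_fun; exact: continuous_cos.
have ms : measurable_fun setT (fun x : R => sin (c * x)).
  apply: (@measurableT_comp _ _ _ _ _ _ (@sin R)); last exact: measurable_lin.
  by apply: continuous_measurable_fun; exact: continuous_sin.
have key (p P : R -> R) : measurable_fun setT p -> (forall x, `|p x| <= 1) ->
    continuous p -> (forall x, is_derive x 1 P (p x)) -> P (2 * pi) = P 0 ->
    (\int[mu]_x p x = 0)%R.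
  move=> mp p1 cp dP PP.
  have ip : rint p by exact: (rint_bd mp p1).
  have H : (\int[mu]_x (1 + p x) = 1)%R.
    rewrite /Rintegral torus_integral_ge0; last 2 first.
    - by apply/measurable_EFinP; apply: measurable_funD.
    - by move=> x; rewrite lee_fin -lerBlDl sub0r; have := p1 x; rewrite ler_norml => /andP[].
    rewrite integral_itv_bndo_bndc; last first.
      apply/measurable_EFinP; apply: measurable_funTS; exact: measurable_funD.
    rewrite (@continuous_FTC2 _ _ (fun x => x + P x))//.
    - by rewrite -EFinB -EFinM /= PP add0r addrK mulVf// gt_eqF.
    - apply: continuous_subspaceT => x; apply: cvgD; first exact: cvg_cst.
      exact: cp.
    - split => [x _||].
      + exact: derivableD.
      + apply: cvg_at_right_filter; apply: cvgD; first exact: cvg_id.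
        by apply: differentiable_continuous; apply/derivable1_diffP; case: (dP 0).
      + apply: cvg_at_left_filter; apply: cvgD; first exact: cvg_id.
        by apply: differentiable_continuous; apply/derivable1_diffP; case: (dP (2 * pi)).
    - by move=> x _; rewrite derive1E derive_val.
  move: H; rewrite RintegralD//; last exact: rint_cst.
  by rewrite Rint_cst => /eqP; rewrite -subr_eq0 addrAC subrr add0r => /eqP.
split.
- apply: (key _ (fun x => c^-1 * sin (c * x))) => //.
  + by move=> x; rewrite ler_norml cos_geN1 cos_le1.
  + by move=> x; apply: continuous_comp; [exact: mulrl_continuous|exact: continuous_cos].
  + by move=> x; apply: is_derive_eq; rewrite /GRing.scale /=; field.
  + by rewrite s1 !mulr0 sin0 mulr0.
- apply: (key _ (fun x => - (c^-1 * cos (c * x)))) => //.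
  + by move=> x; rewrite ler_norml sin_geN1 sin_le1.
  + by move=> x; apply: continuous_comp; [exact: mulrl_continuous|exact: continuous_sin].
  + by move=> x; apply: is_derive_eq; rewrite /GRing.scale /=; field.
  + by rewrite c1 mulr0 cos0.
Qed.

Lemma cexp_2pi k : cexp k (2 * pi) = 1 :> C.
Proof.
have h1 : cexp 1 (2 * pi) = 1 :> C.
  by rewrite /cexp mul1r [2 * pi]mulrC mulr_natr cos2pi sin2pi.
have hn (n : nat) : cexp n%:Z (2 * pi) = 1 :> C.
  by elim: n => [|n IH]; rewrite ?cexp0// -addn1 PoszD cexpD IH h1 mulr1.
case: k => n; first exact: hn.
by rewrite NegzE cexpN hn conjc1.
Qed.

Lemma cint_cexp k : cintegral (@cexp R k) = (k == 0)%:R.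
Proof.
have [->|k0] := eqVneq k 0.
  rewrite (_ : @cexp R 0 = fun=> 1) ?cint_cst//.
  by apply/funext => x; rewrite cexp0.
have kR : (k%:~R : R) != 0 by rewrite intr_eq0.
have := cexp_2pi k; rewrite /cexp => /eqP; rewrite eq_complex /= => /andP[/eqP c1 /eqP s1].
by have [h1 h2] := mean_trig kR s1 c1; apply: eq_C.
Qed.

Lemma inner_cexp j k : inner (@cexp R j) (cexp k) = (j == k)%:R.
Proof.
rewrite /inner; under eq_fun do rewrite -cexpN -cexpD.
by rewrite cint_cexp subr_eq0.
Qed.

Lemma fourier_cexp j k : fourier (@cexp R j) k = (j == k)%:R.
Proof. exact: inner_cexp. Qed.

Lemma cexp_chord1 (n : nat) x y :
  nc (cexp n%:Z x - cexp n%:Z y) <= n%:R * nc (cexp 1 x - cexp 1 y).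
Proof.
elim: n => [|n IH]; first by rewrite !cexp0 subrr nc0 mul0r.
rewrite -addn1 PoszD !cexpD natrD mulrDl mul1r.
rewrite [X in nc X](_ : _ = (cexp n x - cexp n y) * cexp 1 x +
   cexp n y * (cexp 1 x - cexp 1 y)); last by ring.
rewrite (le_trans (ncD _ _))// !ncM !nc_cexp mulr1 mul1r.
by rewrite lerD2r.
Qed.

Lemma cexp_chord k x y :
  nc (cexp k x - cexp k y) <= `|k|%N%:R * nc (cexp 1 x - cexp 1 y).
Proof.
case: k => n; first exact: cexp_chord1.
by rewrite NegzE !cexpN -conjcB nc_conj abszN; exact: cexp_chord1.
Qed.

End exponentials.

(** * Fejer means *)

Section fejer.
Context {R : realType}.
Local Notation C := R[i].
Local Notation mu := (@torus_measure R).
Local Notation nc := (@Normc.normc R).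
Implicit Types (f g h : R -> C) (p q : R -> R) (k : int) (x y : R) (n : nat).

Lemma L1M_bd f g c : L1 f -> cmeas g -> (forall x, nc (g x) <= c) ->
  L1 (fun x => f x * g x).
Proof.
move=> [mf fi] mg gc; apply: L1_dom (rintZ c fi) _; first exact: cmeasM.
by move=> x; rewrite ncM mulrC ler_wpM2r// nc_ge0.
Qed.

Lemma N1M_bd f g c : L1 f -> cmeas g -> (forall x, nc (g x) <= c) ->
  N1 (fun x => f x * g x) <= c * N1 f.
Proof.
move=> [mf fi] mg gc; rewrite -RintM//; apply: le_N1.
- exact: cmeasM.
- exact: rintZ.
- by move=> x; rewrite ncM mulrC ler_wpM2r// nc_ge0.
Qed.

Lemma L1_cexpM f k : L1 f -> L1 (fun x => f x * cexp k x).
Proof.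
move=> lf; apply: (@L1M_bd _ _ 1) => //; first exact: cmeas_cexp.
by move=> x; rewrite nc_cexp.
Qed.

Lemma L1_cexpJ f k : L1 f -> L1 (fun x => f x * conjc (cexp k x)).
Proof.
move=> lf; apply: (@L1M_bd _ _ 1) => //.
  by apply: cmeas_conj; exact: cmeas_cexp.
by move=> x; rewrite nc_conj nc_cexp.
Qed.

Lemma fourierD f g k : L1 f -> L1 g ->
  fourier (fun x => f x + g x) k = fourier f k + fourier g k.
Proof.
move=> lf lg; rewrite /fourier /inner -cintD; try exact: L1_cexpJ.
by congr cintegral; apply/funext => x; rewrite mulrDl.
Qed.

Lemma fourierZ c f k : L1 f -> fourier (fun x => c * f x) k = c * fourier f k.
Proof.
move=> lf; rewrite /fourier /inner -cintZ; last exact: L1_cexpJ.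
by congr cintegral; apply/funext => x; rewrite mulrA.
Qed.

Lemma fourierN f k : L1 f -> fourier (fun x => - f x) k = - fourier f k.
Proof. by move=> lf; under eq_fun do rewrite -mulN1r; rewrite fourierZ// mulN1r. Qed.

Lemma fourierB f g k : L1 f -> L1 g ->
  fourier (fun x => f x - g x) k = fourier f k - fourier g k.
Proof. by move=> lf lg; rewrite fourierD ?fourierN//; exact: L1N. Qed.

Lemma fourier_conj f k : L1 f ->
  fourier (fun x => conjc (f x)) k = conjc (fourier f (- k)).
Proof.
move=> lf; rewrite /fourier /inner -cint_conj; last exact: L1_cexpJ.
by congr cintegral; apply/funext => x; rewrite conjcM cexpN conjcK.
Qed.

Lemma fourier_sum (I : Type) (s : seq I) (F : I -> R -> C) k :
  (forall i, L1 (F i)) ->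
  fourier (fun x => \sum_(i <- s) F i x) k = \sum_(i <- s) fourier (F i) k.
Proof.
move=> lF; rewrite /fourier /inner -cint_sum; last by move=> i; exact: L1_cexpJ.
by congr cintegral; apply/funext => x; rewrite mulr_suml.
Qed.

Lemma fourier0 f : fourier f 0 = cintegral f.
Proof.
by rewrite /fourier /inner; congr cintegral; apply/funext => x; rewrite cexp0 conjc1 mulr1.
Qed.

Lemma fourier_ae f g k : cmeas f -> cmeas g -> f = g %[ae mu] -> fourier f k = fourier g k.
Proof.
move=> mf mg fg; have mk := cmeas_conj (cmeas_cexp k).
apply: cint_ae; [exact: cmeasM|exact: cmeasM|].
by move: fg; apply: ae_imp => x h i; rewrite h.
Qed.

Lemma fourier_le f k : L1 f -> nc (fourier f k) <= N1 f.
Proof.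
move=> lf; rewrite (le_trans (cint_le (L1_cexpJ k lf)))// -[leRHS]mul1r.
apply: N1M_bd => //; first by apply: cmeas_conj; exact: cmeas_cexp.
by move=> x; rewrite nc_conj nc_cexp.
Qed.

Definition fejer n f : R -> C := fun x =>
  n.+1%:R^-1 * \sum_(j < n.+1) \sum_(l < n.+1)
     fourier f (j%:Z - l%:Z) * cexp (j%:Z - l%:Z) x.

Definition dirichlet n x y : C := \sum_(j < n.+1) cexp j%:Z x * conjc (cexp j%:Z y).

(** The Fejer kernel is the squared modulus of a Dirichlet kernel; its square
    root turns averages against it into scalar products. *)
Definition fejer_root n x y : R := Num.sqrt n.+1%:R^-1 * nc (dirichlet n x y).

Lemma dirichlet_sq n x y : (nc (dirichlet n x y) ^+ 2)%:C%C =
  \sum_(j < n.+1) \sum_(l < n.+1)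
     cexp (j%:Z - l%:Z) x * conjc (cexp (j%:Z - l%:Z) y) :> C.
Proof.
rewrite -mul_conj /dirichlet conjc_sum mulr_suml; apply: eq_bigr => j _.
rewrite mulr_sumr; apply: eq_bigr => l _.
rewrite !cexpD !cexpN !conjcM !conjcK; ring.
Qed.

Lemma fejer_root_sq n x y : fejer_root n x y ^+ 2 =
  n.+1%:R^-1 * nc (dirichlet n x y) ^+ 2.
Proof. by rewrite exprMn sqr_sqrtr// invr_ge0. Qed.

Lemma cmeas_dirichlet n x : cmeas (dirichlet n x).
Proof.
apply: (@cmeas_sum _ _ _ (fun (j : 'I_n.+1) y => cexp j%:Z x * conjc (cexp j%:Z y))) => j.
by apply: cmeasM; [exact: cmeas_cst|apply: cmeas_conj; exact: cmeas_cexp].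
Qed.

Lemma measurable_fejer_root n x : measurable_fun setT (fejer_root n x).
Proof. by apply: measurable_funM => //; exact: measurable_modulus (cmeas_dirichlet n x). Qed.

Lemma fejer_root_ge0 n x y : 0 <= fejer_root n x y.
Proof. by rewrite mulr_ge0 ?sqrtr_ge0 ?nc_ge0. Qed.

Lemma fejer_root_le n x y : fejer_root n x y <= Num.sqrt n.+1%:R^-1 * n.+1%:R.
Proof.
rewrite ler_wpM2l ?sqrtr_ge0// (le_trans (nc_sum _ _ _))//.
under eq_bigr do rewrite ncM nc_conj !nc_cexp mulr1.
by rewrite sumr_const card_ord.
Qed.

Local Notation w n x := (fun y => (fejer_root n x y)%:C%C : C).

Lemma cmeas_w n x : cmeas (w n x).
Proof. by apply: cmeas_real; exact: measurable_fejer_root. Qed.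

Lemma w_le n x y : nc (w n x y) <= Num.sqrt n.+1%:R^-1 * n.+1%:R.
Proof. by rewrite nc_real ger0_norm ?fejer_root_ge0// fejer_root_le. Qed.

Lemma fejerE n f x : L1 f ->
  fejer n f x = cintegral (fun y => f y * (fejer_root n x y ^+ 2)%:C%C).
Proof.
move=> lf.
have lF (j l : 'I_n.+1) : L1 (fun y => cexp (j%:Z - l%:Z) x *
    (f y * conjc (cexp (j%:Z - l%:Z) y))).
  by apply: L1Z; exact: L1_cexpJ.
transitivity (n.+1%:R^-1 * cintegral (fun y => \sum_(j < n.+1) \sum_(l < n.+1)
    cexp (j%:Z - l%:Z) x * (f y * conjc (cexp (j%:Z - l%:Z) y)))).
  rewrite /fejer cint_sum; last by move=> j; exact: L1_sum.
  congr (_ * _); apply: eq_bigr => j _; rewrite cint_sum//.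
  apply: eq_bigr => l _; rewrite cintZ; last exact: L1_cexpJ.
  by rewrite mulrC.
rewrite -cintZ; last by apply: L1_sum => j; exact: L1_sum.
congr cintegral; apply/funext => y.
rewrite fejer_root_sq CM dirichlet_sq CV Cnat mulrCA; congr (_ * _).
rewrite mulr_sumr; apply: eq_bigr => j _; rewrite mulr_sumr; apply: eq_bigr => l _.
by rewrite mulrCA.
Qed.

Lemma fejer_linear n f g x : L1 f -> L1 g ->
  fejer n (fun x => f x - g x) x = fejer n f x - fejer n g x.
Proof.
move=> lf lg; rewrite /fejer -mulrBr -sumrB; congr (_ * _); apply: eq_bigr => j _.
rewrite -sumrB; apply: eq_bigr => l _.
by rewrite fourierB// mulrBl.
Qed.

Lemma fejer_conj n f x : L1 f ->
  fejer n (fun x => conjc (f x)) x = conjc (fejer n f x).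
Proof.
move=> lf; rewrite fejerE//; last exact: L1_conj.
rewrite fejerE// -cint_conj; last first.
  apply: (@L1M_bd _ _ ((Num.sqrt n.+1%:R^-1 * n.+1%:R) ^+ 2)) => //.
    by apply: cmeas_real; apply: measurable_funX; exact: measurable_fejer_root.
  move=> y; rewrite nc_real ger0_norm ?sqr_ge0//.
  by apply: lerXn2r (fejer_root_le _ _ _); rewrite ?nnegrE ?fejer_root_ge0// mulr_ge0// sqrtr_ge0.
by congr cintegral; apply/funext => y; rewrite conjcM conjc_real.
Qed.

Lemma diagonal_sum n : \sum_(j < n.+1) \sum_(l < n.+1) ((j%:Z - l%:Z == 0)%:R : C) = n.+1%:R.
Proof.
rewrite (eq_bigr (fun=> 1)); first by rewrite sumr_const card_ord.
move=> j _; rewrite (bigD1 j)//= subrr eqxx big1 ?addr0// => l lj.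
by rewrite subr_eq0 eqz_nat eq_sym (inj_eq val_inj) (negbTE lj).
Qed.

Lemma fejer_cst n c x : fejer n (fun=> c) x = c.
Proof.
have E k : fourier (fun=> c : C) k = c * (k == 0)%:R.
  rewrite /fourier /inner cintZ; last by apply: L1_conj; exact: L1_cexp.
  by rewrite cint_conj ?cint_cexp ?conjc_nat//; exact: L1_cexp.
rewrite /fejer (_ : \sum_(j < _) _ = c * \sum_(j < n.+1) \sum_(l < n.+1) (j%:Z - l%:Z == 0)%:R).
  by rewrite diagonal_sum mulrC mulfK// pnatr_eq0.
rewrite mulr_sumr; apply: eq_bigr => j _; rewrite mulr_sumr; apply: eq_bigr => l _.
rewrite E -mulrA; congr (_ * _); case: eqP => [->|_]; rewrite ?mul0r//.
by rewrite cexp0 mulr1.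
Qed.

Lemma cint_fejer n f : L1 f -> cintegral (fejer n f) = cintegral f.
Proof.
move=> lf; rewrite /fejer cintZ; last first.
  by do 2 (apply: L1_sum => ?); apply: L1Z; exact: L1_cexp.
rewrite cint_sum; last by move=> ?; apply: L1_sum => ?; apply: L1Z; exact: L1_cexp.
rewrite (_ : \sum_(i <- _) _ = fourier f 0 * \sum_(j < n.+1) \sum_(l < n.+1) (j%:Z - l%:Z == 0)%:R).
  by rewrite diagonal_sum mulrC mulfK ?pnatr_eq0// fourier0.
rewrite mulr_sumr; apply: eq_bigr => j _; rewrite mulr_sumr cint_sum; last first.
  by move=> ?; apply: L1Z; exact: L1_cexp.
apply: eq_bigr => l _; rewrite cintZ ?cint_cexp; last exact: L1_cexp.
by case: eqP => [->|_]; rewrite ?mulr0.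
Qed.

Lemma cmeas_fejer n f : cmeas (fejer n f).
Proof.
apply: cmeasM; first exact: cmeas_cst.
by do 2 (apply: cmeas_sum => ?); apply: cmeasM; [exact: cmeas_cst|exact: cmeas_cexp].
Qed.

Lemma L2_fejer n f : L2 (fejer n f).
Proof. by apply: L2Z; do 2 (apply: L2_sum => ?); apply: L2Z; exact: L2_cexp. Qed.

Lemma fejer_real n p x : rint p ->
  complex.Re (fejer n (fun y => (p y)%:C%C) x) =
  (\int[mu]_y (p y * fejer_root n x y ^+ 2))%R.
Proof.
move=> ip; rewrite fejerE /=; last first.
  split; first by apply: cmeas_real; exact: rint_meas ip.
  apply: rint_dom (integrable_norm ip) _ => [|y].
    by apply: measurable_modulus; apply: cmeas_real; exact: rint_meas ip.
  by rewrite /modulus nc_real normr_id.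
by apply: eq_Rintegral => y _; rewrite mul0r subr0.
Qed.

Lemma rint_fejer n p x : rint p -> rint (fun y => p y * fejer_root n x y ^+ 2).
Proof.
move=> ip; pose c : R := Num.sqrt n.+1%:R^-1 * n.+1%:R.
apply: rint_dom (rintZ (c ^+ 2) (integrable_norm ip)) _ => [|y].
  apply: measurable_funM; first exact: rint_meas ip.
  by apply: measurable_funX; exact: measurable_fejer_root.
rewrite normrM mulrC ler_wpM2r// ger0_norm ?sqr_ge0//.
by apply: lerXn2r (fejer_root_le _ _ _); rewrite ?nnegrE ?fejer_root_ge0// mulr_ge0// sqrtr_ge0.
Qed.

Lemma fejer_mono n p q x : rint p -> rint q -> (forall y, p y <= q y) ->
  complex.Re (fejer n (fun y => (p y)%:C%C) x) <=
  complex.Re (fejer n (fun y => (q y)%:C%C) x).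
Proof.
move=> ip iq pq; rewrite !fejer_real//; apply: le_Rintegral => //.
- exact: rint_fejer.
- exact: rint_fejer.
- by move=> y _; rewrite ler_wpM2r ?sqr_ge0.
Qed.

Lemma fejer_le n f x : L1 f ->
  nc (fejer n f x) <= complex.Re (fejer n (fun y => (modulus f y)%:C%C) x).
Proof.
move=> lf; have [mf fi] := lf; rewrite fejer_real// fejerE//.
have H : L1 (fun y => f y * (fejer_root n x y ^+ 2)%:C%C).
  apply: L1_dom (rint_fejer n x fi) _.
    apply: cmeasM => //; apply: cmeas_real; apply: measurable_funX.
    exact: measurable_fejer_root.
  by move=> y; rewrite ncM nc_real [X in _ * X]ger0_norm// sqr_ge0.
apply: le_trans (cint_le H) _; apply: le_N1; [by case: H|exact: rint_fejer|].
by move=> y; rewrite ncM nc_real [X in _ * X]ger0_norm// sqr_ge0.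
Qed.

Lemma fejer_bd n f c x : cmeas f -> (forall x, nc (f x) <= c) ->
  nc (fejer n f x) <= c.
Proof.
move=> mf fc; have lf := L1_bd mf fc; apply: le_trans (fejer_le n x lf) _.
have -> : c = complex.Re (fejer n (fun=> c%:C%C) x) by rewrite fejer_cst.
by apply: fejer_mono => //; [case: lf|exact: rint_cst].
Qed.

Lemma N1_fejer n f : L1 f -> N1 (fejer n f) <= N1 f.
Proof.
move=> lf; have [mf fi] := lf.
have lm : L1 (fun y => (modulus f y)%:C%C).
  apply: L1_dom fi _; first by apply: cmeas_real; exact: rint_meas (proj2 lf).
  by move=> x; rewrite nc_real ger0_norm// nc_ge0.
have := cint_fejer n lm; rewrite cint_real => /(congr1 (@complex.Re R)) /= E; rewrite [leRHS]/N1 -E.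
apply: le_N1; [exact: cmeas_fejer| |by move=> x; exact: fejer_le].
by apply: L1_Re; apply: L2_L1; exact: L2_fejer.
Qed.

(** Jensen's inequality for the probability kernel, as a Cauchy-Schwarz
    inequality. *)
Lemma fejer_sq n f x : L2 f -> nc (fejer n f x) ^+ 2 <=
  complex.Re (fejer n (fun y => (modulus f y ^+ 2)%:C%C) x).
Proof.
move=> lf; have [mf fi] := lf; rewrite fejer_real//.
have lw : L2 (w n x) by apply: L2_bd; [exact: cmeas_w|move=> y; exact: w_le].
have lfw : L2 (fun y => f y * w n x y).
  by apply: L2M_bd => //; [exact: cmeas_w|move=> y; exact: w_le].
have -> : fejer n f x = inner (fun y => f y * w n x y) (w n x).
  rewrite fejerE; last exact: L2_L1.
  rewrite /inner; congr cintegral; apply/funext => y.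
  by rewrite conjc_real expr2 CM mulrA.
have -> : (\int[mu]_y (modulus f y ^+ 2 * fejer_root n x y ^+ 2))%R =
    n2 (fun y => f y * w n x y) ^+ 2.
  rewrite n2sq; apply: eq_Rintegral => y _.
  by rewrite /modulus ncM nc_real (ger0_norm (fejer_root_ge0 _ _ _)) [RHS]exprMn.
have w1 : n2 (w n x) = 1.
  rewrite /n2 [X in Num.sqrt X](_ : _ = 1) ?sqrtr1//.
  have := fejer_real n x (rint_cst 1); rewrite fejer_cst /= => ->.
  apply: eq_Rintegral => y _.
  by rewrite /modulus nc_real (ger0_norm (fejer_root_ge0 _ _ _)) mul1r.
apply: lerXn2r; rewrite ?nnegrE ?nc_ge0 ?n2_ge0//.
by rewrite (le_trans (inner_le lfw lw))// w1 mulr1.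
Qed.

Lemma L1_real p : rint p -> L1 (fun x => (p x)%:C%C).
Proof.
move=> ip; split; first by apply: cmeas_real; exact: rint_meas ip.
apply: rint_dom (integrable_norm ip) _ => [|y].
  by apply: measurable_modulus; apply: cmeas_real; exact: rint_meas ip.
by rewrite /modulus nc_real normr_id.
Qed.

Lemma n2_fejer n f : L2 f -> n2 (fejer n f) <= n2 f.
Proof.
move=> lf; have [mf fi] := lf.
have lm := L1_real fi.
have := cint_fejer n lm; rewrite cint_real => /(congr1 (@complex.Re R)) /= E.
apply: n2_dom; [exact: n2_ge0|exact: cmeas_fejer| | |].
- exact: (L1_Re (L2_L1 (L2_fejer n (fun y => (modulus f y ^+ 2)%:C%C)))).
- by move=> x; exact: fejer_sq.
- by rewrite E n2sq.
Qed.

Lemma subdiagonal_sum n : \sum_(j < n.+1) \sum_(l < n.+1) ((j%:Z - l%:Z == 1)%:R : C) = n%:R.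
Proof.
rewrite big_ord_recl /= big1 ?add0r; last first.
  by move=> l _; rewrite sub0r; case: eqP => // H; exfalso; move: H; case: (nat_of_ord l).
rewrite (eq_bigr (fun=> 1)); first by rewrite sumr_const card_ord.
move=> j _; rewrite (bigD1 (widen_ord (leqnSn n) j))//=.
rewrite [X in X + _](_ : _ = 1); last first.
  by rewrite /bump /= add1n -addn1 PoszD addrAC subrr add0r eqxx.
rewrite big1 ?addr0// => l lj; case: eqP => // H; exfalso; move/negP: lj; apply.
apply/eqP/val_inj => /=; move/eqP: H.
rewrite subr_eq /bump /= add1n -add1n PoszD => /eqP /addrI [].
by move=> ->.
Qed.

Lemma fejer_cexp1 n x : fejer n (cexp 1) x = (n%:R / n.+1%:R) * cexp 1 x.
Proof.
rewrite /fejer (_ : \sum_(j < _) _ = (\sum_(j < n.+1) \sum_(l < n.+1)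
   (j%:Z - l%:Z == 1)%:R) * cexp 1 x).
  by rewrite subdiagonal_sum mulrCA mulrA.
rewrite mulr_suml; apply: eq_bigr => j _; rewrite mulr_suml; apply: eq_bigr => l _.
by rewrite fourier_cexp eq_sym; case: eqP => [->|_]; rewrite ?mul0r.
Qed.

Definition chord_lip f (L : R) :=
  forall x y, nc (f x - f y) <= L * nc (cexp 1 x - cexp 1 y).

(** The second moment of the kernel in the chordal distance is 2 / (n + 1), so
    that Fejer means of functions that are Lipschitz for this distance
    converge uniformly. *)
Lemma fejer_chord n x :
  complex.Re (fejer n (fun y => (nc (cexp 1 y - cexp 1 x) ^+ 2)%:C%C) x) =
  2 / n.+1%:R.
Proof.
have l1 : L1 (@cexp R 1) by exact: L1_cexp.
pose c := conjc (cexp 1 x) : C.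
have E : (fun y => (nc (cexp 1 y - cexp 1 x) ^+ 2)%:C%C) =
   (fun y => 2 - (c * cexp 1 y + conjc (c * cexp 1 y))) :> (R -> C).
  apply/funext => y; rewrite -mul_conj conjcB conjcM /c conjcK.
  rewrite [LHS](_ : _ = cexp 1 y * conjc (cexp 1 y) + cexp 1 x * conjc (cexp 1 x) -
     (conjc (cexp 1 x) * cexp 1 y + cexp 1 x * conjc (cexp 1 y))); last by ring.
  by rewrite !mul_conj !nc_cexp expr1n.
rewrite E; have lc : L1 (fun y => c * cexp 1 y) by exact: L1Z.
have ll : L1 (fun y => conjc (c * cexp 1 y)) by exact: L1_conj.
have -> : fejer n (fun y => 2 - (c * cexp 1 y + conjc (c * cexp 1 y))) x =
    2 - (fejer n (fun y => c * cexp 1 y) x + fejer n (fun y => conjc (c * cexp 1 y)) x).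
  rewrite fejer_linear ?fejer_cst; [|by apply: L2_L1; exact: L2_cst|exact: L1D].
  congr (_ - _); rewrite /fejer -mulrDr -big_split; congr (_ * _).
  apply: eq_bigr => j _; rewrite -big_split; apply: eq_bigr => l _.
  by rewrite fourierD// mulrDl.
rewrite fejer_conj//.
have -> : fejer n (fun y => c * cexp 1 y) x = (n%:R / n.+1%:R)%:C%C.
  have -> : fejer n (fun y => c * cexp 1 y) x = c * fejer n (cexp 1) x.
    rewrite /fejer [RHS]mulrCA; congr (_ * _).
    rewrite mulr_sumr; apply: eq_bigr => j _; rewrite mulr_sumr; apply: eq_bigr => l _.
    by rewrite fourierZ// mulrA.
  rewrite fejer_cexp1 mulrCA /c [conjc _ * _]mulrC mul_conj nc_cexp expr1n mulr1.
  by rewrite CM CV !Cnat.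
rewrite conjc_real -CD -Cnat -CB /=.
have h : (n.+1%:R : R) = n%:R + 1 by rewrite -natr1.
have h0 : n%:R + 1 != 0 :> R by rewrite natr1 pnatr_eq0.
by rewrite h; field.
Qed.

Lemma fejer_uniform n f L x : 0 <= L -> cmeas f -> chord_lip f L ->
  nc (f x - fejer n f x) ^+ 2 <= L ^+ 2 * (2 / n.+1%:R).
Proof.
move=> L0 mf fL.
have bd y : nc (f y) <= nc (f x) + L * 2.
  have := ncD (f y - f x) (f x); rewrite subrK => h.
  apply: (le_trans h); rewrite addrC lerD2l (le_trans (fL y x))// ler_wpM2l//.
  by rewrite (le_trans (ncB _ _))// !nc_cexp.
have l1 : L1 f := L1_bd mf bd.
have lg : L2 (fun y => f y - f x).
  by apply: L2B; [exact: L2_bd mf bd|exact: L2_cst].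
have mg : cmeas (fun y => f y - f x) by case: lg.
rewrite nc_sub -[X in fejer n f x - X](fejer_cst n (f x) x).
rewrite -fejer_linear//; last by apply: L2_L1; exact: L2_cst.
apply: (le_trans (fejer_sq n x lg)); rewrite -(fejer_chord n x).
have mc : cmeas (fun y => cexp 1 y - cexp 1 x).
  by apply: cmeasB; [exact: cmeas_cexp|exact: cmeas_cst].
have ic : rint (fun y => nc (cexp 1 y - cexp 1 x) ^+ 2).
  apply: (@rint_bd _ _ (2 ^+ 2)).
    by apply: measurable_funX; exact: measurable_modulus mc.
  move=> y; rewrite ger0_norm ?sqr_ge0//; apply: lerXn2r; rewrite ?nnegrE ?nc_ge0//.
  by rewrite (le_trans (ncB _ _))// !nc_cexp.
rewrite -[leRHS](_ : complex.Re (fejer n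
  (fun y => (L ^+ 2 * nc (cexp 1 y - cexp 1 x) ^+ 2)%:C%C) x) = _).
  apply: fejer_mono; [by case: lg|exact: rintZ|] => y.
  rewrite -exprMn; apply: lerXn2r (fL y x); rewrite ?nnegrE ?nc_ge0//.
  by rewrite mulr_ge0// nc_ge0.
rewrite !fejer_real//; last exact: rintZ.
by under eq_Rintegral do rewrite -mulrA; rewrite RintM//; exact: rint_fejer.
Qed.

End fejer.

(** * Chord-Lipschitz functions *)

Section fourier_uniqueness.
Context {R : realType}.
Local Notation C := R[i].
Local Notation mu := (@torus_measure R).
Local Notation nc := (@Normc.normc R).
Implicit Types (f g h : R -> C) (p q : R -> R) (k : int) (x y : R) (n : nat).

Lemma small_sq (c a : R) : 0 <= a ->
  (forall n : nat, c ^+ 2 <= a * (2 / n.+1%:R)) -> c = 0.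
Proof.
move=> a0 H; apply/eqP; rewrite -sqrf_eq0 eq_le sqr_ge0 andbT.
apply/ler_addgt0Pr => e e0; rewrite add0r.
have ae : 0 <= 2 * a / e by rewrite divr_ge0 ?mulr_ge0// ltW.
pose n := Num.bound (2 * a / e).
have hn : 2 * a / e < n.+1%:R.
  by rewrite (lt_le_trans (archi_boundP ae))// ler_nat.
apply: (le_trans (H n)); rewrite mulrA ler_pdivrMr ?ltr0n//.
by move: hn; rewrite ltr_pdivrMr// mulrC [e * _]mulrC => /ltW.
Qed.

Lemma chord_lip_bd f L : 0 <= L -> chord_lip f L -> forall x, nc (f x) <= nc (f 0) + L * 2.
Proof.
move=> L0 fL x; have := ncD (f x - f 0) (f 0); rewrite subrK => h.
apply: (le_trans h); rewrite addrC lerD2l (le_trans (fL x 0))// ler_wpM2l//.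
by rewrite (le_trans (ncB _ _))// !nc_cexp.
Qed.

Lemma cint_chord_lip f g L : L1 f -> (forall k, fourier f k = 0) ->
  0 <= L -> cmeas g -> chord_lip g L -> cintegral (fun x => f x * conjc (g x)) = 0.
Proof.
move=> lf f0 L0 mg gL.
have bd := chord_lip_bd L0 gL.
have lfg : L1 (fun x => f x * conjc (g x)).
  by apply: (L1M_bd lf (cmeas_conj mg)) => x; rewrite nc_conj; exact: bd.
apply: nc_eq0; apply: (@small_sq _ ((N1 f * L) ^+ 2)); first exact: sqr_ge0.
move=> n.
have mF := cmeas_fejer n g.
have Z : cintegral (fun x => f x * conjc (fejer n g x)) = 0.
  pose T (j l : 'I_n.+1) x := conjc (n.+1%:R^-1 * fourier g (j%:Z - l%:Z)) *
     (f x * conjc (cexp (j%:Z - l%:Z) x)).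
  have lT j l : L1 (T j l) by apply: L1Z; exact: L1_cexpJ.
  rewrite (_ : (fun x => _) = fun x => \sum_(j < n.+1) \sum_(l < n.+1) T j l x).
    rewrite cint_sum; last by move=> j; exact: L1_sum.
    rewrite big1// => j _; rewrite cint_sum// big1// => l _.
    rewrite /T cintZ; last exact: L1_cexpJ.
    by rewrite [cintegral _](f0 (j%:Z - l%:Z)) mulr0.
  apply/funext => x; rewrite /fejer conjcM conjc_sum mulrCA !mulr_sumr.
  apply: eq_bigr => j _; rewrite conjc_sum !mulr_sumr; apply: eq_bigr => l _.
  by rewrite /T !conjcM; ring.
set s := Num.sqrt (L ^+ 2 * (2 / n.+1%:R)).
have s0 : 0 <= L ^+ 2 * (2 / n.+1%:R) by rewrite mulr_ge0 ?sqr_ge0// divr_ge0.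
have bd2 x : nc (conjc (g x - fejer n g x)) <= s.
  rewrite nc_conj -(@ler_pXn2r _ 2)// ?nnegrE ?nc_ge0 ?sqrtr_ge0// sqr_sqrtr//.
  exact: fejer_uniform.
have md : cmeas (fun x => conjc (g x - fejer n g x)) by apply: cmeas_conj; exact: cmeasB.
have lFf : L1 (fun x => f x * conjc (fejer n g x)).
  apply: (L1M_bd lf (cmeas_conj mF)) => x; rewrite nc_conj.
  exact: fejer_bd bd.
have -> : cintegral (fun x => f x * conjc (g x)) =
    cintegral (fun x => f x * conjc (g x - fejer n g x)).
  rewrite -[LHS]subr0 -Z -cintB//; congr cintegral; apply/funext => x.
  by rewrite conjcB mulrBr.
have h1 : nc (cintegral (fun x => f x * conjc (g x - fejer n g x))) <= N1 f * s.
  rewrite mulrC (le_trans (cint_le (L1M_bd lf md bd2)))//.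
  exact: N1M_bd.
rewrite exprMn -mulrA -[L ^+ 2 * _](sqr_sqrtr s0) -/s -exprMn.
by apply: lerXn2r h1; rewrite ?nnegrE ?nc_ge0// mulr_ge0 ?sqrtr_ge0 ?N1_ge0.
Qed.

Definition clamp x : R := Num.min 1 (Num.max 0 x).

Lemma max_lip (c x y : R) : `|Num.max c x - Num.max c y| <= `|x - y|.
Proof.
have h1 := ler_norm (x - y); have h2 := ler_norm (y - x); rewrite distrC in h2.
rewrite ler_norml; apply/andP.
by case: (leP c x) => ?; case: (leP c y) => ?; split; lra.
Qed.

Lemma min_lip (c x y : R) : `|Num.min c x - Num.min c y| <= `|x - y|.
Proof.
have h1 := ler_norm (x - y); have h2 := ler_norm (y - x); rewrite distrC in h2.
rewrite ler_norml; apply/andP.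
by case: (leP c x) => ?; case: (leP c y) => ?; split; lra.
Qed.

Lemma clamp_lip x y : `|clamp x - clamp y| <= `|x - y|.
Proof. exact: le_trans (min_lip _ _ _) (max_lip _ _ _). Qed.

(** The indicator of an arc is a limit of functions of the distance to its
    center, which are Lipschitz for the chordal distance. *)
Definition arc_bump (a s : R) n x : R := clamp (n%:R * (cos (x - a) - s)).

Lemma arc_bump_le a s n x : `|arc_bump a s n x| <= 1.
Proof.
rewrite /arc_bump /clamp ger0_norm; first by rewrite ge_min lexx.
by rewrite le_min ler01 le_max lexx.
Qed.

Lemma arc_bump_lip a s n : chord_lip (fun x => (arc_bump a s n x)%:C%C) n%:R.
Proof.
move=> x y; rewrite -CB nc_real (le_trans (clamp_lip _ _))//.
rewrite -mulrBr normrM ger0_norm// ler_wpM2l//.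
have E z : cos (z - a) = complex.Re (cexp 1 z * conjc (cexp 1 a)).
  by rewrite Re_M Re_conjc Im_conjc /= !mul1r mulrN opprK cosB.
rewrite opprB addrA subrK !E -Re_N -Re_D -mulrBl.
by rewrite (le_trans (nc_Re _))// ncM nc_conj nc_cexp mulr1.
Qed.

Lemma measurable_arc_bump a s n : measurable_fun setT (arc_bump a s n).
Proof.
apply: (@measurableT_comp _ _ _ _ _ _ clamp).
  by apply: measurable_minr => //; apply: measurable_maxr.
apply: measurable_funM => //; apply: measurable_funB => //.
apply: (@measurableT_comp _ _ _ _ _ _ (@cos R)).
  by apply: continuous_measurable_fun; exact: continuous_cos.
exact: measurable_funB.
Qed.

Lemma arc_bump_cvg a s x :
  arc_bump a s n x @[n --> \oo] --> (if s < cos (x - a) then 1 else 0 : R).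
Proof.
case: ifPn => [h|]; last first.
  rewrite -leNgt => h; apply: cvg_near_cst; apply: nearW => n.
  rewrite /arc_bump /clamp max_l ?(min_idPr ler01)//.
  by rewrite mulr_ge0_le0// subr_le0.
have d0 : 0 < cos (x - a) - s by rewrite subr_gt0.
apply: cvg_near_cst; exists (Num.bound (cos (x - a) - s)^-1) => // n /= hn.
have h2 : 1 <= n%:R * (cos (x - a) - s).
  rewrite -ler_pdivrMr// div1r (le_trans (ltW (archi_boundP _)))// ?ler_nat//.
  by rewrite invr_ge0 ltW.
by rewrite /arc_bump /clamp max_r ?(le_trans ler01)// min_l.
Qed.

Lemma arcE (q x : R) : 0 < q -> q <= 2 * pi -> 0 <= x -> x < 2 * pi ->
  (cos (q / 2) < cos (x - q / 2)) = (0 < x < q).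
Proof.
move=> q0 q2 x0 x2; set l := q / 2.
have l0 : 0 < l by rewrite divr_gt0.
have lpi : l <= pi by rewrite ler_pdivrMr// mulrC.
have ql : q = l + l by rewrite -splitr.
have lpi2 : l \in `[0, pi] by rewrite in_itv/= ltW.
have cosx y : 0 <= y -> y <= pi -> (cos l < cos y) = (y < l).
  by move=> y0 y1; rewrite ltr_cos// in_itv/= y0 y1.
have [h|h] := leP l x.
  have [h2|h2] := leP (x - l) pi.
    rewrite cosx ?subr_ge0//; apply/idP/idP => [?|/andP[? ?]]; last lra.
    by apply/andP; split; lra.
  have -> : cos (x - l) = cos (2 * pi - (x - l)).
    by rewrite -(cosN (2 * pi - _)) opprB mulr_natl -[RHS]cosD2pi subrK.
  rewrite cosx; [|lra|lra].
  by apply/idP/idP => [?|/andP[? ?]]; [exfalso; lra|exfalso; lra].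
rewrite -(cosN (x - l)) opprB cosx; [|lra|lra].
by apply/idP/idP => [?|/andP[? ?]]; [apply/andP; split; lra|lra].
Qed.

End fourier_uniqueness.

(** * Uniqueness of Fourier coefficients *)

Section fourier_uniqueness_theorem.
Context {R : realType}.
Local Notation C := R[i].
Local Notation mu := (@torus_measure R).
Local Notation nc := (@Normc.normc R).
Local Notation leb := (@lebesgue_measure R).
Local Notation D := (`[0, 2 * pi[%classic : set R).
Implicit Types (f g h : R -> C) (p q : R -> R) (k : int) (x y : R) (n : nat).

Lemma pi2_gt0 : 0 < 2 * pi :> R. Proof. by rewrite mulr_gt0// pi_gt0. Qed.

Lemma leb_ge0_rint p : rint p -> (\int[leb]_(x in D) `|p x|%:E < +oo)%E.
Proof.
move=> ip; have /integrableP[mp] := ip.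
have -> : (\int[mu]_x `|(EFin \o p) x| = \int[mu]_x `|p x|%:E)%E by [].
rewrite torus_integral_ge0; last 2 first.
- by apply/measurable_EFinP; apply: measurableT_comp => //; exact: rint_meas ip.
- by move=> x; rewrite lee_fin.
set I := (X in (_ * X < _ -> _)%E); have I0 : (0 <= I)%E.
  by apply: integral_ge0 => x _; rewrite lee_fin.
rewrite !ltey => /negP h; apply/negP => /eqP E; apply: h.
by rewrite /I E gt0_muley// lte_fin invr_gt0 pi2_gt0.
Qed.

Lemma torus_integral p : rint p ->
  (\int[mu]_x p x = (2 * pi)^-1 * \int[leb]_(x in D) p x)%R.
Proof.
move=> ip; have mp : measurable_fun setT (EFin \o p) by apply/measurable_EFinP; exact: rint_meas ip.
have mD : measurable (D : set (measurableTypeR R)) by exact: measurable_itv.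
have iD : leb.-integrable D (EFin \o p).
  apply/integrableP; split; first exact: measurable_funTS.
  exact: leb_ge0_rint.
rewrite /Rintegral integralE [in RHS]integralE.
rewrite !torus_integral_ge0//; [|exact: measurable_funeneg|exact: measurable_funepos].
have hp := integrable_pos_fin_num mD iD.
have hn := integrable_neg_fin_num mD iD.
rewrite -(fineK hp) -(fineK hn) -!EFinM -!EFinB /=.
by rewrite mulrBr.
Qed.

Lemma leb_ae (P : R -> Prop) : {ae leb, forall x, D x -> P x} -> {ae mu, forall x, P x}.
Proof.
have mD : measurable (D : set (measurableTypeR R)) by exact: measurable_itv.
move=> [N [mN N0 sN]]; exists (N `|` ~` D); split.
- by apply: measurableU => //; apply: measurableC; exact: measurable_itv.
- apply/eqP; rewrite /torus_measure /mscale /= mule_eq0; apply/orP; right.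
  rewrite /mrestr setIUl setICl setU0 -measure_le0 -N0.
  apply: le_measure; rewrite ?inE//.
  exact: measurableI.
- move=> x /= nP; have [Dx|nDx] := pselect (D x); last by right.
  by left; apply: sN => /= H; apply: nP; exact: H.
Qed.

Lemma arc_bump_integral p (q : R) : rint p -> (forall k, fourier (fun x => (p x)%:C%C) k = 0) ->
  0 < q -> q <= 2 * pi ->
  (\int[mu]_x (p x * (if cos (q / 2) < cos (x - q / 2) then 1 else 0)) = 0)%R.
Proof.
move=> ip f0 q0 q2; set s := cos _; set a := q / 2.
have mB n : measurable_fun setT (fun x => p x * arc_bump a s n x).
  by apply: measurable_funM; [exact: rint_meas ip|exact: measurable_arc_bump].
have iB n : rint (fun x => p x * arc_bump a s n x).
  apply: rint_dom (mB n) (integrable_norm ip) _ => x.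
  by rewrite normrM ler_piMr// arc_bump_le.
have z n : (\int[mu]_x (p x * arc_bump a s n x))%R = 0.
  have := cint_chord_lip (L1_real ip) f0 (ler0n R n)
    (cmeas_real (measurable_arc_bump a s n)) (arc_bump_lip a s n).
  under eq_fun do rewrite conjc_real -CM.
  by rewrite cint_real => /(congr1 (@complex.Re R)).
have mlim : measurable_fun setT
    (fun x => p x * (if s < cos (x - a) then 1 else 0)).
  apply: (@measurable_fun_cvg _ _ _ _ (fun n x => p x * arc_bump a s n x)) => // x _.
  by apply: cvgM; [exact: cvg_cst|exact: arc_bump_cvg].
have H := @dominated_cvg _ _ _ mu setT measurableT
  (fun n x => (p x * arc_bump a s n x)%:E)
  (fun x => (p x * (if s < cos (x - a) then 1 else 0))%:E)
  (fun x => `|p x|%:E).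
rewrite /Rintegral (_ : (\int[mu]_x _)%E = 0%:E)//.
have Hz : (fun n => \int[mu]_x (p x * arc_bump a s n x)%:E)%E = (fun=> 0%:E).
  apply/funext => n; rewrite -(fineK (integrable_fin_num measurableT (iB n))).
  by congr EFin; exact: z.
suff hl : (fun=> 0%:E : \bar R) @ \oo -->
    (\int[mu]_x (p x * (if (s < cos (x - a))%R then 1 else 0)%R)%:E)%E.
  by have := cvg_lim (@ereal_hausdorff R) hl; rewrite lim_cst// => <-.
rewrite -Hz; apply: H.
- by move=> n; apply/measurable_EFinP; exact: mB.
- move=> x _.
  have h : (fun n => p x * arc_bump a s n x) @ \oo -->
      (p x * (if s < cos (x - a) then 1 else 0) : R).
    by apply: cvgM; [exact: cvg_cst|exact: arc_bump_cvg].
  by apply: cvg_comp; [exact: h|exact: cvg_id].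
- by [].
- exact: integrable_norm ip.
- by move=> n x _; rewrite /= lee_fin normrM ler_piMr// arc_bump_le.
Qed.

Lemma fourier_uniq_real p : rint p -> (forall k, fourier (fun x => (p x)%:C%C) k = 0) ->
  {ae mu, forall x, p x = 0}.
Proof.
move=> ip f0; have mp := rint_meas ip.
have mD : measurable (D : set (measurableTypeR R)) by exact: measurable_itv.
pose g := p \_ D.
have mg : measurable_fun setT g by apply/(measurable_restrictT _ mD); exact: measurable_funTS.
have ig : leb.-integrable setT (EFin \o g).
  apply/integrableP; split; first exact/measurable_EFinP.
  have := leb_ge0_rint ip; rewrite integral_mkcond.
  congr (_ < _)%E; apply: eq_integral => x _ /=.
  by rewrite /g !patchE; case: ifP => //=; rewrite normr0.
have ig' y : leb.-integrable `]-oo, y] (EFin \o g).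
  by apply: integrableS ig => //; exact: measurable_itv.
have F0 y : (\int[leb]_(t in `]-oo, y]) g t)%R = 0.
  have [y0|y0] := leP y 0.
    transitivity (\int[leb]_(t in `]-oo, y]) (0 : R))%R; last first.
      by rewrite /Rintegral integral0.
    congr fine; apply: ae_eq_integral => //.
    + by apply/measurable_EFinP; exact: measurable_funTS.
    exists [set 0]; split => //; first exact: lebesgue_measure_set1.
    move=> x /= /not_implyP[xy /eqP gx]; apply: contrapT => /eqP x0; move/negP: gx; apply.
    rewrite /g patchE; case: ifPn => //; rewrite inE/= in_itv/= => /andP[x00 _].
    move: xy; rewrite /= in_itv/= => xy; exfalso; move/negP: x0; apply; apply/eqP; lra.
  pose q := Num.min y (2 * pi).
  have q0 : 0 < q by rewrite lt_min y0 pi2_gt0.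
  have q2 : q <= 2 * pi by rewrite ge_min lexx orbT.
  have B := arc_bump_integral ip f0 q0 q2.
  have iq : rint (fun x => p x * (if cos (q / 2) < cos (x - q / 2) then 1 else 0)).
    have mif : measurable_fun setT (fun x => if cos (q / 2) < cos (x - q / 2) then 1 else 0 : R).
      apply: (@measurable_fun_cvg _ _ _ _ (fun n x => arc_bump (q / 2) (cos (q / 2)) n x)) => //.
        by move=> n; exact: measurable_arc_bump.
      by move=> x _; exact: arc_bump_cvg.
    apply: rint_dom (integrable_norm ip) _ => [|x]; first exact: measurable_funM.
    by rewrite normrM ler_piMr//; case: ifP; rewrite ?normr1 ?normr0.
  rewrite torus_integral// in B.
  have {}B : (\int[leb]_(x in D) (p x * (if cos (q / 2) < cos (x - q / 2) then 1 else 0)))%R = 0.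
    move/eqP: B; rewrite mulf_eq0 invr_eq0 gt_eqF ?pi2_gt0//= => /eqP; exact.
  rewrite -[RHS]B Rintegral_mkcond [RHS]Rintegral_mkcond.
  congr fine; apply: ae_eq_integral => //.
  + apply/measurable_EFinP; apply/(measurable_restrictT _ (measurable_itv _)).
    exact: measurable_funTS.
  + apply/measurable_EFinP; apply/(measurable_restrictT _ mD).
    by apply: measurable_funTS; exact: rint_meas iq.
  exists ([set 0] `|` [set q]); split.
  + by apply: measurableU.
  + apply: countable_lebesgue_measure0; apply: finite_set_countable.
    by rewrite finite_setU; split; exact: finite_set1.
  + move=> x /= /not_implyP[_ /eqP E]; apply: contrapT => /not_orP[x0 xq].
    move/negP: E; apply; rewrite /g !patchE.
    case: ifPn => [|h1]; case: ifPn => [|h2] //.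
    * rewrite !inE /= !in_itv /= => /andP[x1 x2] xy.
      rewrite arcE//; have -> : 0 < x < q; last by rewrite mulr1.
      rewrite lt_def x1 andbT; apply/andP; split; first exact/eqP.
      by rewrite lt_def; apply/andP; split; [apply/eqP => ?; exact: xq|rewrite le_min xy ltW].
    * rewrite inE /= in_itv /= => /andP[x1 x2].
      rewrite arcE//; case: ifPn => [/andP[_ xq']|]; last by rewrite mulr0.
      exfalso; move: h1; rewrite notin_setE /= in_itv/=; apply.
      by move: xq'; rewrite lt_min => /andP[/ltW].
have oT : open [set: R] by exact: openT.
have := FTC1Ny ig' (open_integrable_locally oT ig).
move=> H; apply: leb_ae; move: H; apply: filterS; first exact: (ae_filter_ringOfSetsType leb).
move=> x /= [_] + Dx.
rewrite (_ : (fun x0 : R => _) = cst 0); last by apply/funext => y; rewrite F0.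
by rewrite derive1_cst /g patchE mem_set.
Qed.

Lemma fourier_uniq f : L1 f -> (forall k, fourier f k = 0) -> f = (fun=> 0) %[ae mu].
Proof.
move=> lf f0; have lj := L1_conj lf.
have re (h : R -> C) : L1 h -> (forall k, fourier h k = 0) ->
    {ae mu, forall x, complex.Re (h x) = 0}.
  move=> lh h0; apply: fourier_uniq_real (L1_Re lh) _ => k.
  have -> : (fun x => (complex.Re (h x))%:C%C) = (fun x => 2^-1 * (h x + conjc (h x))).
    apply/funext => x; rewrite -[2^-1](_ : (2^-1 : R)%:C%C = _); last by rewrite CV Cnat.
    by case: (h x) => a b; apply: eq_C; rewrite ?Re_M ?Im_M ?Re_D ?Im_D /=; field.
  rewrite (@fourierZ _ 2^-1 (fun x => h x + conjc (h x))); last first.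
    by apply: L1D => //; exact: L1_conj.
  rewrite (@fourierD _ h (fun x => conjc (h x)))//; last exact: L1_conj.
  by rewrite fourier_conj// !h0 conjc0 addr0 mulr0.
have h1 := re f lf f0.
have h2 : {ae mu, forall x, complex.Re ('i%C * f x) = 0}.
  by apply: re => [|k]; [exact: L1Z|rewrite fourierZ// f0 mulr0].
apply/ae_eqE; apply: ae_imp2 h1 h2 => x; case: (f x) => a b /= -> /eqP.
by rewrite mul0r mul1r sub0r oppr_eq0 => /eqP ->.
Qed.

Lemma fourier_inj f g : L1 f -> L1 g -> (forall k, fourier f k = fourier g k) ->
  f = g %[ae mu].
Proof.
move=> lf lg fg; have /ae_eqE H := fourier_uniq (L1B lf lg)
   (fun k => eq_trans (fourierB k lf lg) (eq_ind_r (fun z => z - _ = 0) (subrr _) (fg k))).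
by apply/ae_eqE; apply: ae_imp H => x /eqP; rewrite subr_eq0 => /eqP.
Qed.

End fourier_uniqueness_theorem.

(** * The Hardy space and the Szego projection *)

Section hardy.
Context {R : realType}.
Local Notation C := R[i].
Local Notation mu := (@torus_measure R).
Local Notation nc := (@Normc.normc R).
Implicit Types (f g h u v : R -> C) (k : int) (x y : R) (n : nat).

Definition L2p u := L2 u /\ forall k, k < 0 -> fourier u k = 0.

Lemma L2pP u : Lplus 2%:E u <-> L2p u.
Proof. by split=> [[/L2P]|[/L2P]]. Qed.

Lemma L2p_L2 u : L2p u -> L2 u. Proof. by case. Qed.

Lemma L2p_cexp (n : nat) : L2p (@cexp R n%:Z).
Proof.
split; first exact: L2_cexp.
by move=> k k0; rewrite fourier_cexp; case: eqP k0 => // <-.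
Qed.

Lemma L2pD u v : L2p u -> L2p v -> L2p (fun x => u x + v x).
Proof.
move=> [lu u0] [lv v0]; split; first exact: L2D.
by move=> k k0; rewrite fourierD ?u0 ?v0 ?addr0//; exact: L2_L1.
Qed.

Lemma L2pZ c u : L2p u -> L2p (fun x => c * u x).
Proof.
move=> [lu u0]; split; first exact: L2Z.
by move=> k k0; rewrite fourierZ ?u0 ?mulr0//; exact: L2_L1.
Qed.

Lemma L2pN u : L2p u -> L2p (fun x => - u x).
Proof.
move=> [lu u0]; split; first exact: L2N.
by move=> k k0; rewrite fourierN ?u0 ?oppr0//; exact: L2_L1.
Qed.

Lemma L2pB u v : L2p u -> L2p v -> L2p (fun x => u x - v x).
Proof. by move=> lu lv; apply: L2pD => //; exact: L2pN. Qed.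

Lemma L2p_sum (I : Type) (s : seq I) (F : I -> R -> C) :
  (forall i, L2p (F i)) -> L2p (fun x => \sum_(i <- s) F i x).
Proof.
move=> lF; split; first by apply: L2_sum => i; case: (lF i).
move=> k k0; rewrite fourier_sum; last by move=> i; apply: L2_L1; case: (lF i).
by rewrite big1// => i _; have [_ ->] := lF i.
Qed.

Lemma L2p_cst c : L2p (fun=> c).
Proof.
have := L2pZ c (L2p_cexp 0); congr L2p; apply/funext => x.
by rewrite cexp0 mulr1.
Qed.

Lemma L2p_ae u v : cmeas u -> L2p v -> u = v %[ae mu] -> L2p u.
Proof.
move=> mu' [lv v0] uv; split; first exact: L2_ae uv.
by move=> k k0; rewrite (fourier_ae k _ _ uv) ?v0//; case: lv.
Qed.

Definition psum n f : R -> C := fun x => \sum_(j < n) fourier f j%:Z * cexp j%:Z x.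

Lemma L2p_psum n f : L2p (psum n f).
Proof. by apply: L2p_sum => j; apply: L2pZ; exact: L2p_cexp. Qed.

Lemma L2_psum n f : L2 (psum n f). Proof. by case: (L2p_psum n f). Qed.

Lemma inner_psum n f g : L2 g ->
  inner (psum n f) g = \sum_(j < n) fourier f j%:Z * conjc (fourier g j%:Z).
Proof.
move=> lg; have lF (j : 'I_n) : L2 (fun x => fourier f j%:Z * cexp j%:Z x).
  by apply: L2Z; exact: L2_cexp.
rewrite inner_suml//; apply: eq_bigr => j _; rewrite innerZl//; last exact: L2_cexp.
by rewrite (innerC lg)//; exact: L2_cexp.
Qed.

Lemma fourier_psum n f (k : int) : fourier (psum n f) k =
  \sum_(j < n) fourier f j%:Z * (j%:Z == k)%:R.
Proof.
rewrite fourier_sum; last by move=> j; apply: L1Z; exact: L1_cexp.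
by apply: eq_bigr => j _; rewrite fourierZ ?fourier_cexp//; exact: L1_cexp.
Qed.

Lemma fourier_psum_lt n f (j : nat) : (j < n)%N -> fourier (psum n f) j%:Z = fourier f j%:Z.
Proof.
move=> jn; rewrite fourier_psum (bigD1 (Ordinal jn))//= eqxx mulr1 big1 ?addr0// => i ij.
case: eqP => [[E]|]; last by rewrite mulr0.
by exfalso; move/negP: ij; apply; apply/eqP/val_inj.
Qed.

Lemma inner_psum2 n m f : (n <= m)%N ->
  inner (psum n f) (psum m f) = (\sum_(j < n) nc (fourier f j%:Z) ^+ 2)%:C%C.
Proof.
move=> nm; rewrite inner_psum; last exact: L2_psum.
rewrite rmorph_sum; apply: eq_bigr => j _.
by rewrite fourier_psum_lt ?mul_conj// (leq_trans _ nm).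
Qed.

Definition S2 n f : R := \sum_(j < n) nc (fourier f j%:Z) ^+ 2.

Lemma n2sq_psum n f : n2 (psum n f) ^+ 2 = S2 n f.
Proof. by apply: complexI; rewrite -inner_self inner_psum2. Qed.

Lemma n2sq_psumB n m f : (n <= m)%N ->
  n2 (fun x => psum m f x - psum n f x) ^+ 2 = S2 m f - S2 n f.
Proof.
move=> nm; rewrite n2_sub n2sqB; try exact: L2_psum.
by rewrite inner_psum2// !n2sq_psum /= -/(S2 n f); ring.
Qed.

Lemma bessel n f : L2 f -> S2 n f <= n2 f ^+ 2.
Proof.
move=> lf; have := sqr_ge0 (n2 (fun x => psum n f x - f x)).
rewrite n2sqB//; last exact: L2_psum.
have -> : inner (psum n f) f = (S2 n f)%:C%C.
  rewrite inner_psum// rmorph_sum; apply: eq_bigr => j _.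
  exact: mul_conj.
by rewrite n2sq_psum /=; lra.
Qed.

Lemma L2_cauchy_psum f : L2 f -> L2_cauchy (fun n => psum n f).
Proof.
move=> lf e e0.
have nd : nondecreasing_seq (S2 ^~ f).
  by apply/nondecreasing_seqP => n; rewrite /S2 big_ord_recr /= lerDl sqr_ge0.
have cS : cvgn (S2 ^~ f).
  apply: nondecreasing_is_cvgn => //.
  by exists (n2 f ^+ 2) => _ [n _ <-]; exact: bessel.
have e2 : 0 < e ^+ 2 by rewrite exprn_gt0.
have /cvgrPdist_lt /(_ _ e2) [N _ HN] := cS.
have leS n : S2 n f <= limn (S2 ^~ f) by exact: nondecreasing_cvgn_le.
have key m n : (N <= n)%N -> (n <= m)%N -> n2 (fun x => psum m f x - psum n f x) <= e.
  move=> Nn nm; rewrite -(@ler_pXn2r _ 2)// ?nnegrE ?n2_ge0 ?(ltW e0)// n2sq_psumB//.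
  have := HN n Nn; rewrite ger0_norm ?subr_ge0// => /ltW h.
  by apply: (le_trans _ h); rewrite lerD2r.
exists N => m n Nm Nn; have [mn|/ltnW nm] := leqP m n; last exact: key.
by rewrite n2_sub; exact: key.
Qed.

Lemma fourier_n2 f g k : L2 f -> L2 g -> nc (fourier f k - fourier g k) <= n2 (fun x => f x - g x).
Proof.
move=> lf lg; rewrite -fourierB; try exact: L2_L1.
have lfg := L2B lf lg.
exact: le_trans (fourier_le k (L2_L1 lfg)) (N1_le_n2 lfg).
Qed.

Lemma nc_small (z : C) : (forall e : R, 0 < e -> nc z <= e) -> z = 0.
Proof.
move=> H; apply: nc_eq0; apply/eqP; rewrite eq_le nc_ge0 andbT.
by apply/ler_addgt0Pr => e e0; rewrite add0r; exact: H.
Qed.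

Lemma frac_le (a e : R) : 0 <= a -> 0 < e -> a * (e / (a + 1)) <= e.
Proof.
move=> a0 e0; have a1 : 0 < a + 1 by rewrite ltr_wpDl.
by rewrite mulrA ler_pdivrMr// mulrDr mulr1 mulrC lerDl ltW.
Qed.

Lemma exists_projection f : L2 f -> exists2 g, L2p g &
  (forall j : nat, fourier g j%:Z = fourier f j%:Z) /\
  (forall e : R, 0 < e -> exists N, forall n, (N <= n)%N ->
     n2 (fun x => psum n f x - g x) <= e).
Proof.
move=> lf; have [g lg Hg] := riesz_fischer (fun n => L2_psum n f) (L2_cauchy_psum lf).
exists g.
  split => // k k0; apply: nc_small => e e0; have [N HN] := Hg e e0.
  have := fourier_n2 k (L2_psum N f) lg.
  have [_ ->//] := L2p_psum N f; rewrite sub0r ncN => h.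
  exact: le_trans h (HN N (leqnn N)).
split=> // j; apply/eqP; rewrite -subr_eq0; apply/eqP; apply: nc_small => e e0.
have [N HN] := Hg e e0; pose n := maxn N j.+1.
have := fourier_n2 j%:Z (L2_psum n f) lg.
rewrite fourier_psum_lt ?leq_maxr// nc_sub => h.
by apply: le_trans h (HN _ _); rewrite leq_maxl.
Qed.

Lemma psum_cvg u : L2p u -> forall e : R, 0 < e -> exists N, forall n, (N <= n)%N ->
  n2 (fun x => psum n u x - u x) <= e.
Proof.
move=> [lu u0] e e0; have [g [lg g0] [gu H]] := exists_projection lu.
have gu' : g = u %[ae mu].
  apply: fourier_inj; [exact: L2_L1|exact: L2_L1|].
  by move=> [j|j]; [exact: gu|rewrite g0// u0].
have [N HN] := H e e0; exists N => n Nn; rewrite (@n2_ae _ _ (fun x => psum n u x - g x)).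
- exact: HN.
- by apply: cmeasB; [case: (L2_psum n u)|case: lu].
- by apply: cmeasB; [case: (L2_psum n u)|case: lg].
- by apply/ae_eqE; move/ae_eqE: gu'; apply: ae_imp => x ->.
Qed.

Lemma inner_closed f u : L2 f -> L2p u ->
  (forall j : nat, fourier f j%:Z = 0) -> inner f u = 0.
Proof.
move=> lf lu f0; have [lu2 _] := lu; apply: nc_small => e e0.
have e1 : 0 < e / (n2 f + 1) by rewrite divr_gt0// ltr_wpDl ?n2_ge0.
have [N /(_ N (leqnn N)) HN] := psum_cvg lu e1.
have z : inner f (psum N u) = 0.
  rewrite (innerC (L2_psum N u) lf) inner_psum// big1 ?conjc0// => j _.
  by rewrite f0 conjc0 mulr0.
rewrite -[inner f u]subr0 -z -innerBr//; last exact: L2_psum.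
rewrite (le_trans (inner_le lf (L2B lu2 (L2_psum N u))))// n2_sub.
apply: (@le_trans _ _ (n2 f * (e / (n2 f + 1)))); first by rewrite ler_wpM2l ?n2_ge0.
exact: frac_le (n2_ge0 _) e0.
Qed.

Lemma SzegoP f : L2 f -> L2p (Szego f) /\
  forall h, L2p h -> inner (fun x => f x - Szego f x) h = 0.
Proof.
move=> lf; have [g lg [gf _]] := exists_projection lf.
have [l H] : [set g | Lplus 2%:E g /\
    forall h, Lplus 2%:E h -> inner (fun x => f x - g x) h = 0] (Szego f).
  apply: (@xgetPex _ (fun=> 0 : C)); exists g; split; first exact/L2pP.
  move=> h /L2pP lh; have [lg2 _] := lg; apply: inner_closed => //; first exact: L2B.
  by move=> j; rewrite fourierB ?gf ?subrr//; exact: L2_L1.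
by split; [exact/L2pP|move=> h /L2pP; exact: H].
Qed.

Lemma L2p_Szego f : L2 f -> L2p (Szego f). Proof. by move=> /SzegoP[]. Qed.

Lemma L2_Szego f : L2 f -> L2 (Szego f). Proof. by move=> /L2p_Szego[]. Qed.

Lemma inner_Szego f h : L2 f -> L2p h -> inner (Szego f) h = inner f h.
Proof.
move=> lf lh; have [_ /(_ h lh)] := SzegoP lf; have [lh2 _] := lh.
rewrite (innerBl lf (L2_Szego lf) lh2) => /eqP.
by rewrite subr_eq0 => /eqP.
Qed.

Lemma fourier_Szego f (j : nat) : L2 f -> fourier (Szego f) j%:Z = fourier f j%:Z.
Proof. by move=> lf; rewrite /fourier inner_Szego//; exact: L2p_cexp. Qed.

Lemma Szego_uniq f g : L2 f -> L2p g -> (forall j : nat, fourier g j%:Z = fourier f j%:Z) ->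
  Szego f = g %[ae mu].
Proof.
move=> lf [lg g0] gf; have [ls s0] := L2p_Szego lf.
apply: fourier_inj; [exact: L2_L1|exact: L2_L1|].
by move=> [j|j]; [rewrite fourier_Szego// gf|rewrite s0// g0].
Qed.

Lemma n2_Szego f : L2 f -> n2 (Szego f) <= n2 f.
Proof.
move=> lf; have ls := L2_Szego lf.
have H : n2 (Szego f) ^+ 2 <= n2 f * n2 (Szego f).
  have := inner_le lf ls; rewrite -(inner_Szego lf (L2p_Szego lf)) inner_self nc_real.
  by rewrite ger0_norm ?sqr_ge0.
have [->|s0] := eqVneq (n2 (Szego f)) 0; first exact: n2_ge0.
by move: H; rewrite expr2 ler_pM2r// lt_def s0 n2_ge0.
Qed.

Lemma SzegoB f g : L2 f -> L2 g ->
  Szego (fun x => f x - g x) = (fun x => Szego f x - Szego g x) %[ae mu].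
Proof.
move=> lf lg; apply: Szego_uniq; first exact: L2B.
  by apply: L2pB; exact: L2p_Szego.
by move=> j; rewrite !fourierB ?fourier_Szego//; apply: L2_L1 => //; exact: L2_Szego.
Qed.

Lemma n2_SzegoB f g : L2 f -> L2 g ->
  n2 (fun x => Szego f x - Szego g x) <= n2 (fun x => f x - g x).
Proof.
move=> lf lg; have lfg := L2B lf lg.
rewrite -(n2_ae _ _ (SzegoB lf lg)); first exact: n2_Szego.
- by case: (L2_Szego lfg).
- by apply: cmeasB; [case: (L2_Szego lf)|case: (L2_Szego lg)].
Qed.

Lemma n2_eq_small f g : L2 f -> L2 g -> f = g %[ae mu] ->
  forall h, L2 h -> n2 (fun x => f x - h x) = n2 (fun x => g x - h x).
Proof.
move=> lf lg fg h lh; apply: n2_ae.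
- by apply: cmeasB; [case: lf|case: lh].
- by apply: cmeasB; [case: lg|case: lh].
- by apply/ae_eqE; move/ae_eqE: fg; apply: ae_imp => x ->.
Qed.

Lemma inner_ae f g h : cmeas f -> cmeas g -> cmeas h -> f = g %[ae mu] ->
  inner f h = inner g h.
Proof.
move=> mf mg /cmeas_conj mh fg; apply: cint_ae; [exact: cmeasM|exact: cmeasM|].
by apply/ae_eqE; move/ae_eqE: fg; apply: ae_imp => x ->.
Qed.

(** By continuity of the product from L2 to L1, one factor may be taken to be a
    partial sum of its Fourier series. *)
Lemma fourier_mul_psum n f g k : L2 g ->
  fourier (fun x => psum n f x * g x) k =
  \sum_(j < n) fourier f j%:Z * fourier g (k - j%:Z).
Proof.
move=> lg.
have lF (j : 'I_n) : L1 (fun x => fourier f j%:Z * (cexp j%:Z x * g x)).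
  by apply: L1Z; apply: L2M => //; exact: L2_cexp.
have -> : (fun x => psum n f x * g x) =
    (fun x => \sum_(j < n) fourier f j%:Z * (cexp j%:Z x * g x)).
  by apply/funext => x; rewrite /psum mulr_suml; apply: eq_bigr => j _; rewrite mulrA.
rewrite fourier_sum//; apply: eq_bigr => j _; rewrite fourierZ; last first.
  by apply: L2M => //; exact: L2_cexp.
congr (_ * _); rewrite /fourier /inner; congr cintegral; apply/funext => x.
by rewrite cexpD cexpN conjcM conjcK; ring.
Qed.

Lemma fourier_mulB n f g k : L2 f -> L2 g ->
  nc (fourier (fun x => psum n f x * g x) k - fourier (fun x => f x * g x) k) <=
  n2 (fun x => psum n f x - f x) * n2 g.
Proof.
move=> lf lg; have lp := L2_psum n f; rewrite -fourierB; try exact: L2M.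
have -> : (fun x => psum n f x * g x - f x * g x) = (fun x => (psum n f x - f x) * g x).
  by apply/funext => x; rewrite mulrBl.
have lB := L2B lp lf.
exact: le_trans (fourier_le k (L2M lB lg)) (N1M lB lg).
Qed.

Lemma fourier_mul_lim f g k (c : C) : L2p f -> L2 g ->
  (forall n : nat, fourier (fun x => psum n.+1 f x * g x) k = c) ->
  fourier (fun x => f x * g x) k = c.
Proof.
move=> lf lg H; apply/eqP; rewrite -subr_eq0; apply/eqP; apply: nc_small => e e0.
have e1 : 0 < e / (n2 g + 1) by rewrite divr_gt0// ltr_wpDl ?n2_ge0.
have [N /(_ N.+1 (leqnSn N)) HN] := psum_cvg lf e1.
have [lf2 _] := lf; have := fourier_mulB N.+1 k lf2 lg; rewrite H nc_sub.
move=> h; apply: (le_trans h).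
apply: (@le_trans _ _ (e / (n2 g + 1) * n2 g)); first by rewrite ler_wpM2r ?n2_ge0.
by rewrite mulrC; exact: frac_le (n2_ge0 _) e0.
Qed.

Lemma fourier_mul_neg f g k : L2p f -> L2p g -> k < 0 ->
  fourier (fun x => f x * g x) k = 0.
Proof.
move=> lf [lg g0] k0; apply: fourier_mul_lim => // n.
rewrite fourier_mul_psum// big1// => j _; rewrite g0 ?mulr0//.
by rewrite subr_lt0 (lt_le_trans k0).
Qed.

Lemma fourier_mul0 f g : L2p f -> L2p g ->
  fourier (fun x => f x * g x) 0 = fourier f 0 * fourier g 0.
Proof.
move=> lf [lg g0]; apply: fourier_mul_lim => // n.
rewrite fourier_mul_psum// big_ord_recl /= subr0 big1 ?addr0// => j _.
by rewrite g0 ?mulr0// sub0r oppr_lt0.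
Qed.

Lemma L2pM f g : L2p f -> L2p g -> L2 (fun x => f x * g x) ->
  L2p (fun x => f x * g x).
Proof. by move=> lf lg l; split=> // k k0; exact: fourier_mul_neg. Qed.

End hardy.

(** * Forms bounded on H^1 and the L4 estimate *)

Section bmo_bound.
Context {R : realType}.
Local Notation C := R[i].
Local Notation mu := (@torus_measure R).
Local Notation nc := (@Normc.normc R).
Implicit Types (f g h u v b : R -> C) (p q : R -> R) (k : int) (x y M : R) (n : nat).

Definition L2_cvg (F : nat -> R -> C) u := forall e : R, 0 < e ->
  exists N, forall n, (N <= n)%N -> n2 (fun x => F n x - u x) <= e.

Lemma L2p_fejer n f : (forall k, k < 0 -> fourier f k = 0) -> L2p (fejer n f).
Proof.
move=> f0; apply: L2pZ; apply: L2p_sum => j; apply: L2p_sum => l.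
case: (j%:Z - l%:Z) => m; first by apply: L2pZ; exact: L2p_cexp.
rewrite f0//; have := L2p_cst (0 : C); congr L2p; apply/funext => x.
by rewrite mul0r.
Qed.

Lemma inner_fejer n f g : L1 f -> L1 g -> inner (fejer n f) g = inner f (fejer n g).
Proof.
move=> lf lg.
pose c := \sum_(j < n.+1) \sum_(l < n.+1)
   fourier f (j%:Z - l%:Z) * conjc (fourier g (j%:Z - l%:Z)).
have lge k : L1 (fun x => cexp k x * conjc (g x)).
  under eq_fun do rewrite mulrC; apply: L1_cexpM; exact: L1_conj.
have ge k : cintegral (fun x => cexp k x * conjc (g x)) = conjc (fourier g k).
  rewrite /fourier /inner -cint_conj; last exact: L1_cexpJ.
  by congr cintegral; apply/funext => x; rewrite conjcM conjcK mulrC.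
transitivity (n.+1%:R^-1 * c).
  rewrite /inner (_ : (fun x => _) = fun x => n.+1%:R^-1 *
      \sum_(j < n.+1) \sum_(l < n.+1) fourier f (j%:Z - l%:Z) *
         (cexp (j%:Z - l%:Z) x * conjc (g x))).
    rewrite cintZ; last by do 2 (apply: L1_sum => ?); exact: L1Z.
    congr (_ * _); rewrite cint_sum; last by move=> ?; apply: L1_sum => ?; exact: L1Z.
    apply: eq_bigr => j _; rewrite cint_sum; last by move=> ?; exact: L1Z.
    by apply: eq_bigr => l _; rewrite cintZ// ge.
  apply/funext => x; rewrite /fejer -mulrA mulr_suml; congr (_ * _).
  apply: eq_bigr => j _; rewrite mulr_suml; apply: eq_bigr => l _.
  by rewrite mulrA.
rewrite /inner (_ : (fun x => _) = fun x => n.+1%:R^-1 *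
    \sum_(j < n.+1) \sum_(l < n.+1) conjc (fourier g (j%:Z - l%:Z)) *
       (f x * conjc (cexp (j%:Z - l%:Z) x))).
  rewrite cintZ; last by do 2 (apply: L1_sum => ?); apply: L1Z; exact: L1_cexpJ.
  congr (_ * _); rewrite cint_sum; last by move=> ?; apply: L1_sum => ?; apply: L1Z; exact: L1_cexpJ.
  apply: eq_bigr => j _; rewrite cint_sum; last by move=> ?; apply: L1Z; exact: L1_cexpJ.
  apply: eq_bigr => l _; rewrite cintZ; last exact: L1_cexpJ.
  by rewrite mulrC.
apply/funext => x; rewrite /fejer conjcM mulrCA -Cnat -CV conjc_real; congr (_ * _).
rewrite conjc_sum mulr_sumr; apply: eq_bigr => j _; rewrite conjc_sum mulr_sumr.
by apply: eq_bigr => l _; rewrite conjcM mulrCA.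
Qed.

Lemma psum_chord n f : exists2 L : R, 0 <= L & chord_lip (psum n f) L.
Proof.
exists (\sum_(j < n) nc (fourier f j%:Z) * j%:R).
  by apply: sumr_ge0 => j _; rewrite mulr_ge0// nc_ge0.
move=> x y; rewrite /psum -sumrB (le_trans (nc_sum _ _ _))// mulr_suml.
apply: ler_sum => j _; rewrite -mulrBr ncM -mulrA ler_wpM2l ?nc_ge0//.
exact: cexp_chord1.
Qed.

Lemma small_inv (a e : R) : 0 <= a -> 0 < e ->
  exists N, forall n, (N <= n)%N -> a * (2 / n.+1%:R) <= e.
Proof.
move=> a0 e0; have ae : 0 <= a * 2 / e by rewrite divr_ge0 ?mulr_ge0// ltW.
exists (Num.bound (a * 2 / e)) => n Nn; rewrite mulrA ler_pdivrMr ?ltr0n//.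
have : a * 2 / e <= n.+1%:R.
  by rewrite (le_trans (ltW (archi_boundP ae)))// ler_nat (leq_trans Nn).
by rewrite ler_pdivrMr// [e * _]mulrC.
Qed.

Lemma fejer_psum_cvg m f : L2_cvg (fun n => fejer n (psum m f)) (psum m f).
Proof.
have [L L0 HL] := psum_chord m f; move=> e e0.
have [N HN] := small_inv (sqr_ge0 L) (exprn_gt0 2 e0).
exists N => n /HN h; apply: n2_bd.
  by apply: cmeasB; [exact: cmeas_fejer|case: (L2_psum m f)].
move=> x; rewrite -(@ler_pXn2r _ 2)// ?nnegrE ?nc_ge0 ?(ltW e0)// nc_sub.
by apply: le_trans h; apply: fejer_uniform => //; case: (L2_psum m f).
Qed.

Lemma fejer_cvg_L2p u : L2p u -> L2_cvg (fun n => fejer n u) u.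
Proof.
move=> lu e e0; have [lu2 _] := lu.
have e3 : 0 < e / 3 by rewrite divr_gt0.
have [m /(_ m (leqnn m)) hm] := psum_cvg lu e3.
have [N HN] := fejer_psum_cvg m u e3; exists N => n /HN hn.
have lp := L2_psum m u.
have lF := L2_fejer n u; have lFp := L2_fejer n (psum m u).
apply: (le_trans (n2_trans lF lFp lu2)).
have := n2_trans lFp lp lu2.
have : n2 (fun x => fejer n u x - fejer n (psum m u) x) <= e / 3.
  have lB := L2B lu2 lp.
  rewrite (_ : (fun x => _) = fejer n (fun x => u x - psum m u x)).
    by rewrite (le_trans (n2_fejer n lB))// n2_sub.
  by apply/funext => x; rewrite fejer_linear//; exact: L2_L1.
by lra.
Qed.

Lemma L2p_conj_rest f : L2 f -> L2p (fun x => conjc (f x - Szego f x)).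
Proof.
move=> lf; have ls := L2_Szego lf; split; first by apply: L2_conj; exact: L2B.
move=> k k0; rewrite fourier_conj; last by apply: L2_L1; exact: L2B.
rewrite fourierB; try exact: L2_L1.
by case: k k0 => // j _; rewrite NegzE opprK fourier_Szego// subrr conjc0.
Qed.

Lemma fejer_cvg f : L2 f -> L2_cvg (fun n => fejer n f) f.
Proof.
move=> lf e e0; have e2 : 0 < e / 2 by rewrite divr_gt0.
have ls := L2p_Szego lf; have lr := L2p_conj_rest lf.
have [ls2 _] := ls; have lr2 := L2B lf ls2.
have [N1 H1] := fejer_cvg_L2p ls e2; have [N2 H2] := fejer_cvg_L2p lr e2.
exists (maxn N1 N2) => n; rewrite geq_max => /andP[/H1 h1 /H2 h2].
have E : (fun x => fejer n f x - f x) = (fun x => (fejer n (Szego f) x - Szego f x) +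
   conjc (fejer n (fun x => conjc (f x - Szego f x)) x - conjc (f x - Szego f x))).
  apply/funext => x; rewrite fejer_conj; last exact: L2_L1.
  rewrite -conjcB conjcK fejer_linear; try exact: L2_L1.
  ring.
rewrite E (le_trans (n2D _ _))//.
- by apply: L2B => //; exact: L2_fejer.
- by apply: L2_conj; apply: L2B; [exact: L2_fejer|case: lr].
- by rewrite n2_conj; move: h1 h2; lra.
Qed.

Lemma N1D f g : L1 f -> L1 g -> N1 (fun x => f x + g x) <= N1 f + N1 g.
Proof.
move=> [mf fi] [mg gi]; rewrite -RintegralD//; apply: le_N1.
- exact: cmeasD.
- exact: rintD.
- by move=> x; exact: ncD.
Qed.

Lemma N1_sub f g : N1 (fun x => f x - g x) = N1 (fun x => g x - f x).
Proof. by apply: eq_Rintegral => x _; rewrite /modulus nc_sub. Qed.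

Lemma bounded_dense_L1 f : L1 f -> forall e : R, 0 < e ->
  exists2 g, L2 g & N1 (fun x => f x - g x) <= e.
Proof.
move=> [mf fi] e e0.
pose p n x : R := if modulus f x <= n%:R then 0 else modulus f x.
have mm := rint_meas fi.
have mp n : measurable_fun setT (p n).
  apply: measurable_fun_ifT => //; apply: measurable_fun_ler => //.
have pm n x : `|p n x| <= modulus f x.
  by rewrite /p; case: ifP; rewrite ?normr0 ?(ger0_norm (nc_ge0 _))// nc_ge0.
have H : (\int[mu]_x (p n x)%:E @[n --> \oo] --> \int[mu]_x (0 : \bar R))%E.
  apply: (@dominated_cvg _ _ _ mu setT measurableT
    (fun n x => (p n x)%:E) (fun=> 0%E) (fun x => (modulus f x)%:E)).
  - by move=> n; apply/measurable_EFinP; exact: mp.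
  - move=> x _; apply: cvg_near_cst; exists (Num.bound (modulus f x)) => // n /= hn.
    rewrite /p ifT// (le_trans (ltW (archi_boundP (nc_ge0 _))))//.
    by rewrite ler_nat.
  - by [].
  - exact: fi.
  - by move=> n x _; rewrite /= lee_fin; exact: pm.
rewrite integral0 in H.
have ip n : rint (p n) by exact: rint_dom (mp n) fi (pm n).
have [n hn] : exists n, (\int[mu]_x p n x)%R <= e.
  have /fine_cvgP[_ /cvgrPdist_lt /(_ e e0) [N _ /(_ N (leqnn N))]] := H.
  rewrite /= sub0r normrN => h; exists N.
  by apply: ltW; apply: le_lt_trans h; exact: ler_norm.
pose a x : R := if modulus f x <= n%:R then 1 else 0.
have ma : measurable_fun setT a.
  by apply: measurable_fun_ifT => //; exact: measurable_fun_ler.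
exists (fun x => f x * (a x)%:C%C).
  apply: (@L2_bd _ _ n%:R); first by apply: cmeasM => //; exact: cmeas_real.
  move=> x; rewrite ncM nc_real /a; case: ifP => h.
    by rewrite normr1 mulr1.
  by rewrite normr0 mulr0.
apply: le_trans hn; apply: le_N1 => //.
  by apply: cmeasB => //; apply: cmeasM => //; exact: cmeas_real.
move=> x; rewrite -{1}[f x]mulr1 -mulrBr ncM -[1]/(1%:C%C) -CB nc_real /a /p /modulus.
by case: ifP => _; rewrite ?subrr ?subr0 ?normr0 ?normr1 ?mulr0 ?mulr1.
Qed.

Lemma fejer_cvg_L1 f : L1 f -> forall e : R, 0 < e ->
  exists n, N1 (fun x => fejer n f x - f x) <= e.
Proof.
move=> lf e e0; have e3 : 0 < e / 3 by rewrite divr_gt0.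
have [g lg fg] := bounded_dense_L1 lf e3.
have [N /(_ N (leqnn N)) hN] := fejer_cvg lg e3; exists N.
have lg1 := L2_L1 lg; have lB := L1B lf lg1.
have lFg := L2_fejer N g.
have E : (fun x => fejer N f x - f x) = (fun x => fejer N (fun x => f x - g x) x +
   ((fejer N g x - g x) + (g x - f x))).
  by apply/funext => x; rewrite fejer_linear//; ring.
rewrite E; have l1 : L1 (fejer N (fun x => f x - g x)) by apply: L2_L1; exact: L2_fejer.
have l2 : L1 (fun x => fejer N g x - g x) by apply: L2_L1; exact: L2B.
have l3 := L1B lg1 lf.
have h1 := N1D l1 (L1D l2 l3); have h2 := N1D l2 l3; have h3 := N1_fejer N lB.
have h4 := N1_le_n2 (L2B lFg lg); have h5 := N1_sub f g.
lra.
Qed.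

(** The BMO norm is only used through its dual form on L2p. *)
Definition HB M u := L2p u /\ forall f, L2p f -> nc (inner f u) <= M * N1 f.

Lemma HB_L2p M u : HB M u -> L2p u. Proof. by case. Qed.
Lemma HB_L2 M u : HB M u -> L2 u. Proof. by case=> -[]. Qed.

Lemma HB_mono M M' u : M <= M' -> HB M u -> HB M' u.
Proof.
move=> MM' [lu H]; split=> // f lf; apply: (le_trans (H f lf)).
by rewrite ler_wpM2r// N1_ge0.
Qed.

Lemma HB_ae M u v : cmeas u -> HB M v -> u = v %[ae mu] -> HB M u.
Proof.
move=> mu' [lv H] uv; have lu := L2p_ae mu' lv uv; split=> // f lf.
have [lf2 _] := lf; have [lu2 _] := lu; have [lv2 _] := lv.
by rewrite (innerC lu2 lf2) nc_conj (@inner_ae _ _ v)//;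
  [rewrite -nc_conj -innerC//; exact: H|case: lv2|case: lf2].
Qed.

Lemma HB_sub M M' u v : HB M u -> HB M' v -> HB (M + M') (fun x => u x - v x).
Proof.
move=> [lu H] [lv H']; split; first exact: L2pB.
move=> f lf; have [lf2 _] := lf; have [lu2 _] := lu; have [lv2 _] := lv.
rewrite innerBr// (le_trans (ncB _ _))// mulrDl lerD//; [exact: H|exact: H'].
Qed.

Lemma HB_Szego M b : cmeas b -> (forall x, nc (b x) <= M) -> HB M (Szego b).
Proof.
move=> mb bM; have lb := L2_bd mb bM; split; first exact: L2p_Szego.
move=> f lf; have [lf2 _] := lf.
have -> : inner f (Szego b) = inner f b.
  by rewrite (innerC (L2_Szego lb) lf2) inner_Szego// -innerC.
have lJ := L2_conj lb; apply: (le_trans (cint_le (L2M lf2 lJ))).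
apply: N1M_bd; [exact: L2_L1|by case: lJ|by move=> x; rewrite nc_conj].
Qed.

Lemma HB_fejer M n u : 0 <= M -> HB M u -> HB M (fejer n u).
Proof.
move=> M0 [[lu u0] H]; split; first exact: L2p_fejer.
move=> f [lf f0]; rewrite -inner_fejer; try exact: L2_L1.
apply: (le_trans (H _ (L2p_fejer n f0))).
by rewrite ler_wpM2l// N1_fejer//; exact: L2_L1.
Qed.

Lemma fejer_bounded n f : exists c : R, forall x, nc (fejer n f x) <= c.
Proof.
exists (nc n.+1%:R^-1 * \sum_(j < n.+1) \sum_(l < n.+1) nc (fourier f (j%:Z - l%:Z))) => x.
rewrite ncM ler_wpM2l ?nc_ge0// (le_trans (nc_sum _ _ _))//.
apply: ler_sum => j _; rewrite (le_trans (nc_sum _ _ _))//.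
by apply: ler_sum => l _; rewrite ncM nc_cexp mulr1.
Qed.

(** For a bounded function p, the square of the L2 norm of the projection g of
    |p|^2 is (g p | p), which the dual form of the BMO norm controls. *)
Lemma HB_sq_bounded M u c : 0 <= M -> HB M u -> (forall x, nc (u x) <= c) ->
  n2 (fun x => u x ^+ 2) <= 3 * M * n2 u.
Proof.
move=> M0 [lu H] uc; have [lu2 _] := lu; have mu' : cmeas u by case: lu2.
pose q x : C := u x * conjc (u x).
have lq : L2 q.
  by apply: (L2M_bd lu2 (cmeas_conj mu')) => x; rewrite nc_conj; exact: uc.
have qr x : conjc (q x) = q x by rewrite /q conjcM conjcK mulrC.
have lg := L2p_Szego lq; have [lg2 _] := lg.
have lr := L2B lq lg2; have lrJ := L2p_conj_rest lq.
have -> : n2 (fun x => u x ^+ 2) = n2 q.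
  by apply: n2_eq => x; rewrite ncX ncM nc_conj expr2.
have lgu : L2p (fun x => Szego q x * u x) by apply: L2pM => //; exact: L2M_bd uc.
have h1 : n2 (Szego q) ^+ 2 <= M * n2 u * n2 (Szego q).
  have E : inner (Szego q) q = (n2 (Szego q) ^+ 2)%:C%C.
    by rewrite (innerC lq lg2) -(inner_Szego lq lg) inner_self conjc_real.
  have <- : nc (inner (Szego q) q) = n2 (Szego q) ^+ 2.
    by rewrite E nc_real ger0_norm ?sqr_ge0.
  have -> : inner (Szego q) q = inner (fun x => Szego q x * u x) u.
    by rewrite /inner; congr cintegral; apply/funext => x; rewrite qr /q mulrA.
  apply: (le_trans (H _ lgu)); rewrite -mulrA ler_wpM2l// mulrC.
  exact: N1M.
have h2 : n2 (Szego q) <= M * n2 u.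
  have [->|g0] := eqVneq (n2 (Szego q)) 0; first by rewrite mulr_ge0 ?n2_ge0.
  by move: h1; rewrite expr2 ler_pM2r// lt_def g0 n2_ge0.
have h3 : n2 q ^+ 2 <= n2 q * (3 * n2 (Szego q)).
  have E : inner q q = inner q (Szego q) + inner q (fun x => q x - Szego q x).
    rewrite -innerDr//; congr inner; apply/funext => x.
    by rewrite addrC subrK.
  have e1 := inner_le lq lg2.
  have e2 : nc (inner q (fun x => q x - Szego q x)) <= n2 (Szego q) * (2 * n2 q).
    have -> : inner q (fun x => q x - Szego q x) =
        conjc (inner q (fun x => conjc (q x - Szego q x))).
      rewrite /inner -cint_conj; last by apply: L2M => //; apply: L2_conj; case: lrJ.
      by congr cintegral; apply/funext => x; rewrite conjcM conjcK qr.
    have [lrJ2 _] := lrJ.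
    rewrite nc_conj -(inner_Szego lq lrJ) (le_trans (inner_le lg2 lrJ2))//.
    rewrite ler_wpM2l ?n2_ge0// n2_conj (le_trans (n2B lq lg2))//.
    by have := n2_Szego lq; lra.
  have : nc (inner q q) <= n2 q * n2 (Szego q) + n2 (Szego q) * (2 * n2 q).
    by rewrite E (le_trans (ncD _ _))// lerD.
  by rewrite inner_self nc_real ger0_norm ?sqr_ge0//; lra.
have [->|q0] := eqVneq (n2 q) 0; first by rewrite mulr_ge0 ?n2_ge0// mulr_ge0.
move: h3; rewrite expr2 ler_pM2l; last by rewrite lt_def q0 n2_ge0.
by move=> h3; lra.
Qed.

Lemma L2_cvg_ae (F : nat -> R -> C) u : (forall n, L2 (F n)) -> L2 u -> L2_cvg F u ->
  exists phi : nat -> nat, ae_cvg (fun n => F (phi n)) u.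
Proof.
move=> lF lu H.
have e0 (k : nat) : 0 < (2^-1 : R) ^+ k / 2 by rewrite divr_gt0// exprn_gt0// invr_gt0.
have /choice[phi Hphi] : forall k : nat, exists n, n2 (fun x => F n x - u x) <= 2^-1 ^+ k / 2.
  by move=> k; have [N /(_ N (leqnn N))] := H _ (e0 k); exists N.
have step (k : nat) : N1 (fun x => F (phi k.+1) x - F (phi k) x) <= 1 * 2^-1 ^+ k.
  apply: (le_trans (N1_le_n2 (L2B (lF _) (lF _)))).
  apply: (le_trans (n2_trans (lF _) lu (lF _))); rewrite [X in _ + X]n2_sub mul1r.
  have h1 := Hphi k; have h2 := Hphi k.+1; have : (2^-1 : R) ^+ k.+1 <= 2^-1 ^+ k.
    by rewrite exprS ler_piMl ?exprn_ge0 ?invr_ge0// invf_le1// ler1n.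
  move: h1 h2; lra.
have [g mg Hg] := ae_limit (fun k : nat => L2_meas (lF (phi k)))
   (fun k : nat => L2_L1 (L2B (lF _) (lF _))) step.
have key (k : nat) : L2 (fun x => g x - u x) /\ n2 (fun x => g x - u x) <= 2^-1 ^+ k.
  apply: (@fatou_n2 _ (fun j x => F (phi (j + k)%N) x - u x)).
  - by rewrite exprn_ge0// invr_ge0.
  - by move=> j; exact: L2B.
  - move=> j; apply: (le_trans (Hphi _)).
    have : (2^-1 : R) ^+ (j + k) <= 2^-1 ^+ k.
      by rewrite exprD ler_piMl ?exprn_ge0 ?invr_ge0// exprn_ile1// ?invr_ge0// invf_le1// ler1n.
    have : 0 <= (2^-1 : R) ^+ (j + k) by rewrite exprn_ge0// invr_ge0.
    lra.
  - by apply: cmeasB => //; case: lu.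
  - by apply: (@ae_cvg_subr _ (fun j => F (phi (j + k)%N))); exact: (@ae_cvg_shift _ (fun j => F (phi j))).
have [lgu _] := key 0%N.
have z : n2 (fun x => g x - u x) = 0.
  apply/eqP; rewrite eq_le n2_ge0 andbT; apply/ler_addgt0Pr => e ep; rewrite add0r.
  have : (fun k : nat => (2^-1 : R) ^+ k) @ \oo --> 0 by apply: cvg_expr; rewrite ger0_norm// invf_lt1// ltr1n.
  move=> /cvgrPdist_lt /(_ e ep) [k _ /(_ k (leqnn k))] /=.
  rewrite sub0r normrN ger0_norm; last by rewrite exprn_ge0// invr_ge0.
  by move/ltW; apply: le_trans; have [_] := key k.
exists phi; have /ae_eqE guE := n2_eq0 lgu z.
apply: ae_imp2 guE Hg => x /eqP; rewrite subr_eq0 => /eqP ->.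
by [].
Qed.

Lemma cvg_mul0 (a b c : nat -> R) (l : R) : a @ \oo --> (0 : R) -> b @ \oo --> l ->
  (forall n, c n = a n * b n) -> c @ \oo --> (0 : R).
Proof.
move=> ha hb E; rewrite (_ : c = fun n => a n * b n); last exact/funext.
by rewrite -(mul0r l); exact: cvgM.
Qed.

Lemma HB_sq M u : 0 <= M -> HB M u ->
  L2 (fun x => u x ^+ 2) /\ n2 (fun x => u x ^+ 2) <= 3 * M * n2 u.
Proof.
move=> M0 Hu; have lu := HB_L2 Hu; have lup := HB_L2p Hu.
have [phi Hphi] := L2_cvg_ae (fun n => L2_fejer n u) lu (fejer_cvg_L2p lup).
apply: (@fatou_n2 _ (fun n x => fejer (phi n) u x ^+ 2)).
- by rewrite !mulr_ge0 ?n2_ge0.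
- move=> n; have [c hc] := fejer_bounded (phi n) u.
  by under eq_fun do rewrite expr2; apply: (L2M_bd _ (cmeas_fejer _ _) hc); exact: L2_fejer.
- move=> n; have [c hc] := fejer_bounded (phi n) u.
  apply: (le_trans (HB_sq_bounded M0 (HB_fejer (phi n) M0 Hu) hc)).
  by rewrite ler_wpM2l ?mulr_ge0// n2_fejer.
- by apply: cmeasX; case: lu.
- move: Hphi; apply: ae_imp => x hx.
  have b : (fun n => nc (fejer (phi n) u x + u x) : R) @ \oo --> (nc (u x + u x) : R).
    by apply: nc_cvg; under eq_fun do rewrite opprD addrACA subrr addr0.
  by apply: (cvg_mul0 hx b) => n; rewrite -ncM subr_sqr.
Qed.

End bmo_bound.

(** * Nehari's theorem *)

Local Opaque n2 Szego fejer L2.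
Section nehari.
Context {R : realType}.
Local Notation C := R[i].
Local Notation mu := (@torus_measure R).
Local Notation nc := (@Normc.normc R).
Implicit Types (f g h u v b : R -> C) (x y M : R) (n k : nat).

Definition midpoint f g : R -> C := fun x => 2^-1 * (f x + g x).

Lemma nc_half : nc 2^-1 = 2^-1.
Proof. by rewrite -Cnat -CV nc_real ger0_norm// invr_ge0. Qed.

Lemma n2_midpoint f g : L2 f -> L2 g ->
  n2 (fun x => f x - g x) ^+ 2 =
  2 * n2 f ^+ 2 + 2 * n2 g ^+ 2 - 4 * n2 (midpoint f g) ^+ 2.
Proof.
move=> lf lg; have lfg := L2D lf lg.
rewrite /midpoint (n2Z 2^-1 lfg) nc_half -(parallelogram lf lg) exprMn.
by field.
Qed.

Lemma inf_sq (A : set (R -> C)) (e : R) : 0 < e -> A !=set0 ->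
  exists2 f, A f & n2 f ^+ 2 <= inf [set n2 f ^+ 2 | f in A] + e.
Proof.
move=> e0 [f0 Af0]; have hi : has_inf [set n2 f ^+ 2 | f in A].
  by split; [exists (n2 f0 ^+ 2), f0|exists 0 => _ [f _ <-]; exact: sqr_ge0].
by have [_ [f Af <-] /ltW h] := inf_adherent e0 hi; exists f.
Qed.

Lemma inf_sq_le (A : set (R -> C)) f : A f -> inf [set n2 f ^+ 2 | f in A] <= n2 f ^+ 2.
Proof.
move=> Af; apply: ge_inf; last by exists f.
by exists 0 => _ [g _ <-]; exact: sqr_ge0.
Qed.

(** Almost minimal elements of a decreasing sequence of convex sets of a
    Hilbert space form a Cauchy sequence, by the parallelogram identity. *)
Lemma nested_min (A : nat -> set (R -> C)) M : 0 <= M ->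
  (forall k, A k !=set0) -> (forall k m f, (k <= m)%N -> A m f -> A k f) ->
  (forall k f, A k f -> L2 f /\ n2 f <= M) ->
  (forall k f g, A k f -> A k g -> A k (midpoint f g)) ->
  exists F : nat -> R -> C, [/\ forall k, A k (F k), L2_cauchy F &
    forall k f, A k f -> n2 (F k) ^+ 2 <= n2 f ^+ 2 + k.+1%:R^-1].
Proof.
move=> M0 A0 Asub AM Amid.
pose r k := inf [set n2 f ^+ 2 | f in A k].
have k0 k : 0 < (k.+1%:R^-1 : R) by rewrite invr_gt0.
have /choice[F HF] : forall k, exists f, A k f /\ n2 f ^+ 2 <= r k + k.+1%:R^-1.
  by move=> k; have [f Af hf] := inf_sq (k0 k) (A0 k); exists f.
have AF k : A k (F k) by case: (HF k).
have lF k : L2 (F k) by case: (AM _ _ (AF k)).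
have rle k f : A k f -> r k <= n2 f ^+ 2 by exact: inf_sq_le.
have rnd : nondecreasing_seq r.
  move=> k m km; apply/ler_addgt0Pr => e e0.
  have [f Af hf] := inf_sq e0 (A0 m); apply: le_trans hf.
  exact: rle (Asub _ _ _ km Af).
have cr : cvgn r.
  apply: nondecreasing_is_cvgn => //; exists (M ^+ 2) => _ [k _ <-].
  have [_ h] := AM _ _ (AF k); apply: (le_trans (rle _ _ (AF k))).
  by apply: lerXn2r h; rewrite nnegrE ?n2_ge0.
exists F; split => //; last first.
  by move=> k f Af; have [_ h] := HF k; apply: (le_trans h); rewrite lerD2r rle.
move=> e e0; have e4 : 0 < e ^+ 2 / 6 by rewrite divr_gt0// exprn_gt0.
have /cvgrPdist_lt /(_ _ e4) [N1 _ HN1] := cr.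
have [N2 HN2] := small_inv ler01 e4.
have rl k : r k <= limn r by exact: nondecreasing_cvgn_le.
exists (maxn N1 N2).
have key m n : (maxn N1 N2 <= n)%N -> (n <= m)%N -> n2 (fun x => F m x - F n x) <= e.
  rewrite geq_max => /andP[n1 n22] nm.
  rewrite -(@ler_pXn2r _ 2)// ?nnegrE ?n2_ge0 ?(ltW e0)// n2_midpoint//.
  have hm := rle n _ (Amid _ _ _ (Asub _ _ _ nm (AF m)) (AF n)).
  have [_ f1] := HF m; have [_ f2] := HF n.
  have g2 := HN2 n n22; have g3 := HN2 m (leq_trans n22 nm).
  have := HN1 n n1; rewrite /= ger0_norm ?subr_ge0// => g1.
  have rm := rl m; move: hm f1 f2 g1 g2 g3 rm.
  set X := n2 (midpoint _ _) ^+ 2; set Y := n2 (F m) ^+ 2; set Z := n2 (F n) ^+ 2.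
  set p := n.+1%:R^-1; set q := m.+1%:R^-1; set E := e ^+ 2.
  rewrite !mul1r; have : 0 <= E by exact: sqr_ge0.
  lra.
move=> m n Nm Nn; have [mn|/ltnW nm] := leqP m n; last exact: key.
by rewrite n2_sub; exact: key.
Qed.

Definition Bd M : set (R -> C) := [set b | cmeas b /\ forall x, nc (b x) <= M].

Lemma Bd_L2 M b : Bd M b -> L2 b. Proof. by move=> [mb bM]; exact: L2_bd bM. Qed.

Lemma Bd_n2 M b : Bd M b -> n2 b <= M. Proof. by move=> [mb bM]; exact: n2_bd. Qed.

Lemma Bd_mid M b c : Bd M b -> Bd M c -> Bd M (midpoint b c).
Proof.
move=> [mb bM] [mc cM]; split.
  by apply: cmeasM; [exact: cmeas_cst|exact: cmeasD].
move=> x; rewrite ncM nc_half; have := ncD (b x) (c x); have := bM x; have := cM x.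
by lra.
Qed.

Lemma Bd_clip M b : 0 <= M -> cmeas b -> {ae mu, forall x, nc (b x) <= M} ->
  exists2 b', Bd M b' & b' = b %[ae mu].
Proof.
move=> M0 mb bM; have mm := measurable_modulus mb.
exists (fun x => b x * (if modulus b x <= M then 1 else 0 : R)%:C%C).
  split.
    apply: cmeasM => //; apply: cmeas_real; apply: measurable_fun_ifT => //.
    exact: measurable_fun_ler.
  move=> x; rewrite ncM nc_real /modulus; case: ifP => h.
    by rewrite normr1 mulr1.
  by rewrite normr0 mulr0.
apply/ae_eqE; apply: ae_imp bM => x h.
by rewrite /modulus h -[_%:C%C]/(1 : C) mulr1.
Qed.

Lemma Bd_closed M (F : nat -> R -> C) b : 0 <= M -> (forall n, Bd M (F n)) ->
  L2 b -> L2_cvg F b -> exists2 b', Bd M b' & b' = b %[ae mu].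
Proof.
move=> M0 BF lb H.
have [phi Hphi] := L2_cvg_ae (fun n => Bd_L2 (BF n)) lb H.
apply: Bd_clip => //; first by case: lb.
apply: ae_imp Hphi => x /nc_cvg hx.
apply: (cvgr_to_le hx); apply: nearW => n.
by case: (BF (phi n)).
Qed.

Lemma Szego_mid b c : L2 b -> L2 c ->
  Szego (midpoint b c) = midpoint (Szego b) (Szego c) %[ae mu].
Proof.
move=> lb lc; have lbc := L2D lb lc; apply: Szego_uniq; first exact: L2Z.
  by apply: L2pZ; apply: L2pD; exact: L2p_Szego.
move=> j; rewrite /midpoint !fourierZ ?fourierD ?fourier_Szego//;
  by [apply: L2_L1|apply: L2_L1; exact: L2_Szego|
      apply: L1D; apply: L2_L1; exact: L2_Szego|apply: L1D; exact: L2_L1].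
Qed.

Lemma Szego_image_closed M u : 0 <= M -> L2 u ->
  (forall e : R, 0 < e -> exists2 b, Bd M b & n2 (fun x => Szego b x - u x) <= e) ->
  exists2 b, Bd M b & Szego b = u %[ae mu].
Proof.
move=> M0 lu H.
pose A k := [set b | Bd M b /\ n2 (fun x => Szego b x - u x) <= k.+1%:R^-1].
have [F [AF cF _]] : exists F : nat -> R -> C, [/\ forall k, A k (F k), L2_cauchy F &
    forall k f, A k f -> n2 (F k) ^+ 2 <= n2 f ^+ 2 + k.+1%:R^-1].
  apply: (@nested_min A M M0).
  - move=> k; have k0 : 0 < (k.+1%:R^-1 : R) by rewrite invr_gt0.
    by have [b Bb hb] := H _ k0; exists b.
  - move=> k m f km [Bf hf]; split => //; apply: (le_trans hf).
    by rewrite lef_pV2 ?posrE// ler_nat.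
  - by move=> k f [Bf _]; split; [exact: Bd_L2 Bf|exact: Bd_n2].
  - move=> k f g [Bf hf] [Bg hg]; split; first exact: Bd_mid.
    have lf := Bd_L2 Bf; have lg := Bd_L2 Bg.
    have lsf := L2_Szego lf; have lsg := L2_Szego lg.
    have lm : L2 (Szego (midpoint f g)) by apply: L2_Szego; apply: L2Z; exact: L2D.
    have lm' : L2 (midpoint (Szego f) (Szego g)) by apply: L2Z; exact: L2D.
    rewrite (n2_eq_small lm lm' (Szego_mid lf lg) lu).
    have -> : (fun x => midpoint (Szego f) (Szego g) x - u x) =
        (fun x => 2^-1 * ((Szego f x - u x) + (Szego g x - u x))).
      by apply/funext => x; rewrite /midpoint; field.
    have l1 := L2B lsf lu; have l2 := L2B lsg lu.
    rewrite n2Z; last exact: L2D.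
    rewrite nc_half; have := n2D l1 l2; move: hf hg.
    set p := k.+1%:R^-1; move: p => p; abs_lra.
have lF k : L2 (F k) by case: (AF k) => /Bd_L2.
have [b0 lb0 Hb0] := riesz_fischer lF cF.
have [b Bb bE] := @Bd_closed M F b0 M0 (fun k => (AF k).1) lb0 Hb0.
have lb := Bd_L2 Bb; have lsb := L2_Szego lb.
exists b => //; apply: n2B_eq0 => //; apply/eqP; rewrite eq_le n2_ge0 andbT.
apply/ler_addgt0Pr => e e0; rewrite add0r; have e2 : 0 < e / 2 by rewrite divr_gt0.
have [N1 HN1] := Hb0 _ e2; have [N2 HN2] := small_inv ler01 e2.
pose n := maxn N1 N2; have lFn := lF n; have lsF := L2_Szego lFn.
have h1 := n2_trans lsb lsF lu.
have h2 := n2_SzegoB lb lFn.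
have h3 : n2 (fun x => b x - F n x) <= e / 2.
  rewrite (n2_eq_small lb lb0 bE lFn) n2_sub.
  by apply: HN1; rewrite leq_maxl.
have [_ h4] := AF n; have h5 := HN2 n (leq_maxr _ _).
have : (0 : R) <= n.+1%:R^-1 by rewrite invr_ge0.
move: h1 h2 h3 h4 h5; set p := n.+1%:R^-1; move: p => p; abs_lra.
Qed.

Lemma Bd_sign M f : 0 <= M -> L2 f -> exists2 c, Bd M c &
  complex.Re (inner f c) = M * N1 f.
Proof.
move=> M0 lf; have [mf _] := lf; have mm := measurable_modulus mf.
pose s x : R := M * (modulus f x `^ (-1)).
have ms : measurable_fun setT s.
  apply: measurable_funM => //.
  by apply: (@measurableT_comp _ _ _ _ _ _ (fun y : R => y `^ (-1))) => //; exact: measurable_powR.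
have sE x : s x = M * (modulus f x)^-1 by rewrite /s powR_inv1// nc_ge0.
exists (fun x => f x * (s x)%:C%C).
  split; first by apply: cmeasM => //; exact: cmeas_real.
  move=> x; rewrite ncM nc_real sE ger0_norm; last by rewrite mulr_ge0 ?invr_ge0 ?nc_ge0.
  rewrite /modulus; have [->|f0] := eqVneq (nc (f x)) 0; first by rewrite mul0r.
  by rewrite mulrCA mulfV// mulr1.
have -> : inner f (fun x => f x * (s x)%:C%C) = (M * N1 f)%:C%C.
  rewrite /N1 -RintM; last by case: (L2_L1 lf).
  rewrite -cint_real /inner; congr cintegral; apply/funext => x.
  rewrite conjcM conjc_real mulrA mul_conj -CM sE /modulus; congr (_%:C%C).
  have [->|f0] := eqVneq (nc (f x)) 0; first by rewrite expr0n mul0r mulr0.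
  by field.
by [].
Qed.

(** Nehari's theorem: separating u from the closed convex set of projections
    of functions bounded by M would contradict the dual bound. *)
Lemma nehari M u : 0 <= M -> HB M u -> exists2 b, Bd M b & Szego b = u %[ae mu].
Proof.
move=> M0 [lu H]; have [lu2 _] := lu.
pose A (k : nat) := [set f | exists2 b, Bd M b & L2 f /\ f = (fun x => u x - Szego b x) %[ae mu]].
have An k f : A k f -> L2 f /\ n2 f <= n2 u + M.
  move=> [b Bb [lf fE]]; have lb := Bd_L2 Bb; have ls := L2_Szego lb.
  split => //; rewrite (n2_ae _ _ fE); [|by case: lf|by case: (L2B lu2 ls)].
  by rewrite (le_trans (n2B lu2 ls))// lerD2l (le_trans (n2_Szego lb))// Bd_n2.
have [F [AF cF minF]] : exists F : nat -> R -> C, [/\ forall k, A k (F k), L2_cauchy F &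
    forall k f, A k f -> n2 (F k) ^+ 2 <= n2 f ^+ 2 + k.+1%:R^-1].
  apply: (@nested_min A (n2 u + M) (addr_ge0 (n2_ge0 u) M0)); [| |exact: An|].
  - move=> k; exists (fun x => u x - Szego (fun=> 0) x); exists (fun=> 0).
      by split; [exact: cmeas_cst|move=> x; rewrite nc0].
    by split; [apply: L2B => //; apply: L2_Szego; exact: L2_cst|apply/ae_eqE; exact: ae_all].
  - by [].
  - move=> k f g [b Bb [lf fE]] [c Bc [lg gE]]; exists (midpoint b c); first exact: Bd_mid.
    split; first by apply: L2Z; exact: L2D.
    have := Szego_mid (Bd_L2 Bb) (Bd_L2 Bc); move/ae_eqE: fE; move/ae_eqE: gE.
    move=> gE fE /ae_eqE sE; apply/ae_eqE; apply: ae_imp2 sE (ae_imp2 _ fE gE).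
      by move=> x -> h; exact: h.
    by move=> x h1 h2; rewrite /midpoint h1 h2; field.
have lF k : L2 (F k) by case: (An _ _ (AF k)).
have [f lf Hf] := riesz_fischer lF cF.
have lw := L2B lu2 lf.
have [b Bb bE] : exists2 b, Bd M b & Szego b = (fun x => u x - f x) %[ae mu].
  apply: Szego_image_closed => // e e0; have [N /(_ N (leqnn N)) HN] := Hf e e0.
  have [b Bb [_ FE]] := AF N; have lb := Bd_L2 Bb; exists b => //.
  have ls := L2_Szego lb.
  rewrite n2_sub; rewrite (@n2_ae _ _ (fun x => F N x - f x))//.
  - by case: (L2B lw ls).
  - by case: (L2B (lF N) lf).
  - by apply/ae_eqE; move/ae_eqE: FE; apply: ae_imp => x ->; ring.
have lb := Bd_L2 Bb; have lsb := L2p_Szego lb; have [lsb2 _] := lsb.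
have fE : f = (fun x => u x - Szego b x) %[ae mu].
  by apply/ae_eqE; move/ae_eqE: bE; apply: ae_imp => x ->; rewrite opprB addrCA subrr addr0.
have lfp : L2p f by apply: L2p_ae fE; [case: lf|exact: L2pB].
have min c : Bd M c -> n2 f ^+ 2 <= n2 (fun x => u x - Szego c x) ^+ 2.
  move=> Bc; have lc := Bd_L2 Bc; have lsc := L2_Szego lc; have luc := L2B lu2 lsc.
  set X := n2 (fun x => u x - Szego c x).
  have X0 : 0 <= X by exact: n2_ge0.
  apply: lerXn2r; rewrite ?nnegrE ?n2_ge0//.
  apply/ler_addgt0Pr => e e0; have e2 : 0 < e / 2 by rewrite divr_gt0.
  have e3 : 0 < (e / 2) ^+ 2 by rewrite exprn_gt0.
  have [N1 HN1] := Hf _ e2; have [N2 HN2] := small_inv ler01 e3.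
  pose n := maxn N1 N2; have h1 := HN1 n (leq_maxl _ _); have h2 := HN2 n (leq_maxr _ _).
  have h3 : n2 (F n) ^+ 2 <= X ^+ 2 + n.+1%:R^-1.
    apply: minF; exists c; [exact: Bc|split; [exact: luc|]].
    by apply/ae_eqE; exact: ae_all.
  have : n2 (F n) <= X + e / 2.
    rewrite -(@ler_pXn2r _ 2)// ?nnegrE ?n2_ge0 ?addr_ge0 ?(ltW e2)//.
    apply: (le_trans h3); rewrite sqrrD -addrA lerD2l.
    have : 0 <= X * (e / 2) by rewrite mulr_ge0 ?(ltW e2).
    have : (0 : R) <= n.+1%:R^-1 by rewrite invr_ge0.
    move: h2; set p := n.+1%:R^-1; set Z := X * _; set Y := (e / 2) ^+ 2.
    rewrite mul1r mulr2n; lra.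
  have := n2_dist lf (lF n); rewrite n2_sub ler_distl => /andP[_ h5] h6.
  by move: h1 h5 h6; clear; abs_lra.
have [c Bc cE] := Bd_sign M0 lf.
have lc := Bd_L2 Bc; have lsc := L2p_Szego lc; have [lsc2 _] := lsc.
have lD := L2B lsc2 lsb2; set D := (fun x => Szego c x - Szego b x) in lD.
have var (t : R) : 0 < t -> t <= 1 -> 2 * complex.Re (inner f D) <= t * n2 D ^+ 2.
  move=> t0 t1; pose d x := (1 - t)%:C%C * b x + t%:C%C * c x.
  have Bd_d : Bd M d.
    have [mb bM] := Bb; have [mc cM] := Bc; split.
      by apply: cmeasD; apply: cmeasM => //; exact: cmeas_cst.
    move=> x; rewrite (le_trans (ncD _ _))// !ncM !nc_real !ger0_norm ?subr_ge0 ?(ltW t0)//.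
    have h1 : (1 - t) * nc (b x) <= (1 - t) * M by rewrite ler_wpM2l ?subr_ge0.
    have h2 : t * nc (c x) <= t * M by rewrite ler_wpM2l ?(ltW t0).
    by move: h1 h2; set X := (1 - t) * nc _; set Y := t * nc _; lra.
  have ld := Bd_L2 Bd_d; have lsd := L2_Szego ld.
  have ltD := L2Z t%:C%C lD.
  have sd : Szego d = (fun x => Szego b x + t%:C%C * D x) %[ae mu].
    apply: Szego_uniq => //; first by apply: L2pD => //; apply: L2pZ; exact: L2pB.
    move=> j; rewrite fourierD; [|exact: L2_L1|exact: L2_L1].
    rewrite fourierZ; last exact: L2_L1.
    rewrite /D fourierB; [|exact: L2_L1|exact: L2_L1].
    rewrite !fourier_Szego// /d fourierD; try by apply: L1Z; exact: L2_L1.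
    rewrite !fourierZ; try exact: L2_L1.
    by rewrite CB; ring.
  have := min d Bd_d.
  have -> : n2 (fun x => u x - Szego d x) = n2 (fun x => f x - t%:C%C * D x).
    apply: n2_ae; [by case: (L2B lu2 lsd)|by case: (L2B lf ltD)|].
    apply/ae_eqE; move/ae_eqE: sd; move/ae_eqE: fE; apply: ae_imp2 => x -> ->.
    by rewrite opprD addrA.
  rewrite (n2sqB lf ltD) (n2Z _ lD) nc_real (ger0_norm (ltW t0)) (innerZr _ lD lf).
  rewrite conjc_real Re_CM exprMn [t ^+ 2]expr2 => h.
  rewrite -(ler_pM2l t0); move: h.
  by set X := complex.Re _; set Y := n2 D ^+ 2; lra.
have inn : complex.Re (inner f D) <= 0.
  rewrite leNgt; apply/negP => X0; have := sqr_ge0 (n2 D); set Y := n2 D ^+ 2 => Y0.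
  set X := complex.Re (inner f D) in X0.
  have t0 : 0 < X / (X + Y) by rewrite divr_gt0// ltr_wpDr.
  have XY : 0 < X + Y by rewrite ltr_wpDr.
  have t1 : X / (X + Y) <= 1 by rewrite ler_pdivrMr// mul1r lerDl.
  have := var _ t0 t1; rewrite -/X -/Y [leRHS]mulrAC ler_pdivlMr//.
  have h1 : X * Y <= X * (X + Y) by rewrite ler_pM2l// lerDr ltW.
  have h2 : 0 < X * (X + Y) by rewrite mulr_gt0.
  move: h1 h2; set P := X * Y; rewrite -mulrA; set Q := X * (X + Y); lra.
have f0 : n2 f = 0.
  move: inn; rewrite /D innerBr// Re_D Re_N.
  have -> : inner f (Szego c) = inner f c.
    by rewrite (innerC lsc2 lf) inner_Szego// -innerC.
  have -> : inner f (Szego b) = inner f u - inner f f.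
    rewrite -innerBr//; rewrite (innerC lsb2 lf) (innerC lw lf).
    by rewrite (@inner_ae _ _ _ f _ _ _ bE)//; [case: lsb2|case: lw|case: lf].
  rewrite cE Re_D Re_N inner_self (_ : complex.Re (n2 f ^+ 2)%:C%C = n2 f ^+ 2)//.
  have := H f lfp; have := le_trans (ler_norm _) (nc_Re (inner f u)).
  move=> h1 h2 h3; apply/eqP; rewrite -sqrf_eq0 eq_le sqr_ge0 andbT.
  move: h1 h2 h3; set a := complex.Re (inner f u); set Z := M * _; set Y := n2 f ^+ 2.
  by set W := nc _; clear; lra.
exists b => //; apply/ae_eqE; move/ae_eqE: (n2_eq0 lf f0); move/ae_eqE: bE.
by apply: ae_imp2 => x -> ->; rewrite subr0.
Qed.

End nehari.

Local Transparent n2 Szego fejer L2.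

(** * Symbols known up to a constant *)

Section one_step_extension.
Context {R : realType}.
Local Notation C := R[i].
Local Notation mu := (@torus_measure R).
Local Notation nc := (@Normc.normc R).
Implicit Types (f g h u v b k : R -> C) (x y M : R) (n : nat).

Lemma sqrt_CS (a b c d : R) : 0 <= a -> 0 <= b -> 0 <= c -> 0 <= d ->
  a * c + b * d <= Num.sqrt (a ^+ 2 + b ^+ 2) * Num.sqrt (c ^+ 2 + d ^+ 2).
Proof.
move=> a0 b0 c0 d0; rewrite -sqrtrM ?addr_ge0 ?sqr_ge0//.
rewrite -[leLHS](@ger0_norm _ _) ?addr_ge0 ?mulr_ge0// -sqrtr_sqr ler_wsqrtr//.
rewrite -subr_ge0 [leRHS](_ : _ = (a * d - b * c) ^+ 2) ?sqr_ge0//.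
by ring.
Qed.

(** Pi b and u only differ by a constant. *)
Definition tail_symbol b u := forall j : nat, fourier u j.+1%:Z = fourier b j.+1%:Z.

Lemma inner_tail b u f : L2 b -> L2p u -> tail_symbol b u -> L2p f ->
  fourier f 0 = 0 -> inner f u = inner f b.
Proof.
move=> lb lu bu lf f0; have [lu2 _] := lu; have [lf2 _] := lf.
pose c := fourier u 0 - fourier b 0.
have E : Szego b = (fun x => u x - c) %[ae mu].
  apply: Szego_uniq => //; first by apply: L2pB => //; exact: L2p_cst.
  have lc : L1 (fun=> c) by apply: L2_L1; exact: L2_cst.
  have lu1 := L2_L1 lu2; have cE (j : int) : fourier (fun=> c : C) j = c * (j == 0)%:R.
    rewrite /fourier /inner cintZ; last by apply: L1_conj; exact: L1_cexp.
    by rewrite cint_conj ?cint_cexp ?conjc_nat//; exact: L1_cexp.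
  case=> [|j]; rewrite fourierB// cE ?mulr1 ?mulr0 ?subr0; first by rewrite /c opprB addrCA subrr addr0.
  exact: bu.
have lc := L2_cst c; have luc := L2B lu2 lc; have lsb := L2p_Szego lb; have [lsb2 _] := lsb.
have -> : inner f b = inner f (Szego b).
  by rewrite (innerC lb lf2) -(inner_Szego lb lf) -innerC.
have -> : inner f (Szego b) = inner f (fun x => u x - c).
  rewrite (innerC lsb2 lf2) (innerC luc lf2); congr conjc.
  by apply: inner_ae E; [case: lsb2|case: luc|case: lf2].
rewrite innerBr//; have -> : inner f (fun=> c) = 0; last by rewrite subr0.
have -> : inner f (fun=> c) = conjc c * fourier f 0.
  rewrite fourier0 -cintZ; last exact: L2_L1.
  by rewrite /inner; congr cintegral; apply/funext => x; rewrite mulrC.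
by rewrite f0 mulr0.
Qed.

Lemma pythagoras_mean f : L2 f ->
  nc (fourier f 0) ^+ 2 + n2 (fun x => f x - fourier f 0) ^+ 2 = n2 f ^+ 2.
Proof.
move=> lf; have lc := L2_cst (fourier f 0).
rewrite n2sqB// n2_cst.
have -> : inner f (fun=> fourier f 0) = (nc (fourier f 0) ^+ 2)%:C%C.
  transitivity (conjc (fourier f 0) * cintegral f).
    rewrite -(cintZ _ (L2_L1 lf)) /inner; congr cintegral.
    by apply/funext => x; rewrite mulrC.
  by rewrite -fourier0 mulrC; exact: mul_conj.
rewrite (_ : complex.Re (nc (fourier f 0) ^+ 2)%:C%C = nc (fourier f 0) ^+ 2)//.
by ring.
Qed.

(** The compression of the Hankel form to functions of mean zero in one
    argument is bounded by N; the rank one defect costs n2 u. *)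
Lemma product_form N b u g k c : Bd N b -> L2p u -> tail_symbol b u ->
  L2p g -> L2p k -> (forall x, nc (g x) <= c) ->
  nc (inner (fun x => g x * k x) u) <=
  Num.sqrt (N ^+ 2 + n2 u ^+ 2) * (n2 g * n2 k).
Proof.
move=> Bb lu bu lg lk gc.
have lb := Bd_L2 Bb; have [lu2 _] := lu; have [lg2 _] := lg; have [lk2 _] := lk.
have N0 : 0 <= N by have := Bd_n2 Bb; apply: le_trans; exact: n2_ge0.
set k0 := fourier k 0; pose k1 x := k x - k0.
have lk1 : L2p k1 by apply: L2pB => //; exact: L2p_cst.
have [lk12 _] := lk1.
have mg : cmeas g by case: lg2.
have lgk1 : L2p (fun x => k1 x * g x) by apply: L2pM => //; exact: (L2M_bd lk12 mg gc).
have [lgk12 _] := lgk1.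
have z : fourier (fun x => k1 x * g x) 0 = 0.
  have k10 : fourier k1 0 = 0.
    rewrite /k1 fourierB; [|exact: L2_L1|by apply: L2_L1; exact: L2_cst].
    by rewrite [X in _ - X]fourier0 cint_cst subrr.
  by rewrite fourier_mul0// k10 mul0r.
have lZ := L2Z k0 lg2.
have -> : inner (fun x => g x * k x) u = k0 * inner g u + inner (fun x => k1 x * g x) u.
  rewrite -innerZl// -innerDl//; congr inner; apply/funext => x.
  by rewrite /k1; ring.
rewrite (inner_tail lb lu bu lgk1 z).
have h1 : nc (k0 * inner g u) <= nc k0 * (n2 g * n2 u).
  by rewrite ncM ler_wpM2l ?nc_ge0// inner_le.
have h2 : nc (inner (fun x => k1 x * g x) b) <= N * (n2 k1 * n2 g).
  have [mb bN] := Bb; have lJ := L2_conj lb; have mJ : cmeas (fun x => conjc (b x)) by case: lJ.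
  rewrite (le_trans (cint_le (L2M lgk12 lJ)))//.
  have := N1M_bd (L2_L1 lgk12) mJ (fun x => eq_ind_r (fun y => y <= N) (bN x) (nc_conj (b x))).
  move=> h; apply: (le_trans h); rewrite ler_wpM2l//.
  exact: N1M.
rewrite (le_trans (ncD _ _))// (le_trans (lerD h1 h2))//.
have := sqrt_CS N0 (n2_ge0 u) (n2_ge0 k1) (nc_ge0 k0).
rewrite [n2 k1 ^+ 2 + _]addrC (pythagoras_mean lk2) sqrtr_sqr ger0_norm ?n2_ge0// => h3.
rewrite [leLHS](_ : _ = n2 g * (N * n2 k1 + n2 u * nc k0)); last by ring.
rewrite [leRHS]mulrCA ler_wpM2l ?n2_ge0//.
Qed.

End one_step_extension.

(** * Factorization of analytic polynomials *)

Section outer_factorization.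
Context {R : realType}.
Local Notation C := R[i].
Local Notation mu := (@torus_measure R).
Local Notation nc := (@Normc.normc R).
Implicit Types (f g h u v b k : R -> C) (p : R -> R) (x y M : R) (n m : nat).

Definition analytic_weight n (j l : 'I_n.+1) : C :=
  if (l < j)%N then 2 else if (l == j)%N then 1 else 0.

Lemma analytic_weightD n (j l : 'I_n.+1) :
  analytic_weight j l + analytic_weight l j = 2.
Proof.
rewrite /analytic_weight [l == j]eq_sym; case: (ltngtP j l) => jl; rewrite ?add0r ?addr0//.
- by case: eqP => [E|]; rewrite ?addr0// ?add0r//; move: jl; rewrite E ltnn.
- by case: eqP => [E|]; rewrite ?addr0//; move: jl; rewrite E ltnn.
- by move/val_inj: jl => ->; rewrite eqxx.
Qed.

(** The analytic part of a Fejer mean: its real part is the Fejer mean when the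
    function is real. *)
Definition analytic_mean n f : R -> C := fun x =>
  n.+1%:R^-1 * \sum_(j < n.+1) \sum_(l < n.+1)
     analytic_weight j l * fourier f (j%:Z - l%:Z) * cexp (j%:Z - l%:Z) x.

Lemma L2p_analytic_mean n f : L2p (analytic_mean n f).
Proof.
apply: L2pZ; apply: L2p_sum => j; apply: L2p_sum => l.
rewrite /analytic_weight; case: (leqP l j) => jl.
  by rewrite subzn//; apply: L2pZ; exact: L2p_cexp.
rewrite ifF; last by apply/negbTE; rewrite -leqNgt ltnW.
rewrite ifF; last by apply/eqP => E; move: jl; rewrite E ltnn.
have := L2p_cst (0 : C); congr L2p; apply/funext => x.
by rewrite !mul0r.
Qed.

Lemma analytic_mean_bounded n f : exists2 K : R, 0 <= K & forall x, nc (analytic_mean n f x) <= K.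
Proof.
exists (nc n.+1%:R^-1 * \sum_(j < n.+1) \sum_(l < n.+1)
    nc (analytic_weight j l * fourier f (j%:Z - l%:Z))).
  by rewrite mulr_ge0 ?nc_ge0//; do 2 (apply: sumr_ge0 => ? _); exact: nc_ge0.
move=> x; rewrite ncM ler_wpM2l ?nc_ge0// (le_trans (nc_sum _ _ _))//.
apply: ler_sum => j _; rewrite (le_trans (nc_sum _ _ _))//.
by apply: ler_sum => l _; rewrite ncM nc_cexp mulr1.
Qed.

Lemma analytic_mean_re n p x : rint p ->
  complex.Re (analytic_mean n (fun y => (p y)%:C%C) x) =
  complex.Re (fejer n (fun y => (p y)%:C%C) x).
Proof.
move=> ip; set f := (fun y => _).
have lf : L1 f by exact: L1_real.
have fJ (k : int) : fourier f (- k) = conjc (fourier f k).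
  rewrite -{1}[f](_ : (fun y => conjc (f y)) = f); last by apply/funext => y; rewrite /f conjc_real.
  by rewrite fourier_conj// opprK.
have E : analytic_mean n f x + conjc (analytic_mean n f x) = 2 * fejer n f x.
  have cJ : conjc (n.+1%:R^-1 : C) = n.+1%:R^-1 by rewrite -Cnat -CV conjc_real.
  rewrite /analytic_mean conjcM cJ -mulrDr.
  rewrite /fejer [RHS]mulrCA; congr (_ * _).
  rewrite conjc_sum; under [X in _ + X = _]eq_bigr do rewrite conjc_sum.
  rewrite [X in _ + X = _]exchange_big /= -big_split mulr_sumr /=.
  apply: eq_bigr => j _; rewrite -big_split mulr_sumr /=; apply: eq_bigr => l _.
  have -> : conjc (analytic_weight l j * fourier f (l%:Z - j%:Z) * cexp (l%:Z - j%:Z) x) =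
     analytic_weight l j * (fourier f (j%:Z - l%:Z) * cexp (j%:Z - l%:Z) x).
    rewrite !conjcM -cexpN -fJ opprB mulrA; congr (_ * _ * _).
    rewrite /analytic_weight; case: ifP => _; first exact: conjc_nat.
    by case: ifP => _; rewrite ?conjc0 ?conjc1.
  by rewrite -(analytic_weightD j l); ring.
have := congr1 (@complex.Re R) E.
rewrite Re_D Re_conjc -[2 : C](Cnat 2) Re_CM.
by set a := complex.Re _; set b := complex.Re _; clear; lra.
Qed.

Lemma analytic_approx p (L : R) : 0 <= L -> measurable_fun setT p ->
  chord_lip (fun x => (p x)%:C%C) L -> forall d : R, 0 < d ->
  exists A K, [/\ L2p A, 0 <= K, forall x, nc (A x) <= K &
    forall x, `|complex.Re (A x) - p x| <= d].
Proof.
move=> L0 mp pL d d0.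
have mf := cmeas_real mp.
have ip : rint p.
  apply: (@rint_bd _ _ (nc (p 0)%:C%C + L * 2)) => // x.
  by rewrite -nc_real; apply: (chord_lip_bd L0 pL).
have [n hn] := small_inv (sqr_ge0 L) (exprn_gt0 2 d0).
have [K K0 HK] := analytic_mean_bounded n (fun x => (p x)%:C%C).
exists (analytic_mean n (fun x => (p x)%:C%C)), K; split => //.
  exact: L2p_analytic_mean.
move=> x; rewrite analytic_mean_re// -[p x]/(complex.Re (p x)%:C%C) -Re_N -Re_D.
rewrite (le_trans (nc_Re _))// nc_sub -(@ler_pXn2r _ 2)// ?nnegrE ?nc_ge0 ?(ltW d0)//.
exact: le_trans (fejer_uniform n x L0 mf pL) (hn n (leqnn n)).
Qed.

Lemma L2pX A (K : R) n : 0 <= K -> L2p A -> (forall x, nc (A x) <= K) ->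
  L2p (fun x => A x ^+ n) /\ forall x, nc (A x ^+ n) <= K ^+ n.
Proof.
move=> K0 lA AK; have [lA2 _] := lA; have mA : cmeas A by case: lA2.
elim: n => [|n [IH IHb]].
  split; last by move=> x; rewrite !expr0 nc1.
  by under eq_fun do rewrite expr0; exact: L2p_cst.
have bd x : nc (A x ^+ n.+1) <= K ^+ n.+1.
  by rewrite ncX; apply: lerXn2r (AK x); rewrite nnegrE ?nc_ge0.
split => //; have [IH2 _] := IH.
under eq_fun do rewrite exprSr.
by apply: L2pM => //; exact: (L2M_bd IH2 mA AK).
Qed.

Lemma nc_sq1D (z : C) (s : R) : 
  nc (1 + s%:C%C * z) ^+ 2 = 1 + (2 * s * complex.Re z + s ^+ 2 * nc z ^+ 2).
Proof. by rewrite !ncE Re_D Im_D Re_CM Im_CM /=; ring. Qed.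

Lemma pow_exp (z : C) (s t q : R) n : `|s| = n.+1%:R^-1 ->
  2 * s * n.+1%:R * complex.Re z <= t -> nc z ^+ 2 / n.+1%:R <= q ->
  nc ((1 + s%:C%C * z) ^+ n.+1) ^+ 2 <= expR (t + q).
Proof.
move=> sn ht hq; rewrite ncX exprAC nc_sq1D; set y := 2 * s * _ + _.
have n0 : 0 < n.+1%:R :> R by rewrite ltr0n.
have y1 : 0 <= 1 + y by rewrite /y -nc_sq1D sqr_ge0.
apply: (@le_trans _ _ (expR y ^+ n.+1)).
  by apply: lerXn2r (expR_ge1Dx y); rewrite nnegrE ?expR_ge0.
rewrite -expRM_natl ler_expR -mulr_natl /y mulrDr lerD//.
  by apply: le_trans ht; rewrite le_eqVlt; apply/orP; left; apply/eqP; ring.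
apply: le_trans hq; rewrite -(@real_normK _ s) ?num_real// sn.
by rewrite le_eqVlt; apply/orP; left; apply/eqP; field; rewrite addrC natr1 gt_eqF.
Qed.

Lemma nc_1subX (z : C) n : nc (1 - (1 - z) ^+ n) <= (1 + nc z) ^+ n - 1.
Proof.
elim: n => [|n IH]; first by rewrite !expr0 !subrr nc0.
have -> : 1 - (1 - z) ^+ n.+1 = (1 - (1 - z) ^+ n) + z * (1 - z) ^+ n.
  by rewrite exprS; ring.
apply: (le_trans (ncD _ _)); rewrite ncM ncX.
have h : nc (1 - z) ^+ n <= (1 + nc z) ^+ n.
  apply: lerXn2r; rewrite ?nnegrE ?nc_ge0 ?addr_ge0 ?nc_ge0//.
  by rewrite (le_trans (ncB _ _))// nc1.
have h2 : nc z * nc (1 - z) ^+ n <= nc z * (1 + nc z) ^+ n by rewrite ler_wpM2l ?nc_ge0.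
move: IH h2; rewrite [(1 + nc z) ^+ n.+1]exprS mulrDl mul1r.
set a := nc (1 - _); set b := _ ^+ n; set c := nc z * b; set d := nc z * _.
clear; lra.
Qed.

(** An approximate factorization of f into two factors of modulus |f|^(1/2):
    exp A with Re A close to (1/2) ln |f| is replaced by (1 + A/m)^m, and its
    inverse by (1 - A/m)^m, which keeps everything polynomial. *)
Lemma factorization f (c L e eta : R) : L2p f -> (forall x, nc (f x) <= c) ->
  0 <= L -> chord_lip f L -> 0 < e -> 0 < eta ->
  exists g k d, [/\ L2p g, L2p k, forall x, nc (g x) <= d &
   [/\ n2 g ^+ 2 <= (N1 f + e) * expR eta, n2 k ^+ 2 <= N1 f * expR eta &
      forall x, nc (f x - g x * k x) <= c * (expR eta - 1)]].
Proof.
move=> lf fc L0 fL e0 eta0; have [lf2 _] := lf; have mf : cmeas f by case: lf2.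
have mm := measurable_modulus mf.
pose W x := modulus f x + e.
have We x : e <= W x by rewrite /W lerDr; exact: nc_ge0.
have W0 x : 0 < W x by exact: lt_le_trans e0 (We x).
pose p x := 2^-1 * ln (W x).
have mp : measurable_fun setT p.
  apply: measurable_funM => //; apply: (@measurableT_comp _ _ _ _ _ _ (@ln R)).
    exact: measurable_ln.
  exact: measurable_funD.
have ln_lip a a' : e <= a -> e <= a' -> ln a - ln a' <= `|a - a'| / e.
  move=> ha ha'; have a0 := lt_le_trans e0 ha; have a0' := lt_le_trans e0 ha'.
  rewrite lerBlDr -ler_expR expRD !lnK ?posrE//.
  have h := expR_ge1Dx (`|a - a'| / e).
  apply: (@le_trans _ _ ((1 + `|a - a'| / e) * a')); last by rewrite ler_wpM2r// ltW.
  have h2 : `|a - a'| <= `|a - a'| / e * a'.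
    by rewrite mulrAC ler_pdivlMr// ler_wpM2l.
  have h3 := ler_norm (a - a'); move: h2 h3; rewrite mulrDl mul1r.
  by set s := `|a - a'|; set t := s / e * a'; clear; lra.
have pL : chord_lip (fun x => (p x)%:C%C) (2^-1 * (L / e)).
  move=> x y; rewrite -CB nc_real /p -mulrBr normrM ger0_norm ?invr_ge0// -mulrA ler_wpM2l ?invr_ge0//.
  have key : `|W x - W y| <= L * nc (cexp 1 x - cexp 1 y).
    rewrite /W opprD addrACA subrr addr0; apply: le_trans (fL x y).
    rewrite ler_norml /modulus; have h1 := ncD (f x - f y) (f y); rewrite subrK in h1.
    have h2 := ncD (f y - f x) (f x); rewrite subrK nc_sub in h2.
    by apply/andP; split; move: h1 h2; set a := nc (f x); set b := nc (f y); clear; lra.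
  have key2 : `|W x - W y| / e <= L / e * nc (cexp 1 x - cexp 1 y).
    by rewrite mulrAC ler_pM2r// invr_gt0.
  rewrite ler_norml; apply/andP; split.
    rewrite lerNl opprB; apply: le_trans key2; rewrite distrC.
    exact: ln_lip.
  by apply: le_trans key2; exact: ln_lip.
have LL : 0 <= 2^-1 * (L / e) by rewrite mulr_ge0 ?invr_ge0// divr_ge0// ltW.
have d0 : 0 < eta / 4 by rewrite divr_gt0.
have [A [K [lA K0 AK Ap]]] := analytic_approx LL mp pL d0.
have [m hm] : exists m, K ^+ 2 / m.+1%:R <= eta / 2.
  have := small_inv (sqr_ge0 K) eta0 => -[m /(_ m (leqnn m)) h]; exists m.
  by rewrite ler_pdivlMr// -mulrA [_^-1 * 2]mulrC.
pose s : R := m.+1%:R^-1.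
have m0 : 0 < m.+1%:R :> R by rewrite ltr0n.
have s0 : 0 < s by rewrite invr_gt0.
have ns : `|s| = m.+1%:R^-1 by rewrite ger0_norm// ltW.
have nsN : `|- s| = m.+1%:R^-1 by rewrite normrN.
pose g x := (1 + s%:C%C * A x) ^+ m.+1.
pose k x := f x * (1 + (- s)%:C%C * A x) ^+ m.+1.
have Kd (t : R) : `|t| = s -> L2p (fun x => (1 + t%:C%C * A x) ^+ m.+1) /\
    forall x, nc ((1 + t%:C%C * A x) ^+ m.+1) <= (1 + s * K) ^+ m.+1.
  move=> ts; apply: L2pX; first by rewrite addr_ge0 ?mulr_ge0// ltW.
    by apply: L2pD; [exact: L2p_cst|exact: L2pZ].
  move=> x; rewrite (le_trans (ncD _ _))// nc1 lerD2l ncM nc_real ts.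
  by rewrite ler_wpM2l// ltW.
have [lg gd] := Kd s ns; have [lh hd] := Kd (- s) nsN.
have [lh2 _] := lh; have [lg2 _] := lg.
have lk : L2p k.
  by apply: L2pM => //; apply: (L2M_bd lf2 _ hd); case: lh2.
have [lk2 _] := lk.
have zq x : nc (A x) ^+ 2 / m.+1%:R <= eta / 2.
  apply: le_trans hm; rewrite ler_pM2r ?invr_gt0//.
  by apply: lerXn2r (AK x); rewrite nnegrE ?nc_ge0.
have sm : s * m.+1%:R = 1 by rewrite /s mulVf// gt_eqF.
have expW x : expR (ln (W x)) = W x by rewrite lnK// posrE.
have gsq x : nc (g x) ^+ 2 <= W x * expR eta.
  have h : 2 * s * m.+1%:R * complex.Re (A x) <= ln (W x) + eta / 2.
    rewrite -[2 * s * _]mulrA sm mulr1; have := Ap x; rewrite ler_norml => /andP[_].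
    by rewrite /p; set a := complex.Re _; set b := ln _; clear; lra.
  have := pow_exp ns h (zq x); rewrite -addrA -splitr expRD expW; exact.
have ksq x : nc (k x) ^+ 2 <= modulus f x * expR eta.
  have h : 2 * (- s) * m.+1%:R * complex.Re (A x) <= - ln (W x) + eta / 2.
    rewrite mulrN mulNr -[2 * s * _]mulrA sm mulr1; have := Ap x; rewrite ler_norml => /andP[+ _].
    by rewrite /p; set a := complex.Re _; set b := ln _; clear; lra.
  have := pow_exp nsN h (zq x); rewrite -addrA -splitr expRD expRN expW => h2.
  rewrite /k ncM exprMn; apply: (le_trans (ler_wpM2l (sqr_ge0 _) h2)).
  rewrite mulrA ler_wpM2r ?expR_ge0// ler_pdivrMr// expr2 ler_wpM2l ?nc_ge0//.
  by rewrite /W /modulus lerDl ltW.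
have [_ fi] := L2_L1 lf2.
exists g, k, ((1 + s * K) ^+ m.+1); split; [exact: lg|exact: lk|exact: gd|split].
- rewrite n2sq mulrC; have ii : rint (fun x => expR eta * W x).
    by apply: rintZ; exact: rintD fi (rint_cst e).
  apply: (@le_trans _ _ (\int[mu]_x (expR eta * W x))%R).
    apply: le_Rintegral => //; first by case: lg2.
    by move=> x _; rewrite mulrC; exact: gsq.
  by rewrite RintM ?RintegralD ?Rint_cst//; [exact: rint_cst|exact: rintD fi (rint_cst e)].
- rewrite n2sq mulrC; have ii : rint (fun x => expR eta * modulus f x) by exact: rintZ.
  apply: (@le_trans _ _ (\int[mu]_x (expR eta * modulus f x))%R).
    apply: le_Rintegral => //; first by case: lk2.
    by move=> x _; rewrite mulrC; exact: ksq.
  by rewrite RintM.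
- move=> x; have -> : f x - g x * k x = f x * (1 - (1 - (s%:C%C * A x) ^+ 2) ^+ m.+1).
    rewrite /g /k CN mulrCA -exprMn.
    rewrite (_ : (1 + s%:C%C * A x) * (1 + - s%:C%C * A x) = 1 - (s%:C%C * A x) ^+ 2); last by ring.
    by rewrite mulrBr mulr1.
  rewrite ncM; apply: ler_pM; rewrite ?nc_ge0//.
  apply: (le_trans (nc_1subX _ _)); rewrite lerD2r.
  apply: (@le_trans _ _ (expR (nc ((s%:C%C * A x) ^+ 2)) ^+ m.+1)).
    by apply: lerXn2r (expR_ge1Dx _); rewrite nnegrE ?expR_ge0 ?addr_ge0 ?nc_ge0.
  rewrite -expRM_natl ler_expR -mulr_natl mulr1 ncX ncM nc_real ns exprMn.
  have -> : m.+1%:R * (m.+1%:R^-1 ^+ 2 * nc (A x) ^+ 2) = nc (A x) ^+ 2 / m.+1%:R.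
    by field; rewrite addrC natr1 gt_eqF.
  by apply: (le_trans (zq x)); rewrite ler_pdivrMr// ler_peMr ?(ltW eta0)// ler1n.
Qed.

End outer_factorization.

(** * The norm of a form with a given tail symbol *)

Section bmo_one_step.
Context {R : realType}.
Local Notation C := R[i].
Local Notation mu := (@torus_measure R).
Local Notation nc := (@Normc.normc R).
Implicit Types (f g h u v b k : R -> C) (p : R -> R) (x y M : R) (n m : nat).

Lemma fejer_chord_lip n f : exists2 L : R, 0 <= L & chord_lip (fejer n f) L.
Proof.
exists (nc n.+1%:R^-1 * \sum_(j < n.+1) \sum_(l < n.+1)
    nc (fourier f (j%:Z - l%:Z)) * `|j%:Z - l%:Z|%N%:R).
  rewrite mulr_ge0 ?nc_ge0//; do 2 (apply: sumr_ge0 => ? _).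
  by rewrite mulr_ge0 ?nc_ge0.
move=> x y; rewrite /fejer -mulrBr -sumrB ncM -mulrA ler_wpM2l ?nc_ge0//.
rewrite (le_trans (nc_sum _ _ _))// mulr_suml; apply: ler_sum => j _.
rewrite -sumrB (le_trans (nc_sum _ _ _))// mulr_suml; apply: ler_sum => l _.
by rewrite -mulrBr ncM -mulrA ler_wpM2l ?nc_ge0//; exact: cexp_chord.
Qed.

Lemma le_small (a b B : R) : 0 <= B -> (forall s, 0 < s -> s <= 1 -> a <= b + s * B) -> a <= b.
Proof.
move=> B0 H; apply/ler_addgt0Pr => e e0.
have B1 : 0 < B + 1 by rewrite ltr_wpDl.
pose s := Num.min 1 (e / (B + 1)).
have s0 : 0 < s by rewrite lt_min ltr01 divr_gt0.
have s1 : s <= 1 by rewrite ge_min lexx.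
have s2 : s <= e / (B + 1) by rewrite ge_min lexx orbT.
apply: (le_trans (H s s0 s1)); rewrite lerD2l mulrC.
exact: le_trans (ler_wpM2l B0 s2) (frac_le B0 e0).
Qed.

Lemma product_form_lip N b u f (c L : R) : Bd N b -> L2p u -> tail_symbol b u ->
  L2p f -> (forall x, nc (f x) <= c) -> 0 <= L -> chord_lip f L ->
  nc (inner f u) <= Num.sqrt (N ^+ 2 + n2 u ^+ 2) * N1 f.
Proof.
move=> Bb lu bu lf fc L0 fL; set S := Num.sqrt _.
have S0 : 0 <= S by exact: sqrtr_ge0.
have [lu2 _] := lu; have [lf2 _] := lf; have N1f := N1_ge0 f; have u0 := n2_ge0 u.
have c0 : 0 <= c by apply: le_trans (fc 0); exact: nc_ge0.
apply: (@le_small _ _ (S * (N1 f + 2) + c * n2 u)).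
  by rewrite addr_ge0 ?mulr_ge0// addr_ge0.
move=> s s0 s1.
have eta0 : 0 < ln (1 + s) by rewrite ln_gt0// ltrDl.
have expE : expR (ln (1 + s)) = 1 + s by rewrite lnK// posrE addr_gt0.
have [g [k [d [lg lk gd [hg hk hgk]]]]] := factorization lf fc L0 fL s0 eta0.
rewrite expE in hg hk hgk.
have [lg2 _] := lg; have [lk2 _] := lk.
have lgk : L2 (fun x => k x * g x) by apply: (L2M_bd lk2 _ gd); case: lg2.
have {}lgk : L2 (fun x => g x * k x) by under eq_fun do rewrite mulrC.
have lr := L2B lf2 lgk.
have h1 := product_form Bb lu bu lg lk gd.
have h2 : n2 g * n2 k <= (N1 f + s) * (1 + s).
  have B0 : 0 <= (N1 f + s) * (1 + s) by rewrite mulr_ge0// addr_ge0// ltW.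
  rewrite -(@ler_pXn2r _ 2)// ?nnegrE ?mulr_ge0 ?n2_ge0// exprMn [leRHS]expr2.
  apply: ler_pM; rewrite ?sqr_ge0//; apply: (le_trans hk).
  by rewrite ler_wpM2r ?addr_ge0 ?(ltW s0)// lerDl ltW.
have h3 : n2 (fun x => f x - g x * k x) <= c * s.
  apply: n2_bd; first by case: lr.
  by move=> x; have := hgk x; rewrite addrAC subrr add0r.
have h4 : nc (inner (fun x => f x - g x * k x) u) <= c * s * n2 u.
  by apply: (le_trans (inner_le lr lu2)); rewrite ler_wpM2r.
have h5 : inner f u = inner (fun x => g x * k x) u + inner (fun x => f x - g x * k x) u.
  rewrite -innerDl//; congr inner; apply/funext => x.
  by rewrite addrC subrK.
rewrite h5; apply: (le_trans (ncD _ _)).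
have h6 : S * (n2 g * n2 k) <= S * (N1 f + s * (N1 f + 2)).
  rewrite ler_wpM2l//; apply: (le_trans h2).
  have : s * s <= s * 1 by rewrite ler_wpM2l// ltW.
  by move: (N1 f) => X; clear; nra.
move: h1 h4 h6; rewrite -/S; set X := nc _; set Y := nc _; set Z := S * (n2 g * n2 k).
set a := N1 f; set w := n2 u; clear => h1 h4 h6.
apply: (le_trans (lerD h1 h4)); rewrite mulrDr in h6.
apply: (le_trans (lerD h6 (lexx _))).
by rewrite le_eqVlt; apply/orP; left; apply/eqP; ring.
Qed.

(** The BMO norm exceeds the BMO norm modulo constants by at most the L2 norm,
    in the sense of squares. *)
Lemma HB_step N b u : Bd N b -> L2p u -> tail_symbol b u ->
  HB (Num.sqrt (N ^+ 2 + n2 u ^+ 2)) u.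
Proof.
move=> Bb lu bu; split => // f lf; set S := Num.sqrt _.
have [lu2 _] := lu; have [lf2 f0] := lf.
have S0 : 0 <= S by exact: sqrtr_ge0.
apply: (@le_small _ _ (n2 u)); first exact: n2_ge0.
move=> s s0 _; have [n /(_ n (leqnn n)) hn] := fejer_cvg_L2p lf s0.
have lF := L2_fejer n f; have lr := L2B lf2 lF.
have [L L0 HL] := fejer_chord_lip n f; have [c hc] := fejer_bounded n f.
have h1 := product_form_lip Bb lu bu (L2p_fejer n f0) hc L0 HL.
have -> : inner f u = inner (fejer n f) u + inner (fun x => f x - fejer n f x) u.
  rewrite -innerDl//; congr inner; apply/funext => x.
  by rewrite addrC subrK.
apply: (le_trans (ncD _ _)); apply: lerD.
  apply: (le_trans h1); rewrite ler_wpM2l// N1_fejer//.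
  exact: L2_L1.
by apply: (le_trans (inner_le lr lu2)); rewrite n2_sub ler_wpM2r ?n2_ge0.
Qed.

End bmo_one_step.

(** * The right-hand side of the equation *)

Section L4_theory.
Context {R : realType}.
Local Notation C := R[i].
Local Notation mu := (@torus_measure R).
Local Notation nc := (@Normc.normc R).
Implicit Types (f g h u v : R -> C) (p : R -> R) (x y M r : R) (n m : nat) (A : C).

Definition L4 f := L2 f /\ L2 (fun x => f x ^+ 2).
Definition n4 f : R := Num.sqrt (n2 (fun x => f x ^+ 2)).

Lemma n4_ge0 f : 0 <= n4 f. Proof. exact: sqrtr_ge0. Qed.

Lemma n4sq f : n4 f ^+ 2 = n2 (fun x => f x ^+ 2).
Proof. by rewrite sqr_sqrtr ?n2_ge0. Qed.

Lemma n4_eq f g : (forall x, nc (f x) = nc (g x)) -> n4 f = n4 g.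
Proof. by move=> fg; congr Num.sqrt; apply: n2_eq => x; rewrite !ncX fg. Qed.

Lemma L4_meas f : L4 f -> cmeas f. Proof. by case=> -[]. Qed.

Lemma L4M f g : L4 f -> L4 g ->
  L2 (fun x => f x * g x) /\ n2 (fun x => f x * g x) <= n4 f * n4 g.
Proof.
move=> [[mf _] lf] [[mg _] lg]; have lfg := L2M lf lg.
have E : N1 (fun x => f x ^+ 2 * g x ^+ 2) = (\int[mu]_x (modulus (fun x => f x * g x) x ^+ 2))%R.
  by apply: eq_Rintegral => x _; rewrite /modulus -exprMn ncX.
split.
  split; first exact: cmeasM.
  have [_] := lfg; apply: eq_ind; congr rint.
  by apply/funext => x; rewrite /modulus -exprMn ncX.
rewrite -(@ler_pXn2r _ 2)// ?nnegrE ?n2_ge0 ?mulr_ge0 ?n4_ge0// n2sq -E exprMn !n4sq.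
exact: N1M.
Qed.

Lemma L4_mono f g c : 0 <= c -> cmeas f -> L4 g -> (forall x, nc (f x) <= c * nc (g x)) ->
  L4 f /\ n4 f <= c * n4 g.
Proof.
move=> c0 mf [lg lg2] fg.
have h x : nc (f x ^+ 2) <= c ^+ 2 * nc (g x ^+ 2).
  by rewrite !ncX -exprMn; apply: lerXn2r (fg x); rewrite nnegrE ?nc_ge0// mulr_ge0// nc_ge0.
split; first by split; [exact: L2_mono fg|apply: L2_mono h => //; exact: cmeasX].
rewrite -(@ler_pXn2r _ 2)// ?nnegrE ?mulr_ge0 ?n4_ge0// exprMn !n4sq.
by apply: n2_mono => //; [exact: sqr_ge0|exact: cmeasX].
Qed.

Lemma L4_bd f c : cmeas f -> (forall x, nc (f x) <= c) -> L4 f.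
Proof.
move=> mf fc; split; first exact: L2_bd fc.
apply: (@L2_bd _ _ (c ^+ 2)); first exact: cmeasX.
move=> x; rewrite ncX; apply: lerXn2r (fc x); rewrite nnegrE ?nc_ge0//.
by rewrite (le_trans _ (fc x))// nc_ge0.
Qed.

Lemma L4D f g : L4 f -> L4 g ->
  L4 (fun x => f x + g x) /\ n4 (fun x => f x + g x) <= n4 f + n4 g.
Proof.
move=> lf lg; have [lfg hfg] := L4M lf lg; have [lf1 lf2] := lf; have [lg1 lg2] := lg.
have l2 := L2Z 2 lfg; have l3 := L2D lf2 l2; have l4 := L2D l3 lg2.
have E : (fun x => (f x + g x) ^+ 2) = (fun x => f x ^+ 2 + 2 * (f x * g x) + g x ^+ 2).
  by apply/funext => x; ring.
split; first by split; [exact: L2D|rewrite E].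
rewrite -(@ler_pXn2r _ 2)// ?nnegrE ?addr_ge0 ?n4_ge0// sqrrD !n4sq E.
have h1 := n2D l3 lg2; have h2 := n2D lf2 l2.
have : n2 (fun x => 2 * (f x * g x)) <= 2 * (n4 f * n4 g).
  by rewrite n2Z// -Cnat nc_real ger0_norm// ler_wpM2l.
move: h1 h2; set a := n2 _; set b := n2 _; set c := n2 _; set d := n2 _; set e := n2 _.
by set p := n4 f * n4 g; rewrite mulr2n; clear; lra.
Qed.

Lemma L4N f : L4 f -> L4 (fun x => - f x) /\ n4 (fun x => - f x) = n4 f.
Proof.
move=> lf; have mf := L4_meas lf; split; last by apply: n4_eq => x; rewrite ncN.
by apply: (L4_mono ler01 _ lf _).1; [exact: cmeasN|move=> x; rewrite ncN mul1r].
Qed.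

Lemma L4B f g : L4 f -> L4 g ->
  L4 (fun x => f x - g x) /\ n4 (fun x => f x - g x) <= n4 f + n4 g.
Proof. by move=> lf lg; have [lNg <-] := L4N lg; exact: L4D. Qed.

Lemma L4_conj f : L4 f -> L4 (fun x => conjc (f x)) /\ n4 (fun x => conjc (f x)) = n4 f.
Proof.
move=> lf; have mf := L4_meas lf; split; last by apply: n4_eq => x; rewrite nc_conj.
by apply: (L4_mono ler01 _ lf _).1; [exact: cmeas_conj|move=> x; rewrite nc_conj mul1r].
Qed.

Lemma HB_L4 M u : 0 <= M -> HB M u -> L4 u /\ n4 u ^+ 2 <= 3 * M * n2 u.
Proof. by move=> M0 Hu; have [l h] := HB_sq M0 Hu; rewrite n4sq; split=> //; split=> //; exact: HB_L2 Hu. Qed.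

Definition sqmod u : R -> C := fun x => (modulus u x ^+ 2)%:C%C.

Lemma sqmodE u x : sqmod u x = u x * conjc (u x).
Proof. by rewrite mul_conj. Qed.

Lemma L2_sqmod u : L4 u -> L2 (sqmod u).
Proof.
move=> lu; have [lJ _] := L4_conj lu; have [l _] := L4M lu lJ.
by move: l; congr L2; apply/funext => x; rewrite sqmodE.
Qed.

Lemma n2_sqmod u : n2 (sqmod u) = n4 u ^+ 2.
Proof. by rewrite n4sq; apply: n2_eq => x; rewrite sqmodE ncM nc_conj ncX expr2. Qed.

Lemma n2_sqmodB u v : L4 u -> L4 v ->
  n2 (fun x => sqmod u x - sqmod v x) <= (n4 u + n4 v) * n4 (fun x => u x - v x).
Proof.
move=> lu lv; have [ld _] := L4B lu lv; have [ldJ dJ] := L4_conj ld.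
have [lvJ vJ] := L4_conj lv; have [l1 h1] := L4M lu ldJ; have [l2 h2] := L4M lvJ ld.
have -> : (fun x => sqmod u x - sqmod v x) =
    (fun x => u x * conjc (u x - v x) + conjc (v x) * (u x - v x)).
  by apply/funext => x; rewrite !sqmodE conjcB; ring.
apply: (le_trans (n2D l1 l2)); rewrite mulrDl; apply: lerD.
  by rewrite -dJ.
by rewrite -vJ.
Qed.

Lemma n2_sqB u v : L4 u -> L4 v ->
  n2 (fun x => u x ^+ 2 - v x ^+ 2) <= (n4 u + n4 v) * n4 (fun x => u x - v x).
Proof.
move=> lu lv; have [ld _] := L4B lu lv; have [ls hs] := L4D lu lv.
have [l h] := L4M ls ld.
have -> : (fun x => u x ^+ 2 - v x ^+ 2) = (fun x => (u x + v x) * (u x - v x)).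
  by apply/funext => x; ring.
by apply: (le_trans h); rewrite ler_wpM2r// n4_ge0.
Qed.

Lemma J_lip u v K : L4 u -> L4 v -> n4 u <= K -> n4 v <= K ->
  nc (J u - J v) <= 3 * K ^+ 2 * n2 (fun x => u x - v x).
Proof.
move=> lu lv uK vK; have [lu1 lu2] := lu; have [lv1 lv2] := lv.
have K0 : 0 <= K by apply: le_trans uK; exact: n4_ge0.
have ld := L2B lu1 lv1; have [ls hs] := L4D lu lv.
have [lsJ sJ] := L4_conj ls; have [l h] := L4M lsJ lu.
have -> : J u - J v = inner (fun x => u x - v x) (fun x => conjc (u x + v x) * u x) +
    inner (fun x => v x ^+ 2) (fun x => u x - v x).
  rewrite /J innerBr// addrA -[in RHS]addrA.
  have -> : inner (fun x => u x - v x) (fun x => conjc (u x + v x) * u x) =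
      inner (fun x => u x ^+ 2) u - inner (fun x => v x ^+ 2) u.
    rewrite -innerBl// /inner; congr cintegral; apply/funext => x.
    by rewrite conjcM conjcK; ring.
  by rewrite addrA subrK.
apply: (le_trans (ncD _ _)).
have h1 : nc (inner (fun x => u x - v x) (fun x => conjc (u x + v x) * u x)) <=
    n2 (fun x => u x - v x) * (2 * K ^+ 2).
  apply: (le_trans (inner_le ld l)); rewrite ler_wpM2l ?n2_ge0//.
  apply: (le_trans h); rewrite sJ expr2 mulrA; apply: ler_pM; rewrite ?n4_ge0//.
  by apply: (le_trans hs); move: uK vK; clear; lra.
have h2 : nc (inner (fun x => v x ^+ 2) (fun x => u x - v x)) <= K ^+ 2 * n2 (fun x => u x - v x).
  apply: (le_trans (inner_le lv2 ld)); rewrite ler_wpM2r ?n2_ge0// -n4sq.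
  by apply: lerXn2r vK; rewrite nnegrE ?n4_ge0.
apply: (le_trans (lerD h1 h2)).
by rewrite le_eqVlt; apply/orP; left; apply/eqP; ring.
Qed.

Lemma HB_sq_form M u f : 0 <= M -> HB M u -> L2p f -> L4 f ->
  nc (inner (fun x => f x ^+ 2) u) <= M * n2 f ^+ 2.
Proof.
move=> M0 [lu H] lf [lf1 lf2].
have l : L2p (fun x => f x ^+ 2).
  by under eq_fun do rewrite expr2; apply: L2pM => //; under eq_fun do rewrite -expr2.
apply: (le_trans (H _ l)); rewrite ler_wpM2l// n2sq.
by rewrite le_eqVlt; apply/orP; left; apply/eqP; apply: eq_Rintegral => x _; rewrite /modulus ncX.
Qed.

Lemma J_HB M u : 0 <= M -> HB M u -> nc (J u) <= M * n2 u ^+ 2.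
Proof.
move=> M0 Hu; have [lu _] := HB_L4 M0 Hu; apply: HB_sq_form => //.
exact: HB_L2p Hu.
Qed.

Definition rhsA A u : R -> C := fun x => 2 * A * Szego (sqmod u) x + conjc A * u x ^+ 2.

Lemma szego_rhsE u : szego_rhs u = rhsA (J u) u. Proof. by []. Qed.

Lemma L2_rhsA A u : L4 u -> L2 (rhsA A u).
Proof.
move=> lu; have [_ lu2] := lu.
by apply: L2D; apply: L2Z => //; apply: L2_Szego; exact: L2_sqmod.
Qed.

Lemma nc2 : nc 2 = 2. Proof. by rewrite -Cnat nc_real ger0_norm. Qed.

Lemma n2_rhsA A u : L4 u -> n2 (rhsA A u) <= 3 * nc A * n4 u ^+ 2.
Proof.
move=> lu; have [_ lu2] := lu; have lq := L2_sqmod lu; have ls := L2_Szego lq.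
have l1 := L2Z (2 * A) ls; have l2 := L2Z (conjc A) lu2.
apply: (le_trans (n2D l1 l2)); rewrite (n2Z _ ls) (n2Z _ lu2) ncM nc2 nc_conj.
have := n2_Szego lq; rewrite n2_sqmod -n4sq => h.
have : nc A * n2 (Szego (sqmod u)) <= nc A * n4 u ^+ 2 by rewrite ler_wpM2l ?nc_ge0.
rewrite -[2 * nc A * n2 _]mulrA -[3 * nc A * _]mulrA.
by set a := nc A * n2 _; set b := nc A * _; clear; lra.
Qed.

Lemma n2_rhsA_sub A u v : L4 u -> L4 v ->
  n2 (fun x => rhsA A u x - rhsA A v x) <=
  3 * nc A * ((n4 u + n4 v) * n4 (fun x => u x - v x)).
Proof.
move=> lu lv; have [_ lu2] := lu; have [_ lv2] := lv.
have lqu := L2_sqmod lu; have lqv := L2_sqmod lv.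
have lsu := L2_Szego lqu; have lsv := L2_Szego lqv.
have lS := L2B lsu lsv; have lQ := L2B lu2 lv2.
have -> : (fun x => rhsA A u x - rhsA A v x) = (fun x =>
   2 * A * (Szego (sqmod u) x - Szego (sqmod v) x) + conjc A * (u x ^+ 2 - v x ^+ 2)).
  by apply/funext => x; rewrite /rhsA; ring.
have l1 := L2Z (2 * A) lS; have l2 := L2Z (conjc A) lQ.
apply: (le_trans (n2D l1 l2)); rewrite (n2Z _ lS) (n2Z _ lQ) ncM nc2 nc_conj.
have h1 := le_trans (n2_SzegoB lqu lqv) (n2_sqmodB lu lv); have h2 := n2_sqB lu lv.
have h3 := ler_wpM2l (nc_ge0 A) h1; have h4 := ler_wpM2l (nc_ge0 A) h2.
rewrite -[2 * nc A * n2 _]mulrA -[3 * nc A * _]mulrA.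
move: h3 h4; set a := nc A * n2 _; set b := nc A * n2 _; set c := nc A * _.
by clear; lra.
Qed.

Lemma n2_rhsA_subA A A' u : L4 u ->
  n2 (fun x => rhsA A u x - rhsA A' u x) <= 3 * nc (A - A') * n4 u ^+ 2.
Proof.
move=> lu; have -> : (fun x => rhsA A u x - rhsA A' u x) = rhsA (A - A') u.
  by apply/funext => x; rewrite /rhsA conjcB; ring.
exact: n2_rhsA.
Qed.

(** Only the real part of (w' | w) matters for the variation of the norm of w;
    with w' = - i D this is the imaginary part of (D | w). *)
Lemma mass_form (chi : R) u : L2p u -> L4 u ->
  complex.Im (inner (rhsA (chi%:C%C * J u) u) u) = 0.
Proof.
move=> lu lu4; have [lu1 lu2] := lu4; have lq := L2_sqmod lu4; have ls := L2_Szego lq.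
set A := _ * J u; rewrite /rhsA innerDl ?innerZl//; [|exact: L2Z|exact: L2Z].
rewrite inner_Szego//.
have -> : inner (sqmod u) u = conjc (J u).
  rewrite /J /inner -cint_conj; last by apply: L2M => //; exact: L2_conj.
  congr cintegral; apply/funext => x; rewrite sqmodE conjcM conjcK conjcX; ring.
rewrite -/(J u) /A conjcM conjc_real.
have -> : 2 * (chi%:C%C * J u) * conjc (J u) + chi%:C%C * conjc (J u) * J u =
    (3 * chi * nc (J u) ^+ 2)%:C%C.
  by rewrite [(3 * chi * _)%:C%C]CM [(3 * chi)%:C%C]CM Cnat -mul_conj; ring.
by [].
Qed.

(** The terms quadratic in u - v with coefficient v combine into a real number;
    the others are controlled by the dual form of the BMO norm. *)
Lemma energy_form M r u v : 0 <= M -> HB M u -> HB M v -> n2 u <= r -> n2 v <= r ->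
  `|complex.Im (inner (fun x => szego_rhs u x - szego_rhs v x) (fun x => u x - v x))| <=
  (4 * M ^+ 2 * r ^+ 2 + 9 * (3 * M * r) ^+ 2) * n2 (fun x => u x - v x) ^+ 2.
Proof.
move=> M0 Hu Hv ur vr.
have r0 : 0 <= r by apply: le_trans ur; exact: n2_ge0.
have [lu ku] := HB_L4 M0 Hu; have [lv kv] := HB_L4 M0 Hv.
have lup := HB_L2p Hu; have lvp := HB_L2p Hv; have ldp := L2pB lup lvp.
have [lu1 lu2] := lu; have [lv1 lv2] := lv.
have [ld4 _] := L4B lu lv; have [ld ld2] := ld4.
pose d x := u x - v x; rewrite -/d in ldp ld4 ld ld2 *.
pose K2 := 3 * M * r; pose K := Num.sqrt K2.
have K20 : 0 <= K2 by rewrite !mulr_ge0.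
have KK : K ^+ 2 = K2 by rewrite sqr_sqrtr.
have uK : n4 u <= K.
  rewrite -(@ler_pXn2r _ 2)// ?nnegrE ?n4_ge0 ?sqrtr_ge0// KK (le_trans ku)//.
  by rewrite ler_wpM2l ?mulr_ge0.
have vK : n4 v <= K.
  rewrite -(@ler_pXn2r _ 2)// ?nnegrE ?n4_ge0 ?sqrtr_ge0// KK (le_trans kv)//.
  by rewrite ler_wpM2l ?mulr_ge0.
have hJ : nc (J u - J v) <= 3 * K2 * n2 d by rewrite -KK; exact: J_lip.
have h2 : nc (inner (fun x => rhsA (J u) v x - rhsA (J v) v x) d) <= 9 * K2 ^+ 2 * n2 d ^+ 2.
  have lr := L2B (L2_rhsA (J u) lv) (L2_rhsA (J v) lv).
  apply: (le_trans (inner_le lr ld)); rewrite [n2 d ^+ 2]expr2 [leRHS]mulrA ler_wpM2r ?n2_ge0//.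
  apply: (le_trans (n2_rhsA_subA _ _ lv)).
  rewrite [leRHS](_ : _ = 3 * (3 * K2 * n2 d) * K2); last by ring.
  have v2 : n4 v ^+ 2 <= K2.
    by rewrite -KK; apply: lerXn2r vK; rewrite nnegrE ?n4_ge0 ?sqrtr_ge0.
  have j3 : 3 * nc (J u - J v) <= 3 * (3 * K2 * n2 d) by rewrite ler_pM2l.
  have p1 : 0 <= 3 * nc (J u - J v) by rewrite mulr_ge0 ?nc_ge0.
  exact: ler_pM p1 (sqr_ge0 _) j3 v2.
have lr1 := L2B (L2_rhsA (J u) lu) (L2_rhsA (J u) lv).
have lr2 := L2B (L2_rhsA (J u) lv) (L2_rhsA (J v) lv).
have E : inner (fun x => szego_rhs u x - szego_rhs v x) d =
   inner (fun x => rhsA (J u) u x - rhsA (J u) v x) d +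
   inner (fun x => rhsA (J u) v x - rhsA (J v) v x) d.
  rewrite -(innerDl lr1 lr2 ld); congr inner; apply/funext => x.
  by rewrite !szego_rhsE addrA subrK.
have [ldJ _] := L4_conj ld4; have [ldJ2 _] := ldJ; have [lvJ _] := L4_conj lv.
have [luu _] := L4M lu ldJ; have [lvv _] := L4M lvJ ld4; have [lvd _] := L4M lv ld4.
pose X := inner (fun x => v x * d x) d.
have e1 : inner (fun x => rhsA (J u) u x - rhsA (J u) v x) d =
   2 * J u * conjc (inner (fun x => d x ^+ 2) u) +
   (2 * (J u * conjc X + conjc (J u * conjc X)) + conjc (J u) * inner (fun x => d x ^+ 2) d).
  have lqu := L2_sqmod lu; have lqv := L2_sqmod lv.
  have lsu := L2_Szego lqu; have lsv := L2_Szego lqv.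
  have lS := L2B lsu lsv; have lQ := L2B lu2 lv2.
  have -> : (fun x => rhsA (J u) u x - rhsA (J u) v x) = (fun x =>
     2 * J u * (Szego (sqmod u) x - Szego (sqmod v) x) + conjc (J u) * (u x ^+ 2 - v x ^+ 2)).
    by apply/funext => x; rewrite /rhsA; ring.
  rewrite (innerDl (L2Z _ lS) (L2Z _ lQ) ld) (innerZl _ lS ld) (innerZl _ lQ ld).
  rewrite (innerBl lsu lsv ld) (inner_Szego lqu ldp) (inner_Szego lqv ldp) -(innerBl lqu lqv ld).
  have -> : inner (fun x => sqmod u x - sqmod v x) d =
      conjc (inner (fun x => d x ^+ 2) u) + conjc X.
    rewrite -(innerC ld2 lu1) -(innerC lvd ld).
    have i1 : L1 (fun x => u x * conjc (d x ^+ 2)) by apply: L2M => //; exact: L2_conj.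
    have i2 : L1 (fun x => d x * conjc (v x * d x)) by apply: L2M => //; exact: L2_conj.
    rewrite /inner -(cintD i1 i2); congr cintegral; apply/funext => x.
    rewrite !sqmodE /d conjcM conjcX conjcB; ring.
  have -> : inner (fun x => u x ^+ 2 - v x ^+ 2) d = 2 * X + inner (fun x => d x ^+ 2) d.
    rewrite -(innerZl _ lvd ld) -(innerDl (L2Z _ lvd) ld2 ld); congr inner; apply/funext => x.
    by rewrite /d; ring.
  by rewrite conjcM conjcK; ring.
have hd1 := HB_sq_form M0 Hu ldp ld4; have hd2 := HB_sq_form M0 Hv ldp ld4.
have hd3 : nc (inner (fun x => d x ^+ 2) d) <= 2 * (M * n2 d ^+ 2).
  rewrite /d -/d (innerBr lu1 lv1 ld2) (le_trans (ncB _ _))//.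
  by move: hd1 hd2; set a := nc _; set b := nc _; set c := M * _; clear; lra.
have Jr : nc (J u) <= M * r ^+ 2.
  apply: (le_trans (J_HB M0 Hu)); rewrite ler_wpM2l//.
  by apply: lerXn2r ur; rewrite nnegrE ?n2_ge0.
have im0 z : complex.Im (2 * (z + conjc z)) = 0 :> R.
  by rewrite -Cnat Im_CM Im_D Im_conjc subrr mulr0.
rewrite E e1 !Im_D im0 add0r.
have i1 := nc_Im (2 * J u * conjc (inner (fun x => d x ^+ 2) u)).
have i2 := nc_Im (conjc (J u) * inner (fun x => d x ^+ 2) d).
have i3 := nc_Im (inner (fun x => rhsA (J u) v x - rhsA (J v) v x) d).
rewrite ncM ncM nc2 nc_conj in i1; rewrite ncM nc_conj in i2.
have Y0 : 0 <= M * n2 d ^+ 2 by rewrite mulr_ge0// sqr_ge0.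
have j1 : nc (J u) * nc (inner (fun x => d x ^+ 2) u) <= M * r ^+ 2 * (M * n2 d ^+ 2).
  by apply: ler_pM; rewrite ?nc_ge0.
have j2 : nc (J u) * nc (inner (fun x => d x ^+ 2) d) <= M * r ^+ 2 * (2 * (M * n2 d ^+ 2)).
  by apply: ler_pM; rewrite ?nc_ge0.
rewrite -/K2; apply: (le_trans (ler_normD _ _)); apply: (le_trans (lerD (ler_normD _ _) (lexx _))).
apply: (le_trans (lerD (lerD i1 i2) i3)); rewrite -[2 * nc _ * nc _]mulrA.
apply: (le_trans (lerD (lerD (ler_wpM2l _ j1) j2) h2)) => //.
by rewrite le_eqVlt; apply/orP; left; apply/eqP; ring.
Qed.

End L4_theory.

(** * A pointwise step preserving a disc *)

Section pointwise_step.
Context {R : realType}.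
Local Notation C := R[i].
Local Notation nc := (@Normc.normc R).
Implicit Types (x y N : R) (z k e : C).

Let I x : C := Complex 1 (x / 2).

(** A rational substitute for exp(ix), with which it agrees to second order;
    it has modulus one, so that it acts on symbols by rotations. *)
Definition cayley x : C := I x / conjc (I x).

Lemma nc_cayley_den x : 1 <= nc (conjc (I x)).
Proof.
rewrite nc_conj -(@ler_pXn2r _ 2)// ?nnegrE ?nc_ge0// ncE /= expr1n lerDl; exact: sqr_ge0.
Qed.

Lemma cayley_den_neq0 x : conjc (I x) != 0.
Proof.
by apply/eqP => h; have := nc_cayley_den x; rewrite h nc0 leNgt ltr01.
Qed.

Lemma nc_cayley x : nc (cayley x) = 1.
Proof.
rewrite /cayley ncM ncV nc_conj divff//; apply/eqP => h.
by have := nc_cayley_den x; rewrite nc_conj h leNgt ltr01.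
Qed.

Lemma nc_cayley_div x z : nc (z / conjc (I x)) <= nc z.
Proof.
rewrite ncM ncV ler_piMr ?nc_ge0// invf_le1; first exact: nc_cayley_den.
exact: lt_le_trans ltr01 (nc_cayley_den x).
Qed.

Lemma cayley_lip x y : nc (cayley x - cayley y) <= `|x - y|.
Proof.
have -> : cayley x - cayley y = ('i%C * (x - y)%:C%C) / conjc (I y) / conjc (I x).
  have h1 := cayley_den_neq0 x; have h2 := cayley_den_neq0 y.
  apply: (mulIf h1); apply: (mulIf h2); rewrite /cayley mulrBl divfK// mulfVK//.
  rewrite mulrBl [_ / _ * _ * _]mulrAC divfK// mulfVK//.
  by apply: eq_C; rewrite ?(Re_D, Im_D, Re_N, Im_N, Re_M, Im_M, Re_conjc, Im_conjc)/=; lra.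
apply: (le_trans (nc_cayley_div _ _)); apply: (le_trans (nc_cayley_div _ _)).
by rewrite ncM nci mul1r nc_real.
Qed.

Lemma cayley0 : cayley 0 = 1.
Proof. by rewrite /cayley /I mul0r /= oppr0 divff// oner_neq0. Qed.

Lemma cayley_sub1 x : nc (cayley x - 1) <= `|x|.
Proof. by rewrite -cayley0 (le_trans (cayley_lip _ _))// subr0. Qed.

Lemma cayley_taylor x : nc (cayley x - 1 - 'i%C * x%:C%C) <= x ^+ 2.
Proof.
have -> : cayley x - 1 - 'i%C * x%:C%C = - (x ^+ 2 / 2)%:C%C / conjc (I x).
  have h1 := cayley_den_neq0 x; apply: (mulIf h1); rewrite !mulrBl /cayley divfK// mulfVK// mul1r.
  by apply: eq_C; rewrite ?(Re_D, Im_D, Re_N, Im_N, Re_M, Im_M, Re_conjc, Im_conjc)/=; field.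
apply: (le_trans (nc_cayley_div _ _)); rewrite ncN nc_real ger0_norm; last by rewrite divr_ge0 ?sqr_ge0.
by rewrite ler_pdivrMr// ler_peMr ?sqr_ge0// ler1n.
Qed.

Lemma cayley_sq x : nc (cayley x ^+ 2 - cayley (2 * x)) <= 7 * x ^+ 2.
Proof.
set e := cayley x; set r := e - 1 - 'i%C * x%:C%C.
have -> : e ^+ 2 - cayley (2 * x) = r + 'i%C * x%:C%C * (e - 1) + r * e -
    (cayley (2 * x) - 1 - 'i%C * (2 * x)%:C%C).
  by rewrite /r CM Cnat; ring.
apply: (le_trans (ncB _ _)).
have h1 : nc r <= x ^+ 2 by exact: cayley_taylor.
have h2 : nc ('i%C * x%:C%C * (e - 1)) <= x ^+ 2.
  by rewrite !ncM nci mul1r nc_real -[leRHS]real_normK ?num_real// expr2 ler_wpM2l ?cayley_sub1.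
have h3 : nc (r * e) <= x ^+ 2 by rewrite ncM nc_cayley mulr1.
have h4 : nc (cayley (2 * x) - 1 - 'i%C * (2 * x)%:C%C) <= 4 * x ^+ 2.
  by rewrite (_ : 4 * _ = (2 * x) ^+ 2) ?cayley_taylor//; ring.
have := ncD (r + 'i%C * x%:C%C * (e - 1)) (r * e); have := ncD r ('i%C * x%:C%C * (e - 1)).
move: h1 h2 h3 h4; set a := nc _; set b := nc _; set c := nc _; set d := nc _.
set f := nc _; set g := nc _; set y := x ^+ 2; clear; intros; lra.
Qed.

(** Euler step of the Riccati equation z' = N^2 k - conj k z^2, whose flow
    preserves the disc of radius N; the scalar factor restores the invariance
    at the price of an error of second order. *)
Definition riccati N k z : C := z + (N ^+ 2)%:C%C * k - conjc k * z ^+ 2.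
Definition damping N k : R := 1 + 2 * N ^+ 2 * nc k ^+ 2.
Definition disc_step N k z : C := (damping N k)^-1%:C%C * riccati N k z.

Lemma damping_ge1 N k : 1 <= damping N k.
Proof. by rewrite lerDl mulr_ge0 ?sqr_ge0// mulr_ge0// sqr_ge0. Qed.

Lemma damping_gt0 N k : 0 < damping N k.
Proof. exact: lt_le_trans ltr01 (damping_ge1 N k). Qed.

Lemma damping_inv N k : 0 <= (damping N k)^-1 <= 1.
Proof. by rewrite invr_ge0 (ltW (damping_gt0 _ _)) invf_le1 ?damping_gt0 ?damping_ge1. Qed.

Lemma disc_stepK N k z : riccati N k z = (damping N k)%:C%C * disc_step N k z.
Proof. by rewrite mulrA -CM divff ?mul1r// gt_eqF// damping_gt0. Qed.

Lemma nc_forcing N k z : 0 <= N -> nc z <= N ->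
  nc ((N ^+ 2)%:C%C * k - conjc k * z ^+ 2) <= 2 * N ^+ 2 * nc k.
Proof.
move=> N0 zN; apply: (le_trans (ncB _ _)); rewrite !(ncX, ncM) nc_conj nc_real ger0_norm ?sqr_ge0//.
have h : nc z ^+ 2 <= N ^+ 2 by apply: lerXn2r zN; rewrite nnegrE ?nc_ge0.
by have := ler_wpM2l (nc_ge0 k) h; move: (nc k) => a; move: (nc z ^+ 2) (N ^+ 2); clear; intros; lra.
Qed.

(** Inside the disc the first order term is directed inwards, and the damping
    absorbs the term of second order. *)
Lemma disc_step_bd N k z : 0 <= N -> N * nc k <= 2^-1 -> nc z <= N -> nc (disc_step N k z) <= N.
Proof.
move=> N0 kN zN; have D0 := damping_gt0 N k.
rewrite ncM nc_real ger0_norm ?invr_ge0 ?(ltW D0)// mulrC ler_pdivrMr//.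
rewrite -(@ler_pXn2r _ 2)// ?nnegrE ?nc_ge0 ?mulr_ge0 ?(ltW D0)//.
set v := (N ^+ 2)%:C%C * k - conjc k * z ^+ 2.
have E : nc (riccati N k z) ^+ 2 = nc z ^+ 2 + nc v ^+ 2 +
    2 * (N ^+ 2 - nc z ^+ 2) * complex.Re (conjc k * z).
  rewrite /riccati -addrA -/v !ncE Re_D Im_D /v expr2.
  rewrite ?(Re_D, Im_D, Re_N, Im_N, Re_CM, Im_CM, Re_M, Im_M, Re_conjc, Im_conjc).
  move: (complex.Re z) (complex.Im z) (complex.Re k) (complex.Im k) => a b c d; ring.
have h1 : nc v ^+ 2 <= (2 * N ^+ 2 * nc k) ^+ 2.
  by apply: lerXn2r (nc_forcing k N0 zN); rewrite nnegrE ?nc_ge0// mulr_ge0 ?nc_ge0// mulr_ge0// sqr_ge0.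
have z2 : nc z ^+ 2 <= N ^+ 2 by apply: lerXn2r zN; rewrite nnegrE ?nc_ge0.
have h2 : complex.Re (conjc k * z) <= 2^-1.
  apply: (le_trans (ler_norm _)); apply: (le_trans (nc_Re _)); rewrite ncM nc_conj.
  by apply: le_trans kN; rewrite mulrC ler_wpM2r ?nc_ge0.
have h3 : 2 * (N ^+ 2 - nc z ^+ 2) * complex.Re (conjc k * z) <= N ^+ 2 - nc z ^+ 2.
  have p : 0 <= 2 * (N ^+ 2 - nc z ^+ 2) by rewrite mulr_ge0// subr_ge0.
  by apply: (le_trans (ler_wpM2l p h2)); rewrite -mulrA mulrCA divff ?mulr1// pnatr_eq0.
have h4 : (N * damping N k) ^+ 2 = N ^+ 2 + (2 * N ^+ 2 * nc k) ^+ 2 + (2 * N ^+ 3 * nc k ^+ 2) ^+ 2.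
  by rewrite /damping; ring.
have := sqr_ge0 (2 * N ^+ 3 * nc k ^+ 2); move: h1 h3 z2; rewrite h4 E.
set w := _ * complex.Re _; set a := (2 * N ^+ 2 * nc k) ^+ 2; set c := (2 * N ^+ 3 * _) ^+ 2.
by clear; intros; lra.
Qed.

Lemma disc_step_riccati N k z : 0 <= N -> N * nc k <= 2^-1 -> nc z <= N ->
  nc (disc_step N k z - riccati N k z) <= 2 * N ^+ 3 * nc k ^+ 2.
Proof.
move=> N0 kN zN; rewrite disc_stepK.
have -> : disc_step N k z - (damping N k)%:C%C * disc_step N k z =
    - (2 * N ^+ 2 * nc k ^+ 2)%:C%C * disc_step N k z.
  by rewrite /damping CD; ring.
have p : 0 <= 2 * N ^+ 2 * nc k ^+ 2 by rewrite mulr_ge0 ?sqr_ge0// mulr_ge0// sqr_ge0.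
rewrite ncM ncN nc_real ger0_norm//; apply: (le_trans (ler_wpM2l p (disc_step_bd N0 kN zN))).
by rewrite le_eqVlt; apply/orP; left; apply/eqP; ring.
Qed.

Lemma nc_damping_inv N k z : nc ((damping N k)^-1%:C%C * z) <= nc z.
Proof.
have /andP[d0 d1] := damping_inv N k.
by rewrite ncM nc_real ger0_norm// ler_piMl ?nc_ge0.
Qed.

Lemma disc_step_lip N k z z' : 0 <= N -> nc z <= N -> nc z' <= N ->
  nc (disc_step N k z - disc_step N k z') <= (1 + 2 * N * nc k) * nc (z - z').
Proof.
move=> N0 zN zN'; rewrite /disc_step -mulrBr (le_trans (nc_damping_inv _ _ _))//.
rewrite (_ : _ - _ = (1 - conjc k * (z + z')) * (z - z')); last by rewrite /riccati; ring.
rewrite ncM ler_wpM2r ?nc_ge0// (le_trans (ncB _ _))// nc1 lerD2l ncM nc_conj.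
rewrite mulrC ler_wpM2r ?nc_ge0// (le_trans (ncD _ _))//; move: zN zN'; clear; intros; lra.
Qed.

Lemma disc_step_lip_par N k k' z : 0 <= N -> N * nc k <= 2^-1 -> N * nc k' <= 2^-1 ->
  nc z <= N -> nc (disc_step N k z - disc_step N k' z) <= 4 * N ^+ 2 * nc (k - k').
Proof.
move=> N0 kN kN' zN.
have -> : disc_step N k z - disc_step N k' z =
   (damping N k)^-1%:C%C * (riccati N k z - riccati N k' z) +
   (damping N k)^-1%:C%C * ((damping N k' - damping N k)%:C%C * disc_step N k' z).
  set d := (damping N k)^-1%:C%C; set s' := disc_step N k' z.
  have dK : d * (damping N k)%:C%C = 1 by rewrite -CM mulVf// gt_eqF// damping_gt0.
  rewrite (disc_stepK N k' z) -/s' CB; transitivity (d * riccati N k z - d * (damping N k)%:C%C * s').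
    by rewrite dK mul1r.
  ring.
apply: (le_trans (ncD _ _)).
have h1 := nc_damping_inv N k (riccati N k z - riccati N k' z).
have h2 := nc_damping_inv N k ((damping N k' - damping N k)%:C%C * disc_step N k' z).
have h3 : nc (riccati N k z - riccati N k' z) <= 2 * N ^+ 2 * nc (k - k').
  have -> : riccati N k z - riccati N k' z =
    (N ^+ 2)%:C%C * (k - k') - conjc (k - k') * z ^+ 2 by rewrite /riccati conjcB; ring.
  exact: nc_forcing.
have h4 : nc ((damping N k' - damping N k)%:C%C * disc_step N k' z) <= 2 * N ^+ 2 * nc (k - k').
  rewrite ncM nc_real; have h := disc_step_bd N0 kN' zN.
  have q : `|damping N k' - damping N k| <= 2 * N * nc (k - k').
    have -> : damping N k' - damping N k = 2 * N * ((N * nc k' + N * nc k) * (nc k' - nc k)).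
      by rewrite /damping; ring.
    have n2N : 0 <= 2 * N by rewrite mulr_ge0.
    rewrite normrM ger0_norm// ler_wpM2l// normrM.
    have g0 : 0 <= N * nc k' + N * nc k by rewrite addr_ge0 ?mulr_ge0 ?nc_ge0.
    rewrite ger0_norm//.
    have t : `|nc k' - nc k| <= nc (k - k').
      have := ncD (k - k') k'; have := ncD (k' - k) k; rewrite !subrK (nc_sub k').
      by rewrite ler_norml; set a := nc _; set b := nc _; set c := nc _ => ? ?; apply/andP; split; lra.
    apply: (le_trans (ler_wpM2l g0 t)); rewrite ler_piMl ?nc_ge0//.
    by move: kN kN'; set a := _ * _; set b := _ * _; clear; intros; lra.
  apply: (le_trans (ler_pM _ _ q h)); rewrite ?nc_ge0//.
  by rewrite le_eqVlt; apply/orP; left; apply/eqP; ring.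
move: h1 h2 h3 h4; set a := nc _; set b := nc _; set c := nc _; set d := nc _; set f := 2 * N ^+ 2 * _.
move=> *; rewrite -[4 * N ^+ 2 * _]mulrA; have : 2 * (N ^+ 2 * nc (k - k')) = f by rewrite mulrA.
lra.
Qed.

(** Two steps and one step of double length agree to second order; the last
    three terms of the bound measure the defect of the rotations. *)
Lemma disc_step_double N k e e2 z x : 0 <= N -> N * nc k <= 4^-1 -> nc e = 1 -> nc e2 = 1 ->
  nc z <= N -> nc (e - 1) <= x ->
  nc (disc_step N k (e * disc_step N k (e * z)) - disc_step N (2 * k) (e2 * z)) <=
  18 * N ^+ 3 * nc k ^+ 2 + 3 * N * nc (e ^+ 2 - e2) + 2 * N ^+ 2 * nc k * x.
Proof.
move=> N0 kN4 e1 e21 zN ex; set z1 := e * z; set y := disc_step N k z1.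
have kN : N * nc k <= 2^-1 by apply: (le_trans kN4); lra.
have nc2k : nc (2 * k) = 2 * nc k by rewrite ncM -Cnat nc_real ger0_norm.
have kN2 : N * nc (2 * k) <= 2^-1 by rewrite nc2k mulrCA; move: kN4; set a := N * _; lra.
have z1N : nc z1 <= N by rewrite ncM e1 mul1r.
have e2zN : nc (e2 * z) <= N by rewrite ncM e21 mul1r.
have yN : nc y <= N by exact: disc_step_bd.
have eyN : nc (e * y) <= N by rewrite ncM e1 mul1r.
pose g := (N ^+ 2)%:C%C * k - conjc k * z1 ^+ 2.
have gk : nc g <= 2 * N ^+ 2 * nc k by exact: nc_forcing.
have q1 : nc (y - riccati N k z1) <= 2 * N ^+ 3 * nc k ^+ 2 by exact: disc_step_riccati.
have q2 := disc_step_riccati N0 kN eyN.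
have q3 := disc_step_riccati N0 kN2 e2zN; rewrite nc2k in q3.
set r1 := y - _ in q1; set r2 := _ - _ in q2; set r3 := _ - _ in q3.
pose E := e ^+ 2 - e2; set q := nc k.
have Dec : disc_step N k (e * y) - disc_step N (2 * k) (e2 * z) =
  (r2 - r3) + (e * r1 + E * z) + (e - 1) * ((N ^+ 2)%:C%C * k) +
  (conjc k * ((e - 1) * (e ^+ 3 * z ^+ 2)) - conjc k * ((E * (e ^+ 2 + e2)) * (z ^+ 2 *+ 2))
   - conjc k * (e ^+ 2 * ((y - z1) * (y + z1)))).
  rewrite /r2 /r3 /r1 /E /riccati /z1 conjcM conjc_nat.
  set u1 := disc_step _ _ (e * y); set u2 := disc_step _ _ (e2 * z); rewrite CX; ring.
have yz : nc (y - z1) <= 2 * N ^+ 3 * q ^+ 2 + 2 * N ^+ 2 * q.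
  have -> : y - z1 = r1 + g by rewrite /r1 /g /riccati; ring.
  by apply: (le_trans (ncD _ _)); apply: lerD.
have q0 : 0 <= q := nc_ge0 _; have E0 : 0 <= nc E := nc_ge0 _.
have x0 : 0 <= x := le_trans (nc_ge0 _) ex.
have b1 : nc (e * r1 + E * z) <= 2 * N ^+ 3 * q ^+ 2 + nc E * N.
  by apply: (le_trans (ncD _ _)); apply: lerD; rewrite ncM ?e1 ?mul1r// ler_wpM2l.
have b2 : nc ((e - 1) * ((N ^+ 2)%:C%C * k)) <= x * (N ^+ 2 * q).
  by rewrite !ncM nc_real ger0_norm ?sqr_ge0// ler_wpM2r// mulr_ge0 ?sqr_ge0.
have z2 : nc z ^+ 2 <= N ^+ 2 by apply: lerXn2r zN; rewrite nnegrE ?nc_ge0.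
have b3 : nc (conjc k * ((e - 1) * (e ^+ 3 * z ^+ 2))) <= q * (x * N ^+ 2).
  rewrite !(ncX, ncM) e1 nc_conj expr1n mul1r ler_wpM2l//.
  by apply: ler_pM; rewrite ?nc_ge0 ?sqr_ge0.
have b4 : nc (conjc k * ((E * (e ^+ 2 + e2)) * (z ^+ 2 *+ 2))) <= q * ((nc E * 2) * (2 * N ^+ 2)).
  rewrite -mulr_natl !(ncX, ncM) nc_conj -Cnat nc_real ger0_norm// ler_wpM2l//.
  apply: ler_pM; rewrite ?mulr_ge0 ?nc_ge0 ?sqr_ge0//; last by rewrite ler_wpM2l.
  by rewrite ler_wpM2l// (le_trans (ncD _ _))// ncX e1 e21 expr1n.
have b5 : nc (conjc k * (e ^+ 2 * ((y - z1) * (y + z1)))) <=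
    q * ((2 * N ^+ 3 * q ^+ 2 + 2 * N ^+ 2 * q) * (2 * N)).
  rewrite !(ncX, ncM) nc_conj e1 expr1n mul1r ler_wpM2l//.
  apply: ler_pM; rewrite ?nc_ge0//; apply: (le_trans (ncD _ _)); move: yN z1N; clear; intros; lra.
rewrite Dec.
have t1 := ncB r2 r3.
have := ncD (r2 - r3 + (e * r1 + E * z) + (e - 1) * ((N ^+ 2)%:C%C * k))
  (conjc k * ((e - 1) * (e ^+ 3 * z ^+ 2)) - conjc k * ((E * (e ^+ 2 + e2)) * (z ^+ 2 *+ 2))
   - conjc k * (e ^+ 2 * ((y - z1) * (y + z1)))).
have := ncD (r2 - r3 + (e * r1 + E * z)) ((e - 1) * ((N ^+ 2)%:C%C * k)).
have := ncD (r2 - r3) (e * r1 + E * z).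
have := ncB (conjc k * ((e - 1) * (e ^+ 3 * z ^+ 2)) - conjc k * ((E * (e ^+ 2 + e2)) * (z ^+ 2 *+ 2)))
   (conjc k * (e ^+ 2 * ((y - z1) * (y + z1)))).
have := ncB (conjc k * ((e - 1) * (e ^+ 3 * z ^+ 2))) (conjc k * ((E * (e ^+ 2 + e2)) * (z ^+ 2 *+ 2))).
have s1 : q * ((nc E * 2) * (2 * N ^+ 2)) <= nc E * N.
  rewrite [leLHS](_ : _ = nc E * N * (4 * (N * q))); last by ring.
  by rewrite ler_piMr ?mulr_ge0//; move: kN4; rewrite -/q; set a := N * q; clear; intros; lra.
have s2 : q * (2 * N ^+ 3 * q ^+ 2 * (2 * N)) <= N ^+ 3 * q ^+ 2.
  rewrite [leLHS](_ : _ = N ^+ 3 * q ^+ 2 * (4 * (N * q))); last by ring.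
  rewrite ler_piMr ?mulr_ge0 ?sqr_ge0 ?exprn_ge0//.
  by move: kN4; rewrite -/q; set a := N * q; clear; intros; lra.
have P0 : 0 <= N ^+ 3 * q ^+ 2 by rewrite mulr_ge0 ?sqr_ge0// exprn_ge0.
have EN0 : 0 <= nc E * N by rewrite mulr_ge0.
move: t1 q2 q3 b1 b2 b3 b4 b5 s1 s2 P0 EN0; rewrite -/E -/q.
have e5 : q * ((2 * N ^+ 3 * q ^+ 2 + 2 * N ^+ 2 * q) * (2 * N)) =
   q * (2 * N ^+ 3 * q ^+ 2 * (2 * N)) + 4 * (N ^+ 3 * q ^+ 2) by ring.
rewrite e5 exprMn.
rewrite (_ : 18 * N ^+ 3 * q ^+ 2 = 18 * (N ^+ 3 * q ^+ 2)); last by ring.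
rewrite (_ : 2 * N ^+ 3 * q ^+ 2 = 2 * (N ^+ 3 * q ^+ 2)); last by ring.
rewrite (_ : 2 * N ^+ 3 * (2 ^+ 2 * q ^+ 2) = 8 * (N ^+ 3 * q ^+ 2)); last by ring.
rewrite (_ : x * (N ^+ 2 * q) = N ^+ 2 * q * x); last by ring.
rewrite (_ : q * (x * N ^+ 2) = N ^+ 2 * q * x); last by ring.
rewrite (_ : 2 * N ^+ 2 * q * x = 2 * (N ^+ 2 * q * x)); last by ring.
rewrite (_ : 3 * N * nc E = 3 * (nc E * N)); last by ring.
clear; intros; lra.
Qed.

End pointwise_step.

(** * Convergence of one-step methods along dyadic meshes *)

Section dyadic_scheme.
Context {R : realType} {S : Type}.
Variables (d : S -> S -> R) (K : S -> Prop) (Phi : R -> S -> S) (h0 L C C0 : R).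
Hypotheses (h00 : 0 < h0) (L0 : 0 <= L) (Cge0 : 0 <= C) (C00 : 0 <= C0).
Hypothesis d_ge0 : forall x y, 0 <= d x y.
Hypothesis d_refl : forall x, d x x = 0.
Hypothesis d_sym : forall x y, d x y = d y x.
Hypothesis d_tri : forall x y z, K x -> K y -> K z -> d x z <= d x y + d y z.
Hypothesis complete : forall (X : nat -> S) (B : R), 0 <= B -> (forall n, K (X n)) ->
  (forall n, d (X n) (X n.+1) <= B * 2^-1 ^+ n) ->
  exists2 x, K x & forall n, d (X n) x <= 2 * B * 2^-1 ^+ n.
Hypothesis K_step : forall h x, 0 < h -> h <= h0 -> K x -> K (Phi h x).
Hypothesis stable : forall h x y, 0 < h -> h <= h0 -> K x -> K y ->
  d (Phi h x) (Phi h y) <= (1 + L * h) * d x y.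
Hypothesis consistent : forall h x, 0 < h -> 2 * h <= h0 -> K x ->
  d (Phi (2 * h) x) (Phi h (Phi h x)) <= C * h ^+ 2.
Hypothesis move_le : forall h x, 0 < h -> h <= h0 -> K x -> d x (Phi h x) <= C0 * h.

Definition mesh n : R := h0 * 2^-1 ^+ n.

Lemma mesh_gt0 n : 0 < mesh n. Proof. by rewrite mulr_gt0// exprn_gt0// invr_gt0. Qed.

Lemma mesh_le n : mesh n <= h0.
Proof. by rewrite ler_piMr ?(ltW h00)// exprn_ile1// ?invr_ge0// invf_le1// ler1n. Qed.

Lemma meshS n : 2 * mesh n.+1 = mesh n.
Proof. by rewrite /mesh exprS; move: (2^-1 ^+ n) => a; field. Qed.

Definition run h x (k : nat) : S := iter k (Phi h) x.

Lemma K_run h x k : 0 < h -> h <= h0 -> K x -> K (run h x k).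
Proof. by move=> hp hh Kx; elim: k => //= k IH; apply: K_step. Qed.

Lemma run_dist h x j k : 0 < h -> h <= h0 -> K x -> (j <= k)%N ->
  d (run h x j) (run h x k) <= C0 * ((k - j)%:R * h).
Proof.
move=> hp hh Kx /subnKC <-; rewrite addKn; elim: (k - j)%N => [|m IH].
  by rewrite addn0 d_refl mul0r mulr0.
have Kr i := @K_run h x i hp hh Kx.
rewrite addnS; apply: (le_trans (d_tri (Kr _) (Kr (j + m)%N) (Kr _))).
by rewrite -natr1 mulrDl mul1r mulrDr; apply: lerD => //; exact: move_le.
Qed.

(** Discrete Gronwall lemma: defects of order h^2 at each of the steps add up to
    a distance of order h. *)
Lemma run_double h x k : 0 < h -> 2 * h <= h0 -> K x ->
  d (run (2 * h) x k) (run h x (2 * k)) <= k%:R * (C * h ^+ 2) * (1 + L * (2 * h)) ^+ k.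
Proof.
move=> hp hh Kx; have h2 : 0 < 2 * h by rewrite mulr_gt0.
have hle : h <= h0 by apply: le_trans hh; rewrite ler_peMl ?(ltW hp)// ler1n.
have Kr i := @K_run h x i hp hle Kx; have Kr2 i := @K_run (2 * h) x i h2 hh Kx.
set q := 1 + _; have q1 : 1 <= q by rewrite lerDl !mulr_ge0// (ltW hp).
have c0 : 0 <= C * h ^+ 2 by rewrite mulr_ge0 ?sqr_ge0.
elim: k => [|k IH]; first by rewrite muln0 d_refl !mul0r.
rewrite mulnS add2n /= -/(run h x _) -/(run (2 * h) x _).
have := Kr (2 * k)%N; have := Kr2 k; move: IH.
set y := run _ _ (2 * k); set z := run _ _ k => IH Kz Ky.
have KK w : K w -> K (Phi h w) by exact: K_step.
apply: (le_trans (d_tri _ (K_step h2 hh Ky) _)); [exact: K_step|exact/KK/KK|].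
have s1 : d (Phi (2 * h) z) (Phi (2 * h) y) <= q * (k%:R * (C * h ^+ 2) * q ^+ k).
  by apply: (le_trans (stable _ _ _ _)) => //; rewrite ler_wpM2l// (le_trans ler01).
apply: (le_trans (lerD s1 (consistent _ _ _))) => //.
have qk : 1 <= q ^+ k.+1 by rewrite exprn_ege1.
have := ler_wpM2l c0 qk; rewrite -natr1 [q ^+ k.+1]exprS; set c := C * _; set a := q ^+ k; set b := k%:R.
by lra.
Qed.

Definition index (h t : R) : nat := Num.truncn (t / h).

Lemma index_le h t : 0 < h -> 0 <= t -> (index h t)%:R * h <= t.
Proof. by move=> hp t0; rewrite -ler_pdivlMr// truncn_le divr_ge0// ltW. Qed.

Lemma index_gt h t : 0 < h -> 0 <= t -> t < (index h t)%:R * h + h.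
Proof.
move=> hp t0; have /truncn_itv/andP[_] : 0 <= t / h by rewrite divr_ge0// ltW.
by rewrite ltr_pdivrMr// -natr1 mulrDl mul1r.
Qed.

Lemma index_mono h s t : 0 < h -> 0 <= s -> s <= t -> (index h s <= index h t)%N.
Proof.
move=> hp s0 st; rewrite /index truncn_ge_nat; last by rewrite divr_ge0 ?(le_trans s0 st) ?(ltW hp).
by rewrite ler_pdivlMr//; apply: le_trans st; exact: index_le.
Qed.

Lemma index_half h t : 0 < h -> 0 <= t ->
  (2 * index (2 * h) t <= index h t <= (2 * index (2 * h) t).+1)%N.
Proof.
move=> hp t0; have h2 : 0 < 2 * h by rewrite mulr_gt0.
have q0 : 0 <= t / h by rewrite divr_ge0// ltW.
apply/andP; split.
  rewrite {2}/index truncn_ge_nat// ler_pdivlMr// natrM.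
  by have := index_le h2 t0; rewrite mulrCA mulrA.
have h1 := index_le hp t0; have h3 := index_gt h2 t0.
rewrite -ltnS -(@ltr_nat R) -(ltr_pM2r hp); apply: (le_lt_trans h1); apply: (lt_le_trans h3).
by rewrite -!natr1 natrM !mulrDl; move: ((index _ _)%:R) => a; lra.
Qed.

Lemma scheme_cvg x : K x -> exists X : R -> S, X 0 = x /\ forall t, 0 <= t -> K (X t) /\
  exists2 B, 0 <= B & forall n, d (run (mesh n) x (index (mesh n) t)) (X t) <= B * 2^-1 ^+ n.
Proof.
move=> Kx.
suff H t : 0 <= t -> exists y, K y /\
  exists2 B, 0 <= B & forall n, d (run (mesh n) x (index (mesh n) t)) y <= B * 2^-1 ^+ n.
  have /choice[X HX] : forall t, exists y, 0 <= t -> K y /\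
    exists2 B, 0 <= B & forall n, d (run (mesh n) x (index (mesh n) t)) y <= B * 2^-1 ^+ n.
    move=> t; have [/H[y Hy]|_] := boolP (0 <= t); first by exists y.
    by exists x.
  exists (fun t => if t == 0 then x else X t); rewrite eqxx; split => // t t0.
  have [->|_] := eqVneq t 0; last exact: HX.
  split => //; exists 0 => // n.
  by rewrite /index mul0r truncn0 /run /= d_refl mul0r.
move=> t0.
have Kr n i : K (run (mesh n) x i) by apply: K_run => //; [exact: mesh_gt0|exact: mesh_le].
have e0 : 0 <= expR (L * t) by exact: expR_ge0.
pose B := (t * C * expR (L * t) + C0) * h0.
have B0 : 0 <= B by rewrite mulr_ge0 ?(ltW h00)// addr_ge0// !mulr_ge0.
have [|y Ky Hy] := @complete (fun n => run (mesh n) x (index (mesh n) t)) B B0 (fun n => Kr n _).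
  move=> n; set h := mesh n.+1; have hp : 0 < h := mesh_gt0 _.
  have h2 : 2 * h <= h0 by rewrite meshS; exact: mesh_le.
  have hle : h <= h0 by exact: mesh_le.
  rewrite -meshS -/h; set k := index (2 * h) t.
  have K1 i : K (run h x i) by exact: Kr.
  have K2 i : K (run (2 * h) x i) by rewrite meshS; exact: Kr.
  apply: (le_trans (d_tri (K2 k) (K1 (2 * k)%N) (K1 _))).
  have /andP[i1 i2] := index_half hp t0; rewrite -/k in i1 i2.
  have kt : k%:R * (2 * h) <= t by apply: index_le => //; rewrite mulr_gt0.
  have s1 : d (run (2 * h) x k) (run h x (2 * k)) <= t * C * expR (L * t) * h.
    apply: (le_trans (run_double k hp h2 Kx)).
    have p : (1 + L * (2 * h)) ^+ k <= expR (L * t).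
      apply: (@le_trans _ _ (expR (L * (2 * h)) ^+ k)).
        apply: lerXn2r (expR_ge1Dx _); rewrite nnegrE ?expR_ge0// addr_ge0// !mulr_ge0//; exact: ltW.
      by rewrite -expRM_natl ler_expR mulrCA ler_wpM2l.
    have q : k%:R * (C * h ^+ 2) <= t * C * h.
      rewrite (_ : k%:R * _ = k%:R * h * C * h); last by rewrite expr2; ring.
      rewrite ler_wpM2r ?(ltW hp)// ler_wpM2r//.
      by move: kt; have : 0 <= k%:R * h; [rewrite mulr_ge0// ltW|set a := k%:R; nra].
    have g1 : 0 <= k%:R * (C * h ^+ 2) by rewrite mulr_ge0 ?ler0n// mulr_ge0 ?sqr_ge0.
    have g2 : 0 <= (1 + L * (2 * h)) ^+ k.
      by rewrite exprn_ge0// addr_ge0// !mulr_ge0//; exact: ltW.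
    by apply: (le_trans (ler_pM g1 g2 q p)); rewrite mulrAC.
  have s2 : d (run h x (2 * k)) (run h x (index h t)) <= C0 * h.
    apply: (le_trans (run_dist hp hle Kx i1)).
    rewrite ler_wpM2l// ler_piMl ?(ltW hp)//.
    by rewrite -[1]/(1%:R) ler_nat leq_subLR addn1.
  apply: (le_trans (lerD s1 s2)); rewrite -mulrDl.
  rewrite [leRHS](_ : _ = (t * C * expR (L * t) + C0) * (2 * h)); last by rewrite meshS /B /mesh mulrA.
  rewrite ler_wpM2l//; first by rewrite addr_ge0// !mulr_ge0.
  by rewrite ler_peMl ?(ltW hp)// ler1n.
by exists y; split => //; exists (2 * B); [rewrite mulr_ge0|].
Qed.

End dyadic_scheme.

(** * States of the evolution of the symbol *)

Section states.
Context {R : realType}.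
Local Notation C := R[i].
Local Notation mu := (@torus_measure R).
Local Notation nc := (@Normc.normc R).
Implicit Types (f g u v b : R -> C) (x y h : R) (A c : C).

Local Opaque n2 L2 Szego fourier inner.

Lemma L2_nc f : L2 f -> L2 (fun x => (nc (f x))%:C%C).
Proof.
move=> lf; apply: (@L2_mono _ _ f 1) => //.
  exact: cmeas_real (measurable_modulus (L2_meas lf)).
by move=> x; rewrite nc_real ger0_norm ?nc_ge0// mul1r.
Qed.

Lemma n2_nc f : n2 (fun x => (nc (f x))%:C%C) = n2 f.
Proof. by apply: n2_eq => x; rewrite nc_real ger0_norm ?nc_ge0. Qed.

Lemma n2_le3 f g1 g2 (p q r : R) : 0 <= p -> 0 <= q -> 0 <= r -> cmeas f -> L2 g1 -> L2 g2 ->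
  (forall x, nc (f x) <= p * nc (g1 x) + q * nc (g2 x) + r) ->
  n2 f <= p * n2 g1 + q * n2 g2 + r.
Proof.
move=> p0 q0 r0 mf l1 l2 H.
have k1 := L2Z p%:C%C (L2_nc l1); have k2 := L2Z q%:C%C (L2_nc l2).
have k3 := L2D k1 k2; have k4 := L2_cst (r%:C%C).
have h : n2 f <= 1 * n2 (fun x => p%:C%C * (nc (g1 x))%:C%C + q%:C%C * (nc (g2 x))%:C%C + r%:C%C).
  apply: n2_mono => //; first exact: L2D.
  move=> x; rewrite mul1r -!CM -!CD nc_real; apply: le_trans (H x) (ler_norm _).
rewrite mul1r in h; apply: (le_trans h); apply: (le_trans (n2D k3 k4)).
rewrite n2_cst nc_real ger0_norm// lerD2r; apply: (le_trans (n2D k1 k2)).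
by rewrite (n2Z _ (L2_nc l1)) (n2Z _ (L2_nc l2)) !n2_nc !nc_real !ger0_norm.
Qed.

Definition state := ((R -> C) * C)%type.
Implicit Types s : state.

Definition profile s : R -> C := fun x => Szego s.1 x - fourier s.1 0 + s.2.
Definition state_dist s s' : R := n2 (fun x => s.1 x - s'.1 x) + nc (s.2 - s'.2).

Lemma state_dist_ge0 s s' : 0 <= state_dist s s'.
Proof. by rewrite addr_ge0 ?n2_ge0 ?nc_ge0. Qed.

Lemma state_dist_refl s : state_dist s s = 0.
Proof.
rewrite /state_dist subrr nc0 addr0; under eq_fun do rewrite subrr.
by rewrite n2_cst nc0.
Qed.

Lemma state_dist_sym s s' : state_dist s s' = state_dist s' s.
Proof. by rewrite /state_dist n2_sub nc_sub. Qed.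

Variables (N rho M : R).
Hypotheses (N0 : 0 <= N) (rho0 : 0 <= rho) (ME : M = 2 * N + rho + 2).

Let M1 : 1 <= M. Proof. by have := N0; have := rho0; rewrite ME; lra. Qed.
Let M0 : 0 <= M. Proof. exact: le_trans ler01 M1. Qed.
Let NM : N <= M. Proof. by have := N0; have := rho0; rewrite ME; lra. Qed.
Let Mpow j k : (j <= k)%N -> M ^+ j <= M ^+ k. Proof. exact: ler_weXn2l. Qed.
Let Mn0 n : 0 <= M ^+ n. Proof. exact: exprn_ge0. Qed.

Definition in_states s := Bd N s.1 /\ nc s.2 <= rho + 2.

Lemma state_L2 s : in_states s -> L2 s.1. Proof. by move=> [/Bd_L2]. Qed.

Lemma state_dist_tri s1 s2 s3 : in_states s1 -> in_states s2 -> in_states s3 ->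
  state_dist s1 s3 <= state_dist s1 s2 + state_dist s2 s3.
Proof.
move=> /state_L2 l1 /state_L2 l2 /state_L2 l3; rewrite /state_dist.
have h := n2_trans l1 l2 l3.
have k : nc (s1.2 - s3.2) <= nc (s1.2 - s2.2) + nc (s2.2 - s3.2).
  by rewrite (_ : s1.2 - s3.2 = (s1.2 - s2.2) + (s2.2 - s3.2)) ?ncD//; ring.
by move: h k; set a := nc _; set b := nc _; set c := nc _; abs_lra.
Qed.

Lemma nc_mean s : in_states s -> nc (fourier s.1 0) <= N.
Proof.
move=> [Bb _]; have lb := Bd_L2 Bb; apply: (le_trans (fourier_le 0 (L2_L1 lb))).
exact: le_trans (N1_le_n2 lb) (Bd_n2 Bb).
Qed.

Lemma fourier_shift f c k : L2 f ->
  fourier (fun x => f x + c) k = fourier f k + (k == 0)%:R * c.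
Proof.
move=> lf; rewrite (fourierD k (L2_L1 lf) (L2_L1 (L2_cst c))); congr (_ + _).
have -> : (fun=> c) = (fun x => c * @cexp R 0 x).
  by apply/funext => x; rewrite cexp0 mulr1.
by rewrite fourierZ ?fourier_cexp 1?mulrC ?[0 == _]eq_sym//; exact: L1_cexp.
Qed.

Lemma profileE s : profile s = (fun x => Szego s.1 x + (s.2 - fourier s.1 0)).
Proof. by apply/funext => x; rewrite /profile; ring. Qed.

Lemma profile_L2p s : in_states s -> L2p (profile s).
Proof.
by move=> /state_L2 l; rewrite profileE; apply: L2pD; [exact: L2p_Szego|exact: L2p_cst].
Qed.

Lemma fourier_profile s (j : nat) : in_states s ->
  fourier (profile s) j%:Z = if j is 0%N then s.2 else fourier s.1 j%:Z.
Proof.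
move=> /state_L2 l; rewrite profileE fourier_shift; last exact: L2_Szego.
rewrite fourier_Szego//; case: j => [|j] /=.
  by rewrite mul1r addrC subrK.
by rewrite mul0r addr0.
Qed.

Lemma profile_tail s : in_states s -> tail_symbol s.1 (profile s).
Proof. by move=> Ks j; rewrite fourier_profile. Qed.

Lemma HB_profile s : in_states s -> HB M (profile s).
Proof.
move=> Ks; have l := state_L2 Ks; have lp := profile_L2p Ks; have hm := nc_mean Ks.
have [[mb bN] cr] := Ks.
pose b' x := s.1 x + (s.2 - fourier s.1 0).
have lb' : L2 b' by apply: L2D => //; exact: L2_cst.
have b'M x : nc (b' x) <= M.
  apply: (le_trans (ncD _ _)); have := ncB s.2 (fourier s.1 0); have := bN x; rewrite ME.
  by move: hm cr; set a := nc _; set a2 := nc _; set a3 := nc _; set a4 := nc _; lra.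
apply: HB_ae (HB_Szego (L2_meas lb') b'M) _; first exact: (L2_meas (L2p_L2 lp)).
have h := @Szego_uniq _ b' (profile s) lb' lp.
have := h; have hf (j : nat) : fourier (profile s) j%:Z = fourier b' j%:Z.
  rewrite profileE (fourier_shift _ _ (L2_Szego l)) (fourier_shift _ _ l).
  by rewrite fourier_Szego.
by move=> /(_ hf); apply: ae_imp => x ->.
Qed.

Lemma n2_profile s : in_states s -> n2 (profile s) <= M.
Proof.
move=> Ks; have l := state_L2 Ks; have hm := nc_mean Ks; have [Bb cr] := Ks.
have ls := L2_Szego l; rewrite profileE; apply: (le_trans (n2D ls (L2_cst _))); rewrite n2_cst.
have := n2_Szego l; have := Bd_n2 Bb; have := ncB s.2 (fourier s.1 0).
by rewrite ME; move: hm cr; set a := nc _; set a2 := nc _; set a3 := nc _; abs_lra.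
Qed.

Lemma L4_profile s : in_states s -> L4 (profile s) /\ n4 (profile s) <= 2 * M.
Proof.
move=> Ks; have [l h] := HB_L4 M0 (HB_profile Ks); split => //.
rewrite -(@ler_pXn2r _ 2)// ?nnegrE ?n4_ge0 ?mulr_ge0//; apply: (le_trans h).
have p : 0 <= 3 * M by rewrite mulr_ge0.
apply: (le_trans (ler_wpM2l p (n2_profile Ks))); rewrite exprMn -mulrA -expr2.
by rewrite ler_wpM2r ?sqr_ge0//; lra.
Qed.

Lemma L2_profile s : in_states s -> L2 (profile s).
Proof. by move=> /profile_L2p/L2p_L2. Qed.

Lemma n2_profileB s s' : in_states s -> in_states s' ->
  n2 (fun x => profile s x - profile s' x) <= 2 * state_dist s s'.
Proof.
move=> Ks Ks'; have l := state_L2 Ks; have l' := state_L2 Ks'.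
rewrite (_ : (fun x => _) = (fun x => (Szego s.1 x - Szego s'.1 x) +
  ((s.2 - s'.2) - (fourier s.1 0 - fourier s'.1 0)))); last first.
  by apply/funext => x; rewrite /profile; ring.
apply: (le_trans (n2D (L2B (L2_Szego l) (L2_Szego l')) (L2_cst _))); rewrite n2_cst.
have := n2_SzegoB l l'; have := fourier_n2 0 l l'; have := nc_ge0 (s.2 - s'.2).
have := ncB (s.2 - s'.2) (fourier s.1 0 - fourier s'.1 0); rewrite /state_dist.
by set a := nc _; set a2 := nc _; set a3 := nc _; abs_lra.
Qed.

(** The cut-off freezes the evolution when the mean becomes too large, so that
    the set of states is invariant; it equals 1 along the solutions because of
    the conservation of mass. *)
Definition cutoff c : R := clamp (rho + 1 - nc c).
Definition coupling s : C := (cutoff s.2)%:C%C * J (profile s).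

Lemma cutoff_bd c : 0 <= cutoff c <= 1.
Proof. by rewrite /cutoff /clamp le_min ler01 le_max lexx/= ge_min lexx. Qed.

Lemma cutoff_lip c c' : `|cutoff c - cutoff c'| <= nc (c - c').
Proof.
apply: (le_trans (clamp_lip _ _)).
have := ncD (c - c') c'; have := ncD (c' - c) c; rewrite !subrK (nc_sub c').
rewrite ler_norml; set a := nc _; set b := nc _; set d := nc _ => ? ?; apply/andP; split; lra.
Qed.

Lemma cutoff1 c : nc c <= rho -> cutoff c = 1.
Proof.
move=> h; have h1 : 1 <= rho + 1 - nc c by lra.
by rewrite /cutoff /clamp (max_idPr _) ?(le_trans ler01)// (min_idPl _).
Qed.

Lemma cutoff0 c : rho + 1 <= nc c -> cutoff c = 0.
Proof.
by move=> h; rewrite /cutoff /clamp (max_idPl _) ?subr_le0// (min_idPr _).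
Qed.

Lemma nc_J_profile s : in_states s -> nc (J (profile s)) <= M ^+ 3.
Proof.
move=> Ks; apply: (le_trans (J_HB M0 (HB_profile Ks))); rewrite [M ^+ 3]exprS ler_wpM2l//.
by apply: lerXn2r (n2_profile Ks); rewrite nnegrE ?n2_ge0.
Qed.

Lemma nc_coupling s : in_states s -> nc (coupling s) <= M ^+ 3.
Proof.
move=> Ks; have /andP[c0 c1] := cutoff_bd s.2.
rewrite ncM nc_real ger0_norm//; apply: le_trans (nc_J_profile Ks).
by rewrite ler_piMl ?nc_ge0.
Qed.

Lemma coupling_lip s s' : in_states s -> in_states s' ->
  nc (coupling s - coupling s') <= 25 * M ^+ 3 * state_dist s s'.
Proof.
move=> Ks Ks'; have [l4 k4] := L4_profile Ks; have [l4' k4'] := L4_profile Ks'.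
have hJ := J_lip l4 l4' k4 k4'; have hU := n2_profileB Ks Ks'.
have /andP[c0 c1] := cutoff_bd s.2.
have -> : coupling s - coupling s' = (cutoff s.2)%:C%C * (J (profile s) - J (profile s')) +
   (cutoff s.2 - cutoff s'.2)%:C%C * J (profile s') by rewrite /coupling CB; ring.
apply: (le_trans (ncD _ _)); rewrite !ncM !nc_real (ger0_norm c0).
set D := state_dist s s'; have D0 : 0 <= D := state_dist_ge0 _ _.
have hc : `|cutoff s.2 - cutoff s'.2| <= D.
  by apply: (le_trans (cutoff_lip _ _)); rewrite lerDr n2_ge0.
have h1 : cutoff s.2 * nc (J (profile s) - J (profile s')) <= 24 * M ^+ 3 * D.
  apply: (@le_trans _ _ (nc (J (profile s) - J (profile s')))); first by rewrite ler_piMl ?nc_ge0.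
  have p : 0 <= 3 * (2 * M) ^+ 2 by rewrite mulr_ge0 ?sqr_ge0.
  apply: (le_trans hJ); apply: (le_trans (ler_wpM2l p hU)).
  rewrite [leLHS](_ : _ = 24 * M ^+ 2 * D); last by rewrite -/D; ring.
  by rewrite ler_wpM2r// ler_wpM2l// Mpow.
have h2 : `|cutoff s.2 - cutoff s'.2| * nc (J (profile s')) <= D * M ^+ 3.
  by apply: ler_pM; rewrite ?nc_ge0 ?nc_J_profile.
by apply: (le_trans (lerD h1 h2)); rewrite le_eqVlt; apply/orP; left; apply/eqP; ring.
Qed.

(** The rotation speed: b rotates so that w = u - b stays antiholomorphic. *)
Definition phase s x : R := 4 * complex.Re (conjc (coupling s) * profile s x).

Lemma nc_phase s x : nc (phase s x)%:C%C <= 4 * nc (coupling s) * nc (profile s x).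
Proof.
rewrite nc_real normrM ger0_norm// -mulrA ler_wpM2l// (le_trans (nc_Re _))//.
by rewrite ncM nc_conj.
Qed.

Lemma nc_phaseB s s' x : nc ((phase s x)%:C%C - (phase s' x)%:C%C) <=
  4 * nc (coupling s) * nc (profile s x - profile s' x) +
  4 * nc (coupling s - coupling s') * nc (profile s' x).
Proof.
rewrite -CB nc_real /phase; move: (coupling s) (coupling s') => A B.
rewrite -mulrBr normrM ger0_norm// -!mulrA -mulrDr ler_wpM2l//.
rewrite -Re_N -Re_D (le_trans (nc_Re _))//.
rewrite (_ : _ - _ = conjc A * (profile s x - profile s' x) + conjc (A - B) * profile s' x); last by rewrite conjcB; ring.
by apply: (le_trans (ncD _ _)); rewrite !ncM !nc_conj.
Qed.

Lemma cmeas_phase s : in_states s -> cmeas (fun x => (phase s x)%:C%C).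
Proof.
move=> Ks; apply: cmeas_real; have m := L2_meas (L2Z (conjc (coupling s)) (L2_profile Ks)).
by have [mr _] := m; apply: measurable_funM => //; exact: measurable_cst.
Qed.

Lemma L4_phase s : in_states s ->
  L4 (fun x => (phase s x)%:C%C) /\ n4 (fun x => (phase s x)%:C%C) <= 8 * M ^+ 4.
Proof.
move=> Ks; have [l4 k4] := L4_profile Ks.
have c0 : 0 <= 4 * nc (coupling s) by rewrite mulr_ge0 ?nc_ge0.
have [l k] := L4_mono c0 (cmeas_phase Ks) l4 (@nc_phase s); split => //.
have q : 4 * nc (coupling s) <= 4 * M ^+ 3 by rewrite ler_wpM2l// nc_coupling.
apply: (le_trans k); apply: (le_trans (ler_pM c0 (n4_ge0 _) q k4)).
by rewrite le_eqVlt; apply/orP; left; apply/eqP; ring.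
Qed.

Lemma L2_phase s : in_states s -> L2 (fun x => (phase s x)%:C%C).
Proof. by move=> /L4_phase[[]]. Qed.

Lemma n2_phase s : in_states s -> n2 (fun x => (phase s x)%:C%C) <= 4 * M ^+ 4.
Proof.
move=> Ks; have c0 : 0 <= 4 * nc (coupling s) by rewrite mulr_ge0 ?nc_ge0.
have k := n2_mono c0 (cmeas_phase Ks) (L2_profile Ks) (@nc_phase s).
have q : 4 * nc (coupling s) <= 4 * M ^+ 3 by rewrite ler_wpM2l// nc_coupling.
apply: (le_trans k); apply: (le_trans (ler_pM c0 (n2_ge0 _) q (n2_profile Ks))).
by rewrite le_eqVlt; apply/orP; left; apply/eqP; ring.
Qed.

Lemma n2_phaseB s s' : in_states s -> in_states s' ->
  n2 (fun x => (phase s x)%:C%C - (phase s' x)%:C%C) <= 108 * M ^+ 4 * state_dist s s'.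
Proof.
move=> Ks Ks'; set D := state_dist s s'; have D0 : 0 <= D := state_dist_ge0 _ _.
have c0 : 0 <= 4 * nc (coupling s) by rewrite mulr_ge0 ?nc_ge0.
have c1 : 0 <= 4 * nc (coupling s - coupling s') by rewrite mulr_ge0 ?nc_ge0.
have k := @n2_le3 _ _ _ _ _ 0 c0 c1 (lexx 0) (L2_meas (L2B (L2_phase Ks) (L2_phase Ks')))
  (L2B (L2_profile Ks) (L2_profile Ks')) (L2_profile Ks')
  (fun x => le_trans (nc_phaseB s s' x) (eq_ind_r (fun y => _ <= y) (lexx _) (addr0 _))).
have q1 : 4 * nc (coupling s) <= 4 * M ^+ 3 by rewrite ler_wpM2l// nc_coupling.
have q2 : 4 * nc (coupling s - coupling s') <= 4 * (25 * M ^+ 3 * D).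
  by rewrite ler_wpM2l// coupling_lip.
have h1 := ler_pM c0 (n2_ge0 _) q1 (n2_profileB Ks Ks').
have h2 := ler_pM c1 (n2_ge0 _) q2 (n2_profile Ks').
rewrite addr0 in k; apply: (le_trans k); apply: (le_trans (lerD h1 h2)); rewrite -/D.
rewrite [leLHS](_ : _ = 8 * (M ^+ 3 * D) + 100 * (M ^+ 4 * D)); last by ring.
have : M ^+ 3 * D <= M ^+ 4 * D by rewrite ler_wpM2r// Mpow.
by rewrite -[108 * _ * _]mulrA; set a := _ * D; set b := _ * D; lra.
Qed.

Definition mean_drift s : C :=
  2 * coupling s * (n2 (profile s) ^+ 2)%:C%C + conjc (coupling s) * s.2 ^+ 2.

Lemma nc_mean_le s : in_states s -> nc s.2 <= M.
Proof. by move=> [_ h]; have := N0; rewrite ME; lra. Qed.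

Lemma sq_M (t : R) : 0 <= t -> t <= M -> t ^+ 2 <= M ^+ 2.
Proof. by move=> t0 tM; apply: lerXn2r tM; rewrite nnegrE. Qed.

Lemma nc_mean_drift s : in_states s -> nc (mean_drift s) <= 3 * M ^+ 5.
Proof.
move=> Ks; have nA := nc_coupling Ks; rewrite /mean_drift; move: (coupling s) nA => A nA.
apply: (le_trans (ncD _ _)); rewrite (ncM (conjc A)) ncX nc_conj !ncM nc2 nc_real ger0_norm ?sqr_ge0//.
have h1 := ler_pM (nc_ge0 _) (sqr_ge0 _) nA (sq_M (n2_ge0 _) (n2_profile Ks)).
have h2 := ler_pM (nc_ge0 _) (sqr_ge0 _) nA (sq_M (nc_ge0 _) (nc_mean_le Ks)).
move: h1 h2; rewrite -exprD -[2 * nc _ * _]mulrA; set a := _ * n2 _ ^+ 2; set b := _ * nc _ ^+ 2.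
lra.
Qed.

Lemma sq_diff (t t' D : R) : 0 <= t -> t <= M -> 0 <= t' -> t' <= M -> `|t - t'| <= D ->
  `|t ^+ 2 - t' ^+ 2| <= 2 * M * D.
Proof.
move=> t0 tM t0' tM' h; rewrite subr_sqr normrM mulrC; apply: ler_pM; rewrite ?normr_ge0//.
by rewrite ger0_norm ?addr_ge0//; lra.
Qed.

Lemma mean_drift_lip s s' : in_states s -> in_states s' ->
  nc (mean_drift s - mean_drift s') <= 85 * M ^+ 5 * state_dist s s'.
Proof.
move=> Ks Ks'; set D := state_dist s s'; have D0 : 0 <= D := state_dist_ge0 _ _.
have nA := nc_coupling Ks; have nB := coupling_lip Ks Ks'; rewrite -/D in nB.
rewrite /mean_drift; move: (coupling s) (coupling s') nA nB => A B nA nB.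
rewrite (_ : _ - _ = 
   2 * A * (n2 (profile s) ^+ 2 - n2 (profile s') ^+ 2)%:C%C +
   2 * (A - B) * (n2 (profile s') ^+ 2)%:C%C +
   (conjc A * ((s.2 - s'.2) * (s.2 + s'.2)) + conjc (A - B) * s'.2 ^+ 2)); last first.
  by rewrite CB conjcB; ring.
have pB : 0 <= 25 * M ^+ 3 * D by rewrite !mulr_ge0.
have d1 : `|n2 (profile s) ^+ 2 - n2 (profile s') ^+ 2| <= 2 * M * (2 * D).
  apply: sq_diff; rewrite ?n2_ge0 ?n2_profile//.
  exact: le_trans (n2_dist (L2_profile Ks) (L2_profile Ks')) (n2_profileB Ks Ks').
have e1 : nc (2 * A * (n2 (profile s) ^+ 2 - n2 (profile s') ^+ 2)%:C%C) <=
    2 * M ^+ 3 * (2 * M * (2 * D)).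
  rewrite !ncM nc2 nc_real; apply: ler_pM; rewrite ?mulr_ge0 ?nc_ge0 ?normr_ge0//.
  by rewrite ler_wpM2l.
have e2 : nc (2 * (A - B) * (n2 (profile s') ^+ 2)%:C%C) <=
    2 * (25 * M ^+ 3 * D) * M ^+ 2.
  rewrite !ncM nc2 nc_real ger0_norm ?sqr_ge0//.
  have p : 0 <= 2 * nc (A - B) by rewrite mulr_ge0 ?nc_ge0.
  have k : 2 * nc (A - B) <= 2 * (25 * M ^+ 3 * D) by rewrite ler_wpM2l.
  exact: ler_pM p (sqr_ge0 _) k (sq_M (n2_ge0 _) (n2_profile Ks')).
have e3 : nc (conjc A * ((s.2 - s'.2) * (s.2 + s'.2))) <= M ^+ 3 * (D * (2 * M)).
  rewrite !ncM nc_conj; apply: ler_pM; rewrite ?mulr_ge0 ?nc_ge0//.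
  apply: ler_pM; rewrite ?nc_ge0 ?lerDr ?n2_ge0//.
  have := nc_mean_le Ks; have := nc_mean_le Ks'; have := ncD s.2 s'.2.
  by set a := nc _; set b := nc _; set c := nc _; lra.
have e4 : nc (conjc (A - B) * s'.2 ^+ 2) <= 25 * M ^+ 3 * D * M ^+ 2.
  rewrite ncM ncX nc_conj; apply: ler_pM; rewrite ?nc_ge0 ?sqr_ge0//.
  by apply: sq_M; rewrite ?nc_ge0 ?nc_mean_le.
apply: (le_trans (ncD _ _)); apply: (le_trans (lerD (ncD _ _) (ncD _ _))).
apply: (le_trans (lerD (lerD e1 e2) (lerD e3 e4))).
rewrite [leLHS](_ : _ = 75 * (M ^+ 5 * D) + 10 * (M ^+ 4 * D)); last by ring.
have : M ^+ 4 * D <= M ^+ 5 * D by rewrite ler_wpM2r// Mpow.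
by rewrite -[85 * _ * _]mulrA; set a := _ * D; set b := _ * D; lra.
Qed.

End states.

(** * The step on symbols and its stability *)

Lemma fourier_cst {R : realType} (c : R[i]) : fourier (fun=> c) 0 = c.
Proof.
rewrite /fourier /inner -[RHS]cint_cst; congr cintegral; apply/funext => x.
by rewrite cexp0 rmorph1 mulr1.
Qed.

Section steps.
Context {R : realType}.
Local Notation C := R[i].
Local Notation mu := (@torus_measure R).
Local Notation nc := (@Normc.normc R).
Implicit Types (f g u v b : R -> C) (x y h : R) (A c : C).
Local Notation state := (@state R).
Implicit Types s : state.
Local Opaque n2 L2 Szego fourier inner.
Variables (N rho M : R).
Hypotheses (N0 : 0 <= N) (rho0 : 0 <= rho) (ME : M = 2 * N + rho + 2).
Let M1 : 1 <= M. Proof. by have := N0; have := rho0; rewrite ME; lra. Qed.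
Let M0 : 0 <= M. Proof. exact: le_trans ler01 M1. Qed.
Let NM : N <= M. Proof. by have := N0; have := rho0; rewrite ME; lra. Qed.
Let Mpow j k : (j <= k)%N -> M ^+ j <= M ^+ k. Proof. exact: ler_weXn2l. Qed.
Let Mn0 n : 0 <= M ^+ n. Proof. exact: exprn_ge0. Qed.
Local Notation L4_profile := (L4_profile N0 rho0 ME).
Local Notation nc_coupling := (nc_coupling N0 rho0 ME).
Local Notation coupling_lip := (coupling_lip N0 rho0 ME).
Local Notation L4_phase := (L4_phase N0 rho0 ME).
Local Notation n2_phase := (n2_phase N0 rho0 ME).
Local Notation L2_phase := (L2_phase N0 rho0 ME).
Local Notation n2_phaseB := (n2_phaseB N0 rho0 ME).
Local Notation nc_mean_drift := (nc_mean_drift N0 rho0 ME).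
Local Notation mean_drift_lip := (mean_drift_lip N0 rho0 ME).
Local Notation phase := (phase rho).
Local Notation coupling := (coupling rho).
Local Notation mean_drift := (mean_drift rho).
Local Notation in_states := (in_states N rho).
Let Npow j : N ^+ j <= M ^+ j. Proof. by apply: lerXn2r; rewrite ?nnegrE. Qed.
Let Nn0 n : 0 <= N ^+ n. Proof. exact: exprn_ge0. Qed.

Lemma state_complete (X : nat -> state) (B : R) : 0 <= B -> (forall n, in_states (X n)) ->
  (forall n, state_dist (X n) (X n.+1) <= B * 2^-1 ^+ n) ->
  exists2 s, in_states s & forall n, state_dist (X n) s <= 2 * B * 2^-1 ^+ n.
Proof.
move=> B0 KX dX.
have e0 n : 0 < (2^-1 : R) ^+ n by rewrite exprn_gt0// invr_gt0.
have dXk n k : state_dist (X n) (X (n + k)%N) <= 2 * B * (2^-1 ^+ n - 2^-1 ^+ (n + k)).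
  elim: k => [|k IH]; first by rewrite addn0 state_dist_refl subrr mulr0.
  rewrite addnS; apply: (le_trans (state_dist_tri (KX _) (KX (n + k)%N) (KX _))).
  apply: (le_trans (lerD IH (dX _))); rewrite exprS; set a := 2^-1 ^+ n; set a' := _ ^+ (n + k).
  by rewrite le_eqVlt; apply/orP; left; apply/eqP; field.
have B2 : 0 <= 2 * B by rewrite mulr_ge0.
have dXm n m : (n <= m)%N -> state_dist (X n) (X m) <= 2 * B * 2^-1 ^+ n.
  move=> /subnKC <-; apply: (le_trans (dXk _ _)); rewrite ler_wpM2l// gerBl; exact: ltW.
have small e : 0 < e -> exists n0, forall n m, (n0 <= n)%N -> (n0 <= m)%N ->
    state_dist (X n) (X m) <= e.
  move=> ep; have ep' : 0 < e / (2 * B + 1) by rewrite divr_gt0// ltr_wpDl.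
  have /cvgr0_norm_le/(_ _ ep')[n0 _ H] : (fun n => (2^-1 : R) ^+ n) @ \oo --> (0 : R).
    by apply: cvg_expr; rewrite ger0_norm ?invr_ge0// invf_lt1// ltr1n.
  have H' n : (n0 <= n)%N -> 2 * B * 2^-1 ^+ n <= e.
    move=> h; have := H n h; rewrite /= ger0_norm ?(ltW (e0 _))// => k.
    exact: le_trans (ler_wpM2l B2 k) (frac_le B2 ep).
  exists n0 => n m hn hm; case: (leqP n m) => nm; first exact: le_trans (dXm _ _ nm) (H' _ hn).
  by rewrite state_dist_sym (le_trans (dXm _ _ (ltnW nm)))// H'.
have lX n : L2 (X n).1 := state_L2 (KX n).
have [g lg Hg] : exists2 g, L2 g & L2_cvg (fun n => (X n).1) g.
  apply: (riesz_fischer lX) => e ep; have [n0 H] := small e ep; exists n0 => n m hn hm.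
  by apply: le_trans (H n m hn hm); rewrite lerDl nc_ge0.
have lc n : L2 (fun _ : R => (X n).2) := L2_cst _.
have [w lw Hw] : exists2 w, L2 w & L2_cvg (fun n _ => (X n).2) w.
  apply: (riesz_fischer lc) => e ep; have [n0 H] := small e ep; exists n0 => n m hn hm.
  by apply: le_trans (H n m hn hm); rewrite n2_cst lerDr n2_ge0.
have [b Bb bg] := @Bd_closed _ N _ g N0 (fun n => (KX n).1) lg Hg.
have lb := Bd_L2 Bb.
pose c := fourier w 0.
have cn n : nc ((X n).2 - c) <= n2 (fun x => (X n).2 - w x).
  have := fourier_n2 0 (lc n) lw; by rewrite fourier_cst.
have bn n : n2 (fun x => (X n).1 x - b x) = n2 (fun x => (X n).1 x - g x).
  apply: n2_ae; [exact: L2_meas (L2B _ lb)|exact: L2_meas (L2B _ lg)|].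
  by apply: ae_imp bg => x ->.
have lim e : 0 < e -> exists n0, forall n, (n0 <= n)%N -> state_dist (X n) (b, c) <= e.
  move=> ep; have e2 : 0 < e / 2 by rewrite divr_gt0.
  have [n1 H1] := Hg _ e2; have [n2' H2] := Hw _ e2; exists (maxn n1 n2') => n.
  rewrite geq_max => /andP[h1 h2]; rewrite /state_dist /= bn.
  have := H1 n h1; have := H2 n h2; have := cn n; set z := nc _; abs_lra.
have Kbc : in_states (b, c).
  split => //=; apply/ler_addgt0Pr => e ep; have [n0 /(_ _ (leqnn _)) H] := lim e ep.
  have [_ k] := KX n0.
  have h1 : nc c <= nc (X n0).2 + nc ((X n0).2 - c).
    have := ncB (X n0).2 ((X n0).2 - c).
    by rewrite (_ : (X n0).2 - ((X n0).2 - c) = c)//; ring.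
  have h2 : nc ((X n0).2 - c) <= e by apply: le_trans H; rewrite lerDr n2_ge0.
  by move: k h1 h2; set z1 := nc _; set z2 := nc _; set z3 := nc _; lra.
exists (b, c) => // n; apply/ler_addgt0Pr => e ep; have [n0 H] := lim e ep.
apply: (le_trans (state_dist_tri (KX n) (KX (maxn n n0)) Kbc)); apply: lerD.
  by apply: dXm; exact: leq_maxl.
by apply: H; exact: leq_maxr.
Qed.

Lemma cmeas_cayley (p : R -> R) : measurable_fun setT p -> cmeas (fun x => cayley (p x)).
Proof.
move=> mp; have m2 : measurable_fun setT (fun x => p x / 2).
  by apply: measurable_funM => //; exact: measurable_cst.
pose q x : R := 1 + (p x / 2) ^+ 2.
have mq : measurable_fun setT q.
  by apply: measurable_funD; [exact: measurable_cst|exact: measurable_funX].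
have mi : measurable_fun setT (fun x => (q x)^-1).
  rewrite (_ : (fun x => _) = (fun x => q x `^ (-1))).
    exact: measurableT_comp (measurable_powR (-1)) mq.
  by apply/funext => x; rewrite powR_inv1// addr_ge0// sqr_ge0.
have mw : cmeas (fun x => 1 + 'i%C * (p x / 2)%:C%C).
  apply: cmeasD; first exact: cmeas_cst.
  by apply: cmeasM; [exact: cmeas_cst|exact: cmeas_real].
rewrite (_ : (fun x => _) = (fun x => (1 + 'i%C * (p x / 2)%:C%C) ^+ 2 * ((q x)^-1)%:C%C)).
  by apply: cmeasM; [exact: cmeasX|exact: cmeas_real].
apply/funext => x; have -> : 1 + 'i%C * (p x / 2)%:C%C = Complex 1 (p x / 2).
  by apply: eq_C; rewrite ?(Re_D, Im_D, Re_M, Im_M)/=; ring.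
rewrite /cayley; set w := Complex _ _.
have w0 : conjc w != 0 by exact: cayley_den_neq0.
apply: (mulIf w0); rewrite divfK//.
transitivity (w * (w * conjc w) * ((q x)^-1)%:C%C); last by ring.
rewrite mul_conj (_ : nc w ^+ 2 = q x); last by rewrite ncE /= expr1n.
by rewrite -mulrA -CM divff ?mulr1// /q gt_eqF// ltr_pwDl// sqr_ge0.
Qed.

Definition kick h s : C := 'i%C * h%:C%C * coupling s.
Definition turn h s x : C := cayley (- (h * phase s x)).
Definition step h s : state :=
  (fun x => disc_step N (kick h s) (turn h s x * s.1 x), s.2 - 'i%C * h%:C%C * mean_drift s).

Lemma stepE h s x : (step h s).1 x = disc_step N (kick h s) (turn h s x * s.1 x).
Proof. by []. Qed.

Lemma nc_kick h s : in_states s -> nc (kick h s) <= `|h| * M ^+ 3.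
Proof.
move=> Ks; have := nc_coupling Ks; rewrite /kick; move: (coupling s) => A nA.
by rewrite !ncM nci mul1r nc_real ler_wpM2l.
Qed.

Lemma kick_lip h s s' : in_states s -> in_states s' ->
  nc (kick h s - kick h s') <= `|h| * (25 * M ^+ 3 * state_dist s s').
Proof.
move=> Ks Ks'; have := coupling_lip Ks Ks'; rewrite /kick.
move: (coupling s) (coupling s') => A B nAB.
by rewrite -mulrBr !ncM nci mul1r nc_real ler_wpM2l.
Qed.

Definition small_step h := `|h| * M ^+ 5 <= 4^-1.

Lemma small_kick h s : small_step h -> in_states s -> N * nc (kick h s) <= 4^-1.
Proof.
move=> hs Ks; apply: le_trans hs; apply: (le_trans (ler_wpM2l N0 (nc_kick h Ks))).
rewrite mulrCA ler_wpM2l// (@le_trans _ _ (M * M ^+ 3))//; first by rewrite ler_wpM2r.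
by rewrite -exprS Mpow.
Qed.

Lemma small_kick2 h s : small_step h -> in_states s -> N * nc (kick h s) <= 2^-1.
Proof. by move=> hs Ks; apply: (le_trans (small_kick hs Ks)); lra. Qed.

Lemma nc_turn h s x : nc (turn h s x) = 1. Proof. exact: nc_cayley. Qed.

Lemma turn_lip h s s' x :
  nc (turn h s x - turn h s' x) <= `|h| * nc ((phase s x)%:C%C - (phase s' x)%:C%C).
Proof.
apply: (le_trans (cayley_lip _ _)); rewrite -CB nc_real -normrM.
by rewrite [_ - _](_ : _ = - (h * (phase s x - phase s' x))) ?normrN//; ring.
Qed.

Lemma turn_sub1 h s x : nc (turn h s x - 1) <= `|h| * nc (phase s x)%:C%C.
Proof. by apply: (le_trans (cayley_sub1 _)); rewrite nc_real normrN normrM. Qed.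

Lemma turn_bd h s x : in_states s -> nc (turn h s x * s.1 x) <= N.
Proof. by move=> [[_ bN] _]; rewrite ncM nc_turn mul1r. Qed.

Lemma cmeas_turn h s : in_states s -> cmeas (turn h s).
Proof.
move=> Ks; have [mp _] := cmeas_phase (rho := rho) Ks; apply: cmeas_cayley.
by apply: measurableT_comp => //; apply: measurable_funM => //; exact: measurable_cst.
Qed.

Lemma Bd_step h s : small_step h -> in_states s -> Bd N (step h s).1.
Proof.
move=> hs Ks; have mb := L2_meas (state_L2 Ks); have mt := cmeas_turn h Ks.
have mz := cmeasM mt mb; split; last first.
  by move=> x; apply: disc_step_bd => //; [exact: small_kick2|exact: turn_bd].
apply: cmeasM; first exact: cmeas_cst.
apply: cmeasB; first by apply: cmeasD => //; exact: cmeas_cst.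
by apply: cmeasM; [exact: cmeas_cst|exact: cmeasX].
Qed.

Lemma in_states_step h s : small_step h -> in_states s -> in_states (step h s).
Proof.
move=> hs Ks; split; first exact: Bd_step.
rewrite /=; have [|c1] := leP (rho + 1) (nc s.2).
  move=> /cutoff0 c0; rewrite /mean_drift /coupling /Submission.mean_drift /Submission.coupling c0 mul0r mulr0.
  by rewrite conjc0 !mul0r addr0 mulr0 subr0; case: Ks.
apply: (le_trans (ncB _ _)); have := nc_mean_drift Ks; move: (mean_drift s) => G nG.
rewrite !ncM nci mul1r nc_real.
have : `|h| * nc G <= 3 * (`|h| * M ^+ 5) by rewrite mulrCA ler_wpM2l.
by move: hs c1; rewrite /small_step; set a := _ * M ^+ 5; set b := _ * nc G; lra.
Qed.

Definition lipC : R := 403 * M ^+ 5.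

Lemma step_stable h s s' : small_step h -> in_states s -> in_states s' ->
  state_dist (step h s) (step h s') <= (1 + lipC * `|h|) * state_dist s s'.
Proof.
move=> hs Ks Ks'; have Kp := in_states_step hs Ks; have Kp' := in_states_step hs Ks'.
set D := state_dist s s'; have D0 : 0 <= D := state_dist_ge0 _ _.
have k4 := small_kick hs Ks; have k2 := small_kick2 hs Ks; have k2' := small_kick2 hs Ks'.
have q0 : 0 <= 1 + 2 * N * nc (kick h s) by rewrite addr_ge0// !mulr_ge0// nc_ge0.
have q2 : 1 + 2 * N * nc (kick h s) <= 2.
  by move: k4; rewrite -[2 * N * _]mulrA; set a := N * _; lra.
have nk := nc_kick h Ks; have dk := kick_lip h Ks Ks'; rewrite -/D in dk.
have pt x : nc ((step h s).1 x - (step h s').1 x) <=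
   (1 + 2 * N * nc (kick h s)) * nc (s.1 x - s'.1 x) +
   2 * N * `|h| * nc ((phase s x)%:C%C - (phase s' x)%:C%C) +
   4 * N ^+ 2 * nc (kick h s - kick h s').
  rewrite !stepE; set z := turn h s x * _; set z' := turn h s' x * _.
  have zN : nc z <= N by exact: turn_bd.
  have zN' : nc z' <= N by exact: turn_bd.
  have h1 := disc_step_lip (kick h s) N0 zN zN'; have h2 := disc_step_lip_par N0 k2 k2' zN'.
  have -> : disc_step N (kick h s) z - disc_step N (kick h s') z' =
    (disc_step N (kick h s) z - disc_step N (kick h s) z') +
    (disc_step N (kick h s) z' - disc_step N (kick h s') z') by rewrite addrA subrK.
  apply: (le_trans (ncD _ _)); apply: lerD => //; apply: (le_trans h1).
  have -> : z - z' = turn h s x * (s.1 x - s'.1 x) + (turn h s x - turn h s' x) * s'.1 x.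
    rewrite /z /z'; move: (turn h s x) (turn h s' x) => e e'; ring.
  have h3 : nc (turn h s x * (s.1 x - s'.1 x) + (turn h s x - turn h s' x) * s'.1 x) <=
      nc (s.1 x - s'.1 x) + `|h| * nc ((phase s x)%:C%C - (phase s' x)%:C%C) * N.
    apply: (le_trans (ncD _ _)); rewrite (ncM (turn h s x)) nc_turn mul1r lerD2l ncM.
    have [[_ bN] _] := Ks'; apply: ler_pM; rewrite ?nc_ge0//; exact: turn_lip.
  apply: (le_trans (ler_wpM2l q0 h3)); rewrite mulrDr lerD2l.
  rewrite [leRHS](_ : _ = 2 * (`|h| * nc ((phase s x)%:C%C - (phase s' x)%:C%C) * N)); last by ring.
  by rewrite ler_wpM2r// mulr_ge0// mulr_ge0// nc_ge0.
have p2 : 0 <= 2 * N * `|h| by rewrite !mulr_ge0.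
have p3 : 0 <= 4 * N ^+ 2 * nc (kick h s - kick h s') by rewrite mulr_ge0 ?nc_ge0// mulr_ge0.
have H := n2_le3 q0 p2 p3 (L2_meas (L2B (state_L2 Kp) (state_L2 Kp')))
  (L2B (state_L2 Ks) (state_L2 Ks')) (L2B (L2_phase Ks) (L2_phase Ks')) pt.
have i1 : (1 + 2 * N * nc (kick h s)) * n2 (fun x => s.1 x - s'.1 x) <=
   n2 (fun x => s.1 x - s'.1 x) + 2 * `|h| * M ^+ 5 * D.
  rewrite mulrDl mul1r lerD2l; apply: ler_pM; rewrite ?mulr_ge0 ?nc_ge0 ?n2_ge0//.
    rewrite -!mulrA ler_wpM2l//; apply: (le_trans (ler_wpM2l N0 nk)); rewrite mulrCA ler_wpM2l//.
    apply: (@le_trans _ _ (M * M ^+ 3)); first by rewrite ler_wpM2r.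
    by rewrite -exprS Mpow.
  by rewrite lerDl nc_ge0.
have i2 : 2 * N * `|h| * n2 (fun x => (phase s x)%:C%C - (phase s' x)%:C%C) <=
    216 * `|h| * M ^+ 5 * D.
  apply: (le_trans (ler_wpM2l p2 (n2_phaseB Ks Ks'))); rewrite -/D.
  rewrite [leRHS](_ : _ = 2 * M * `|h| * (108 * M ^+ 4 * D)); last by ring.
  rewrite ler_wpM2r//; first by rewrite !mulr_ge0.
  by rewrite ler_wpM2r// ler_wpM2l.
have i3 : 4 * N ^+ 2 * nc (kick h s - kick h s') <= 100 * `|h| * M ^+ 5 * D.
  have p : 0 <= 4 * N ^+ 2 by rewrite mulr_ge0.
  apply: (le_trans (ler_wpM2l p dk)).
  rewrite [leRHS](_ : _ = 4 * M ^+ 2 * (`|h| * (25 * M ^+ 3 * D))); last by ring.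
  by rewrite ler_wpM2r ?mulr_ge0// ler_wpM2l.
have i4 : nc ((step h s).2 - (step h s').2) <= nc (s.2 - s'.2) + 85 * `|h| * M ^+ 5 * D.
  rewrite /step /=; have := mean_drift_lip Ks Ks'; rewrite -/D.
  move: (mean_drift s) (mean_drift s') => G G' nG.
  have -> : s.2 - 'i%C * h%:C%C * G - (s'.2 - 'i%C * h%:C%C * G') =
     (s.2 - s'.2) - 'i%C * h%:C%C * (G - G') by ring.
  apply: (le_trans (ncB _ _)); rewrite lerD2l !ncM nci mul1r nc_real.
  by apply: (le_trans (ler_wpM2l (normr_ge0 h) nG)); rewrite le_eqVlt; apply/orP; left; apply/eqP; ring.
have DE : D = n2 (fun x => s.1 x - s'.1 x) + nc (s.2 - s'.2) by [].
rewrite /state_dist [leRHS](_ : _ = D + 403 * (`|h| * M ^+ 5 * D)); last by rewrite /lipC; ring.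
move: H i1 i2 i3 i4 DE; clearbody D.
by set a2 := nc _; set a3 := nc _; set a4 := nc _; abs_lra.
Qed.

End steps.

(** * Consistency of the step *)

Section consistency.
Context {R : realType}.
Local Notation C := R[i].
Local Notation mu := (@torus_measure R).
Local Notation nc := (@Normc.normc R).
Implicit Types (f g u v b : R -> C) (x y h : R) (A c : C).
Local Notation state := (@state R).
Implicit Types s : state.
Local Opaque n2 L2 Szego fourier inner.
Variables (N rho M : R).
Hypotheses (N0 : 0 <= N) (rho0 : 0 <= rho) (ME : M = 2 * N + rho + 2).
Let M1 : 1 <= M. Proof. by have := N0; have := rho0; rewrite ME; lra. Qed.
Let M0 : 0 <= M. Proof. exact: le_trans ler01 M1. Qed.
Let NM : N <= M. Proof. by have := N0; have := rho0; rewrite ME; lra. Qed.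
Let Mpow j k : (j <= k)%N -> M ^+ j <= M ^+ k. Proof. exact: ler_weXn2l. Qed.
Let Mn0 n : 0 <= M ^+ n. Proof. exact: exprn_ge0. Qed.
Local Notation L4_profile := (L4_profile N0 rho0 ME).
Local Notation nc_coupling := (nc_coupling N0 rho0 ME).
Local Notation coupling_lip := (coupling_lip N0 rho0 ME).
Local Notation L4_phase := (L4_phase N0 rho0 ME).
Local Notation n2_phase := (n2_phase N0 rho0 ME).
Local Notation L2_phase := (L2_phase N0 rho0 ME).
Local Notation n2_phaseB := (n2_phaseB N0 rho0 ME).
Local Notation nc_mean_drift := (nc_mean_drift N0 rho0 ME).
Local Notation mean_drift_lip := (mean_drift_lip N0 rho0 ME).
Local Notation phase := (phase rho).
Local Notation coupling := (coupling rho).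
Local Notation mean_drift := (mean_drift rho).
Local Notation in_states := (in_states N rho).
Local Notation nc_kick := (nc_kick N0 rho0 ME).
Local Notation kick_lip := (kick_lip N0 rho0 ME).
Local Notation small_kick := (small_kick N0 rho0 ME).
Local Notation small_kick2 := (small_kick2 N0 rho0 ME).
Local Notation in_states_step := (in_states_step N0 rho0 ME).
Local Notation step := (step N rho).
Local Notation kick := (kick rho).
Local Notation turn := (turn rho).
Local Notation small_step := (small_step M).
Local Notation n2_profile := (n2_profile ME).
Let Npow j : N ^+ j <= M ^+ j. Proof. by apply: lerXn2r; rewrite ?nnegrE. Qed.
Let Nn0 n : 0 <= N ^+ n. Proof. exact: exprn_ge0. Qed.

Lemma step_move h s : small_step h -> in_states s -> state_dist s (step h s) <= 10 * M ^+ 5 * `|h|.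
Proof.
move=> hs Ks; have Kp := in_states_step hs Ks.
have k2 := small_kick2 hs Ks; have k4 := small_kick hs Ks; have nk := nc_kick h Ks.
have pt x : nc (s.1 x - (step h s).1 x) <=
    N * `|h| * nc (phase s x)%:C%C + 0 * nc (phase s x)%:C%C + 3 * N ^+ 2 * nc (kick h s).
  rewrite mul0r addr0 stepE; set z := turn h s x * _.
  have zN : nc z <= N by exact: turn_bd.
  have h1 := disc_step_riccati N0 k2 zN; have h2 := nc_forcing (kick h s) N0 zN.
  have -> : s.1 x - disc_step N (kick h s) z = - ((turn h s x - 1) * s.1 x) -
     (disc_step N (kick h s) z - riccati N (kick h s) z) -
     ((N ^+ 2)%:C%C * kick h s - conjc (kick h s) * z ^+ 2).
    by rewrite /riccati /z; move: (turn h s x) (kick h s) => e k; ring.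
  have h3 : nc (- ((turn h s x - 1) * s.1 x)) <= N * `|h| * nc (phase s x)%:C%C.
    rewrite ncN ncM [leRHS](_ : _ = `|h| * nc (phase s x)%:C%C * N); last by ring.
    have [[_ bN] _] := Ks; apply: ler_pM; rewrite ?nc_ge0//; exact: turn_sub1.
  have h4 : 2 * N ^+ 3 * nc (kick h s) ^+ 2 <= N ^+ 2 * nc (kick h s).
    rewrite [leLHS](_ : _ = N ^+ 2 * nc (kick h s) * (2 * (N * nc (kick h s)))); last by ring.
    rewrite ler_piMr//; first by rewrite mulr_ge0 ?nc_ge0.
    by move: k2; set a := N * _; lra.
  apply: (le_trans (ncB _ _)); apply: (le_trans (lerD (ncB _ _) h2)).
  apply: (le_trans (lerD (lerD h3 (le_trans h1 h4)) (lexx _))).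
  by rewrite le_eqVlt; apply/orP; left; apply/eqP; ring.
have p1 : 0 <= N * `|h| by rewrite mulr_ge0.
have p3 : 0 <= 3 * N ^+ 2 * nc (kick h s) by rewrite mulr_ge0 ?nc_ge0// mulr_ge0.
have H := n2_le3 p1 (lexx 0) p3 (L2_meas (L2B (state_L2 Ks) (state_L2 Kp)))
   (L2_phase Ks) (L2_phase Ks) pt.
have i1 : N * `|h| * n2 (fun x => (phase s x)%:C%C) <= 4 * (`|h| * M ^+ 5).
  apply: (le_trans (ler_wpM2l p1 (n2_phase Ks))).
  rewrite [leRHS](_ : _ = M * `|h| * (4 * M ^+ 4)); last by ring.
  by rewrite ler_wpM2r ?mulr_ge0// ler_wpM2r.
have i2 : 3 * N ^+ 2 * nc (kick h s) <= 3 * (`|h| * M ^+ 5).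
  rewrite [leRHS](_ : _ = 3 * M ^+ 2 * (`|h| * M ^+ 3)); last by ring.
  by apply: ler_pM; rewrite ?nc_ge0 ?mulr_ge0// ler_wpM2l.
have i3 : nc (s.2 - (step h s).2) <= 3 * (`|h| * M ^+ 5).
  have -> : s.2 - (step h s).2 = 'i%C * h%:C%C * mean_drift s by rewrite /Submission.step /= opprB addrC subrK.
  have := nc_mean_drift Ks; move: (mean_drift s) => G nG.
  by rewrite !ncM nci mul1r nc_real mulrCA ler_wpM2l.
rewrite /state_dist [leRHS](_ : _ = 10 * (`|h| * M ^+ 5)); last by ring.
by move: H i1 i2 i3; rewrite mul0r addr0; set a := nc (_ - _); set b := _ * n2 _; set c := _ * nc _; abs_lra.
Qed.

Lemma kick2 h s : kick (2 * h) s = 2 * kick h s.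
Proof. by rewrite /Submission.kick CM Cnat; ring. Qed.

Lemma turn2 h s x : turn (2 * h) s x = cayley (2 * - (h * phase s x)).
Proof. by rewrite /Submission.turn; congr cayley; ring. Qed.

Lemma step_consistent h s : small_step (2 * h) -> in_states s ->
  state_dist (step (2 * h) s) (step h (step h s)) <= 5400 * M ^+ 10 * h ^+ 2.
Proof.
move=> hs2 Ks.
have hs : small_step h.
  move: hs2; rewrite /Submission.small_step normrM ger0_norm// -mulrA.
  have : 0 <= `|h| * M ^+ 5 by rewrite mulr_ge0.
  by set a := _ * M ^+ 5; lra.
have K1 := in_states_step hs Ks; set s1 := step h s in K1 *.
have K2 := in_states_step hs K1; have K3 := in_states_step hs2 Ks.
have k2 := small_kick2 hs Ks; have k4 := small_kick hs Ks; have k2' := small_kick2 hs K1.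
have k4' := small_kick hs K1; have nk := nc_kick h Ks.
have D1 : state_dist s s1 <= 10 * M ^+ 5 * `|h| := step_move hs Ks.
have h2E : `|h| * `|h| = h ^+ 2 by rewrite -expr2 real_normK ?num_real.
set mD := fun x => (phase s1 x)%:C%C - (phase s x)%:C%C.
pose m2 := fun x => (phase s x)%:C%C ^+ 2.
have l2m2 : L2 m2 by have [[_ l] _] := L4_phase Ks.
have n2m2 : n2 m2 <= 64 * M ^+ 8.
  have [_ l] := L4_phase Ks; rewrite -n4sq [leRHS](_ : _ = (8 * M ^+ 4) ^+ 2); last by ring.
  by apply: lerXn2r l; rewrite nnegrE ?n4_ge0// mulr_ge0.
have c1 : 0 <= 4 * N * `|h| by rewrite !mulr_ge0.
(* the second step uses the coefficients of s1 instead of those of s *)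
pose y x := disc_step N (kick h s) (turn h s x * s1.1 x).
have ptA x : nc ((step h s1).1 x - y x) <=
    2 * N * `|h| * nc (mD x) + 0 * nc (mD x) + 4 * N ^+ 2 * nc (kick h s1 - kick h s).
  rewrite mul0r addr0 stepE /y; set z := turn h s1 x * _; set z' := turn h s x * _.
  have zN : nc z <= N by exact: turn_bd.
  have zN' : nc z' <= N by rewrite (ncM (turn h s x)) nc_turn mul1r; have [[_ ->] _] := K1.
  have h1 := disc_step_lip (kick h s1) N0 zN zN'; have h2 := disc_step_lip_par N0 k2' k2 zN'.
  have -> : disc_step N (kick h s1) z - disc_step N (kick h s) z' =
    (disc_step N (kick h s1) z - disc_step N (kick h s1) z') +
    (disc_step N (kick h s1) z' - disc_step N (kick h s) z') by rewrite addrA subrK.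
  apply: (le_trans (ncD _ _)); apply: lerD => //; apply: (le_trans h1).
  have h3 : nc (z - z') <= N * `|h| * nc (mD x).
    rewrite /z /z' -mulrBl ncM [leRHS](_ : _ = `|h| * nc (mD x) * N); last by ring.
    have [[_ bN] _] := K1; apply: ler_pM; rewrite ?nc_ge0//; exact: turn_lip.
  rewrite [leRHS](_ : _ = 2 * (N * `|h| * nc (mD x))); last by ring.
  apply: ler_pM; rewrite ?nc_ge0//; first by rewrite addr_ge0// !mulr_ge0// nc_ge0.
  by rewrite -[2 * N * nc (kick h s1)]mulrA; move: k4'; set a := N * _; lra.
have ptB x : nc (y x - (step (2 * h) s).1 x) <=
    21 * N * h ^+ 2 * nc (m2 x) + 2 * N ^+ 2 * nc (kick h s) * `|h| * nc (phase s x)%:C%C +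
    18 * N ^+ 3 * nc (kick h s) ^+ 2.
  rewrite /y !stepE kick2 turn2.
  have [[_ bN] _] := Ks.
  have := disc_step_double N0 k4 (nc_turn rho h s x) (nc_cayley _) (bN x) (turn_sub1 rho h s x).
  move=> /(_ (2 * - (h * phase s x))) H; apply: (le_trans H).
  have q := cayley_sq (- (h * phase s x)); rewrite -/(turn h s x) in q.
  have q' : 3 * N * nc (turn h s x ^+ 2 - cayley (2 * - (h * phase s x))) <= 21 * N * h ^+ 2 * nc (m2 x).
    have p : 0 <= 3 * N by rewrite mulr_ge0.
    apply: (le_trans (ler_wpM2l p q)); rewrite /m2 ncX nc_real real_normK ?num_real//.
    by rewrite le_eqVlt; apply/orP; left; apply/eqP; ring.
  rewrite [leRHS]addrC addrA [2 * N ^+ 2 * _ * (_ * _)]mulrA.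
  by rewrite lerD2r lerD2l.
have mt := cmeas_turn h Ks; have my : L2 y.
  have mz := cmeasM mt (L2_meas (state_L2 K1)).
  apply: (@L2_bd _ _ N).
    apply: cmeasM; first exact: cmeas_cst.
    apply: cmeasB; first by apply: cmeasD => //; exact: cmeas_cst.
    by apply: cmeasM; [exact: cmeas_cst|exact: cmeasX].
  move=> x; apply: disc_step_bd => //.
  by rewrite (ncM (turn h s x)) nc_turn mul1r; have [[_ ->] _] := K1.
have p1 : 0 <= 2 * N * `|h| by rewrite !mulr_ge0.
have p3 : 0 <= 4 * N ^+ 2 * nc (kick h s1 - kick h s) by rewrite mulr_ge0 ?nc_ge0// mulr_ge0.
have lD : L2 mD := L2B (L2_phase K1) (L2_phase Ks).
have HA := n2_le3 p1 (lexx 0) p3 (L2_meas (L2B (state_L2 K2) my)) lD lD ptA.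
have p4 : 0 <= 21 * N * h ^+ 2 by rewrite mulr_ge0 ?sqr_ge0// mulr_ge0.
have p5 : 0 <= 2 * N ^+ 2 * nc (kick h s) * `|h| by rewrite mulr_ge0// mulr_ge0 ?nc_ge0// mulr_ge0.
have p6 : 0 <= 18 * N ^+ 3 * nc (kick h s) ^+ 2 by rewrite mulr_ge0 ?sqr_ge0// mulr_ge0.
have HB' := n2_le3 p4 p5 p6 (L2_meas (L2B my (state_L2 K3))) l2m2 (L2_phase Ks) ptB.
have D1' : state_dist s1 s <= 10 * M ^+ 5 * `|h| by rewrite state_dist_sym.
set T := h ^+ 2 * M ^+ 10.
have T0 : 0 <= T by rewrite mulr_ge0 ?sqr_ge0.
have i1 : 2 * N * `|h| * n2 mD <= 2160 * T.
  have q1 : n2 mD <= 108 * M ^+ 4 * (10 * M ^+ 5 * `|h|).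
    by apply: (le_trans (n2_phaseB K1 Ks)); rewrite ler_wpM2l// mulr_ge0.
  apply: (le_trans (ler_wpM2l p1 q1)).
  rewrite [leRHS](_ : _ = 2 * M * `|h| * (108 * M ^+ 4 * (10 * M ^+ 5 * `|h|))); last by rewrite /T -h2E; ring.
  by rewrite ler_wpM2r ?mulr_ge0// ler_wpM2r// ler_wpM2l.
have i2 : 4 * N ^+ 2 * nc (kick h s1 - kick h s) <= 1000 * T.
  have q1 : nc (kick h s1 - kick h s) <= `|h| * (25 * M ^+ 3 * (10 * M ^+ 5 * `|h|)).
    by apply: (le_trans (kick_lip h K1 Ks)); rewrite ler_wpM2l// ler_wpM2l// mulr_ge0.
  rewrite [leRHS](_ : _ = 4 * M ^+ 2 * (`|h| * (25 * M ^+ 3 * (10 * M ^+ 5 * `|h|)))); last by rewrite /T -h2E; ring.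
  by apply: ler_pM; rewrite ?nc_ge0 ?mulr_ge0// ler_wpM2l.
have M9 : h ^+ 2 * M ^+ 9 <= T by rewrite ler_wpM2l ?sqr_ge0// Mpow.
have W (k : nat) : k%:R * (h ^+ 2 * M ^+ 9) <= k%:R * T by rewrite ler_wpM2l// ler0n.
have i3 : 21 * N * h ^+ 2 * n2 m2 <= 1344 * T.
  apply: (@le_trans _ _ (1344 * (h ^+ 2 * M ^+ 9))); last exact: W.
  rewrite [leRHS](_ : _ = 21 * M * h ^+ 2 * (64 * M ^+ 8)); last by ring.
  by apply: ler_pM; rewrite ?n2_ge0// ler_wpM2r ?sqr_ge0// ler_wpM2l.
have i4 : 2 * N ^+ 2 * nc (kick h s) * `|h| * n2 (fun x => (phase s x)%:C%C) <= 8 * T.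
  apply: (@le_trans _ _ (8 * (h ^+ 2 * M ^+ 9))); last exact: W.
  rewrite [leRHS](_ : _ = 2 * M ^+ 2 * (`|h| * M ^+ 3) * `|h| * (4 * M ^+ 4)); last by rewrite -h2E; ring.
  apply: ler_pM; rewrite ?n2_ge0//; last exact: n2_phase.
  by rewrite ler_wpM2r//; apply: ler_pM; rewrite ?nc_ge0 ?mulr_ge0// ler_wpM2l.
have i5 : 18 * N ^+ 3 * nc (kick h s) ^+ 2 <= 18 * T.
  apply: (@le_trans _ _ (18 * (h ^+ 2 * M ^+ 9))); last exact: W.
  rewrite [leRHS](_ : _ = 18 * M ^+ 3 * (`|h| * M ^+ 3) ^+ 2); last by rewrite -h2E; ring.
  apply: ler_pM; rewrite ?sqr_ge0 ?mulr_ge0//; first by rewrite ler_wpM2l.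
  by apply: lerXn2r nk; rewrite nnegrE ?nc_ge0// mulr_ge0.
have i6 : nc ((step (2 * h) s).2 - (step h s1).2) <= 850 * T.
  have -> : (step (2 * h) s).2 - (step h s1).2 = 'i%C * h%:C%C * (mean_drift s1 - mean_drift s).
    by rewrite /s1 /Submission.step /= CM Cnat; ring.
  have := mean_drift_lip K1 Ks; move: (mean_drift s1) (mean_drift s) => G G' nG.
  rewrite !ncM nci mul1r nc_real.
  have q0 : 0 <= 85 * M ^+ 5 by rewrite mulr_ge0.
  apply: (le_trans (ler_wpM2l (normr_ge0 h) (le_trans nG (ler_wpM2l q0 D1')))).
  by rewrite le_eqVlt; apply/orP; left; apply/eqP; rewrite /T -h2E; ring.
have tri := n2_trans (state_L2 K3) my (state_L2 K2).
rewrite /state_dist [leRHS](_ : _ = 5400 * T); last by rewrite /T; ring.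
rewrite mul0r addr0 in HA; rewrite n2_sub in HA; rewrite n2_sub in HB'.
move: tri HA HB' i1 i2 i3 i4 i5 i6 T0; clearbody T.
set a1 := _ * n2 mD; set a2 := _ * nc (kick h s1 - _); set a3 := _ * n2 m2.
set a4 := _ * n2 (fun _ => _); set a5 := _ * nc _ ^+ 2; set a6 := nc _.
by abs_lra.
Qed.

End consistency.

(** * Consistency with the equation *)

Lemma fourier_mean {R : realType} (f : R -> R[i]) : fourier f 0 = cintegral f.
Proof.
by rewrite /fourier /inner; congr cintegral; apply/funext => x; rewrite cexp0 rmorph1 mulr1.
Qed.

Lemma fourier_sqmod0 {R : realType} (u : R -> R[i]) : fourier (sqmod u) 0 = (n2 u ^+ 2)%:C%C.
Proof.
by rewrite fourier_mean -inner_self /inner; congr cintegral; apply/funext => x; rewrite sqmodE.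
Qed.

Section profile_consistency.
Context {R : realType}.
Local Notation C := R[i].
Local Notation mu := (@torus_measure R).
Local Notation nc := (@Normc.normc R).
Implicit Types (f g u v b : R -> C) (x y h : R) (A c : C).
Local Notation state := (@state R).
Implicit Types s : state.
Local Opaque n2 L2 Szego fourier inner.
Variables (N rho M : R).
Hypotheses (N0 : 0 <= N) (rho0 : 0 <= rho) (ME : M = 2 * N + rho + 2).
Let M1 : 1 <= M. Proof. by have := N0; have := rho0; rewrite ME; lra. Qed.
Let M0 : 0 <= M. Proof. exact: le_trans ler01 M1. Qed.
Let NM : N <= M. Proof. by have := N0; have := rho0; rewrite ME; lra. Qed.
Let Mpow j k : (j <= k)%N -> M ^+ j <= M ^+ k. Proof. exact: ler_weXn2l. Qed.
Let Mn0 n : 0 <= M ^+ n. Proof. exact: exprn_ge0. Qed.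
Local Notation L4_profile := (L4_profile N0 rho0 ME).
Local Notation nc_coupling := (nc_coupling N0 rho0 ME).
Local Notation coupling_lip := (coupling_lip N0 rho0 ME).
Local Notation L4_phase := (L4_phase N0 rho0 ME).
Local Notation n2_phase := (n2_phase N0 rho0 ME).
Local Notation L2_phase := (L2_phase N0 rho0 ME).
Local Notation n2_phaseB := (n2_phaseB N0 rho0 ME).
Local Notation nc_mean_drift := (nc_mean_drift N0 rho0 ME).
Local Notation mean_drift_lip := (mean_drift_lip N0 rho0 ME).
Local Notation phase := (phase rho).
Local Notation coupling := (coupling rho).
Local Notation mean_drift := (mean_drift rho).
Local Notation in_states := (in_states N rho).
Local Notation nc_kick := (nc_kick N0 rho0 ME).
Local Notation kick_lip := (kick_lip N0 rho0 ME).
Local Notation small_kick := (small_kick N0 rho0 ME).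
Local Notation small_kick2 := (small_kick2 N0 rho0 ME).
Local Notation in_states_step := (in_states_step N0 rho0 ME).
Local Notation step := (step N rho).
Local Notation kick := (kick rho).
Local Notation turn := (turn rho).
Local Notation small_step := (small_step M).
Local Notation n2_profile := (n2_profile ME).
Let Npow j : N ^+ j <= M ^+ j. Proof. by apply: lerXn2r; rewrite ?nnegrE. Qed.
Let Nn0 n : 0 <= N ^+ n. Proof. exact: exprn_ge0. Qed.

Lemma fourier_antiholo f (j : nat) : L2 f -> L2p (fun x => conjc (f x)) -> fourier f j.+1%:Z = 0.
Proof.
move=> lf [_ h]; have := fourier_conj j.+1%:Z (L2_L1 (L2_conj lf)).
rewrite (_ : (fun x => conjc (conjc (f x))) = f); last by apply/funext => x; rewrite conjcK.
by move=> ->; rewrite h ?conjc0// oppr_lt0.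
Qed.

Lemma two_Re (z : C) : (2 * complex.Re z)%:C%C = z + conjc z.
Proof. by apply: eq_C; rewrite ?(Re_D, Im_D, Re_conjc, Im_conjc)/=; ring. Qed.

Definition symbol_drift s x : C :=
  (phase s x)%:C%C * s.1 x - (N ^+ 2)%:C%C * coupling s - conjc (coupling s) * s.1 x ^+ 2.

Lemma L4_symbol s : in_states s -> L4 s.1.
Proof. by move=> [[mb bN] _]; exact: L4_bd bN. Qed.

Lemma L2_symbol_drift s : in_states s -> L2 (symbol_drift s).
Proof.
move=> Ks; have [l4p _] := L4_phase Ks; have l4 := L4_symbol Ks.
have [l1 _] := L4M l4p l4; have [_ l2] := l4.
by apply: L2B; [apply: L2B => //; exact: L2_cst|exact: L2Z].
Qed.

(** The drift of the symbol and the right-hand side of the equation differ by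
    the conjugate of an element of the Hardy space. *)
Lemma fourier_drift s (j : nat) : in_states s ->
  fourier (symbol_drift s) j.+1%:Z = fourier (rhsA (coupling s) (profile s)) j.+1%:Z.
Proof.
move=> Ks; have l4 := L4_symbol Ks; have [l4u _] := L4_profile Ks; have lb := state_L2 Ks.
have lVV := L2_symbol_drift Ks; set A := coupling s; set u := profile s; set b := s.1.
pose w x := u x - b x; have [l4w _] : L4 w /\ _ := L4B l4u l4.
have [l4wJ _] := L4_conj l4w; have [l4uJ _] := L4_conj l4u.
have [_ lw2] := l4w; have [_ lu2] := l4u; have [_ lwJ2] := l4wJ.
have [lwu _] := L4M l4w l4uJ; have [lwu' _] := L4M l4wJ l4u; have lq := L2_sqmod l4u.
have lpw : L2p (fun x => conjc (w x)).
  rewrite (_ : (fun x => _) = (fun x => conjc (s.2 - fourier s.1 0) - conjc (b x - Szego b x))).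
    by apply: L2pB; [exact: L2p_cst|exact: L2p_conj_rest].
  by apply/funext => x; rewrite -conjcB /w /u /profile -/b; congr conjc; ring.
have lpu : L2p u := profile_L2p Ks.
pose W x := 2 * A * (w x * conjc (u x)) + conjc A * w x ^+ 2 + A * (N ^+ 2)%:C%C.
have lW : L2 W by apply: L2D; [apply: L2D; exact: L2Z|exact: L2_cst].
have lpW : L2p (fun x => conjc (W x)).
  rewrite (_ : (fun x => _) = (fun x => conjc (2 * A) * (conjc (w x) * u x) +
     A * conjc (w x) ^+ 2 + conjc (A * (N ^+ 2)%:C%C))); last first.
    apply/funext => x; rewrite /W; move: (w x) (u x) => w' u'.
    by rewrite !conjcD (conjcM (conjc A)) conjcX (conjcM (2 * A)) (conjcM w') !conjcK.
  apply: L2pD; last exact: L2p_cst.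
  apply: L2pD; apply: L2pZ; first exact: L2pM.
  under eq_fun do rewrite expr2; apply: L2pM => //; by under eq_fun do rewrite -expr2.
have E : (fun x => symbol_drift s x + W x) = (fun x => 2 * A * sqmod u x + conjc A * u x ^+ 2).
  apply/funext => x; rewrite /symbol_drift /W sqmodE /w.
  have -> : (phase s x)%:C%C = 2 * (conjc A * u x + A * conjc (u x)).
    rewrite /Submission.phase (_ : 4 * _ = 2 * (2 * complex.Re (conjc A * u x))); last by rewrite -/A -/u; ring.
    by rewrite CM two_Re Cnat (conjcM (conjc A)) conjcK.
  rewrite -/A -/b; move: (u x) (conjc (u x)) (b x) (conjc A) ((N ^+ 2)%:C%C) => z z' y A' n; ring.
have lr := L2D (L2Z (2 * A) lq) (L2Z (conjc A) lu2).
have h := fourierD j.+1%:Z (L2_L1 lVV) (L2_L1 lW).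
rewrite E (fourier_antiholo j lW lpW) addr0 in h; rewrite -h /rhsA.
rewrite (fourierD _ (L2_L1 (L2Z _ lq)) (L2_L1 (L2Z _ lu2))).
rewrite (fourierD _ (L2_L1 (L2Z _ (L2_Szego lq))) (L2_L1 (L2Z _ lu2))).
by rewrite (fourierZ _ _ (L2_L1 lq)) (fourierZ _ _ (L2_L1 (L2_Szego lq))) fourier_Szego.
Qed.

Lemma fourier_rhs_mean s : in_states s ->
  fourier (rhsA (coupling s) (profile s)) 0 = mean_drift s.
Proof.
move=> Ks; have [l4u _] := L4_profile Ks; have lq := L2_sqmod l4u; have [_ lu2] := l4u.
rewrite /rhsA (fourierD _ (L2_L1 (L2Z _ (L2_Szego lq))) (L2_L1 (L2Z _ lu2))).
rewrite (fourierZ _ _ (L2_L1 (L2_Szego lq))) (fourierZ _ _ (L2_L1 lu2)).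
have := @fourier_Szego _ _ 0%N lq => ->; rewrite fourier_sqmod0.
have lp := profile_L2p Ks.
have -> : fourier (fun x => profile s x ^+ 2) 0 = s.2 ^+ 2.
  under eq_fun do rewrite expr2.
  by rewrite (fourier_mul0 lp lp) (@fourier_profile _ _ _ _ 0%N Ks) expr2.
by [].
Qed.

Lemma L2p_rhsA A u : L4 u -> L2p u -> L2p (rhsA A u).
Proof.
move=> lu lp; have [_ lu2] := lu; apply: L2pD; apply: L2pZ; first exact: L2p_Szego (L2_sqmod lu).
by under eq_fun do rewrite expr2; apply: L2pM => //; under eq_fun do rewrite -expr2.
Qed.

Lemma symbol_taylor h s : small_step h -> in_states s ->
  n2 (fun x => (step h s).1 x - s.1 x + 'i%C * h%:C%C * symbol_drift s x) <= 74 * M ^+ 10 * h ^+ 2.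
Proof.
move=> hs Ks; have K1 := in_states_step hs Ks; have k2 := small_kick2 hs Ks.
have nk := nc_kick h Ks; have h2E : `|h| * `|h| = h ^+ 2 by rewrite -expr2 real_normK ?num_real.
pose m2 := fun x => (phase s x)%:C%C ^+ 2.
have l2m2 : L2 m2 by have [[_ l] _] := L4_phase Ks.
have n2m2 : n2 m2 <= 64 * M ^+ 8.
  have [_ l] := L4_phase Ks; rewrite -n4sq [leRHS](_ : _ = (8 * M ^+ 4) ^+ 2); last by ring.
  by apply: lerXn2r l; rewrite nnegrE ?n4_ge0// mulr_ge0.
have pt x : nc ((step h s).1 x - s.1 x + 'i%C * h%:C%C * symbol_drift s x) <=
   N * h ^+ 2 * nc (m2 x) + 2 * N ^+ 2 * nc (kick h s) * `|h| * nc (phase s x)%:C%C +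
   2 * N ^+ 3 * nc (kick h s) ^+ 2.
  rewrite stepE; have [[_ bN] _] := Ks; have zN := turn_bd h x Ks.
  have h1 := disc_step_riccati N0 k2 zN.
  have t1 := cayley_taylor (- (h * phase s x)); rewrite -/(turn h s x) in t1.
  have t2 := turn_sub1 rho h s x; have e1 := nc_turn rho h s x.
  set b := s.1 x; set e := turn h s x in h1 t1 t2 e1 *; set z := e * b in h1 *.
  rewrite -/b in h1.
  have kJ : conjc (kick h s) = - ('i%C * h%:C%C * conjc (coupling s)).
    by rewrite /Submission.kick !conjcM conjci conjc_real; ring.
  have D : disc_step N (kick h s) z - b + 'i%C * h%:C%C * symbol_drift s x =
    (disc_step N (kick h s) z - riccati N (kick h s) z) +
    (e - 1 - 'i%C * (- (h * phase s x))%:C%C) * b - conjc (kick h s) * ((e - 1) * (e + 1) * b ^+ 2).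
    rewrite /riccati /symbol_drift kJ /z /b CN CM.
    move: (disc_step _ _ _) => S; rewrite /Submission.kick; move: (coupling s) (conjc (coupling s)) (phase s x)%:C%C => A A' m.
    move: (s.1 x) (N ^+ 2)%:C%C (h%:C%C) => b0 n h'; ring.
  rewrite D.
  have b1 : nc ((e - 1 - 'i%C * (- (h * phase s x))%:C%C) * b) <= N * h ^+ 2 * nc (m2 x).
    rewrite ncM /m2 ncX nc_real real_normK ?num_real//.
    rewrite [leRHS](_ : _ = (- (h * phase s x)) ^+ 2 * N); last by ring.
    by apply: ler_pM; rewrite ?nc_ge0 ?bN.
  have b2 : nc (conjc (kick h s) * ((e - 1) * (e + 1) * b ^+ 2)) <=
     2 * N ^+ 2 * nc (kick h s) * `|h| * nc (phase s x)%:C%C.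
    rewrite (ncM (conjc _)) nc_conj [leRHS](_ : _ = nc (kick h s) *
      ((`|h| * nc (phase s x)%:C%C) * 2 * N ^+ 2)); last by ring.
    rewrite ler_wpM2l ?nc_ge0// ncM ncX ncM.
    have b2 : nc b ^+ 2 <= N ^+ 2 by apply: lerXn2r (bN x); rewrite nnegrE ?nc_ge0.
    have e2 : nc (e + 1) <= 2 by apply: (le_trans (ncD _ _)); rewrite e1 nc1.
    have q0 : 0 <= nc (e - 1) * nc (e + 1) by rewrite mulr_ge0 ?nc_ge0.
    exact: ler_pM q0 (sqr_ge0 _) (ler_pM (nc_ge0 _) (nc_ge0 _) t2 e2) b2.
  apply: (le_trans (ncB _ _)); apply: (le_trans (lerD (ncD _ _) b2)).
  apply: (le_trans (lerD (lerD h1 b1) (lexx _))).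
  by rewrite [leRHS]addrC addrA.
have p4 : 0 <= N * h ^+ 2 by rewrite mulr_ge0 ?sqr_ge0.
have p5 : 0 <= 2 * N ^+ 2 * nc (kick h s) * `|h| by rewrite mulr_ge0// mulr_ge0 ?nc_ge0// mulr_ge0.
have p6 : 0 <= 2 * N ^+ 3 * nc (kick h s) ^+ 2 by rewrite mulr_ge0 ?sqr_ge0// mulr_ge0.
have mf := L2_meas (L2D (L2B (state_L2 K1) (state_L2 Ks)) (L2Z ('i%C * h%:C%C) (L2_symbol_drift Ks))).
have H := n2_le3 p4 p5 p6 mf l2m2 (L2_phase Ks) pt.
set T := h ^+ 2 * M ^+ 10.
have T0 : 0 <= T by rewrite mulr_ge0 ?sqr_ge0.
have M9 : h ^+ 2 * M ^+ 9 <= T by rewrite ler_wpM2l ?sqr_ge0// Mpow.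
have W (k : nat) : k%:R * (h ^+ 2 * M ^+ 9) <= k%:R * T by rewrite ler_wpM2l// ler0n.
have i3 : N * h ^+ 2 * n2 m2 <= 64 * T.
  apply: (@le_trans _ _ (64 * (h ^+ 2 * M ^+ 9))); last exact: W.
  rewrite [leRHS](_ : _ = M * h ^+ 2 * (64 * M ^+ 8)); last by ring.
  by apply: ler_pM; rewrite ?n2_ge0// ler_wpM2r ?sqr_ge0.
have i4 : 2 * N ^+ 2 * nc (kick h s) * `|h| * n2 (fun x => (phase s x)%:C%C) <= 8 * T.
  apply: (@le_trans _ _ (8 * (h ^+ 2 * M ^+ 9))); last exact: W.
  rewrite [leRHS](_ : _ = 2 * M ^+ 2 * (`|h| * M ^+ 3) * `|h| * (4 * M ^+ 4)); last by rewrite -h2E; ring.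
  apply: ler_pM; rewrite ?n2_ge0//; last exact: n2_phase.
  by rewrite ler_wpM2r//; apply: ler_pM; rewrite ?nc_ge0 ?mulr_ge0// ler_wpM2l.
have i5 : 2 * N ^+ 3 * nc (kick h s) ^+ 2 <= 2 * T.
  apply: (@le_trans _ _ (2 * (h ^+ 2 * M ^+ 9))); last exact: W.
  rewrite [leRHS](_ : _ = 2 * M ^+ 3 * (`|h| * M ^+ 3) ^+ 2); last by rewrite -h2E; ring.
  apply: ler_pM; rewrite ?sqr_ge0 ?mulr_ge0//; first by rewrite ler_wpM2l.
  by apply: lerXn2r nk; rewrite nnegrE ?nc_ge0// mulr_ge0.
rewrite [leRHS](_ : _ = 74 * T); last by rewrite /T; ring.
move: H i3 i4 i5; set a3 := _ * n2 m2; set a4 := _ * n2 (fun _ => _); set a5 := _ * nc _ ^+ 2.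
by abs_lra.
Qed.

(** Both sides lie in the Hardy space, so that it suffices to compare Fourier
    coefficients: those of positive index come from the symbol, the mean value
    from the second component of the state. *)
Lemma profile_consistent h s : small_step h -> in_states s ->
  n2 (fun x => profile (step h s) x - profile s x +
     'i%C * h%:C%C * rhsA (coupling s) (profile s) x) <= 148 * M ^+ 10 * h ^+ 2.
Proof.
move=> hs Ks; have K1 := in_states_step hs Ks; have [l4u _] := L4_profile Ks.
set c := 'i%C * h%:C%C; set F := rhsA _ _.
have lF : L2 F := L2_rhsA _ l4u; have lV := L2_symbol_drift Ks.
have lp := profile_L2p Ks; have lp1 := profile_L2p K1; have lpF : L2p F := L2p_rhsA _ l4u lp.
have lb := state_L2 Ks; have lb1 := state_L2 K1.
pose r x := (step h s).1 x - s.1 x + c * symbol_drift s x.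
have lr : L2 r := L2D (L2B lb1 lb) (L2Z _ lV).
pose f x := profile (step h s) x - profile s x + c * F x.
have lpf : L2p f by apply: L2pD; [exact: L2pB|exact: L2pZ].
pose g x := Szego r x - fourier r 0.
have lpg : L2p g by apply: L2pB; [exact: L2p_Szego|exact: L2p_cst].
have lu := L2p_L2 lp; have lu1 := L2p_L2 lp1.
have fE k : fourier f k = fourier (profile (step h s)) k - fourier (profile s) k + c * fourier F k.
  rewrite (fourierD k (L2_L1 (L2B lu1 lu)) (L2_L1 (L2Z _ lF))) (fourierZ _ _ (L2_L1 lF)).
  by rewrite (fourierB k (L2_L1 lu1) (L2_L1 lu)).
have rE k : fourier r k = fourier (step h s).1 k - fourier s.1 k + c * fourier (symbol_drift s) k.
  rewrite (fourierD k (L2_L1 (L2B lb1 lb)) (L2_L1 (L2Z _ lV))) (fourierZ _ _ (L2_L1 lV)).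
  by rewrite (fourierB k (L2_L1 lb1) (L2_L1 lb)).
have gE (j : nat) : fourier g j%:Z = fourier r j%:Z + (j%:Z == 0)%:R * - fourier r 0.
  by rewrite (fourier_shift (- fourier r 0) _ (L2_Szego lr)) fourier_Szego.
have fg : f = g %[ae mu].
  apply: fourier_inj; [exact: L2_L1 (L2p_L2 lpf)|exact: L2_L1 (L2p_L2 lpg)|] => -[j|j]; last first.
    by rewrite (lpf.2)// (lpg.2).
  rewrite gE fE (fourier_profile _ Ks) (fourier_profile _ K1); case: j => [|j].
    rewrite eqxx mul1r subrr (fourier_rhs_mean Ks) /Submission.step /=.
    by rewrite -/c; move: (mean_drift s) => G; ring.
  by rewrite (_ : (j.+1%:Z == 0) = false)// mul0r addr0 rE (fourier_drift _ Ks).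
rewrite -/f (n2_ae (L2_meas (L2p_L2 lpf)) (L2_meas (L2p_L2 lpg)) fg).
apply: (le_trans (n2B (L2_Szego lr) (L2_cst _))); rewrite n2_cst.
have := symbol_taylor hs Ks; rewrite -/c -/r; have := n2_Szego lr.
have := le_trans (fourier_le 0 (L2_L1 lr)) (N1_le_n2 lr).
rewrite (_ : 148 * M ^+ 10 * h ^+ 2 = 2 * (74 * M ^+ 10 * h ^+ 2)); last by ring.
by set z := nc _; set T := 74 * _ * _; abs_lra.
Qed.

End profile_consistency.

(** * The limit evolution *)

Section evolution.
Context {R : realType}.
Local Notation C := R[i].
Local Notation mu := (@torus_measure R).
Local Notation nc := (@Normc.normc R).
Implicit Types (f g u v b : R -> C) (x y h : R) (A c : C).
Local Notation state := (@state R).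
Implicit Types s : state.
Local Opaque n2 L2 Szego fourier inner.
Variables (N rho M : R).
Hypotheses (N0 : 0 <= N) (rho0 : 0 <= rho) (ME : M = 2 * N + rho + 2).
Let M1 : 1 <= M. Proof. by have := N0; have := rho0; rewrite ME; lra. Qed.
Let M0 : 0 <= M. Proof. exact: le_trans ler01 M1. Qed.
Let NM : N <= M. Proof. by have := N0; have := rho0; rewrite ME; lra. Qed.
Let Mpow j k : (j <= k)%N -> M ^+ j <= M ^+ k. Proof. exact: ler_weXn2l. Qed.
Let Mn0 n : 0 <= M ^+ n. Proof. exact: exprn_ge0. Qed.
Local Notation L4_profile := (L4_profile N0 rho0 ME).
Local Notation nc_coupling := (nc_coupling N0 rho0 ME).
Local Notation coupling_lip := (coupling_lip N0 rho0 ME).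
Local Notation L4_phase := (L4_phase N0 rho0 ME).
Local Notation n2_phase := (n2_phase N0 rho0 ME).
Local Notation L2_phase := (L2_phase N0 rho0 ME).
Local Notation n2_phaseB := (n2_phaseB N0 rho0 ME).
Local Notation nc_mean_drift := (nc_mean_drift N0 rho0 ME).
Local Notation mean_drift_lip := (mean_drift_lip N0 rho0 ME).
Local Notation phase := (phase rho).
Local Notation coupling := (coupling rho).
Local Notation mean_drift := (mean_drift rho).
Local Notation in_states := (in_states N rho).
Local Notation nc_kick := (nc_kick N0 rho0 ME).
Local Notation kick_lip := (kick_lip N0 rho0 ME).
Local Notation small_kick := (small_kick N0 rho0 ME).
Local Notation small_kick2 := (small_kick2 N0 rho0 ME).
Local Notation in_states_step := (in_states_step N0 rho0 ME).
Local Notation step := (step N rho).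
Local Notation kick := (kick rho).
Local Notation turn := (turn rho).
Local Notation small_step := (small_step M).
Local Notation n2_profile := (n2_profile ME).
Local Notation step_move := (step_move N0 rho0 ME).
Local Notation step_consistent := (step_consistent N0 rho0 ME).
Local Notation step_stable := (step_stable N0 rho0 ME).
Local Notation profile_consistent := (profile_consistent N0 rho0 ME).
Local Notation state_complete := (state_complete N0).
Local Notation lipC := (lipC M).
Definition drift s : R -> C := rhsA (coupling s) (profile s).

Lemma L2_drift s : in_states s -> L2 (drift s).
Proof. by move=> Ks; apply: L2_rhsA; have [] := L4_profile Ks. Qed.

Lemma state_dist_le s s' : in_states s -> in_states s' -> state_dist s s' <= 2 * M.
Proof.
move=> Ks Ks'; have [Bb cb] := Ks; have [Bb' cb'] := Ks'.
have := n2B (state_L2 Ks) (state_L2 Ks'); have := Bd_n2 Bb; have := Bd_n2 Bb'.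
have := ncB s.2 s'.2; have := N0; rewrite /state_dist ME; move: cb cb'.
by set a := nc _; set b := nc _; set c := nc _; abs_lra.
Qed.

Lemma drift_holder : exists2 K, 0 <= K & forall s s', in_states s -> in_states s' ->
  n2 (fun x => drift s x - drift s' x) <= K * Num.sqrt (state_dist s s').
Proof.
exists (12 * M ^+ 4 * Num.sqrt (12 * M) + 300 * M ^+ 5 * Num.sqrt (2 * M)).
  by apply: addr_ge0; (apply: mulr_ge0; [exact: mulr_ge0 (ler0n _ _) (Mn0 _)|exact: sqrtr_ge0]).
move=> s s' Ks Ks'; set D := state_dist s s'; have D0 : 0 <= D := state_dist_ge0 _ _.
have [l4 k4] := L4_profile Ks; have [l4' k4'] := L4_profile Ks'.
have Hd := HB_sub (HB_profile ME Ks) (HB_profile ME Ks').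
have [ld kd] := HB_L4 (addr_ge0 M0 M0) Hd.
have nA := nc_coupling Ks; have nAB := coupling_lip Ks Ks'; rewrite -/D in nAB.
have r1 := n2_rhsA_sub (coupling s) l4 l4'.
have r2 := n2_rhsA_subA (coupling s) (coupling s') l4'.
have lr1 := L2_rhsA (coupling s) l4; have lr2 := L2_rhsA (coupling s) l4'.
have lr3 := L2_rhsA (coupling s') l4'.
apply: (le_trans (n2_trans lr1 lr2 lr3)); rewrite mulrDl.
have sD : Num.sqrt (12 * M) * Num.sqrt D = Num.sqrt (12 * M * D) by rewrite [in RHS]sqrtrM ?mulr_ge0.
have hd : n4 (fun x => profile s x - profile s' x) <= Num.sqrt (12 * M) * Num.sqrt D.
  rewrite sD -(@ler_pXn2r _ 2)// ?nnegrE ?n4_ge0 ?sqrtr_ge0//.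
  rewrite [leRHS]sqr_sqrtr ?mulr_ge0//.
  apply: (le_trans kd).
  have p : 0 <= 3 * (M + M) by rewrite mulr_ge0// addr_ge0.
  apply: (le_trans (ler_wpM2l p (n2_profileB Ks Ks'))); rewrite -/D.
  by rewrite le_eqVlt; apply/orP; left; apply/eqP; ring.
apply: lerD.
  apply: (le_trans r1); rewrite [leRHS](_ : _ = 3 * M ^+ 3 * ((2 * M + 2 * M) *
     (Num.sqrt (12 * M) * Num.sqrt D))); last by ring.
  apply: ler_pM; rewrite ?mulr_ge0 ?nc_ge0 ?n4_ge0//.
  - by rewrite addr_ge0 ?n4_ge0.
  - by rewrite ler_wpM2l.
  by apply: ler_pM; rewrite ?addr_ge0 ?n4_ge0 ?lerD.
apply: (le_trans r2).
have DD : D <= Num.sqrt (2 * M) * Num.sqrt D.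
  rewrite -{1}[D]sqr_sqrtr// expr2 ler_wpM2r ?sqrtr_ge0// ler_wsqrtr//.
  exact: state_dist_le.
rewrite [leRHS](_ : _ = 3 * (25 * M ^+ 3 * (Num.sqrt (2 * M) * Num.sqrt D)) * (2 * M) ^+ 2); last by ring.
have g1 : 3 * nc (coupling s - coupling s') <= 3 * (25 * M ^+ 3 * (Num.sqrt (2 * M) * Num.sqrt D)).
  rewrite ler_wpM2l//; apply: (le_trans nAB); rewrite ler_wpM2l// mulr_ge0//.
have g2 : n4 (profile s') ^+ 2 <= (2 * M) ^+ 2.
  by apply: lerXn2r k4'; rewrite nnegrE ?n4_ge0// mulr_ge0.
by apply: ler_pM g1 g2; rewrite ?sqr_ge0// mulr_ge0// nc_ge0.
Qed.

Lemma drift_bd s : in_states s -> n2 (drift s) <= 12 * M ^+ 5.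
Proof.
move=> Ks; have [l4 k4] := L4_profile Ks; have nA := nc_coupling Ks.
apply: (le_trans (n2_rhsA _ l4)); rewrite [leRHS](_ : _ = 3 * M ^+ 3 * (2 * M) ^+ 2); last by ring.
have g2 : n4 (profile s) ^+ 2 <= (2 * M) ^+ 2.
  by apply: lerXn2r k4; rewrite nnegrE ?n4_ge0// mulr_ge0.
apply: ler_pM g2; rewrite ?sqr_ge0//; first by rewrite mulr_ge0// nc_ge0.
by rewrite ler_wpM2l.
Qed.

Let h0 : R := (4 * M ^+ 5)^-1.
Let Mgt0 : 0 < M. Proof. exact: lt_le_trans ltr01 M1. Qed.
Let h00 : 0 < h0. Proof. by rewrite invr_gt0 mulr_gt0// exprn_gt0. Qed.
Let h01 : h0 <= 1.
Proof.
rewrite invf_le1 ?mulr_gt0 ?exprn_gt0//; have : 1 <= M ^+ 5 by exact: exprn_ege1.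
by set a := M ^+ 5; lra.
Qed.

Lemma small_of_le (sg h : R) : `|sg| = 1 -> 0 < h -> h <= h0 -> small_step (sg * h).
Proof.
move=> s1 hp hh; rewrite /Submission.small_step normrM s1 mul1r gtr0_norm//.
apply: (@le_trans _ _ (h0 * M ^+ 5)); first by rewrite ler_wpM2r.
rewrite /h0 invfM -mulrA mulVf ?mulr1//; by rewrite expf_neq0// gt_eqF.
Qed.

Section signed.
Variable sg : R.
Hypothesis sg1 : `|sg| = 1.
Let Phi h s := step (sg * h) s.

Let K_step h s : 0 < h -> h <= h0 -> in_states s -> in_states (Phi h s).
Proof. by move=> hp hh; apply: in_states_step; exact: small_of_le. Qed.

Let Cmove : 0 <= 10 * M ^+ 5. Proof. by rewrite mulr_ge0. Qed.
Let Ccons : 0 <= 5400 * M ^+ 10. Proof. by rewrite mulr_ge0 ?ler0n. Qed.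
Let Clip : 0 <= lipC. Proof. by rewrite mulr_ge0 ?ler0n. Qed.

Let nsg h : 0 < h -> `|sg * h| = h. Proof. by move=> hp; rewrite normrM sg1 mul1r gtr0_norm. Qed.

Let Phi_stable h s s' : 0 < h -> h <= h0 -> in_states s -> in_states s' ->
  state_dist (Phi h s) (Phi h s') <= (1 + lipC * h) * state_dist s s'.
Proof.
move=> hp hh Ks Ks'; have := step_stable (small_of_le sg1 hp hh) Ks Ks'.
by rewrite nsg.
Qed.

Let Phi_cons h s : 0 < h -> 2 * h <= h0 -> in_states s ->
  state_dist (Phi (2 * h) s) (Phi h (Phi h s)) <= 5400 * M ^+ 10 * h ^+ 2.
Proof.
move=> hp hh Ks; have h2 : 0 < 2 * h by rewrite mulr_gt0.
have := small_of_le sg1 h2 hh; rewrite mulrCA => sm.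
have := step_consistent sm Ks; rewrite [(sg * h) ^+ 2]exprMn -[sg ^+ 2]real_normK ?num_real// sg1.
by rewrite expr1n mul1r /Phi mulrCA.
Qed.

Let Phi_move h s : 0 < h -> h <= h0 -> in_states s -> state_dist s (Phi h s) <= 10 * M ^+ 5 * h.
Proof.
by move=> hp hh Ks; have := step_move (small_of_le sg1 hp hh) Ks; rewrite nsg.
Qed.

Let run := run Phi.

Lemma run_sum h s0 (l k : nat) (y : state) (dl : R) : 0 < h -> h <= h0 -> in_states s0 -> in_states y ->
  (forall j, (l <= j < l + k)%N -> n2 (fun x => drift (run h s0 j) x - drift y x) <= dl) ->
  n2 (fun x => profile (run h s0 (l + k)) x - profile (run h s0 l) x +
    'i%C * (sg * (k%:R * h))%:C%C * drift y x) <= k%:R * (148 * M ^+ 10 * h ^+ 2 + h * dl).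
Proof.
move=> hp hh K0 Ky; have Kr j : in_states (run h s0 j) by apply: K_run hp hh K0.
have lF := L2_drift Ky.
elim: k => [|k IH] H.
  rewrite addn0 [leRHS]mul0r; have -> : (fun x => profile (run h s0 l) x - profile (run h s0 l) x +
      'i%C * (sg * (0%:R * h))%:C%C * drift y x) = (fun=> 0).
    by apply/funext => x; rewrite mul0r mulr0 -[0%:C%C]/(0 : C) mulr0 mul0r subrr addr0.
  by rewrite n2_cst nc0.
have H1 : n2 (fun x => profile (run h s0 (l + k)) x - profile (run h s0 l) x +
    'i%C * (sg * (k%:R * h))%:C%C * drift y x) <= k%:R * (148 * M ^+ 10 * h ^+ 2 + h * dl).
  by apply: IH => j /andP[a b]; apply: H; rewrite a/= addnS ltnS ltnW.
have H2 := profile_consistent (small_of_le sg1 hp hh) (Kr (l + k)%N).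
have H3 := H (l + k)%N; rewrite leq_addr addnS ltnS leqnn in H3; have {}H3 := H3 isT.
rewrite addnS; set z := run h s0 (l + k) in H1 H2 H3 *.
have Kz : in_states z := Kr _; have Kz' : in_states (Phi h z) := K_step hp hh Kz.
have lz := L2_profile Kz; have lz' := L2_profile Kz'; have l0 := L2_profile (Kr l).
have lFz := L2_drift Kz.
rewrite (_ : (fun x => _) = (fun x => (profile z x - profile (run h s0 l) x +
    'i%C * (sg * (k%:R * h))%:C%C * drift y x) + ((profile (Phi h z) x - profile z x +
     'i%C * (sg * h)%:C%C * drift z x) - 'i%C * (sg * h)%:C%C * (drift z x - drift y x)))); last first.
  apply/funext => x; rewrite -natr1 mulrDl mul1r mulrDr CD.
  rewrite (_ : run h s0 (l + k).+1 = Phi h z)//; ring.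
have L1' := L2D (L2B lz l0) (L2Z ('i%C * (sg * (k%:R * h))%:C%C) lF).
have L2' := L2D (L2B lz' lz) (L2Z ('i%C * (sg * h)%:C%C) lFz).
have L3' := L2Z ('i%C * (sg * h)%:C%C) (L2B lFz lF).
apply: (le_trans (n2D L1' (L2B L2' L3'))).
rewrite -natr1 mulrDl mul1r; apply: lerD => //.
apply: (le_trans (n2B L2' L3')); apply: lerD.
  by apply: (le_trans H2); rewrite exprMn -[sg ^+ 2]real_normK ?num_real// sg1 expr1n mul1r.
rewrite (n2Z _ (L2B lFz lF)) ncM nci mul1r nc_real nsg//.
by rewrite ler_wpM2l// ltW.
Qed.

Lemma half_evolution s0 : in_states s0 -> exists X : R -> state, [/\ X 0 = s0,
  forall t, 0 <= t -> in_states (X t),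
  forall p q, 0 <= p -> p <= q -> state_dist (X p) (X q) <= 10 * M ^+ 5 * (q - p) &
  exists2 K, 0 <= K & forall p xi q, 0 <= p -> p <= xi -> xi <= q ->
    n2 (fun x => profile (X q) x - profile (X p) x + 'i%C * (sg * (q - p))%:C%C * drift (X xi) x)
    <= K * ((q - p) * Num.sqrt (q - p))].
Proof.
move=> K0.
have [X [X0 HX]] := @scheme_cvg _ _ (@state_dist R) in_states Phi h0 lipC (5400 * M ^+ 10)
  (10 * M ^+ 5) h00 Clip Ccons Cmove (@state_dist_refl R)
  (@state_dist_tri _ _ _) state_complete K_step Phi_stable Phi_cons Phi_move s0 K0.
have KX t : 0 <= t -> in_states (X t) by move=> /HX[].
have mg n : 0 < mesh h0 n := mesh_gt0 h00 n; have ml n : mesh h0 n <= h0 := mesh_le h00 n.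
have Kr n j : in_states (run (mesh h0 n) s0 j) by apply: K_run (mg n) (ml n) K0.
have pw e : 0 < e -> exists n, (2^-1 : R) ^+ n <= e.
  move=> ep; have /cvgr0_norm_le/(_ _ ep)[n0 _ H] : (fun n => (2^-1 : R) ^+ n) @ \oo --> (0 : R).
    by apply: cvg_expr; rewrite ger0_norm ?invr_ge0// invf_lt1// ltr1n.
  by exists n0; have := H n0 (leqnn _); rewrite /= ger0_norm// exprn_ge0// invr_ge0.
have lip p q : 0 <= p -> p <= q -> state_dist (X p) (X q) <= 10 * M ^+ 5 * (q - p).
  move=> p0 pq; have q0 := le_trans p0 pq; have [_ [B B0 HB]] := HX p p0; have [_ [B' B0' HB']] := HX q q0.
  have A0 : 0 <= B + B' + 10 * M ^+ 5 by rewrite !addr_ge0.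
  apply/ler_addgt0Pr => e ep; have ep' : 0 < e / (B + B' + 10 * M ^+ 5 + 1).
    by rewrite divr_gt0// ltr_wpDl.
  have [n hn] := pw _ ep'; set h := mesh h0 n; set l := index h p; set m := index h q.
  have lm : (l <= m)%N by apply: index_mono => //; exact: mg.
  have d1 := run_dist (@state_dist_refl R) (@state_dist_tri _ _ _) K_step Phi_move (mg n) (ml n) K0 lm.
  have t1 := state_dist_tri (KX p p0) (Kr n l) (KX q q0).
  have t2 := state_dist_tri (Kr n l) (Kr n m) (KX q q0).
  have i1 := index_gt (mg n) p0; have i2 := index_le (mg n) q0.
  have d2 : 10 * M ^+ 5 * ((m - l)%:R * h) <= 10 * M ^+ 5 * (q - p + h).
    rewrite ler_wpM2l// natrB// mulrBl; move: i1 i2; rewrite -/h -/l -/m.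
    by set a := _ * h; set b := _ * h; lra.
  have hh : 10 * M ^+ 5 * h <= 10 * M ^+ 5 * 2^-1 ^+ n.
    by rewrite ler_wpM2l// /h /mesh ler_piMl// exprn_ge0// invr_ge0.
  have fin := le_trans (ler_wpM2l A0 hn) (frac_le A0 ep).
  have s1 := HB n; have s2 := HB' n; rewrite state_dist_sym in s1.
  rewrite mulrDr in d2; move: t1 t2 d1 d2 hh fin s1 s2; rewrite -/h -/l -/m -/run.
  set a1 := state_dist _ _; set a2 := state_dist _ _; set a3 := state_dist _ _.
  set a4 := state_dist _ _; set a5 := state_dist _ _; set w := 2^-1 ^+ n.
  by lra.
exists X; split => //.
have [KF KF0 HF] := drift_holder.
exists (KF * Num.sqrt (10 * M ^+ 5)); first by rewrite mulr_ge0 ?sqrtr_ge0.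
move=> p xi q p0 pxi xiq; have q0 := le_trans p0 (le_trans pxi xiq); have xi0 := le_trans p0 pxi.
have pq := le_trans pxi xiq.
have [_ [B1 B10 HB1]] := HX p p0; have [_ [B2 B20 HB2]] := HX q q0; have [_ [B3 B30 HB3]] := HX xi xi0.
set T := q - p; have T0 : 0 <= T by rewrite subr_ge0.
set C0 := 10 * M ^+ 5; set E := 148 * M ^+ 10; set Fb := 12 * M ^+ 5.
have E0 : 0 <= E by rewrite mulr_ge0 ?ler0n.
have Fb0 : 0 <= Fb by rewrite mulr_ge0.
set r0 := Num.sqrt (C0 * T); set r1 := Num.sqrt (C0 + B3).
have r00 : 0 <= r0 := sqrtr_ge0 _; have r10 : 0 <= r1 := sqrtr_ge0 _.
set Kc := 2 * (B1 + B2) + Fb + (T + 1) * (E + KF * r1) + KF * r0.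
have Kc0 : 0 <= Kc.
  have q1 : 0 <= 2 * (B1 + B2) by rewrite mulr_ge0// addr_ge0.
  have q2 : 0 <= (T + 1) * (E + KF * r1).
    by apply: mulr_ge0; [exact: addr_ge0|apply: addr_ge0 => //; exact: mulr_ge0].
  have q3 : 0 <= KF * r0 by rewrite mulr_ge0.
  by rewrite /Kc; apply: addr_ge0 q3; apply: addr_ge0 q2; exact: addr_ge0.
have -> : KF * Num.sqrt C0 * (T * Num.sqrt T) = T * (KF * r0).
  by rewrite /r0 (_ : Num.sqrt (C0 * T) = Num.sqrt C0 * Num.sqrt T); [ring|exact: sqrtrM].
apply/ler_addgt0Pr => e ep; pose eta := Num.min 1 (e / (Kc + 1)).
have eta0 : 0 < eta by rewrite lt_min ltr01 divr_gt0// ltr_wpDl.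
have eta1 : eta <= 1 by rewrite ge_min lexx.
have fin : Kc * eta <= e.
  apply: le_trans (frac_le Kc0 ep); rewrite ler_wpM2l// ge_min lexx orbT//.
have [n hn] := pw (eta ^+ 2) (exprn_gt0 _ eta0).
have e2e : eta ^+ 2 <= eta by rewrite expr2 ler_piMl// ltW.
have w0 : 0 <= (2^-1 : R) ^+ n by rewrite exprn_ge0// invr_ge0.
set h := mesh h0 n; have hp : 0 < h := mg n; have hle : h <= h0 := ml n.
have hw : h <= 2^-1 ^+ n by rewrite /h /mesh ler_piMl.
have he2 : h <= eta ^+ 2 := le_trans hw hn; have he : h <= eta := le_trans he2 e2e.
set l := index h p; set m := index h q; set j := index h xi.
have lj : (l <= j)%N by apply: index_mono.
have jm : (j <= m)%N by apply: index_mono.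
have lm := leq_trans lj jm.
have i1 := index_gt hp p0; have i2 := index_le hp q0; have i1' := index_le hp p0; have i2' := index_gt hp q0.
rewrite -/l -/m in i1 i2 i1' i2'.
set S := (m - l)%:R * h.
have SE : S = m%:R * h - l%:R * h by rewrite /S natrB// mulrBl.
have ST : `|T - S| <= h.
  rewrite SE /T ler_norml; move: i1 i2 i1' i2'; set a := _ * h; set b := _ * h.
  by move=> *; apply/andP; split; lra.
have S0 : 0 <= S by rewrite mulr_ge0// ltW.
have STh : S <= T + h by move: ST; rewrite ler_norml => /andP[? ?]; lra.
pose dl := KF * (r0 + r1 * eta).
have Hdl k : (l <= k < l + (m - l))%N -> n2 (fun x => drift (run h s0 k) x - drift (X xi) x) <= dl.
  rewrite subnKC// => /andP[lk km].
  apply: (le_trans (HF _ _ (Kr n k) (KX xi xi0))); rewrite ler_wpM2l//.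
  have d1 : state_dist (run h s0 k) (run h s0 j) <= C0 * S.
    have rd := run_dist (@state_dist_refl R) (@state_dist_tri _ _ _) K_step Phi_move hp hle K0.
    have mono a : (a <= m - l)%N -> C0 * (a%:R * h) <= C0 * S.
      by move=> am; rewrite ler_wpM2l// ler_wpM2r ?(ltW hp)// ler_nat.
    case: (leqP k j) => kj.
      by apply: (le_trans (rd _ _ kj)); apply: mono; exact: leq_sub.
    rewrite state_dist_sym; apply: (le_trans (rd _ _ (ltnW kj))); apply: mono.
    by apply: leq_sub => //; exact: ltnW.
  have d2 : state_dist (run h s0 j) (X xi) <= B3 * eta ^+ 2.
    by apply: (le_trans (HB3 n)); rewrite ler_wpM2l.
  have d3 := state_dist_tri (Kr n k) (Kr n j) (KX xi xi0).
  have d4 : state_dist (run h s0 k) (X xi) <= C0 * T + (C0 + B3) * eta ^+ 2.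
    have : C0 * S <= C0 * T + C0 * eta ^+ 2.
      by rewrite -mulrDr ler_wpM2l// (le_trans STh)// lerD2l.
    move: d1 d2 d3; rewrite mulrDl -/run; set b1 := state_dist _ _; set b2 := state_dist _ _.
    set b3 := state_dist _ _; set y1 := C0 * S; set y2 := C0 * T; set y3 := C0 * _; set y4 := B3 * _.
    by lra.
  have C00 : 0 <= C0 + B3 by rewrite addr_ge0.
  rewrite -(@ler_pXn2r _ 2)// ?nnegrE ?sqrtr_ge0 ?addr_ge0 ?mulr_ge0 ?(ltW eta0)//.
  rewrite sqr_sqrtr ?state_dist_ge0//; apply: (le_trans d4).
  rewrite sqrrD exprMn !sqr_sqrtr ?mulr_ge0// addrAC lerDl mulrn_wge0// mulr_ge0// mulr_ge0//; exact: ltW.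
have Hs := run_sum hp hle K0 (KX xi xi0) Hdl; rewrite subnKC// -/S in Hs.
have lF := L2_drift (KX xi xi0); have lq := L2_profile (KX q q0); have lp := L2_profile (KX p p0).
have lm' := L2_profile (Kr n m); have ll := L2_profile (Kr n l).
have lH := L2D (L2B lm' ll) (L2Z ('i%C * (sg * S)%:C%C) lF).
have lQ := L2B lq lm'; have lP := L2B lp ll.
have lT := L2Z ('i%C * (sg * (T - S))%:C%C) lF.
rewrite (_ : (fun x => _) = (fun x => ((profile (X q) x - profile (run h s0 m) x) -
   (profile (X p) x - profile (run h s0 l) x)) + ((profile (run h s0 m) x - profile (run h s0 l) x +
   'i%C * (sg * S)%:C%C * drift (X xi) x) + 'i%C * (sg * (T - S))%:C%C * drift (X xi) x))); last first.
  apply/funext => x; have -> : (sg * (T - S))%:C%C = (sg * T)%:C%C - (sg * S)%:C%C :> C.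
    by rewrite -CB; congr (_%:C%C); ring.
  by move: (sg * T)%:C%C (sg * S)%:C%C => a b; ring.
apply: (le_trans (n2D (L2B lQ lP) (L2D lH lT))).
have b3 : n2 (fun x => profile (X q) x - profile (run h s0 m) x) <= 2 * (B2 * eta).
  apply: (le_trans (n2_profileB (KX q q0) (Kr n m))); rewrite state_dist_sym ler_wpM2l//.
  by apply: (le_trans (HB2 n)); rewrite ler_wpM2l// (le_trans hn).
have b4 : n2 (fun x => profile (X p) x - profile (run h s0 l) x) <= 2 * (B1 * eta).
  apply: (le_trans (n2_profileB (KX p p0) (Kr n l))); rewrite state_dist_sym ler_wpM2l//.
  by apply: (le_trans (HB1 n)); rewrite ler_wpM2l// (le_trans hn).
have b5 : n2 (fun x => 'i%C * (sg * (T - S))%:C%C * drift (X xi) x) <= eta * Fb.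
  rewrite (n2Z _ lF) ncM nci mul1r nc_real normrM sg1 mul1r.
  exact: ler_pM (normr_ge0 _) (n2_ge0 _) (le_trans ST he) (drift_bd (KX xi xi0)).
have b6 : (m - l)%:R * (E * h ^+ 2 + h * dl) <= T * (KF * r0) + eta * ((T + 1) * (E + KF * r1) + KF * r0).
  rewrite [leLHS](_ : _ = S * (E * h + dl)); last by rewrite /S; ring.
  have s1 : S <= T + eta by apply: (le_trans STh); rewrite lerD2l.
  have s2 : S <= T + 1 by apply: (le_trans s1); rewrite lerD2l.
  have x1 : S * (E * h) <= (T + 1) * (E * eta).
    exact: ler_pM S0 (mulr_ge0 E0 (ltW hp)) s2 (ler_wpM2l E0 he).
  have x2 : S * (KF * r0) <= (T + eta) * (KF * r0) by rewrite ler_wpM2r// mulr_ge0.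
  have x3 : S * (KF * (r1 * eta)) <= (T + 1) * (KF * (r1 * eta)).
    by rewrite ler_wpM2r// mulr_ge0// mulr_ge0// ltW.
  rewrite /dl !mulrDr; apply: (le_trans (lerD x1 (lerD x2 x3))).
  by rewrite le_eqVlt; apply/orP; left; apply/eqP; ring.
have KcE : Kc * eta = 2 * (B1 * eta) + 2 * (B2 * eta) + eta * Fb +
    eta * ((T + 1) * (E + KF * r1) + KF * r0) by rewrite /Kc; ring.
have b1 := le_trans (n2B lQ lP) (lerD b3 b4).
have b2 := le_trans (n2D lH lT) (lerD (le_trans Hs b6) b5).
apply: (le_trans (lerD b1 b2)); move: fin; rewrite KcE.
set y1 := 2 * (B1 * eta); set y2 := 2 * (B2 * eta); set y3 := eta * Fb; set y4 := eta * _.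
by set y5 := T * _; lra.
Qed.

End signed.

End evolution.

(** * Riemann integrals in L2 and a Gronwall lemma *)

Section L2_integral.
Context {R : realType}.
Local Notation C := R[i].
Local Notation mu := (@torus_measure R).
Local Notation nc := (@Normc.normc R).
Local Opaque n2 L2 inner.
Implicit Types (F u w v : R -> R -> C) (G D f g : R -> C) (a b c t e K : R).

(** A quantitative form of u' = F, uniform in the point where F is evaluated, as
    needed for Riemann sums with arbitrary tags. *)
Definition good_curve u F K (I : R -> Prop) :=
  forall p xi q, I p -> I q -> p <= xi -> xi <= q ->
    n2 (fun x => u q x - u p x - (q - p)%:C%C * F xi x) <= K * ((q - p) * Num.sqrt (q - p)).

Fixpoint left_sum F a (s : seq R) : R -> C :=
  if s is y :: s' then (fun x => (y - a)%:C%C * F a x + left_sum F y s' x) else fun=> 0.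

Definition fine d a b (s : seq R) :=
  path (fun x y => (x < y) && (y - x < d)) a s && (last a s == b).

Lemma fineP d a b s : fine d a b s -> itv_partition a b s /\
  forall i, (i < size s)%N -> nth b (a :: s) i.+1 - nth b (a :: s) i < d.
Proof.
move=> /andP[p l]; split.
  by split => //; apply: sub_path p => x y /andP[].
by move=> i si; have := pathP b p i si => /andP[_].
Qed.

Lemma left_sumE F a b s x :
  riemann_sum F a b s (fun i => nth b (a :: s) i) x = left_sum F a s x.
Proof.
elim: s a => [|y s IH] a; first by rewrite /riemann_sum big_geq.
by rewrite /riemann_sum big_nat_recl//= -IH.
Qed.

Lemma left_sum_cat F a s1 s2 x :
  left_sum F a (s1 ++ s2) x = left_sum F a s1 x + left_sum F (last a s1) s2 x.
Proof. by elim: s1 a => [|y s1 IH] a /=; rewrite ?add0r// IH addrA. Qed.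

Lemma fine_cat d a b c s1 s2 : fine d a b s1 -> fine d b c s2 -> fine d a c (s1 ++ s2).
Proof.
move=> /andP[p1 /eqP l1] /andP[p2 l2]; rewrite /fine cat_path p1 l1 p2 last_cat l1.
exact: l2.
Qed.

Lemma fine_exists d a b : 0 < d -> a <= b -> exists s, fine d a b s.
Proof.
move=> d0 ab; have d20 : 0 < d / 2 by rewrite divr_gt0.
have [n hn] : exists n : nat, b - a <= n%:R * (d / 2).
  exists (Num.truncn ((b - a) / (d / 2))).+1; rewrite -ler_pdivrMr//.
  have /truncn_itv/andP[_ /ltW] // : 0 <= (b - a) / (d / 2).
  by rewrite divr_ge0 ?subr_ge0// ltW.
elim: n a ab hn => [|n IH] a ab hn.
  exists [::]; rewrite /fine /=; apply/eqP/le_anti; rewrite ab /=.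
  by move: hn; rewrite mul0r subr_le0.
have [h|h] := leP (b - a) (d / 2).
  have [->|ne] := eqVneq a b; first by exists [::]; rewrite /fine /= eqxx.
  exists [:: b]; rewrite /fine /= eqxx !andbT lt_neqAle ne ab /=; lra.
have [||s hs] := IH (a + d / 2); [lra|move: hn; rewrite -natr1; lra|].
move/andP: hs => [p l]; exists (a + d / 2 :: s); rewrite /fine /= p l !andbT; apply/andP; split; lra.
Qed.

Lemma left_sum_bound F G d a b s e : (forall t, L2 (F t)) -> L2 G -> fine d a b s ->
  (forall t, a <= t -> t <= b -> n2 (fun x => F t x - G x) <= e) ->
  L2 (left_sum F a s) /\ a <= b /\
  n2 (fun x => left_sum F a s x - (b - a)%:C%C * G x) <= (b - a) * e.
Proof.
move=> lF lG; elim: s a => [|y s IH] a /=.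
  move=> /andP[_ /eqP/= <-] _; split; first exact: L2_cst.
  split => //; rewrite subrr mul0r (_ : (fun x => _) = (fun=> 0)) ?n2_cst ?nc0//.
  by apply/funext => x; rewrite -[0%:C%C]/(0 : C) mul0r subrr.
move=> /andP[/= /andP[/andP[ay ayd] p] l] H.
have {p l} fs : fine d y b s by rewrite /fine p.
have [l [yb h]] := IH y fs (fun t yt tb => H t (le_trans (ltW ay) yt) tb).
have la := L2Z (y - a)%:C%C (lF a).
split; first exact: L2D.
split; first exact: le_trans (ltW ay) yb.
rewrite (_ : (fun x => _) = (fun x => (y - a)%:C%C * (F a x - G x) +
   (left_sum F y s x - (b - y)%:C%C * G x))); last first.
  by apply/funext => x; rewrite !CB; ring.
have lx := L2Z (y - a)%:C%C (L2B (lF a) lG).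
apply: (le_trans (n2D lx (L2B l (L2Z _ lG)))).
rewrite (n2Z _ (L2B (lF a) lG)) nc_real ger0_norm ?subr_ge0 ?(ltW ay)//.
have h1 : (y - a) * n2 (fun x => F a x - G x) <= (y - a) * e.
  by rewrite ler_wpM2l ?subr_ge0 ?(ltW ay)// H// (le_trans (ltW ay) yb).
by apply: (le_trans (lerD h1 h)); rewrite le_eqVlt; apply/orP; left; apply/eqP; ring.
Qed.

Lemma L2_left_sum F a s : (forall t, L2 (F t)) -> L2 (left_sum F a s).
Proof.
move=> lF; elim: s a => [|y s IH] a /=; first exact: L2_cst.
by apply: L2D; [exact: L2Z|exact: IH].
Qed.

Lemma Rint_left_sum F a b G e : (forall t, L2 (F t)) -> is_L2_Rint_le F a b G -> 0 < e ->
  L2 G /\ exists2 d, 0 < d & forall s, fine d a b s -> n2 (fun x => left_sum F a s x - G x) < e.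
Proof.
move=> lF [/L2P lG H] e0; split => //; have [d d0 {}H] := H e e0; exists d => // s fs.
have [ps ms] := fineP fs.
have := H s (fun i => nth b (a :: s) i) ps.
have -> : riemann_sum F a b s (fun i => nth b (a :: s) i) = left_sum F a s.
  by apply/funext => x; exact: left_sumE.
rewrite (L2dist_n2 (L2_left_sum a s lF) lG) lte_fin; apply => i si; split; first exact: ms.
rewrite lexx /=; move/andP: fs => [p _]; have := pathP b p i si => /andP[h _]; exact: ltW.
Qed.

Lemma fine_mono d d' a b s : d <= d' -> fine d a b s -> fine d' a b s.
Proof.
move=> dd /andP[p l]; apply/andP; split => //; apply: sub_path p => x y /andP[-> /=] h.
exact: lt_le_trans h dd.
Qed.

Lemma Rint_bound F a b V G e : (forall t, L2 (F t)) -> L2 G -> a <= b ->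
  is_L2_Rint_le F a b V ->
  (forall t, a <= t -> t <= b -> n2 (fun x => F t x - G x) <= e) ->
  n2 (fun x => V x - (b - a)%:C%C * G x) <= (b - a) * e.
Proof.
move=> lF lG ab HV H; apply/ler_addgt0Pr => r r0.
have [lV [d d0 Hd]] := Rint_left_sum lF HV r0; have [s fs] := fine_exists d0 ab.
have [ls [_ h]] := left_sum_bound lF lG fs H; have h1 := Hd s fs.
apply: (le_trans (n2_trans lV ls (L2Z (b - a)%:C%C lG))); rewrite addrC; apply: lerD => //.
by rewrite n2_sub ltW.
Qed.

Lemma Rint_diff_right F a b c V W G e : (forall t, L2 (F t)) -> L2 G -> a <= b -> b <= c ->
  is_L2_Rint_le F a b V -> is_L2_Rint_le F a c W ->
  (forall t, b <= t -> t <= c -> n2 (fun x => F t x - G x) <= e) ->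
  n2 (fun x => W x - V x - (c - b)%:C%C * G x) <= (c - b) * e.
Proof.
move=> lF lG ab bc HV HW H; apply/ler_addgt0Pr => r r0; have r20 : 0 < r / 2 by rewrite divr_gt0.
have [lV [d d0 Hd]] := Rint_left_sum lF HV r20; have [lW [d' d0' Hd']] := Rint_left_sum lF HW r20.
have m0 : 0 < Num.min d d' by rewrite lt_min d0.
have [s1 f1] := fine_exists m0 ab; have [s2 f2] := fine_exists m0 bc.
have h1 : n2 (fun x => left_sum F a s1 x - V x) < r / 2.
  by apply: Hd; apply: fine_mono f1; rewrite ge_min lexx.
have h2 : n2 (fun x => left_sum F a (s1 ++ s2) x - W x) < r / 2.
  by apply: Hd'; apply: fine_mono (fine_cat f1 f2); rewrite ge_min lexx orbT.
have [l2 [_ h]] := left_sum_bound lF lG f2 H.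
have l1 := L2_left_sum a s1 lF; have l12 := L2_left_sum a (s1 ++ s2) lF.
have E x : left_sum F a (s1 ++ s2) x = left_sum F a s1 x + left_sum F b s2 x.
  by rewrite left_sum_cat; move/andP: f1 => [_ /eqP ->].
rewrite (_ : (fun x => _) = (fun x => ((left_sum F a s1 x - V x) - (left_sum F a (s1 ++ s2) x - W x))
   + (left_sum F b s2 x - (c - b)%:C%C * G x))); last by apply/funext => x; rewrite E; ring.
have k1 := L2B (L2B l1 lV) (L2B l12 lW); have k2 := L2B l2 (L2Z (c - b)%:C%C lG).
apply: (le_trans (n2D k1 k2)); rewrite addrC; apply: lerD; first exact: h.
by apply: (le_trans (n2B (L2B l1 lV) (L2B l12 lW))); rewrite [r]splitr; apply: lerD; exact: ltW.
Qed.

Lemma Rint_diff_left F a b c V W G e : (forall t, L2 (F t)) -> L2 G -> a <= b -> b <= c ->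
  is_L2_Rint_le F a c V -> is_L2_Rint_le F b c W ->
  (forall t, a <= t -> t <= b -> n2 (fun x => F t x - G x) <= e) ->
  n2 (fun x => V x - W x - (b - a)%:C%C * G x) <= (b - a) * e.
Proof.
move=> lF lG ab bc HV HW H; apply/ler_addgt0Pr => r r0; have r20 : 0 < r / 2 by rewrite divr_gt0.
have [lV [d d0 Hd]] := Rint_left_sum lF HV r20; have [lW [d' d0' Hd']] := Rint_left_sum lF HW r20.
have m0 : 0 < Num.min d d' by rewrite lt_min d0.
have [s1 f1] := fine_exists m0 ab; have [s2 f2] := fine_exists m0 bc.
have h1 : n2 (fun x => left_sum F a (s1 ++ s2) x - V x) < r / 2.
  by apply: Hd; apply: fine_mono (fine_cat f1 f2); rewrite ge_min lexx.
have h2 : n2 (fun x => left_sum F b s2 x - W x) < r / 2.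
  by apply: Hd'; apply: fine_mono f2; rewrite ge_min lexx orbT.
have [l1 [_ h]] := left_sum_bound lF lG f1 H.
have l2 := L2_left_sum b s2 lF; have l12 := L2_left_sum a (s1 ++ s2) lF.
have E x : left_sum F a (s1 ++ s2) x = left_sum F a s1 x + left_sum F b s2 x.
  by rewrite left_sum_cat; move/andP: f1 => [_ /eqP ->].
rewrite (_ : (fun x => _) = (fun x => ((left_sum F b s2 x - W x) - (left_sum F a (s1 ++ s2) x - V x))
   + (left_sum F a s1 x - (b - a)%:C%C * G x))); last by apply/funext => x; rewrite E; ring.
have k1 := L2B (L2B l2 lW) (L2B l12 lV); have k2 := L2B l1 (L2Z (b - a)%:C%C lG).
apply: (le_trans (n2D k1 k2)); rewrite addrC; apply: lerD; first exact: h.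
by apply: (le_trans (n2B (L2B l2 lW) (L2B l12 lV))); rewrite [r]splitr; apply: lerD; exact: ltW.
Qed.

Definition L2_continuous F := forall t e, 0 < e -> exists2 d, 0 < d &
  forall s, `|s - t| < d -> n2 (fun x => F s x - F t x) <= e.

Definition L2_derivative w t D := forall e, 0 < e -> exists2 d, 0 < d &
  forall s, `|s - t| < d -> n2 (fun x => w s x - w t x - (s - t)%:C%C * D x) <= e * `|s - t|.

Lemma is_L2_Rint_L2 F a b V : is_L2_Rint F a b V -> L2 V.
Proof.
rewrite /is_L2_Rint; case: ifP => _ [/L2P l _] //.
by have := L2N l; congr L2; apply/funext => x; rewrite opprK.
Qed.

Lemma Rint_refl0 F V : (forall t, L2 (F t)) -> is_L2_Rint F 0 0 V -> n2 V = 0.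
Proof.
move=> lF HV; have lV := is_L2_Rint_L2 HV; move: HV; rewrite /is_L2_Rint lexx => HV.
have := @Rint_bound F 0 0 V (F 0) 0 lF (lF 0) (lexx _) HV.
rewrite subrr mul0r (_ : (fun x => V x - _) = V); last first.
  by apply/funext => x; rewrite -[0%:C%C]/(0 : C) mul0r subr0.
move=> h; apply/eqP; rewrite eq_le n2_ge0 andbT; apply: h => t t0 t1.
have -> : t = 0 by apply: le_anti; rewrite t0 t1.
by rewrite (_ : (fun x => _) = (fun=> 0)) ?n2_cst ?nc0//; apply/funext => x; rewrite subrr.
Qed.

(** Fundamental theorem of calculus, with the two orientations of the integral
    on both sides of the origin. *)
Lemma Rint_derivative F v t : (forall t, L2 (F t)) -> L2_continuous F ->
  (forall t, is_L2_Rint F 0 t (v t)) -> L2_derivative v t (F t).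
Proof.
move=> lF cF Hv e e0; have [d d0 Hd] := cF t e e0.
have lv s : L2 (v s) := is_L2_Rint_L2 (Hv s).
have pos s : 0 <= s -> is_L2_Rint_le F 0 s (v s) by move=> s0; have := Hv s; rewrite /is_L2_Rint s0.
have neg s : s < 0 -> is_L2_Rint_le F s 0 (fun x => - v s x).
  by move=> s0; have := Hv s; rewrite /is_L2_Rint leNgt s0.
have v00 : n2 (v 0) = 0 := Rint_refl0 lF (Hv 0).
have neg' s G e' : s < 0 -> L2 G -> (forall r, s <= r -> r <= 0 -> n2 (fun x => F r x - G x) <= e') ->
    n2 (fun x => v s x - v 0 x - (s - 0)%:C%C * G x) <= (0 - s) * e'.
  move=> s0 lG H; have := Rint_bound lF lG (ltW s0) (neg s s0) H.
  rewrite -[X in X <= _](n2N (fun x => - v s x - (0 - s)%:C%C * G x)).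
  rewrite (_ : (fun x => - (- v s x - _)) = (fun x => v s x - (s - 0)%:C%C * G x)); last first.
    by apply/funext => x; rewrite subr0 sub0r CN; ring.
  move=> h; have l1 := L2B (lv s) (L2Z (s - 0)%:C%C lG).
  rewrite (_ : (fun x => _ - v 0 x - _) = (fun x => (v s x - (s - 0)%:C%C * G x) - v 0 x)).
    by apply: (le_trans (n2B l1 (lv 0))); rewrite v00 addr0.
  by apply/funext => x; ring.
pose dd := if t == 0 then d else Num.min d `|t|.
exists dd.
  by rewrite /dd; case: eqP => [//|/eqP h]; rewrite lt_min d0 normr_gt0.
move=> s sd.
have sd' : `|s - t| < d by apply: lt_le_trans sd _; rewrite /dd; case: eqP => // _; rewrite ge_min lexx.
have near r : (s <= r <= t) || (t <= r <= s) -> n2 (fun x => F r x - F t x) <= e.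
  move=> h; apply: Hd; apply: le_lt_trans sd'; rewrite ler_norml.
  have := ler_norm (s - t); have := ler_norm (- (s - t)); rewrite normrN.
  move: h; set A := `|s - t|; clear=> h h1 h2; apply/andP.
  by case/orP: h => /andP[? ?]; split; lra.
have [ts|st] := leP t s; last first.
  have nst : `|s - t| = t - s by rewrite ltr0_norm ?subr_lt0// opprB.
  rewrite nst mulrC.
  have H r : s <= r -> r <= t -> n2 (fun x => F r x - F t x) <= e.
    by move=> a1 a2; apply: near; rewrite a1 a2.
  rewrite -n2N (_ : (fun x => - _) = (fun x => v t x - v s x - (t - s)%:C%C * F t x)); last first.
    by apply/funext => x; rewrite !CB; ring.
  have [t0|t0] := ltP t 0.
    have s0 : s < 0 := lt_trans st t0.
    have := Rint_diff_left lF (lF t) (ltW st) (ltW t0) (neg s s0) (neg t t0) H.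
    by rewrite (_ : (fun x => - _ - - _ - _) = (fun x => v t x - v s x - (t - s)%:C%C * F t x))//;
      apply/funext => x; ring.
  have [s0|s0] := leP 0 s.
    exact: (Rint_diff_right lF (lF t) s0 (ltW st) (pos s s0) (pos t t0)).
  have t00 : t = 0.
    apply/eqP; move: sd; rewrite /dd; case: eqP => // _; rewrite nst lt_min => /andP[_].
    by rewrite ger0_norm//; lra.
  move: H; rewrite t00 => H; have := neg' s (F 0) e s0 (lF 0) H.
  rewrite -n2N (_ : (fun x => - _) = (fun x => v 0 x - v s x - (0 - s)%:C%C * F 0 x))//.
  by apply/funext => x; rewrite !CB; ring.
have nst : `|s - t| = s - t by rewrite ger0_norm ?subr_ge0.
rewrite nst mulrC.
have H r : t <= r -> r <= s -> n2 (fun x => F r x - F t x) <= e.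
  by move=> a1 a2; apply: near; rewrite a1 a2 orbT.
have [t0|t0] := leP 0 t.
  exact: (Rint_diff_right lF (lF t) t0 ts (pos t t0) (pos s (le_trans t0 ts))).
have s0 : s < 0.
  move: sd; rewrite /dd lt_eqF// nst lt_min => /andP[_]; rewrite ltr0_norm//; lra.
have := Rint_diff_left lF (lF t) ts (ltW s0) (neg t t0) (neg s s0) H.
by rewrite (_ : (fun x => - _ - - _ - _) = (fun x => v s x - v t x - (s - t)%:C%C * F t x))//;
  apply/funext => x; ring.
Qed.

Lemma riemann_sum_cons F a b y s xi x :
  riemann_sum F a b (y :: s) xi x =
  (y - a)%:C%C * F (xi 0%N) x + riemann_sum F y b s (fun i => xi i.+1) x.
Proof. by rewrite /riemann_sum big_nat_recl. Qed.

Lemma L2_riemann_sum F a b s xi : (forall t, L2 (F t)) -> L2 (riemann_sum F a b s xi).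
Proof. by move=> lF; apply: L2_sum => i; exact: L2Z. Qed.

Lemma good_sum u F K I a b s xi d : (forall t, L2 (F t)) -> (forall t, L2 (u t)) -> 0 <= K ->
  good_curve u F K I -> (forall t, a <= t -> t <= b -> I t) -> itv_partition a b s ->
  (forall i, (i < size s)%N -> nth b (a :: s) i.+1 - nth b (a :: s) i < d /\
         nth b (a :: s) i <= xi i <= nth b (a :: s) i.+1) ->
  a <= b /\ n2 (fun x => riemann_sum F a b s xi x - (u b x - u a x)) <= K * ((b - a) * Num.sqrt d).
Proof.
move=> lF lu K0 gd; elim: s a xi => [|y s IH] a xi Iab [p l] H.
  move/eqP: l => /= <-; split => //; rewrite subrr mul0r mulr0.
  rewrite (_ : (fun x => _) = (fun=> 0)) ?n2_cst ?nc0//; apply/funext => x.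
  by rewrite /riemann_sum big_geq// !subrr.
move: p l => /= /andP[ay p] l; have ps : itv_partition y b s by split.
have Hs i : (i < size s)%N -> nth b (y :: s) i.+1 - nth b (y :: s) i < d /\
         nth b (y :: s) i <= xi i.+1 <= nth b (y :: s) i.+1 by move=> hi; exact: (H i.+1).
have [yb h] := IH y (fun i => xi i.+1) (fun t yt tb => Iab t (le_trans (ltW ay) yt) tb) ps Hs.
have ab := le_trans (ltW ay) yb; split => //.
have [/= yd /andP[x1 x2]] := H 0%N isT.
have g := gd a (xi 0%N) y (Iab a (lexx _) ab) (Iab y (ltW ay) yb) x1 x2.
rewrite (_ : (fun x => _) = (fun x => (riemann_sum F y b s (fun i => xi i.+1) x - (u b x - u y x)) -
   (u y x - u a x - (y - a)%:C%C * F (xi 0%N) x))); last first.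
  by apply/funext => x; rewrite riemann_sum_cons; ring.
have k1 := L2B (L2_riemann_sum y b s (fun i => xi i.+1) lF) (L2B (lu b) (lu y)).
have k2 := L2B (L2B (lu y) (lu a)) (L2Z (y - a)%:C%C (lF (xi 0%N))).
apply: (le_trans (n2B k1 k2)).
have g2 : K * ((y - a) * Num.sqrt (y - a)) <= K * ((y - a) * Num.sqrt d).
  by rewrite ler_wpM2l// ler_wpM2l ?subr_ge0 ?(ltW ay)// ler_wsqrtr// ltW.
apply: (le_trans (lerD h (le_trans g g2))).
by rewrite le_eqVlt; apply/orP; left; apply/eqP; ring.
Qed.

Lemma good_Rint_le u F K (I : R -> Prop) a b : (forall t, L2 (F t)) -> (forall t, L2 (u t)) -> 0 <= K ->
  good_curve u F K I -> (forall t, a <= t -> t <= b -> I t) -> a <= b ->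
  is_L2_Rint_le F a b (fun x => u b x - u a x).
Proof.
move=> lF lu K0 gd Iab ab; have lB := L2B (lu b) (lu a); split; first by apply/L2P.
move=> e e0; have A0 : 0 <= K * (b - a) by rewrite mulr_ge0// subr_ge0.
pose r := e / 2 / (K * (b - a) + 1).
have r0 : 0 < r by rewrite !divr_gt0// ltr_wpDl.
exists (r ^+ 2); first exact: exprn_gt0.
move=> s xi ps H; have [_ h] := good_sum lF lu K0 gd Iab ps H.
rewrite (L2dist_n2 (L2_riemann_sum a b s xi lF) lB) lte_fin; apply: (le_lt_trans h).
rewrite sqrtr_sqr gtr0_norm// mulrA.
have e20 : 0 < e / 2 by rewrite divr_gt0.
by have := frac_le A0 e20; rewrite -/r; move: e0; set X := _ * r; clear; lra.
Qed.

Lemma good_Rint u F K1 K2 t : (forall t, L2 (F t)) -> (forall t, L2 (u t)) -> 0 <= K1 -> 0 <= K2 ->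
  good_curve u F K1 (fun t => 0 <= t) -> good_curve u F K2 (fun t => t <= 0) ->
  is_L2_Rint F 0 t (fun x => u t x - u 0 x).
Proof.
move=> lF lu K10 K20 g1 g2; rewrite /is_L2_Rint; case: (leP 0 t) => t0.
  by apply: good_Rint_le g1 _ _.
have := good_Rint_le lF lu K20 g2 (fun r _ h => h) (ltW t0).
by congr is_L2_Rint_le; apply/funext => x; rewrite opprB.
Qed.

Lemma n2sq_derivative w t D : (forall t, L2 (w t)) -> L2 D -> L2_derivative w t D ->
  is_derive t 1 (fun s => n2 (w s) ^+ 2) (2 * complex.Re (inner D (w t))).
Proof.
move=> lw lD H; set phi := fun s => _; set c := 2 * _.
have key e : 0 < e -> exists2 d, 0 < d & forall s, `|s - t| < d ->
    `|phi s - phi t - (s - t) * c| <= e * `|s - t|.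
  move=> e0; pose A := 2 * n2 (w t); pose B := 1 + n2 D.
  have A0 : 0 <= A by rewrite mulr_ge0 ?n2_ge0.
  have B0 : 0 < B by rewrite ltr_pwDl ?n2_ge0.
  pose e1 := Num.min 1 (e / 2 / (A + 1)).
  have e10 : 0 < e1 by rewrite lt_min ltr01 !divr_gt0// ltr_wpDl.
  have e11 : e1 <= 1 by rewrite ge_min lexx.
  have Ae : A * e1 <= e / 2.
    have e20 : 0 < e / 2 by rewrite divr_gt0.
    by apply: le_trans (frac_le A0 e20); rewrite ler_wpM2l// ge_min lexx orbT.
  have [d d0 Hd] := H e1 e10.
  exists (Num.min d (e / 2 / B ^+ 2)); first by rewrite lt_min d0 !divr_gt0// exprn_gt0.
  move=> s; rewrite lt_min => /andP[sd sB]; have h1 := Hd s sd.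
  pose y x := w s x - w t x; pose r x := y x - (s - t)%:C%C * D x.
  have ly : L2 y := L2B (lw s) (lw t); have lr : L2 r := L2B ly (L2Z _ lD).
  have ny : n2 y <= B * `|s - t|.
    have := n2D lr (L2Z (s - t)%:C%C lD); rewrite (n2Z _ lD) nc_real.
    rewrite (_ : (fun x => r x + _) = y); last by apply/funext => x; rewrite /r subrK.
    have h2 : e1 * `|s - t| <= `|s - t| by rewrite ler_piMl.
    move: h1 h2; rewrite /B -/r mulrDl mul1r; set a := `|s - t|; rewrite [a * n2 D]mulrC.
    by set b := n2 D * a; abs_lra.
  have E : phi s - phi t - (s - t) * c = n2 y ^+ 2 + 2 * complex.Re (inner r (w t)).
    have -> : phi s = n2 (fun x => w t x + y x) ^+ 2.
      by rewrite /phi; congr (n2 _ ^+ 2); apply/funext => x; rewrite /y addrC subrK.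
    rewrite (n2sqD (lw t) ly) /phi.
    have -> : complex.Re (inner (w t) y) = complex.Re (inner y (w t)).
      by rewrite (innerC ly (lw t)) Re_conjc.
    rewrite (innerBl ly (L2Z _ lD) (lw t)) (innerZl _ lD (lw t)) Re_D Re_N Re_CM /c.
    by move: (complex.Re _) (complex.Re _) => p q; ring.
  rewrite E; apply: (le_trans (ler_normD _ _)); rewrite ger0_norm ?sqr_ge0//.
  have k1 : n2 y ^+ 2 <= e / 2 * `|s - t|.
    apply: (@le_trans _ _ ((B * `|s - t|) ^+ 2)).
      by apply: lerXn2r ny; rewrite nnegrE ?n2_ge0// mulr_ge0// ltW.
    rewrite exprMn [`|s - t| ^+ 2]expr2 mulrA ler_wpM2r//.
    by rewrite mulrC -ler_pdivlMr ?exprn_gt0// ltW.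
  have k2 : `|2 * complex.Re (inner r (w t))| <= e / 2 * `|s - t|.
    rewrite normrM ger0_norm//; have := nc_Re (inner r (w t)); have := inner_le lr (lw t) => i1 i2.
    have i3 : n2 r * n2 (w t) <= e1 * `|s - t| * n2 (w t) by rewrite ler_wpM2r ?n2_ge0.
    have i4 : 2 * (e1 * `|s - t| * n2 (w t)) <= e / 2 * `|s - t|.
      by rewrite [leLHS](_ : _ = A * e1 * `|s - t|) ?ler_wpM2r// /A; ring.
    apply: le_trans i4; rewrite ler_wpM2l//; exact: le_trans i2 (le_trans i1 i3).
  by apply: (le_trans (lerD k1 k2)); rewrite -mulrDl -splitr.
have cv : h^-1 *: (phi (h *: (1 : R) + t) - phi t) @[h --> (0 : R)^'] --> c.
  apply/cvgrPdist_le => e e0; have [d d0 Hd] := key e e0; near=> h.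
  have h0 : h != 0 by near: h; exact: nbhs_dnbhs_neq.
  have hd : `|h| < d by near: h; apply: dnbhs0_lt.
  have := Hd (h + t); rewrite addrK => /(_ hd) k.
  rewrite /= [h *: 1]mulr1 [_ *: _]mulrC.
  rewrite -(@ler_pM2r _ `|h|) ?normr_gt0// -normrM mulrBl divfK// distrC.
  by rewrite [c * h]mulrC.
by apply: DeriveDef; [exact: cvgP cv|exact: cvg_lim cv].
Unshelve. all: by end_near. Qed.

End L2_integral.

Section gronwall.
Context {R : realType}.

Lemma gronwall_le (phi dphi : R -> R) (C a b : R) : a <= b ->
  (forall t : R, is_derive t (1 : R) phi (dphi t)) ->
  (forall t, a <= t -> t <= b -> dphi t <= C * phi t) ->
  phi b <= phi a * expR (C * (b - a)).
Proof.
move=> ab D H; pose psi s := phi s * expR (- C * s).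
pose dpsi s := (dphi s - C * phi s) * expR (- C * s).
have Dpsi s : is_derive s (1 : R) psi (dpsi s).
  have := D s => Ds.
  have d1 : is_derive s (1 : R) (fun s => - C * s) (- C).
    have d0 := is_deriveZ (- C) (is_derive_id s (1 : R)); apply: is_derive_eq d0 _.
    by rewrite /GRing.scale /= mulr1.
  have d2 := is_derive1_comp (is_derive_expR (- C * s)) d1.
  have := is_deriveM Ds d2; rewrite /psi /dpsi => d3; apply: is_derive_eq d3 _.
  by rewrite /= /GRing.scale /=; ring.
have dd s : derivable psi s 1 by have [] := Dpsi s.
have cont : {within `[a, b], continuous psi} by apply: derivable_within_continuous.
have le0 s : s \in `]a, b[%R -> derive1 psi s <= 0.
  rewrite in_itv /= => /andP[as' sb]; rewrite derive1E; have [_ ->] := Dpsi s.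
  by rewrite /dpsi mulr_le0_ge0 ?expR_ge0// subr_le0 H// ltW.
have m := ler0_derive1_le_cc (fun s _ => dd s) le0 cont.
have : psi b <= psi a by apply: m => //; rewrite in_itv /= ?lexx ?ab.
rewrite /psi !mulNr !expRN ler_pdivrMr ?expR_gt0// => h; apply: (le_trans h).
by rewrite mulrBr expRB mulrA mulrAC.
Qed.

Lemma gronwall_ge (phi dphi : R -> R) (C a b : R) : a <= b ->
  (forall t : R, is_derive t (1 : R) phi (dphi t)) ->
  (forall t, a <= t -> t <= b -> - (C * phi t) <= dphi t) ->
  phi a <= phi b * expR (C * (b - a)).
Proof.
move=> ab D H; pose psi s := phi s * expR (C * s).
pose dpsi s := (dphi s + C * phi s) * expR (C * s).
have Dpsi s : is_derive s (1 : R) psi (dpsi s).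
  have := D s => Ds.
  have d1 : is_derive s (1 : R) (fun s => C * s) C.
    have d0 := is_deriveZ C (is_derive_id s (1 : R)); apply: is_derive_eq d0 _.
    by rewrite /GRing.scale /= mulr1.
  have d2 := is_derive1_comp (is_derive_expR (C * s)) d1.
  have := is_deriveM Ds d2; rewrite /psi /dpsi => d3; apply: is_derive_eq d3 _.
  by rewrite /= /GRing.scale /=; ring.
have dd s : derivable psi s 1 by have [] := Dpsi s.
have cont : {within `[a, b], continuous psi} by apply: derivable_within_continuous.
have ge0 s : s \in `]a, b[%R -> 0 <= derive1 psi s.
  rewrite in_itv /= => /andP[as' sb]; rewrite derive1E; have [_ ->] := Dpsi s.
  by rewrite /dpsi mulr_ge0 ?expR_ge0// -lerBlDr sub0r H// ltW.
have m := ger0_derive1_le_cc (fun s _ => dd s) ge0 cont.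
have : psi a <= psi b by apply: m => //; rewrite in_itv /= ?lexx ?ab.
rewrite /psi => h; rewrite -(ler_pM2r (expR_gt0 (C * a))); apply: (le_trans h).
by rewrite -mulrA -expRD mulrBr subrK.
Qed.

End gronwall.

(** * Duality, weak-* continuity and uniform boundedness *)

Section duality.
Context {R : realType}.
Local Notation C := R[i].
Local Notation mu := (@torus_measure R).
Local Notation nc := (@Normc.normc R).
Implicit Types (f g u b : R -> C) (w : R -> R -> C) (M e : R).

Lemma cLinftyP b M : cmeas b -> 0 <= M ->
  (cLnorm +oo%E b <= M%:E)%E <-> {ae mu, forall x, nc (b x) <= M}.
Proof.
move=> mb M0; rewrite /cLnorm unlock /= mu_setT lte01; split.
  move=> /ess_supP; apply: ae_imp => x /=.
  by rewrite ger0_norm ?nc_ge0.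
move=> h; apply/ess_supP; apply: ae_imp h => x /=.
by rewrite lee_fin ger0_norm ?nc_ge0.
Qed.

Lemma cLinfty_ge0 b : (0 <= cLnorm +oo%E b)%E.
Proof. exact: Lnorm_ge0. Qed.

Lemma cLinfty_fin b : cLfun +oo%E b -> exists M, [/\ 0 <= M, cLnorm +oo%E b = M%:E & L2 b].
Proof.
move=> [m1 m2 fin]; have := cLinfty_ge0 b; have mb : cmeas b by split.
case E : (cLnorm +oo%E b) fin => [M| |]// _; rewrite lee_fin => M0; exists M; split => //.
have [b' Bb' bb'] : exists2 b', Bd M b' & b' = b %[ae mu].
  by apply: Bd_clip => //; apply/cLinftyP; rewrite // E.
by apply: L2_ae (Bd_L2 Bb') _ => //; apply: ae_imp bb' => x ->.
Qed.

Lemma Bd_cLfun M b : Bd M b -> cLfun +oo%E b /\ (cLnorm +oo%E b <= M%:E)%E.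
Proof.
move=> [[m1 m2] bM]; have M0 : 0 <= M := le_trans (nc_ge0 _) (bM 0).
have h : (cLnorm +oo%E b <= M%:E)%E.
  apply/cLinftyP => //; exact: ae_all.
by split => //; split => //; exact: le_lt_trans h (ltry _).
Qed.

Lemma Szego_ae f g : L2 f -> L2 g -> f = g %[ae mu] -> Szego f = Szego g %[ae mu].
Proof.
move=> lf lg fg; apply: Szego_uniq => //; first exact: L2p_Szego.
move=> j; rewrite fourier_Szego//; apply: fourier_ae; [exact: L2_meas|exact: L2_meas|].
by apply: ae_imp fg => x ->.
Qed.

Lemma symbol_HB u b M : cmeas u -> bmo_symbol u b -> 0 <= M -> (cLnorm +oo%E b <= M%:E)%E -> HB M u.
Proof.
move=> mu_ [Hb bu] M0 bM; have [_ [_ _ lb]] := cLinfty_fin Hb.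
have [b' [mb' bM'] bb'] : exists2 b', Bd M b' & b' = b %[ae mu].
  by apply: Bd_clip => //; [exact: L2_meas|apply/cLinftyP => //; exact: L2_meas].
have lb' := L2_bd mb' bM'.
apply: HB_ae (HB_Szego mb' bM') _ => //.
by apply: ae_imp2 bu (Szego_ae lb' lb bb') => x h1 h2 _; rewrite -h1// h2.
Qed.

Lemma HB_closed M u : (forall e, 0 < e -> HB (M + e) u) -> HB M u.
Proof.
move=> H; have [lu _] := H 1 ltr01; split => // f lf; apply/ler_addgt0Pr => e e0.
have A0 := N1_ge0 f; have ep : 0 < e / (N1 f + 1) by rewrite divr_gt0// ltr_wpDl.
have [_ /(_ f lf) h] := H _ ep; apply: (le_trans h); rewrite mulrDl lerD2l mulrC.
exact: frac_le.
Qed.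

(** The norm of BMO_+ is the norm of the corresponding form on H^1. *)
Lemma bmo_normP u M : 0 <= M -> L2p u -> (bmo_norm u <= M%:E)%E <-> HB M u.
Proof.
move=> M0 lu; have lu2 := L2p_L2 lu; split => [h|Hu].
  apply: HB_closed => e e0.
  have /ereal_inf_lt[_ [b bu <-] hb] : (bmo_norm u < (M + e)%:E)%E.
    by apply: le_lt_trans h _; rewrite lte_fin ltrDl.
  by apply: symbol_HB bu _ (ltW hb); [exact: L2_meas|rewrite addr_ge0// ltW].
have [b Bb bu] := nehari M0 Hu; have [Hb hb] := Bd_cLfun Bb.
by apply: le_trans hb; apply: ereal_inf_lbound; exists b.
Qed.

Lemma HB_BMO M u : 0 <= M -> HB M u -> BMOplus u.
Proof.
move=> M0 Hu; split; first by apply/L2pP; exact: HB_L2p Hu.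
by have [b Bb bu] := nehari M0 Hu; exists b; split => //; exact: (Bd_cLfun Bb).1.
Qed.

Lemma bmo_norm_ge0 u : (0 <= bmo_norm u)%E.
Proof. by apply: le_ereal_inf_tmp => _ [b _ <-]; exact: cLinfty_ge0. Qed.

Lemma BMO_HB u : BMOplus u -> exists M, [/\ 0 <= M, bmo_norm u = M%:E & HB M u].
Proof.
move=> [/L2pP lu [b bu]]; have [Mb [Mb0 bE _]] := cLinfty_fin bu.1.
have h : (bmo_norm u <= Mb%:E)%E by rewrite -bE; apply: ereal_inf_lbound; exists b.
have := bmo_norm_ge0 u; case E : (bmo_norm u) h => [M| |]//; rewrite !lee_fin => _ M0.
by exists M; split => //; apply/bmo_normP; rewrite ?E.
Qed.

Definition L1p f := L1 f /\ forall k : int, k < 0 -> fourier f k = 0.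

Lemma L1P f : cLfun 1%E f <-> L1 f.
Proof.
have key : cmeas f -> ((cLnorm 1%E f < +oo)%E <-> rint (modulus f)).
  move=> mf; have mm := measurable_modulus mf.
  have mi : measurable_fun setT (EFin \o modulus f) by exact/measurable_EFinP.
  have E : cLnorm 1%E f = (\int[mu]_x `|(EFin \o modulus f) x|)%E by rewrite /cLnorm Lnorm1.
  by rewrite E; split => [h|/integrableP[]//]; apply/integrableP.
by split => [[m1 m2 h]|[[m1 m2] h]]; split => //; apply/key.
Qed.

Lemma L1pP f : Lplus 1%E f <-> L1p f.
Proof. by split => -[h1 h2]; split => //; apply/L1P. Qed.

Lemma symbolP u : BMOplus u -> exists b M, [/\ Bd M b, 0 <= M, Szego b = u %[ae mu] &
  forall f, L1 f -> bmo_pairing f u = inner f b].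
Proof.
move=> [_ [b0 hb0]]; rewrite /bmo_pairing; set b := xget _ _.
have [Hb bu] : bmo_symbol u b by apply: (xgetI _ hb0).
have [M [M0 bE lb]] := cLinfty_fin Hb.
have [b' Bb' bb'] : exists2 b', Bd M b' & b' = b %[ae mu].
  by apply: Bd_clip => //; [exact: L2_meas|apply/cLinftyP; rewrite ?bE//; exact: L2_meas].
have lb' := Bd_L2 Bb'.
exists b', M; split => //.
  by apply: ae_imp2 bu (Szego_ae lb' lb bb') => x h1 h2 _; rewrite h2// h1.
move=> f lf; rewrite /inner; apply: cint_ae.
- by apply: cmeasM; [exact: lf.1|apply: cmeas_conj; exact: L2_meas].
- by apply: cmeasM; [exact: lf.1|apply: cmeas_conj; exact: L2_meas].
by apply: ae_imp bb' => x ->.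
Qed.

Lemma inner_symbol f b : L2p f -> L2 b -> inner f (Szego b) = inner f b.
Proof.
move=> lf lb; have lf2 := L2p_L2 lf; have lsb := L2_Szego lb.
by rewrite (innerC lsb lf2) (innerC lb lf2) inner_Szego.
Qed.

Lemma inner_aer f g h : cmeas f -> cmeas g -> cmeas h -> g = h %[ae mu] -> inner f g = inner f h.
Proof.
move=> mf mg mh gh; rewrite /inner; apply: cint_ae.
- by apply: cmeasM => //; exact: cmeas_conj.
- by apply: cmeasM => //; exact: cmeas_conj.
by apply: ae_imp gh => x ->.
Qed.

Lemma pairing_L2p f u : L2p f -> BMOplus u -> bmo_pairing f u = inner f u.
Proof.
move=> lf Hu; have [b [M [Bb M0 bu ->]]] := symbolP Hu; last exact: L2_L1 (L2p_L2 lf).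
have lb := Bd_L2 Bb; rewrite -(inner_symbol lf lb).
have lu : L2p u by apply/L2pP; case: Hu.
apply: inner_aer => //; [exact: L2_meas (L2p_L2 lf)|exact: L2_meas (L2_Szego lb)|].
exact: L2_meas (L2p_L2 lu).
Qed.

Lemma inner_bd_le f b M : L1 f -> Bd M b -> nc (inner f b) <= M * N1 f.
Proof.
move=> lf [mb bM]; have mbJ := cmeas_conj mb.
have bMJ x : nc (conjc (b x)) <= M by rewrite nc_conj.
apply: (le_trans (cint_le (L1M_bd lf mbJ bMJ))); exact: N1M_bd.
Qed.

Lemma pairing_le f g u M : 0 <= M -> HB M u -> L1p f -> L2p g ->
  nc (bmo_pairing f u - inner g u) <= M * N1 (fun x => f x - g x).
Proof.
move=> M0 Hu [lf f0] lg; have Bu := HB_BMO M0 Hu; have lg1 := L2_L1 (L2p_L2 lg).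
have [b [Mb [Bb Mb0 bu Eb]]] := symbolP Bu; have lb := Bd_L2 Bb.
apply/ler_addgt0Pr => e e0; have A0 : 0 <= M + Mb by rewrite addr_ge0.
have ep : 0 < e / (M + Mb + 1) by rewrite divr_gt0// ltr_wpDl.
have [n hn] := fejer_cvg_L1 lf ep; set p := fejer n f in hn *.
have lp : L2p p by exact: L2p_fejer. have lp1 := L2_L1 (L2p_L2 lp).
have lu : L2 u := HB_L2 Hu.
have E1 : inner p u = inner p b by rewrite -(pairing_L2p lp Bu) Eb.
have i1 : nc (bmo_pairing f u - inner p u) <= Mb * (e / (M + Mb + 1)).
  rewrite Eb// E1; have mbJ := cmeas_conj Bb.1.
  have bMJ x : nc (conjc (b x)) <= Mb by rewrite nc_conj; exact: Bb.2.
  have -> : inner f b - inner p b = inner (fun x => f x - p x) b.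
    rewrite /inner -cintB; [|exact: L1M_bd bMJ|exact: L1M_bd bMJ].
    by congr cintegral; apply/funext => x; rewrite mulrBl.
  apply: (le_trans (inner_bd_le (L1B lf lp1) Bb)).
  by rewrite ler_wpM2l// N1_sub.
have i2 : nc (inner p u - inner g u) <= M * (e / (M + Mb + 1)) + M * N1 (fun x => f x - g x).
  rewrite -(innerBl (L2p_L2 lp) (L2p_L2 lg) lu); have [_ h] := Hu.
  apply: (le_trans (h _ (L2pB lp lg))); rewrite -mulrDr ler_wpM2l//.
  rewrite (_ : (fun x => p x - g x) = (fun x => (p x - f x) + (f x - g x))).
    by apply: (le_trans (N1D (L1B lp1 lf) (L1B lf lg1))); rewrite lerD2r.
  by apply/funext => x; rewrite addrA subrK.
have fin := frac_le A0 e0; rewrite mulrDl in fin.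
have -> : bmo_pairing f u - inner g u = (bmo_pairing f u - inner p u) + (inner p u - inner g u).
  by rewrite addrA subrK.
apply: (le_trans (ncD _ _)); move: fin i1 i2; set a := nc _; set a' := nc _.
set q := e / _; set r := M * N1 _; clear; lra.
Qed.

(** Weak-* continuity follows from L2 continuity and a bound in BMO, by density. *)
Lemma weakstar_of_L2 w M : 0 <= M -> (forall t, HB M (w t)) ->
  (forall t e, 0 < e -> exists2 d, 0 < d &
     forall s, `|s - t| < d -> n2 (fun x => w s x - w t x) <= e) ->
  continuous_weakstar_BMOplus w.
Proof.
move=> M0 Hw cw; split => [t|f /L1pP lf t]; first exact: HB_BMO (Hw t).
have lw s : L2 (w s) := HB_L2 (Hw s).
apply/cvgr0Pnorm_le => e e0; have e20 : 0 < e / 2 by rewrite divr_gt0.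
have M20 : 0 <= M * 2 by rewrite mulr_ge0.
have ep : 0 < e / 2 / (M * 2 + 1) by rewrite divr_gt0// ltr_wpDl.
have [n hn] := fejer_cvg_L1 lf.1 ep; set p := fejer n f in hn *.
have lp : L2p p by apply: L2p_fejer; exact: lf.2. have lp2 := L2p_L2 lp.
have ep' : 0 < e / 2 / (n2 p + 1) by rewrite divr_gt0// ltr_wpDl// n2_ge0.
have [d d0 Hd] := cw t _ ep'.
near=> s; rewrite ger0_norm ?nc_ge0//.
have sd : `|s - t| < d by near: s; apply/nbhs_ballP; exists d => //= z; rewrite /ball/= distrC.
have h1 := pairing_le M0 (Hw s) lf lp; have h2 := pairing_le M0 (Hw t) lf lp.
have h3 : nc (inner p (w s) - inner p (w t)) <= e / 2.
  rewrite -(innerBr (lw s) (lw t) lp2) (le_trans (inner_le lp2 (L2B (lw s) (lw t))))//.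
  apply: le_trans (frac_le (n2_ge0 p) e20); rewrite ler_wpM2l ?n2_ge0//; exact: Hd.
have h4 : M * N1 (fun x => f x - p x) + M * N1 (fun x => f x - p x) <= e / 2.
  rewrite [leLHS](_ : _ = M * 2 * N1 (fun x => f x - p x)); last by ring.
  apply: le_trans (frac_le M20 e20).
  by rewrite ler_wpM2l// N1_sub.
have -> : bmo_pairing f (w s) - bmo_pairing f (w t) = (bmo_pairing f (w s) - inner p (w s)) +
  (inner p (w s) - inner p (w t)) - (bmo_pairing f (w t) - inner p (w t)) by ring.
apply: (le_trans (ncB _ _)); apply: (le_trans (lerD (ncD _ _) h2)).
move: h1 h3 h4; set a := nc _; set b := nc _; set c := M * _; clear.
by move=> *; rewrite (splitr e); lra.
Unshelve. all: by end_near. Qed.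

Lemma N1Z (c : C) f : L1 f -> N1 (fun x => c * f x) = nc c * N1 f.
Proof.
by move=> [_ fi]; rewrite /N1 -RintM//; apply: eq_Rintegral => x _; rewrite /modulus ncM.
Qed.

Lemma N1N f : N1 (fun x => - f x) = N1 f.
Proof. by apply: eq_Rintegral => x _; rewrite /modulus ncN. Qed.

Lemma N1_0 : N1 (fun=> 0 : C) = 0.
Proof. by rewrite /N1 /modulus nc0 Rint_cst. Qed.

(** An almost optimal constant, found along a geometric progression. *)
Lemma HB_sharp u B M0 : 0 < B -> 0 <= M0 -> HB M0 u -> ~ HB B u ->
  exists M, [/\ B <= M, HB M u & ~ HB (3 / 4 * M) u].
Proof.
move=> B0 M00 H0 nH; pose a n : R := M0 * (3 / 4) ^+ n.
have q0 : 0 <= 3 / 4 :> R by lra.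
have [n0 hn0] : exists n, a n <= B.
  have /cvgr0_norm_le/(_ (B / (M0 + 1)))[|n0 _ H] : (fun n => (3 / 4 : R) ^+ n) @ \oo --> (0 : R).
  - by apply: cvg_expr; rewrite ger0_norm//; lra.
  - by rewrite divr_gt0// ltr_wpDl.
  exists n0; have := H n0 (leqnn _); rewrite /= ger0_norm ?exprn_ge0// => h.
  exact: le_trans (ler_wpM2l M00 h) (frac_le M00 B0).
have nHn0 : ~ HB (a n0) u by move=> h; apply: nH; exact: HB_mono hn0 h.
elim: n0 {hn0} nHn0 => [|n IH] hn; first by case: hn; rewrite /a expr0 mulr1.
have [h|h] := pselect (HB (a n) u); last exact: IH.
exists (a n); split => //.
  by rewrite leNgt; apply/negP => /ltW lt; apply: nH; exact: HB_mono lt h.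
by rewrite mulrC /a -mulrA -exprSr.
Qed.

Lemma not_HB_witness u M M' : HB M' u -> 0 <= M -> ~ HB M u -> exists f, [/\ L2p f, N1 f = 1 & M <= nc (inner f u)].
Proof.
move=> H' M0 nH; have lu := HB_L2p H'.
have [f lf hf] : exists2 f, L2p f & M * N1 f < nc (inner f u).
  apply: contrapT => H; apply: nH; split => // f lf; rewrite leNgt; apply/negP => h.
  by apply: H; exists f.
have n0 : 0 < N1 f.
  rewrite lt_neqAle N1_ge0 andbT eq_sym; apply/eqP => f0.
  by have [_ /(_ f lf)] := H'; rewrite f0 mulr0 leNgt (le_lt_trans _ hf)// f0 mulr0.
exists (fun x => ((N1 f)^-1)%:C%C * f x); split; first exact: L2pZ.
  rewrite (N1Z _ (L2_L1 (L2p_L2 lf))) nc_real ger0_norm ?invr_ge0 ?N1_ge0// mulVf//.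
  by rewrite gt_eqF.
rewrite (innerZl _ (L2p_L2 lf) (L2p_L2 lu)) ncM nc_real ger0_norm ?invr_ge0 ?N1_ge0//.
by rewrite mulrC ler_pdivlMr// ltW.
Qed.

Lemma bounded_on_segment (phi : R -> R) (T : R) :
  (forall t, phi s @[s --> t] --> phi t) -> 0 <= T -> exists Q, forall t, `|t| <= T -> phi t <= Q.
Proof.
move=> cphi T0; have TT : - T <= T by lra.
have [c _ Hc] := EVT_max TT (continuous_subspaceT cphi).
by exists (phi c) => t; rewrite ler_norml => tT; apply: Hc; rewrite in_itv.
Qed.

(** Uniform boundedness principle, by the gliding hump argument: the signs of
    the terms of the series defining the test function are chosen so that no
    cancellation occurs. *)
Lemma local_bound w (T : R) : continuous_weakstar_BMOplus w -> 0 <= T ->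
  exists2 M, 0 <= M & forall t, `|t| <= T -> HB M (w t).
Proof.
move=> [Bw cw] T0; apply: contrapT => nM.
have bad B : 0 <= B -> exists2 t, `|t| <= T & ~ HB B (w t).
  move=> B0; apply: contrapT => H; apply: nM; exists B => // t tT.
  by apply: contrapT => h; apply: H; exists t.
have lw t : L2p (w t) by have [/L2pP] := Bw t.
pose th n : R := 12 * 3 ^+ n * n.+1%:R.
have th0 n : 0 < th n by rewrite !mulr_gt0// exprn_gt0.
have /choice[tM HtM] : forall n, exists p : R * R, [/\ `|p.1| <= T, th n <= p.2,
    HB p.2 (w p.1) & ~ HB (3 / 4 * p.2) (w p.1)].
  move=> n; have [t tT nH] := bad _ (ltW (th0 n)); have [M0 [M00 _ H0]] := BMO_HB (Bw t).
  by have [M [h1 h2 h3]] := HB_sharp (th0 n) M00 H0 nH; exists (t, M).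
pose t n := (tM n).1; pose M n := (tM n).2.
have tT n : `|t n| <= T by case: (HtM n).
have thM n : th n <= M n by case: (HtM n).
have HM n : HB (M n) (w (t n)) by case: (HtM n).
have M0 n : 0 <= M n := le_trans (ltW (th0 n)) (thM n).
have /choice[g Hg] : forall n, exists f, [/\ L2p f, N1 f = 1 & 3 / 4 * M n <= nc (inner f (w (t n)))].
  move=> n; apply: (not_HB_witness (HM n)); first by rewrite mulr_ge0//; lra.
  by case: (HtM n).
pose r n : R := 3^-1 ^+ n.+1.
have r0 n : 0 < r n by rewrite exprn_gt0// invr_gt0.
pose y n x := (r n)%:C%C * g n x.
have ly n : L2p (y n) by apply: L2pZ; case: (Hg n).
have Ny n : N1 (y n) = r n.
  have [lg ng _] := Hg n; rewrite (N1Z _ (L2_L1 (L2p_L2 lg))) ng mulr1 nc_real gtr0_norm//.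
pose next n (x : R -> C) : R -> C :=
  if nc (inner (y n) (w (t n))) <= nc (inner (fun z => x z + y n z) (w (t n)))
  then (fun z => x z + y n z) else (fun z => x z - y n z).
pose X := fix X n := if n is m.+1 then next m (X m) else (fun=> 0).
have XS n : X n.+1 = next n (X n) by [].
have lX n : L2p (X n).
  elim: n => [|n IH]; first exact: L2p_cst.
  by rewrite XS /next; case: ifP => _; [exact: L2pD|exact: L2pB].
have lX1 n : L1 (X n) := L2_L1 (L2p_L2 (lX n)).
have lw2 s : L2 (w s) := L2p_L2 (lw s).
have hump n : nc (inner (y n) (w (t n))) <= nc (inner (X n.+1) (w (t n))).
  rewrite XS /next; case: ifP => // /negbT; rewrite -ltNge => h.
  rewrite (innerDl (L2p_L2 (lX n)) (L2p_L2 (ly n)) (lw2 _)) in h.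
  rewrite (innerBl (L2p_L2 (lX n)) (L2p_L2 (ly n)) (lw2 _)).
  set a := inner (X n) _ in h *; set b := inner (y n) _ in h *.
  have := ncB (a + b) (a - b); rewrite (_ : a + b - (a - b) = 2 * b); last by ring.
  by rewrite ncM nc2; move: h; set p := nc b; set q := nc _; set q' := nc _; clear; lra.
have dX n : N1 (fun x => X n.+1 x - X n x) = r n.
  rewrite -Ny XS /next; case: ifP => _.
    by congr N1; apply/funext => x; rewrite addrAC subrr add0r.
  rewrite -(N1N (y n)); congr N1; apply/funext => x; by rewrite addrAC subrr add0r.
have Xdist n k : N1 (fun x => X (n + k)%N x - X n x) <= 3 / 2 * r n - 3 / 2 * r (n + k)%N.
  elim: k => [|k IH].
    rewrite addn0 subrr (_ : (fun x => _) = (fun=> 0)) ?N1_0//.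
    by apply/funext => x; rewrite subrr.
  rewrite addnS (_ : (fun x => _) = (fun x => (X (n + k).+1 x - X (n + k)%N x) + (X (n + k)%N x - X n x))).
    apply: (le_trans (N1D (L1B (lX1 _) (lX1 _)) (L1B (lX1 _) (lX1 _)))); rewrite dX.
    have e3 : r (n + k).+1 = r (n + k)%N / 3 by rewrite /r exprSr.
    by rewrite e3; move: IH; set a := N1 _; clear; lra.
  by apply/funext => x; rewrite addrA subrK.
have [f mf Xf] : exists2 f, cmeas f & {ae mu, forall x, nc (X n x - f x) @[n --> \oo] --> (0 : R)}.
  apply: (@ae_limit _ X 1) => n; first exact: (lX1 n).1.
    exact: L1B.
  rewrite dX mul1r /r exprS; apply: (@le_trans _ _ (3^-1 ^+ n)).
    by rewrite ler_piMl ?exprn_ge0 ?invr_ge0// invf_le1// ler1n.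
  by apply: lerXn2r; rewrite ?nnegrE ?invr_ge0// lef_pV2 ?posrE// ler_nat.
have fX n : L1 (fun x => f x - X n x) /\ N1 (fun x => f x - X n x) <= 3 / 2 * r n.
  apply: (@fatou_N1 _ (fun k x => X (n + k)%N x - X n x)) => //.
  - by move=> k; exact: L1B.
  - by move=> k; apply: (le_trans (Xdist n k)); rewrite gerBl mulr_ge0 ?(ltW (r0 _))//; lra.
  - by apply: cmeasB => //; exact: (lX1 n).1.
  apply: ae_imp Xf => x h.
  have -> : (fun k => nc (X (n + k)%N x - X n x - (f x - X n x))) =
      (fun k => nc (X (k + n)%N x - f x)).
    by apply/funext => k; rewrite addnC; congr nc; ring.
  by rewrite (cvg_shiftn n (fun k => nc (X k x - f x))).
have lf : L1 f.
  have := L1D (fX 0%N).1 (lX1 0%N); congr L1; apply/funext => x; by rewrite subrK.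
have lfp : L1p f.
  split => // k k0; apply: nc_small => e e0.
  have [n hn] : exists n, 3 / 2 * r n <= e.
    have e1 : 0 < e / (3 / 2 + 1) by rewrite divr_gt0//; lra.
    have /cvgr0_norm_le/(_ _ e1)[n0 _ H] : (fun n => (3^-1 : R) ^+ n) @ \oo --> (0 : R).
      by apply: cvg_expr; rewrite ger0_norm ?invr_ge0// invf_lt1// ltr1n.
    exists n0; have := H n0.+1 (leqW (leqnn _)); rewrite /= ger0_norm ?exprn_ge0 ?invr_ge0// => h.
    have A0 : 0 <= 3 / 2 :> R by lra.
    by apply: le_trans (frac_le A0 e0); rewrite ler_wpM2l.
  have := fourierB k lf (lX1 n); rewrite (lX n).2// subr0 => <-.
  exact: le_trans (fourier_le k (fX n).1) (le_trans (fX n).2 hn).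
have cphi s : nc (bmo_pairing f (w s')) @[s' --> s] --> nc (bmo_pairing f (w s)).
  apply/cvgrPdist_le => e e0.
  have /cvgr0Pnorm_le/(_ e e0) := cw f ((L1pP f).2 lfp) s.
  apply: filterS => s'; rewrite ger0_norm ?nc_ge0// => h; apply: le_trans h.
  set a := bmo_pairing f (w s'); set b := bmo_pairing f (w s).
  have := ncD (a - b) b; have := ncD (b - a) a; rewrite !subrK (nc_sub b).
  rewrite ler_norml; set p := nc _; set q := nc _; set q' := nc _; clear=> ? ?; apply/andP; split; lra.
have [Q HQ] := bounded_on_segment cphi T0.
have big n : n.+1%:R <= Q.
  apply: le_trans (HQ (t n) (tT n)).
  have h1 := pairing_le (M0 n) (HM n) lfp (lX n.+1).
  have h2 := hump n; have [lg _ hg] := Hg n.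
  have Ey : nc (inner (y n) (w (t n))) = r n * nc (inner (g n) (w (t n))).
    by rewrite (innerZl _ (L2p_L2 lg) (lw2 _)) ncM nc_real gtr0_norm.
  have h3 : M n * N1 (fun x => f x - X n.+1 x) <= M n * (3 / 2 * r n.+1).
    by rewrite ler_wpM2l// (fX n.+1).2.
  have e3 : r n.+1 = r n / 3 by rewrite /r exprSr.
  have h4 : r n * (3 / 4 * M n) <= r n * nc (inner (g n) (w (t n))) by rewrite ler_wpM2l// ltW.
  have h5 : n.+1%:R <= r n * M n / 4.
    have := ler_wpM2l (ltW (r0 n)) (thM n); rewrite (_ : r n * th n = 4 * n.+1%:R).
      by set a := r n * M n; clear; lra.
    rewrite /r /th exprVn exprS; have : (3 : R) ^+ n != 0 by rewrite expf_neq0.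
    by move: (3 ^+ n) => z z0; field.
  have h6 : nc (inner (X n.+1) (w (t n))) <= nc (bmo_pairing f (w (t n))) +
      nc (bmo_pairing f (w (t n)) - inner (X n.+1) (w (t n))).
    set a := bmo_pairing _ _; set b := inner _ _.
    by have := ncB a (a - b); rewrite (_ : a - (a - b) = b)//; ring.
  rewrite Ey in h2; rewrite e3 in h3; move: h1 h2 h3 h4 h5 h6.
  set a := nc _; set b := r n * nc _; set c := nc _; set d := nc _; set z := M n * N1 _.
  rewrite [r n * (3 / 4 * M n)](_ : _ = 3 / 4 * (r n * M n)); last by ring.
  rewrite [M n * (3 / 2 * (r n / 3))](_ : _ = 1 / 2 * (r n * M n)); last by field.
  by set zz := r n * M n; clear; lra.
have Q0 : 0 <= Q by apply: le_trans (big 0%N).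
have := big (Num.truncn Q); have /truncn_itv/andP[_] := Q0.
by move=> h1 h2; have := lt_le_trans h1 h2; rewrite ltxx.
Qed.

End duality.

(** * Curves solving the equation *)

Section curves.
Context {R : realType}.
Local Notation C := R[i].
Local Notation mu := (@torus_measure R).
Local Notation nc := (@Normc.normc R).
Local Opaque n2 L2 inner Szego fourier.
Implicit Types (f g u v b : R -> C) (w : R -> R -> C) (M e r t T : R).

Lemma L2dist_cvgP w : (forall t, L2 (w t)) ->
  (forall t, L2dist (w s) (w t) @[s --> t] --> 0%E) <->
  (forall t e, 0 < e -> exists2 d, 0 < d &
     forall s, `|s - t| < d -> n2 (fun x => w s x - w t x) <= e).
Proof.
move=> lw; have E t : (fun s => L2dist (w s) (w t)) = EFin \o (fun s => n2 (fun x => w s x - w t x)).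
  by apply/funext => s; rewrite (L2dist_n2 (lw s) (lw t)).
split => [H t e e0|H t].
  have h : n2 (fun x => w s x - w t x) @[s --> t] --> (0 : R).
    by have := H t; rewrite E => /fine_cvg.
  have /cvgr0Pnorm_le/(_ e e0) /nbhs_ballP[d /= d0 Hd] := h.
  exists d => // s sd; have := Hd s; rewrite /ball/= distrC => /(_ sd).
  by rewrite ger0_norm ?n2_ge0.
have h : n2 (fun x => w s x - w t x) @[s --> t] --> (0 : R).
  apply/cvgr0Pnorm_le => e e0; have [d d0 Hd] := H t e e0.
  by apply/nbhs_ballP; exists d => //= s; rewrite /ball/= distrC => sd; rewrite ger0_norm ?n2_ge0// Hd.
by rewrite E; apply: cvg_comp; [exact: h|exact: cvg_id].
Qed.

Lemma HB_n4 M r u : 0 <= M -> HB M u -> n2 u <= r -> L4 u /\ n4 u <= Num.sqrt (3 * M * r).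
Proof.
move=> M0 Hu ur; have [l k] := HB_L4 M0 Hu; split => //.
have r0 : 0 <= r := le_trans (n2_ge0 u) ur.
have p : 0 <= 3 * M by rewrite mulr_ge0.
rewrite -(@ler_pXn2r _ 2)// ?nnegrE ?n4_ge0 ?sqrtr_ge0// [leRHS]sqr_sqrtr ?mulr_ge0//.
by apply: (le_trans k); rewrite ler_wpM2l.
Qed.

(** On the balls of BMO_+, the right-hand side is Hoelder continuous of order
    1/2 for the L2 distance. *)
Lemma rhs_holder M r : 0 <= M -> 0 <= r -> exists2 K, 0 <= K & forall u v,
  HB M u -> HB M v -> n2 u <= r -> n2 v <= r ->
  n2 (fun x => szego_rhs u x - szego_rhs v x) <= K * Num.sqrt (n2 (fun x => u x - v x)).
Proof.
move=> M0 r0; pose K4 := Num.sqrt (3 * M * r).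
have K40 : 0 <= K4 := sqrtr_ge0 _.
have Mr : 0 <= M * r ^+ 2 by rewrite mulr_ge0 ?sqr_ge0.
exists (3 * (M * r ^+ 2) * ((K4 + K4) * Num.sqrt (6 * M)) +
        3 * (3 * K4 ^+ 2 * Num.sqrt (2 * r)) * K4 ^+ 2).
  by rewrite addr_ge0// !mulr_ge0 ?sqrtr_ge0 ?sqr_ge0 ?addr_ge0.
move=> u v Hu Hv ur vr; have [lu ku] := HB_n4 M0 Hu ur; have [lv kv] := HB_n4 M0 Hv vr.
have lu2 := HB_L2 Hu; have lv2 := HB_L2 Hv.
set D := n2 (fun x => u x - v x); have D0 : 0 <= D := n2_ge0 _.
have Dr : D <= 2 * r.
  by apply: (le_trans (n2B lu2 lv2)); move: ur vr; clear; abs_lra.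
have [_ kd] := HB_L4 (addr_ge0 M0 M0) (HB_sub Hu Hv); rewrite -/D in kd.
have hd : n4 (fun x => u x - v x) <= Num.sqrt (6 * M) * Num.sqrt D.
  rewrite -(@ler_pXn2r _ 2)// ?nnegrE ?n4_ge0 ?mulr_ge0 ?sqrtr_ge0//.
  have -> : (Num.sqrt (6 * M) * Num.sqrt D) ^+ 2 = 6 * M * D.
    by rewrite exprMn !sqr_sqrtr ?mulr_ge0.
  apply: (le_trans kd).
  by rewrite le_eqVlt; apply/orP; left; apply/eqP; ring.
have DD : D <= Num.sqrt (2 * r) * Num.sqrt D.
  by rewrite -{1}[D]sqr_sqrtr// expr2 ler_wpM2r ?sqrtr_ge0// ler_wsqrtr.
have Jr : nc (J u) <= M * r ^+ 2.
  apply: (le_trans (J_HB M0 Hu)); rewrite ler_wpM2l//.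
  by apply: lerXn2r ur; rewrite nnegrE ?n2_ge0.
have dJ : nc (J u - J v) <= 3 * K4 ^+ 2 * (Num.sqrt (2 * r) * Num.sqrt D).
  apply: (le_trans (J_lip lu lv ku kv)); rewrite -/D -/K4 ler_wpM2l// mulr_ge0 ?sqr_ge0//.
rewrite !szego_rhsE.
have lr1 := L2_rhsA (J u) lu; have lr2 := L2_rhsA (J u) lv; have lr3 := L2_rhsA (J v) lv.
apply: (le_trans (n2_trans lr1 lr2 lr3)); rewrite mulrDl; apply: lerD.
  apply: (le_trans (n2_rhsA_sub (J u) lu lv)).
  rewrite [leRHS](_ : _ = 3 * (M * r ^+ 2) * ((K4 + K4) * (Num.sqrt (6 * M) * Num.sqrt D))); last by ring.
  apply: ler_pM; rewrite ?mulr_ge0 ?nc_ge0 ?addr_ge0 ?n4_ge0//; first by rewrite ler_wpM2l.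
  by apply: ler_pM; rewrite ?addr_ge0 ?n4_ge0// lerD.
apply: (le_trans (n2_rhsA_subA (J u) (J v) lv)).
rewrite [leRHS](_ : _ = 3 * (3 * K4 ^+ 2 * (Num.sqrt (2 * r) * Num.sqrt D)) * K4 ^+ 2); last by ring.
have g1 : 3 * nc (J u - J v) <= 3 * (3 * K4 ^+ 2 * (Num.sqrt (2 * r) * Num.sqrt D)) by rewrite ler_wpM2l.
have g2 : n4 v ^+ 2 <= K4 ^+ 2 by apply: lerXn2r kv; rewrite nnegrE ?n4_ge0.
by apply: ler_pM g1 g2; rewrite ?sqr_ge0// mulr_ge0// nc_ge0.
Qed.

Lemma L2_derivative_transfer w (v : R -> R -> C) u0 t (D : R -> C) : (forall s, L2 (w s)) -> (forall s, L2 (v s)) -> L2 u0 -> L2 D ->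
  (forall s, w s = (fun x => u0 x - 'i%C * v s x) %[ae mu]) ->
  L2_derivative v t D -> L2_derivative w t (fun x => - 'i%C * D x).
Proof.
move=> lw lv l0 lD E H e e0; have [d d0 Hd] := H e e0; exists d => // s sd.
apply: le_trans (Hd s sd).
have lx := L2B (L2B (lv s) (lv t)) (L2Z (s - t)%:C%C lD).
have lz := L2Z (- 'i%C) lx.
rewrite (_ : n2 (fun x => v s x - _ - _) = n2 (fun x => - 'i%C * (v s x - v t x - (s - t)%:C%C * D x))).
  rewrite le_eqVlt; apply/orP; left; apply/eqP; apply: n2_ae; [|exact: L2_meas|].
    exact: L2_meas (L2B (L2B (lw s) (lw t)) (L2Z _ (L2Z (- 'i%C) lD))).
  by apply: ae_imp2 (E s) (E t) => x h1 h2 _; rewrite h1// h2//; ring.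
by rewrite (n2Z _ lx) ncN nci mul1r.
Qed.

(** The curves in H^1-dual balls solving the equation in L2, pointwise in time. *)
Definition solves w := (forall t, L2p (w t) /\ L4 (w t)) /\
  forall t, L2_derivative w t (fun x => - 'i%C * szego_rhs (w t) x).

Lemma Re_mNi (z : C) : complex.Re (- 'i%C * z) = complex.Im z.
Proof. by rewrite Re_M Re_N Im_N /=; ring. Qed.

Lemma sqr_constant (phi dphi : R -> R) : (forall t : R, is_derive t (1 : R) phi (dphi t)) ->
  (forall t, dphi t = 0) -> forall t, phi t = phi 0.
Proof.
move=> D d0 t.
have h (a b : R) : a <= b -> phi a = phi b.
  move=> ab; apply/le_anti/andP; split.
    have := @gronwall_ge _ phi dphi 0 a b ab D; rewrite mul0r expR0 mulr1; apply => s _ _.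
    by rewrite mul0r oppr0 d0.
  have := @gronwall_le _ phi dphi 0 a b ab D; rewrite mul0r expR0 mulr1; apply => s _ _.
  by rewrite mul0r d0.
by have [t0|t0] := leP 0 t; [rewrite (h 0 t)|rewrite (h t 0)// ltW].
Qed.

Lemma mass_conserved w (chi : R -> R) : (forall t, L2p (w t) /\ L4 (w t)) ->
  (forall t, L2_derivative w t (fun x => - 'i%C * rhsA ((chi t)%:C%C * J (w t)) (w t) x)) ->
  forall t, n2 (w t) = n2 (w 0).
Proof.
move=> lw dw t; have l2 s : L2 (w s) := L2p_L2 (lw s).1.
have lF s := L2_rhsA ((chi s)%:C%C * J (w s)) (lw s).2.
have D s := n2sq_derivative l2 (L2Z (- 'i%C) (lF s)) (dw s).
have h := sqr_constant D _ t.
apply/eqP; rewrite -(@eqrXn2 _ 2)// ?n2_ge0//; apply/eqP; apply: h => s.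
by rewrite (innerZl _ (lF s) (l2 s)) Re_mNi (mass_form _ (lw s).1 (lw s).2) mulr0.
Qed.

Lemma solves_mass w : solves w -> forall t, n2 (w t) = n2 (w 0).
Proof.
move=> [lw dw]; apply: (@mass_conserved w (fun=> 1) lw) => t.
by have := dw t; rewrite szego_rhsE -[1%:C%C]/(1 : C) mul1r.
Qed.

Lemma solves_shift w t0 : solves w -> solves (fun s => w (s + t0)).
Proof.
move=> [lw dw]; split => [t|t e e0]; first exact: lw.
have [d d0 Hd] := dw (t + t0) e e0; exists d => // s sd.
have e1 : s + t0 - (t + t0) = s - t by ring.
by have := Hd (s + t0); rewrite e1; apply.
Qed.

(** Gronwall's lemma for the square of the L2 distance; the conservation of mass
    makes the radius r uniform in time. *)
Lemma solves_stable w w' M r T : 0 <= M -> 0 <= T -> solves w -> solves w' ->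
  (forall t, `|t| <= T -> HB M (w t)) -> (forall t, `|t| <= T -> HB M (w' t)) ->
  n2 (w 0) <= r -> n2 (w' 0) <= r ->
  forall t, `|t| <= T -> n2 (fun x => w t x - w' t x) <=
    expR (2 * (4 * M ^+ 2 * r ^+ 2 + 9 * (3 * M * r) ^+ 2) * T) * n2 (fun x => w 0 x - w' 0 x).
Proof.
move=> M0 T0 sw sw' Hw Hw' wr wr' t tT; set C0 := 2 * _.
have C00 : 0 <= C0 by rewrite mulr_ge0// addr_ge0// mulr_ge0 ?sqr_ge0// mulr_ge0 ?sqr_ge0.
have [lw dw] := sw; have [lw' dw'] := sw'.
have l2 s : L2 (w s) := L2p_L2 (lw s).1; have l2' s : L2 (w' s) := L2p_L2 (lw' s).1.
have lF s : L2 (szego_rhs (w s)) by apply: L2_rhsA; exact: (lw s).2.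
have lF' s : L2 (szego_rhs (w' s)) by apply: L2_rhsA; exact: (lw' s).2.
pose d s x := w s x - w' s x; have ld s : L2 (d s) := L2B (l2 s) (l2' s).
pose G s x := szego_rhs (w s) x - szego_rhs (w' s) x; have lG s : L2 (G s) := L2B (lF s) (lF' s).
have dd s : L2_derivative d s (fun x => - 'i%C * G s x).
  move=> e e0; have e20 : 0 < e / 2 by rewrite divr_gt0.
  have [d1 d10 H1] := dw s _ e20; have [d2 d20 H2] := dw' s _ e20.
  exists (Num.min d1 d2); first by rewrite lt_min d10.
  move=> z; rewrite lt_min => /andP[z1 z2].
  rewrite (_ : (fun x => _) = (fun x => (w z x - w s x - (z - s)%:C%C * (- 'i%C * szego_rhs (w s) x)) -
     (w' z x - w' s x - (z - s)%:C%C * (- 'i%C * szego_rhs (w' s) x)))); last first.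
    by apply/funext => x; rewrite /d /G; ring.
  apply: (le_trans (n2B (L2B (L2B (l2 z) (l2 s)) (L2Z _ (L2Z _ (lF s))))
    (L2B (L2B (l2' z) (l2' s)) (L2Z _ (L2Z _ (lF' s)))))).
  by apply: (le_trans (lerD (H1 z z1) (H2 z z2))); rewrite -mulrDl -splitr.
pose phi s := n2 (d s) ^+ 2.
have D s := n2sq_derivative ld (L2Z (- 'i%C) (lG s)) (dd s).
set dphi := fun s => 2 * complex.Re (inner (fun x => - 'i%C * G s x) (d s)) in D.
have bd s : `|s| <= T -> `|dphi s| <= C0 * phi s.
  move=> sT; rewrite /dphi (innerZl _ (lG s) (ld s)) Re_mNi normrM ger0_norm// /C0 -mulrA.
  rewrite ler_wpM2l//; apply: energy_form => //; [exact: Hw|exact: Hw'| |].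
    by rewrite (solves_mass sw).
  by rewrite (solves_mass sw').
have key : phi t <= phi 0 * expR (C0 * T).
  have phi0 : 0 <= phi 0 := sqr_ge0 _.
  have [t0|t0] := leP 0 t.
    have h := @gronwall_le _ phi dphi C0 0 t t0 D; apply: (le_trans (h _)).
      move=> s s0 st; apply: (le_trans (ler_norm _)); apply: bd.
      by rewrite ger0_norm//; apply: le_trans st (le_trans (ler_norm _) tT).
    rewrite ler_wpM2l// ler_expR ler_wpM2l// subr0; exact: le_trans (ler_norm _) tT.
  have h := @gronwall_ge _ phi dphi C0 t 0 (ltW t0) D; apply: (le_trans (h _)).
    move=> s ts s0; have : `|s| <= T.
      by rewrite ler0_norm//; apply: le_trans tT; rewrite ltr0_norm// lerN2.
    by move=> /bd; rewrite ler_norml => /andP[].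
  by rewrite ler_wpM2l// ler_expR ler_wpM2l// sub0r -(ltr0_norm t0).
have E1 : 1 <= expR (C0 * T) by rewrite -expR0 ler_expR mulr_ge0.
rewrite -(@ler_pXn2r _ 2)// ?nnegrE ?n2_ge0 ?mulr_ge0 ?expR_ge0 ?n2_ge0//.
apply: (le_trans key); rewrite exprMn [phi 0 * _]mulrC ler_wpM2r ?sqr_ge0//.
by rewrite expr2 ler_peMl ?expR_ge0.
Qed.

Lemma solution_solves u0 w : BMOplus u0 -> is_BMO_solution u0 w -> solves w /\ w 0 = u0 %[ae mu].
Proof.
move=> [/L2pP lu0 _] [[lw' cw'] wsw sw]; have l0 := L2p_L2 lu0.
have lw t : L2p (w t) by apply/L2pP. have l2 t : L2 (w t) := L2p_L2 (lw t).
have cw := (L2dist_cvgP l2).1 cw'.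
have l4 t : L4 (w t).
  have [M M0 H] := local_bound wsw (normr_ge0 t).
  by have [] := HB_L4 M0 (H t (lexx _)).
have lF t : L2 (szego_rhs (w t)) by apply: L2_rhsA.
have cF : L2_continuous (fun t => szego_rhs (w t)).
  move=> t e e0; have T0 : 0 <= `|t| + 1 by rewrite addr_ge0.
  have [M M0 HM] := local_bound wsw T0.
  have r0 : 0 <= n2 (w t) + 1 by rewrite addr_ge0 ?n2_ge0.
  have [K K0 HK] := rhs_holder M0 r0.
  have ep : 0 < e / (K + 1) by rewrite divr_gt0// ltr_wpDl.
  have m0 : 0 < Num.min 1 ((e / (K + 1)) ^+ 2) by rewrite lt_min ltr01 exprn_gt0.
  have [d d0 Hd] := cw t _ m0.
  exists (Num.min 1 d); first by rewrite lt_min ltr01.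
  move=> s; rewrite lt_min => /andP[s1 sd]; have := Hd s sd; rewrite le_min => /andP[h1 h2].
  have sT : `|s| <= `|t| + 1.
    have := ler_normD (s - t) t; rewrite subrK; move: s1; set a := `|s|; set b := `|t|; set c := `|_|.
    by clear; lra.
  have tT : `|t| <= `|t| + 1 by rewrite lerDl.
  have ws : n2 (w s) <= n2 (w t) + 1.
    have := n2_dist (l2 s) (l2 t); rewrite ler_norml => /andP[_].
    by move: h1; clear; abs_lra.
  have wt : n2 (w t) <= n2 (w t) + 1 by rewrite lerDl.
  apply: (le_trans (HK _ _ (HM s sT) (HM t tT) ws wt)).
  apply: le_trans (frac_le K0 e0); rewrite ler_wpM2l//.
  rewrite -[leRHS]gtr0_norm// -sqrtr_sqr ler_wsqrtr//.
have /choice[v Hv] : forall t, exists v : R -> C, is_L2_Rint (fun tau => szego_rhs (w tau)) 0 t v /\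
    w t = (fun x => u0 x - 'i%C * v x) %[ae mu].
  by move=> t; have [v h1 h2] := sw t; exists v.
have HvI t : is_L2_Rint (fun tau => szego_rhs (w tau)) 0 t (v t) := (Hv t).1.
have lv t : L2 (v t) := is_L2_Rint_L2 (HvI t).
split.
  split => [t|t]; first by split.
  have dv := @Rint_derivative _ (fun tau => szego_rhs (w tau)) v t lF cF HvI.
  exact: (@L2_derivative_transfer w v u0 t (szego_rhs (w t)) l2 lv l0 (lF t) (fun s => (Hv s).2) dv).
have v0 : v 0 = (fun=> 0) %[ae mu] by apply: n2_eq0 => //; exact: Rint_refl0 lF (HvI 0).
by apply: ae_imp2 (Hv 0).2 v0 => x h1 h2 _; rewrite h1// h2// mulr0 subr0.
Qed.

End curves.

(** * The flow on BMO *)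

Section flow.
Context {R : realType}.
Local Notation C := R[i].
Local Notation mu := (@torus_measure R).
Local Notation nc := (@Normc.normc R).
Local Opaque n2 L2 inner Szego fourier.
Implicit Types (f g u v b : R -> C) (w : R -> R -> C) (M e r t T N : R).

Lemma ii : 'i%C * 'i%C = - 1 :> C.
Proof. by apply: eq_C; rewrite ?Re_M ?Im_M ?Re_N ?Im_N /=; ring. Qed.

(** The cut-off of the auxiliary evolution is inactive: the mass is conserved
    and dominates the mean value. *)
Lemma existence u0 N : 0 <= N -> HB N u0 -> exists w : R -> R -> C,
  is_BMO_solution u0 w /\ forall t, HB (Num.sqrt (N ^+ 2 + n2 u0 ^+ 2)) (w t).
Proof.
move=> N0 H0; have lu0 := HB_L2p H0; have l0 := HB_L2 H0.
have [b0 Bb0 b0u] := nehari N0 H0; have lb0 := Bd_L2 Bb0.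
pose rho := n2 u0; have rho0 : 0 <= rho := n2_ge0 _.
pose M := 2 * N + rho + 2; have ME : M = 2 * N + rho + 2 by [].
have M0 : 0 <= M by rewrite /M; lra.
pose s0 : @state R := (b0, fourier u0 0).
have mean_le f : L2 f -> nc (fourier f 0) <= n2 f.
  by move=> lf; apply: le_trans (fourier_le 0 (L2_L1 lf)) (N1_le_n2 lf).
have K0 : in_states N rho s0.
  split => //=; apply: (le_trans (mean_le _ l0)); rewrite -/rho; lra.
have [X1 [X10 K1 lip1 [Ka Ka0 g1]]] := half_evolution N0 rho0 ME (normr1 R) K0.
have [X2 [X20 K2 lip2 [Kb Kb0 g2]]] := half_evolution N0 rho0 ME (normrN1 R) K0.
pose X t := if 0 <= t then X1 t else X2 (- t).
have Xp t : 0 <= t -> X t = X1 t by rewrite /X => ->.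
have Xn t : t <= 0 -> X t = X2 (- t).
  rewrite /X; case: ifP => // t0 t0'; have -> : t = 0 by apply/le_anti; rewrite t0 t0'.
  by rewrite oppr0 X10 X20.
have KX t : in_states N rho (X t).
  by have [t0|t0] := leP 0 t; [rewrite Xp//; exact: K1|rewrite Xn ?(ltW t0)//; apply: K2; rewrite oppr_ge0 ltW].
set c0 := 10 * M ^+ 5 in lip1 lip2.
have c00 : 0 <= c0 by apply: mulr_ge0 (ler0n _ _) (exprn_ge0 _ M0).
have lipw s t : s <= t -> state_dist (X s) (X t) <= c0 * (t - s).
  move=> st; have [s0'|s0'] := leP 0 s.
    by rewrite !Xp ?(le_trans s0' st)//; exact: lip1.
  have [t0|t0] := leP t 0.
    rewrite !Xn ?(ltW s0')// state_dist_sym [t - s]addrC -{2}[t]opprK.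
    by apply: lip2; rewrite ?oppr_ge0// lerN2.
  have h1 := lip1 0 t (lexx _) (ltW t0); have s0n : 0 <= - s by rewrite oppr_ge0 ltW.
  have h2 := lip2 0 (- s) (lexx _) s0n; rewrite X10 in h1; rewrite X20 in h2.
  rewrite (Xp t (ltW t0)) (Xn s (ltW s0')).
  apply: (le_trans (state_dist_tri (K2 _ s0n) K0 (K1 _ (ltW t0)))).
  rewrite state_dist_sym in h2; apply: (le_trans (lerD h2 h1)).
  by rewrite le_eqVlt; apply/orP; left; apply/eqP; ring.
have lip s t : state_dist (X s) (X t) <= c0 * `|s - t|.
  have [st|ts] := leP s t.
    by rewrite ler0_norm ?subr_le0// opprB; exact: lipw.
  by rewrite gtr0_norm ?subr_gt0// state_dist_sym; apply: lipw; exact: ltW.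
pose w t := profile (X t); pose F t := drift rho (X t).
have lpw t : L2p (w t) := profile_L2p (KX t). have lw t : L2 (w t) := L2p_L2 (lpw t).
have l4 t : L4 (w t) by have [] := L4_profile N0 rho0 ME (KX t).
have lF t : L2 (F t) := L2_drift N0 rho0 ME (KX t).
have cF : L2_continuous F.
  have [K Kp HK] := drift_holder N0 rho0 ME; move=> t e e0.
  have ep : 0 < e / (K + 1) by rewrite divr_gt0// ltr_wpDl.
  have ep2 : 0 < (e / (K + 1)) ^+ 2 by rewrite exprn_gt0.
  exists ((e / (K + 1)) ^+ 2 / (c0 + 1)); first by rewrite divr_gt0// ltr_wpDl.
  move=> s sd; apply: (le_trans (HK _ _ (KX s) (KX t))).
  apply: le_trans (frac_le Kp e0); rewrite ler_wpM2l//.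
  rewrite -[leRHS]gtr0_norm// -sqrtr_sqr ler_wsqrtr//; apply: (le_trans (lip s t)).
  by apply: le_trans (frac_le c00 ep2); rewrite ler_wpM2l// ltW.
pose w' t x := 'i%C * w t x; have lw' t : L2 (w' t) := L2Z _ (lw t).
have G1 : good_curve w' F Ka (fun t => 0 <= t).
  move=> p xi q p0 q0 pxi xiq; have xi0 := le_trans p0 pxi.
  have := g1 p xi q p0 pxi xiq; rewrite -!Xp// => h; apply: le_trans h.
  rewrite le_eqVlt; apply/orP; left; apply/eqP; apply: n2_eq => x.
  have nciM (z : C) : nc z = nc ('i%C * z) by rewrite ncM nci mul1r.
  rewrite [1 * (q - p)]mul1r [RHS]nciM; congr nc; rewrite /w' -/(w q) -/(w p) -/(F xi).
  have iE z : 'i%C * ('i%C * (q - p)%:C%C * z) = - ((q - p)%:C%C * z).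
    by rewrite !mulrA ii mulN1r mulNr.
  transitivity ('i%C * (w q x - w p x) + 'i%C * ('i%C * (q - p)%:C%C * F xi x)).
    by rewrite iE; ring.
  by rewrite -mulrDr.
have G2 : good_curve w' F Kb (fun t => t <= 0).
  move=> p xi q p0 q0 pxi xiq; have xi0 := le_trans xiq q0.
  have n0 : 0 <= - q by rewrite oppr_ge0.
  have pxi' : - xi <= - p by rewrite lerN2. have xiq' : - q <= - xi by rewrite lerN2.
  have := g2 (- q) (- xi) (- p) n0 xiq' pxi'; rewrite -!Xn//.
  rewrite (_ : - p - - q = q - p); last by ring.
  move=> h; apply: le_trans h.
  rewrite le_eqVlt; apply/orP; left; apply/eqP; apply: n2_eq => x.
  have nciM (z : C) : nc z = nc ('i%C * z) by rewrite ncM nci mul1r.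
  rewrite [RHS]nciM -[RHS]ncN; congr nc; rewrite mulN1r CN /w' -/(w q) -/(w p) -/(F xi).
  have iE z : 'i%C * ('i%C * - (q - p)%:C%C * z) = (q - p)%:C%C * z.
    by rewrite !mulrA ii mulN1r opprK.
  transitivity (- ('i%C * (w p x - w q x) + 'i%C * ('i%C * - (q - p)%:C%C * F xi x))).
    by rewrite iE; ring.
  by rewrite -mulrDr.
have HR t : is_L2_Rint F 0 t (fun x => w' t x - w' 0 x) := good_Rint t lF lw' Ka0 Kb0 G1 G2.
pose v t x := w' t x - w' 0 x; have lv t : L2 (v t) := L2B (lw' t) (lw' 0).
have wE t x : w t x = w 0 x - 'i%C * v t x.
  rewrite /v /w' -mulrBr mulrA ii; ring.
have dw t : L2_derivative w t (fun x => - 'i%C * F t x).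
  have dv := @Rint_derivative _ F v t lF cF HR.
  apply: (@L2_derivative_transfer _ w v (w 0) t (F t) lw lv (lw 0) (lF t) _ dv).
  by move=> s; apply: ae_all => x _; exact: wE.
have mE : fourier b0 0 = fourier u0 0.
  have := @fourier_Szego _ _ 0%N lb0 => <-.
  by apply: fourier_ae => //; [exact: L2_meas (L2_Szego lb0)|exact: L2_meas].
have w0 : w 0 = u0 %[ae mu].
  apply: ae_imp b0u => x h _; rewrite /w (Xp 0 (lexx _)) X10 /profile /= h//.
  by rewrite mE subrK.
have mass t : n2 (w t) = rho.
  rewrite (@mass_conserved _ w (fun t => cutoff rho (X t).2) (fun t => conj (lpw t) (l4 t)) dw t).
  by apply: n2_ae w0; exact: L2_meas.
have FE t : F t = szego_rhs (w t).
  rewrite /F /drift szego_rhsE /coupling -/(w t) cutoff1 -?[1%:C%C]/(1 : C) ?mul1r//.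
  have := @fourier_profile _ _ _ _ 0%N (KX t) => <-; rewrite -(mass t); exact: (mean_le _ (lw t)).
have S0 : 0 <= Num.sqrt (N ^+ 2 + rho ^+ 2) := sqrtr_ge0 _.
have Hw t : HB (Num.sqrt (N ^+ 2 + rho ^+ 2)) (w t).
  have [Bt _] := KX t; have := HB_step Bt (lpw t) (profile_tail (KX t)).
  by rewrite -/(w t) mass.
have wcont t e : 0 < e -> exists2 d, 0 < d & forall s, `|s - t| < d -> n2 (fun x => w s x - w t x) <= e.
  move=> e0; have c20 : 0 <= 2 * c0 by rewrite mulr_ge0.
  exists (e / (2 * c0 + 1)); first by rewrite divr_gt0// ltr_wpDl.
  move=> s sd; apply: (le_trans (n2_profileB (KX s) (KX t))).
  have two : 0 <= 2 :> R by [].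
  apply: (le_trans (ler_wpM2l two (lip s t))); rewrite mulrA.
  by apply: le_trans (frac_le c20 e0); rewrite ler_wpM2l// ltW.
exists w; split => //; split.
- split => [t|]; first by apply/L2pP.
  by apply/L2dist_cvgP.
- exact: weakstar_of_L2 S0 Hw wcont.
move=> t; exists (v t).
  by rewrite (_ : (fun tau => szego_rhs (w tau)) = F)//; apply/funext => s; rewrite FE.
by apply: ae_imp w0 => x h _; rewrite wE h.
Qed.

Lemma unique u0 w w' : BMOplus u0 -> is_BMO_solution u0 w -> is_BMO_solution u0 w' ->
  forall t, w' t = w t %[ae mu].
Proof.
move=> B0 S S' t; have [sw w0] := solution_solves B0 S; have [sw' w0'] := solution_solves B0 S'.
have [_ Ww _] := S; have [_ Ww' _] := S'; have T0 := normr_ge0 t.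
have [M1 M10 H1] := local_bound Ww T0; have [M2 M20 H2] := local_bound Ww' T0.
have l2 s : L2 (w s) := L2p_L2 (sw.1 s).1; have l2' s : L2 (w' s) := L2p_L2 (sw'.1 s).1.
have l0 : L2 u0 by case: B0 => /L2pP[].
pose M := M1 + M2; have M0 : 0 <= M by rewrite addr_ge0.
have H1' s : `|s| <= `|t| -> HB M (w s) by move=> /H1; apply: HB_mono; rewrite lerDl.
have H2' s : `|s| <= `|t| -> HB M (w' s) by move=> /H2; apply: HB_mono; rewrite lerDr.
have e1 : n2 (w 0) <= n2 u0 by rewrite (n2_ae (L2_meas (l2 0)) (L2_meas l0) w0).
have e2 : n2 (w' 0) <= n2 u0 by rewrite (n2_ae (L2_meas (l2' 0)) (L2_meas l0) w0').
have := solves_stable M0 T0 sw' sw H2' H1' e2 e1 (lexx _).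
have -> : n2 (fun x => w' 0 x - w 0 x) = 0.
  by apply: n2B_ae; [exact: L2_meas|exact: L2_meas|apply: ae_imp2 w0 w0' => x h h' _; rewrite h'// h].
rewrite mulr0 => h; apply: n2B_eq0 => //; apply/eqP; by rewrite eq_le h n2_ge0.
Qed.

Lemma solution_bound u0 N w : 0 <= N -> HB N u0 -> is_BMO_solution u0 w ->
  forall t, HB (Num.sqrt (N ^+ 2 + n2 u0 ^+ 2)) (w t).
Proof.
move=> N0 H0 S t; have [z [Sz Hz]] := existence N0 H0; have B0 := HB_BMO N0 H0.
have [sw _] := solution_solves B0 S.
apply: HB_ae (Hz t) _; first exact: L2_meas (L2p_L2 (sw.1 t).1).
exact: unique Sz S t.
Qed.

Lemma HB_n2 M u : 0 <= M -> HB M u -> n2 u <= M.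
Proof.
move=> M0 Hu; have [b Bb bu] := nehari M0 Hu; have lb := Bd_L2 Bb.
rewrite -(n2_ae (L2_meas (L2_Szego lb)) (L2_meas (HB_L2 Hu)) bu).
exact: le_trans (n2_Szego lb) (Bd_n2 Bb).
Qed.

(** Running the equation backwards from time t turns the upper bound into the
    lower one. *)
Lemma solution_lower_bound u0 w M t : BMOplus u0 -> is_BMO_solution u0 w -> 0 <= M ->
  HB M (w t) -> HB (Num.sqrt (M ^+ 2 + n2 u0 ^+ 2)) u0.
Proof.
move=> B0 S M0 Ht; have [N [N0 _ H0]] := BMO_HB B0.
have [sw w0] := solution_solves B0 S; have [z [Sz Hz]] := existence M0 Ht.
have [sz z0] := solution_solves (HB_BMO M0 Ht) Sz.
have l2 s : L2 (w s) := L2p_L2 (sw.1 s).1; have lz s : L2 (z s) := L2p_L2 (sz.1 s).1.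
have l0 : L2 u0 := HB_L2 H0.
have mt : n2 (w t) = n2 u0.
  by rewrite (solves_mass sw) (n2_ae (L2_meas (l2 0)) (L2_meas l0) w0).
have ss := solves_shift t sw.
pose A := Num.sqrt (N ^+ 2 + n2 u0 ^+ 2); pose B := Num.sqrt (M ^+ 2 + n2 (w t) ^+ 2).
have A0 : 0 <= A := sqrtr_ge0 _; have B0' : 0 <= B := sqrtr_ge0 _.
have AB0 : 0 <= A + B by rewrite addr_ge0.
have h1 s : `|s| <= `|t| -> HB (A + B) (w (s + t)).
  by move=> _; apply: HB_mono (solution_bound N0 H0 S (s + t)); rewrite lerDl.
have h2 s : `|s| <= `|t| -> HB (A + B) (z s).
  by move=> _; apply: HB_mono (Hz s); rewrite lerDr.
have e1 : n2 (w (0 + t)) <= n2 u0 by rewrite add0r mt.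
have e2 : n2 (z 0) <= n2 u0 by rewrite (n2_ae (L2_meas (lz 0)) (L2_meas (l2 t)) z0) mt.
have nt : `|- t| <= `|t| by rewrite normrN.
have := solves_stable AB0 (normr_ge0 t) ss sz h1 h2 e1 e2 nt.
have -> : n2 (fun x => w (0 + t) x - z 0 x) = 0.
  rewrite add0r; apply: n2B_ae; [exact: L2_meas|exact: L2_meas|].
  by apply: ae_imp z0 => x h _; rewrite h.
rewrite mulr0 addNr => h.
have wz : w 0 = z (- t) %[ae mu].
  by apply: n2B_eq0 => //; apply/eqP; rewrite eq_le h n2_ge0.
rewrite -mt; apply: HB_ae (Hz (- t)) _; first exact: L2_meas.
by apply: ae_imp2 w0 wz => x h1' h2' _; rewrite -h1'// h2'.
Qed.

Lemma flow_lipschitz t r : 0 < r -> exists2 L : R, 0 <= L & forall u0 v0 w w',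
  bmo_ball r u0 -> bmo_ball r v0 -> is_BMO_solution u0 w -> is_BMO_solution v0 w' ->
  (L2dist (w t) (w' t) <= L%:E * L2dist u0 v0)%E.
Proof.
move=> r0; have r0' := ltW r0; have r20 : 0 <= 2 * r by rewrite mulr_ge0.
exists (expR (2 * (4 * (2 * r) ^+ 2 * r ^+ 2 + 9 * (3 * (2 * r) * r) ^+ 2) * `|t|)).
  exact: expR_ge0.
move=> u0 v0 w w' [Bu ur] [Bv vr] S S'.
have [/L2pP lu _] := Bu; have [/L2pP lv _] := Bv.
have Hu := (bmo_normP r0' lu).1 ur; have Hv := (bmo_normP r0' lv).1 vr.
have [sw w0] := solution_solves Bu S; have [sw' w0'] := solution_solves Bv S'.
have l2 s : L2 (w s) := L2p_L2 (sw.1 s).1; have l2' s : L2 (w' s) := L2p_L2 (sw'.1 s).1.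
have lu2 := L2p_L2 lu; have lv2 := L2p_L2 lv.
have bd f : n2 f <= r -> Num.sqrt (r ^+ 2 + n2 f ^+ 2) <= 2 * r.
  move=> fr; have f2 : n2 f ^+ 2 <= r ^+ 2 by apply: lerXn2r fr; rewrite nnegrE ?n2_ge0.
  rewrite -(@ler_pXn2r _ 2)// ?nnegrE ?sqrtr_ge0// sqr_sqrtr ?addr_ge0 ?sqr_ge0//.
  rewrite exprMn; have := sqr_ge0 r; move: f2; set a := _ ^+ 2; set b := r ^+ 2.
  by rewrite (_ : 2 ^+ 2 = 4 :> R); [lra|ring].
have nu := HB_n2 r0' Hu; have nv := HB_n2 r0' Hv.
have H1 s : `|s| <= `|t| -> HB (2 * r) (w s).
  by move=> _; apply: HB_mono (solution_bound r0' Hu S s); exact: bd.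
have H2 s : `|s| <= `|t| -> HB (2 * r) (w' s).
  by move=> _; apply: HB_mono (solution_bound r0' Hv S' s); exact: bd.
have e1 : n2 (w 0) <= r by rewrite (n2_ae (L2_meas (l2 0)) (L2_meas lu2) w0).
have e2 : n2 (w' 0) <= r by rewrite (n2_ae (L2_meas (l2' 0)) (L2_meas lv2) w0').
have := solves_stable r20 (normr_ge0 t) sw sw' H1 H2 e1 e2 (lexx _).
rewrite (L2dist_n2 (l2 t) (l2' t)) (L2dist_n2 lu2 lv2) -EFinM lee_fin => h; apply: (le_trans h).
rewrite le_eqVlt; apply/orP; left; apply/eqP; congr (_ * _).
apply: n2_ae; [exact: L2_meas (L2B (l2 0) (l2' 0))|exact: L2_meas (L2B lu2 lv2)|].
by apply: ae_imp2 w0 w0' => x h1 h2 _; rewrite h1// h2.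
Qed.

End flow.

Theorem proposition3p3 (R : realType) :
  (* existence and uniqueness *)
  (forall u0 : R -> R[i], BMOplus u0 ->
    exists u : R -> R -> R[i],
      is_BMO_solution u0 u /\
      forall v : R -> R -> R[i], is_BMO_solution u0 v ->
        forall t : R, v t = u t %[ae @torus_measure R]) /\
  (* bounds on the BMO norm *)
  (forall (u0 : R -> R[i]) (u : R -> R -> R[i]),
    BMOplus u0 -> is_BMO_solution u0 u ->
    forall t : R,
      (bmo_norm u0 ^+ 2 - cLnorm 2%:E u0 ^+ 2 <= bmo_norm (u t) ^+ 2
        <= bmo_norm u0 ^+ 2 + cLnorm 2%:E u0 ^+ 2)%E) /\
  (* Lipschitz continuity of the flow on the balls of BMO_+ *)
  (forall t r : R, 0 < r ->
    exists2 L : R, 0 <= L &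
      forall (u0 v0 : R -> R[i]) (u v : R -> R -> R[i]),
        bmo_ball r u0 -> bmo_ball r v0 ->
        is_BMO_solution u0 u -> is_BMO_solution v0 v ->
        (L2dist (u t) (v t) <= L%:E * L2dist u0 v0)%E).
Proof.
split=> [u0 B0|].
  have [N [N0 _ H0]] := BMO_HB B0; have [w [S _]] := existence N0 H0.
  by exists w; split => // v Sv t; exact: unique B0 S Sv t.
split=> [u0 w B0 S t|t r r0]; last exact: flow_lipschitz.
have [N [N0 NE H0]] := BMO_HB B0; have Ht := solution_bound N0 H0 S t.
have [M [M0 ME HM]] := BMO_HB (HB_BMO (sqrtr_ge0 _) Ht).
have l0 := HB_L2 H0; rewrite NE ME (cLnorm2 l0) -!EFin_expe -EFinB -EFinD !lee_fin.
have s0 (a : R) : 0 <= a ^+ 2 + n2 u0 ^+ 2 by rewrite addr_ge0// sqr_ge0.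
have sq (a c : R) : 0 <= a -> a <= Num.sqrt (c ^+ 2 + n2 u0 ^+ 2) -> a ^+ 2 <= c ^+ 2 + n2 u0 ^+ 2.
  move=> a0 h; rewrite -[leRHS]sqr_sqrtr//; apply: lerXn2r h; by rewrite nnegrE ?sqrtr_ge0.
apply/andP; split; last first.
  by apply: sq => //; rewrite -lee_fin -ME; apply/bmo_normP; [exact: sqrtr_ge0|exact: HB_L2p HM|exact: Ht].
rewrite lerBlDr; apply: sq => //; rewrite -lee_fin -NE; apply/bmo_normP.
- exact: sqrtr_ge0.
- exact: HB_L2p H0.
exact: solution_lower_bound B0 S M0 HM.
Qed.
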